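(* Suppose $f\in L^{2}(\Omega)$, $\varphi\in H^{1}(\Sigma_{0})$, and $\psi\in H^{1}(\Sigma_{1})$. Let $v\in C^2(\Omega)\cap C^1(\Omega\cup\Sigma_0\cup\Sigma_1)$ be a solution of $$Lv=f\ \text{ in }\Omega,\qquad v|_{\Sigma_0}=\varphi,\qquad v|_{\Sigma_1}=\psi .$$ Then $$\|v\|_{H^{1}(\Omega)}+\|\partial_{z}v\|_{L^{2}(\Sigma_1)}\leq C\{\|f\|_{L^{2}(\Omega)}+\|\varphi\|_{H^{1}(\Sigma_{0})}+\|\psi\|_{H^{1}(\Sigma_{1})}\},$$ where $C$ is a positive constant depending only on $z_0$, $T$, $\lambda$, $\Lambda$, $|g^{ij}|_{C^{1}(\Omega)}$, $|a^{i}|_{L^{\infty}(\Omega)}$, and $|\omega|_{L^{\infty}(\Omega)}$.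
   Context: Fix $T>0$, $z_0>0$. Coordinates: $x^0=\tau$, $x^1=z$, and $(x^2,x^3)$ local coordinates on $S^2$ (from a fixed finite atlas). Indices $i,j\in\{0,1,2,3\}$, $A,B\in\{2,3\}$, repeated indices summed. Set $$\Omega=\{(\tau,z):0<\tau<T,\ 0<z<z_0\}\times S^2,\quad \Sigma_0=\{(0,z):0<z\le z_0\}\times S^2,\quad \Sigma_1=\{(\tau,z_0):0\le\tau\le T\}\times S^2.$$ Let $V$, $U^A$, $h_{AB}$ be functions on $\Omega$ (extending to $\Sigma_0\cup\Sigma_1$; $U^A\partial_A$ is a vector field and $h_{AB}dx^Adx^B$ a Riemannian metric on $S^2$ depending on $\tau,z$) such that, as $z\to0$, $V\to1$, $U^A\to0$, $h_{AB}dx^Adx^B\to g_{S^2}$ (the round metric), uniformly on $[0,T]\times S^2$. Let $$g=-z^2Vd\tau^{2}+2d\tau dz+h_{AB}(dx^{A}-U^{A}d\tau)(dx^{B}-U^{B}d\tau),$$ so that the inverse metric is $g^{00}=g^{0A}=0$, $g^{01}=1$, $g^{11}=z^2V$, $g^{1A}=U^A$, $g^{AB}=h^{AB}$. Assume $\frac12\le V\le\frac32$ in $\Omega\cup\Sigma_0\cup\Sigma_1$ and $\lambda I_2\le(h_{AB})\le\Lambda I_2$ in $\Omega$ for some constants $\lambda,\Lambda>0$. Let $\Box_g$ be the wave operator of $g$ and $$Lv=\Box_gv+a^i\partial_iv+\omega v$$ for given functions $a^i$, $\omega$ on $\Omega$. The norms of $g^{ij},a^i,\omega$ that appear in the dependence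 of $C$ are assumed finite. $H^p(\Sigma_0)$ and $H^p(\Sigma_1)$ are Sobolev spaces with derivatives taken only in the variables on $\Sigma_0$ (that is, $z,x^2,x^3$), respectively on $\Sigma_1$ (that is, $\tau,x^2,x^3$). *)

(* Defs.v *)
From HB Require Import structures.
From mathcomp Require Import all_boot all_order all_algebra.
From mathcomp Require Import all_classical all_reals all_analysis.

Set Implicit Arguments.
Unset Strict Implicit.
Unset Printing Implicit Defensive.

Import Order.TTheory GRing.Theory Num.Theory numFieldNormedType.Exports.

Local Open Scope classical_set_scope.
Local Open Scope ring_scope.

(* Lebesgue measure on R^2, R^3 and R^4, with points of R^3 grouped as
   (s, (x2, x3)) and points of R^4 grouped as ((tau, z), (x2, x3)). *)
Section Lebesgue.
Context {R : realType}.
Local Notation mR := (measurableTypeR R).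

Definition leb2 : set (mR * mR) -> \bar R :=
  (@lebesgue_measure R \x @lebesgue_measure R)%E.

HB.instance Definition _ := Measure.on leb2.

Lemma leb2_sigma_finite : sigma_finite [set: mR * mR] leb2.
Proof.
have /sigma_finiteP[F [TF ndF Foo]] := sigma_finiteT (@lebesgue_measure R).
exists (fun n => F n `*` F n).
  rewrite -setXTT TF predeqE => -[x y]; split.
    move=> [/= [n _ Fnx] [k _ Gky]]; exists (maxn n k) => //; split.
    - by move: x Fnx; exact/subsetPset/ndF/leq_maxl.
    - by move: y Gky; exact/subsetPset/ndF/leq_maxr.
  by move=> [n _ []/= ? ?]; split; exists n.
move=> k; have [? ?] := Foo k.
split; first exact: measurableX.
by rewrite /leb2 product_measure1E// lte_mul_pinfty// ge0_fin_numE.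
Qed.

HB.instance Definition _ :=
  @Measure_isSigmaFinite.Build _ _ _ leb2 leb2_sigma_finite.

Definition leb3 : set (mR * (mR * mR)) -> \bar R :=
  (@lebesgue_measure R \x leb2)%E.

HB.instance Definition _ := Measure.on leb3.

Definition leb4 : set ((mR * mR) * (mR * mR)) -> \bar R := (leb2 \x leb2)%E.

HB.instance Definition _ := Measure.on leb4.

(* Identity maps from the Borel spaces to the normed spaces R^3 and R^4. *)
Definition to3 (q : mR * (mR * mR)) : R * (R * R) := q.
Definition to4 (q : (mR * mR) * (mR * mR)) : (R * R) * (R * R) := q.

End Lebesgue.

Section Regularity.
Context {R : realType} {E W : normedModType R}.

Fixpoint iterD (s : seq E) (f : E -> W) : E -> W :=
  if s is v :: s' then 'D_v (iterD s' f) else f.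

(* Meaningful for open D. *)
Definition Ck_on (k : nat) (D : set E) (f : E -> W) : Prop :=
  forall (s : seq E) (x : E), D x -> (size s <= k)%N ->
    {for x, continuous (iterD s f)} /\
    ((size s < k)%N -> forall v, derivable (iterD s f) x v).

Definition smooth_on (D : set E) (f : E -> W) : Prop := forall k, Ck_on k D f.

(* f is C^1 in the open set D, and f and its partial derivatives (along the
   basis e) extend continuously to S; the values of the extension of f on S
   are those of f itself. *)
Definition C1_upto n (e : 'I_n -> E) (D S : set E) (f : E -> W) : Prop :=
  [/\ Ck_on 1 D f,
      {within S, continuous f} &
      forall i, exists w : E -> W, {within S, continuous w} /\
        (forall x, D x -> w x = 'D_(e i) f x)].

(* Value at a boundary point p of the continuous extension of u from D. *)
Definition bd_trace (D : set E) (u : E -> W) (p : E) : W :=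
  lim (u x @[x --> within D (nbhs p)]).

End Regularity.

(* Lebesgue and Sobolev norms on an open subset D of the normed space E,
   whose underlying Borel measure space is X (toE : X -> E is the identity).
   H^1 is defined with distributional derivatives along the basis e; outside
   H^1 the infimum is over the empty set, so that the norm is +oo (inside H^1
   the weak gradient is unique almost everywhere). *)
Section Sobolev.
Context {R : realType} {d : measure_display} {X : measurableType d}.
Context {E : normedModType R}.
Variables (mu : {measure set X -> \bar R}) (toE : X -> E).

Definition Lpnorm (p : \bar R) (D : set E) (u : E -> R) : \bar R :=
  ('N[mu]_p[EFin \o ((u \_ D) \o toE)])%E.

Definition measurable_on (D : set E) (u : E -> R) : Prop :=
  measurable_fun (toE @^-1` D) (u \o toE).

Definition inL2 (D : set E) (u : E -> R) : Prop :=
  measurable_on D u /\ (Lpnorm 2%:E D u < +oo)%E.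

Definition test_function (D : set E) (eta : E -> R) : Prop :=
  smooth_on setT eta /\
  exists K : set E,
    [/\ compact K, K `<=` D & forall x, ~ K x -> eta x = 0].

Definition weak_derivative (D : set E) (v : E) (u g : E -> R) : Prop :=
  forall eta, test_function D eta ->
    (\int[mu]_(x in toE @^-1` D) (u (toE x) * 'D_v eta (toE x))%:E =
     - \int[mu]_(x in toE @^-1` D) (g (toE x) * eta (toE x))%:E)%E.

Definition weak_gradient n (e : 'I_n -> E) (D : set E) (u : E -> R)
    (G : 'I_n -> E -> R) : Prop :=
  inL2 D u /\
  forall i, inL2 D (G i) /\ weak_derivative D (e i) u (G i).

Definition H1sqnorm n (e : 'I_n -> E) (D : set E) (u : E -> R) : \bar R :=
  ereal_inf
    [set (Lpnorm 2%:E D u ^+ 2 + \sum_(i < n) Lpnorm 2%:E D (G i) ^+ 2)%E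
    | G in [set G | weak_gradient e D u G]].

End Sobolev.

Section Coordinates.
Context {R : realType}.

Definition e2 (A : 'I_2) : R * R := nth 0 [:: (1, 0); (0, 1)] A.

Definition e3 (i : 'I_3) : R * (R * R) :=
  nth 0 [:: (1, (0, 0)); (0, (1, 0)); (0, (0, 1))] i.

Definition e4 (i : 'I_4) : (R * R) * (R * R) :=
  nth 0 [:: ((1, 0), (0, 0)); ((0, 1), (0, 0));
            ((0, 0), (1, 0)); ((0, 0), (0, 1))] i.

Definition coord2 (w : R * R) (A : 'I_2) : R := nth 0 [:: w.1; w.2] A.

Definition sphere : set 'rV[R]_3 :=
  [set p | \sum_(i < 3) p 0 i ^+ 2 = 1].

(* Quadratic form of a 2 x 2 matrix. *)
Definition quad (h : 'M[R]_2) (w : R * R) : R :=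
  \sum_(A < 2) \sum_(B < 2) h A B * coord2 w A * coord2 w B.

End Coordinates.

(* A finite atlas of the unit sphere, given by inverse charts
   chart k : R^2 -> S^2.  Each chart is a smooth parametrization of a larger
   open set chart_ext k containing the compact closure of the coordinate
   domain chart_dom k, so that all coordinate changes are bounded together
   with their derivatives and the Sobolev norms do not depend, up to
   equivalence, on the atlas. *)
Record sphere_atlas (R : realType) := SphereAtlas {
  nb_charts : nat ;
  chart_dom : 'I_nb_charts -> set (R * R) ;
  chart_ext : 'I_nb_charts -> set (R * R) ;
  chart : 'I_nb_charts -> R * R -> 'rV[R]_3 ;
  chart_dom_open : forall k, open (chart_dom k) ;
  chart_ext_open : forall k, open (chart_ext k) ;
  chart_dom_closure : forall k,
    compact (closure (chart_dom k)) /\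
    closure (chart_dom k) `<=` chart_ext k ;
  chart_smooth : forall k, smooth_on (chart_ext k) (chart k) ;
  chart_sphere : forall k x, chart_ext k x -> sphere (chart k x) ;
  chart_inj : forall k x y, chart_ext k x -> chart_ext k y ->
    chart k x = chart k y -> x = y ;
  chart_immersion : forall k x w, chart_ext k x ->
    'D_w (chart k) x = 0 -> w = 0 ;
  chart_open_map : forall k (B : set (R * R)), open B -> B `<=` chart_ext k ->
    exists O : set 'rV[R]_3, open O /\ chart k @` B = O `&` sphere ;
  chart_cover : forall p, sphere p ->
    exists k, exists2 x, chart_dom k x & chart k x = p }.

Notation chart_index At := 'I_(nb_charts At).

Section Wave.
Context {R : realType}.
Local Notation E2 := (R * R)%type.
Local Notation E3 := (R * (R * R))%type.
Local Notation E4 := ((R * R) * (R * R))%type.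

(* The (tau, z)-parts of Omega, Sigma_0 and Sigma_1. *)
Definition base_Omega (T z0 : R) : set E2 :=
  [set b | 0 < b.1 < T /\ 0 < b.2 < z0].
Definition base_Sigma0 (z0 : R) : set E2 :=
  [set b | b.1 = 0 /\ 0 < b.2 <= z0].
Definition base_Sigma1 (T z0 : R) : set E2 :=
  [set b | 0 <= b.1 <= T /\ b.2 = z0].
Definition base_all (T z0 : R) : set E2 :=
  base_Omega T z0 `|` base_Sigma0 z0 `|` base_Sigma1 T z0.

Variable At : sphere_atlas R.
Local Notation K := (chart_index At).

Definition cyl (B : set E2) (k : K) : set E4 :=
  [set q | B q.1 /\ chart_dom k q.2].
Definition cyl3 (s : R) (k : K) : set E3 :=
  [set y | 0 < y.1 < s /\ chart_dom k y.2].

(* Coordinate expressions of functions on R^2 x S^2 and on R x S^2. *)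
Definition pull (k : K) (u : E2 -> 'rV[R]_3 -> R) (q : E4) : R :=
  u q.1 (chart k q.2).
Definition pull3 (k : K) (u : R -> 'rV[R]_3 -> R) (y : E3) : R :=
  u y.1 (chart k y.2).

(* The components in the different charts define a vector field, respectively
   a Riemannian metric, on S^2 for every (tau, z) in B. *)
Definition is_vector_field (B : set E2) (U : K -> E4 -> E2) : Prop :=
  forall k l b x y, B b -> chart_dom k x -> chart_dom l y ->
    chart k x = chart l y ->
    'D_(U k (b, x)) (chart k) x = 'D_(U l (b, y)) (chart l) y.

Definition is_metric (B : set E2) (h : K -> E4 -> 'M[R]_2) : Prop :=
  [/\ forall k q, cyl B k q -> (h k q)^T = h k q,
      forall k q w, cyl B k q -> w != 0 -> 0 < quad (h k q) w &
      forall k l b x y w w', B b -> chart_dom k x -> chart_dom l y ->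
        chart k x = chart l y ->
        'D_w (chart k) x = 'D_w' (chart l) y ->
        quad (h k (b, x)) w = quad (h l (b, y)) w'].

Definition round_metric (k : K) (x : E2) : 'M[R]_2 :=
  \matrix_(A, B) \sum_(i < 3)
    'D_(e2 A) (chart k) x 0 i * 'D_(e2 B) (chart k) x 0 i.

(* V -> 1, U^A -> 0 and h -> g_{S^2} as z -> 0, uniformly. *)
Definition asymptotics (S : set E2) (V : E2 -> 'rV[R]_3 -> R)
    (U : K -> E4 -> E2) (h : K -> E4 -> 'M[R]_2) : Prop :=
  forall eps, 0 < eps -> exists2 delta, 0 < delta &
    forall k q, cyl S k q -> q.1.2 < delta ->
      [/\ `|pull k V q - 1| < eps,
          forall A, `|coord2 (U k q) A| < eps &
          forall A B, `|h k q A B - round_metric k q.2 A B| < eps].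

(* g = - z^2 V dtau^2 + 2 dtau dz
       + h_AB (dx^A - U^A dtau) (dx^B - U^B dtau). *)
Definition metric (V : E2 -> 'rV[R]_3 -> R) (U : K -> E4 -> E2)
    (h : K -> E4 -> 'M[R]_2) (k : K) (q : E4) : 'M[R]_4 :=
  let dtau (i : 'I_4) : R := (i == 0%N :> nat)%:R in
  let dz (i : 'I_4) : R := (i == 1%N :> nat)%:R in
  let dx (A : 'I_2) (i : 'I_4) : R := (i == A.+2 :> nat)%:R in
  \matrix_(i, j)
    (- (q.1.2 ^+ 2 * pull k V q * dtau i * dtau j)
     + (dtau i * dz j + dz i * dtau j)
     + \sum_(A < 2) \sum_(B < 2)
         h k q A B * (dx A i - coord2 (U k q) A * dtau i)
                   * (dx B j - coord2 (U k q) B * dtau j)).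

(* The wave operator |g|^{-1/2} d_i (|g|^{1/2} g^{ij} d_j u). *)
Definition box (g : E4 -> 'M[R]_4) (u : E4 -> R) (q : E4) : R :=
  (Num.sqrt `|\det (g q)|)^-1 *
  \sum_(i < 4) 'D_(e4 i)
    (fun q' => Num.sqrt `|\det (g q')| *
       \sum_(j < 4) invmx (g q') i j * 'D_(e4 j) u q') q.

Definition Lop (g : E4 -> 'M[R]_4) (a : 'I_4 -> E4 -> R) (omega : E4 -> R)
    (u : E4 -> R) (q : E4) : R :=
  box g u q + \sum_(i < 4) a i q * 'D_(e4 i) u q + omega q * u q.

(* C^1(Omega)-norm of the g^{ij}: supremum over charts, indices, points. *)
Definition C1norm_inv (T z0 : R) (g : K -> E4 -> 'M[R]_4) : \bar R :=
  ereal_sup [set y | exists k i j q, cyl (base_Omega T z0) k q /\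
    y = (`|invmx (g k q) i j|
         + \sum_(l < 4) `|'D_(e4 l) (fun q' => invmx (g k q') i j) q|)%:E].

(* Norms on Omega, Sigma_0 and Sigma_1 are the l^2-sums of the norms of the
   coordinate expressions; the null sets of boundary points of the intervals
   are left out. *)
Definition L2norm_Omega (T z0 : R) (f : E2 -> 'rV[R]_3 -> R) : \bar R :=
  ((\sum_(k : K) Lpnorm leb4 to4 2%:E (cyl (base_Omega T z0) k) (pull k f) ^+ 2)
     `^ 2^-1)%E.

Definition H1norm_Omega (T z0 : R) (u : E2 -> 'rV[R]_3 -> R) : \bar R :=
  ((\sum_(k : K) H1sqnorm leb4 to4 e4 (cyl (base_Omega T z0) k) (pull k u))
     `^ 2^-1)%E.

Definition H1norm_Sigma (s : R) (u : R -> 'rV[R]_3 -> R) : \bar R :=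
  ((\sum_(k : K) H1sqnorm leb3 to3 e3 (cyl3 s k) (pull3 k u)) `^ 2^-1)%E.

(* d_z v on Sigma_1, in the chart k. *)
Definition dz_Sigma1 (T z0 : R) (v : E2 -> 'rV[R]_3 -> R) (k : K) (y : E3) : R :=
  bd_trace (cyl (base_Omega T z0) k)
    ('D_(e4 (inord 1)) (pull k v)) ((y.1, z0), y.2).

Definition L2norm_dz_Sigma1 (T z0 : R) (v : E2 -> 'rV[R]_3 -> R) : \bar R :=
  ((\sum_(k : K) Lpnorm leb3 to3 2%:E (cyl3 T k) (dz_Sigma1 T z0 v k) ^+ 2)
     `^ 2^-1)%E.

End Wave.

(* Main.v *)
(* Multiply the equation by Xv with X = d_tau - beta d_z.  The energy current
   F^i = g^{ij} v_j Xv - X^i g^{jk} v_j v_k / 2 satisfies, for large beta, K, N,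
   F^1 - N F^0 >= c |Dv|^2 and F^1 - K z^2 F^0 >= 0.  Use the weight
   exp(mu (z - N tau)) e(1 - eps / z - K eps tau), where e(s) = exp(-1/s) for
   s > 0 and e(s) = 0 otherwise: differentiating the exponential gives the
   coercive term mu c |Dv|^2, differentiating the cutoff e gives a term with a
   good sign, and the cutoff removes the degenerate boundary z = 0.  On the
   initial surface -F^0 is bounded by tangential derivatives; on z = z1 so is
   F^1 + c z^2 (d_z v)^2, which yields the estimate of d_z v.

   On the sphere one integrates over closed coordinate squares S_j against
   polynomials vanishing on the boundary of S_j.  Their derivatives produce an
   energy on S_j, which is bounded by the energies on the half-size squares,
   as these cover the sphere and coordinate changes are bi-Lipschitz; it is
   absorbed by taking mu large.  Letting the slab exhaust Omega, the derivatives
   of v at Sigma_0 and Sigma_1 are compared with the weak gradients of the data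
   by testing with bumps that approximate indicators of boxes. *)
Require Import Defs.
From HB Require Import structures.
From mathcomp Require Import all_boot all_order all_algebra.
From mathcomp Require Import all_classical all_reals all_analysis.
From mathcomp Require Import measurable_realfun ess_sup_inf.
From mathcomp Require Import ring lra.

Set Implicit Arguments.
Unset Strict Implicit.
Unset Printing Implicit Defensive.

Import Order.TTheory GRing.Theory Num.Theory numFieldNormedType.Exports.

Local Open Scope classical_set_scope.
Local Open Scope ring_scope.

(** * Directional derivatives *)

(** The obstacle is the degeneration of g^{11} = z^2 V at z = 0. Coercivity in d_z v comes from
    -F^0, which contains beta (d_z v)^2 without a factor z; the bad terms of F^1 in (d_z v)^2 carry
    z^2, so a multiple K z^2 of -F^0 absorbs them. The argument 1 - eps/z - K eps tau of the cutoff
    has (tau, z)-gradient eps z^{-2} (-K z^2, 1): hence the combination F^1 - K z^2 F^0, and hence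
    constants that do not see eps. The gradient terms alone do not control v itself, so -v^2 is
    added to the tau-component of the current. No regularity is assumed at tau = T for z < z0, and v
    is C^2 only inside. The divergence theorem is therefore used on closed boxes inside Omega; the
    later time face is dropped by its sign, and the other faces reach Sigma_0 and Sigma_1 by uniform
    continuity of the first derivatives. The density |det g|^{-1} is the minor of (g^{AB}), so
    derivatives fall only on the inverse metric. The sphere is handled without a change of variables
    formula: chart changes are only Lipschitz relations, and integrals are compared through the
    measures of superlevel sets. *)

Lemma filter_and3 {T : Type} {F : set_system T} {FF : Filter F} (A B C : T -> Prop) :
  F A -> F B -> F C -> F (fun x => A x /\ B x /\ C x).
Proof. by move=> FA FB FC; apply: filterI => //; exact: filterI. Qed.

Lemma convex_lt {R : realType} (h U V a b r : R) : 0 <= U -> 0 <= V -> 0 < h ->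
  0 <= a -> a <= 1 -> 0 <= b -> b <= 1 -> h * (2 * (U + V + 1)) = r ->
  a * h * U + b * h * V < r.
Proof.
move=> U0 V0 h0 a0 a1 b0 b1 <-.
have : 0 <= h * U by rewrite mulr_ge0// ltW.
have : 0 <= h * V by rewrite mulr_ge0// ltW.
have : a * (h * U) <= 1 * (h * U) by rewrite ler_wpM2r// mulr_ge0// ltW.
have : b * (h * V) <= 1 * (h * V) by rewrite ler_wpM2r// mulr_ge0// ltW.
rewrite !mulrA; lra.
Qed.

Lemma double_difference {R : realType} (k X Y a b c d : R) : k != 0 ->
  a - b - (c - d) = k * X -> a - c - (b - d) = k * Y -> X = Y.
Proof. by move=> k0 HX HY; apply: (mulfI k0); rewrite -HX -HY; ring. Qed.

Lemma dist_lt2 {R : realType} (a b x e : R) :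
  `|a - x| < e -> `|b - x| < e -> `|a - b| < e + e.
Proof.
move=> ax bx; rewrite (_ : a - b = (a - x) - (b - x)); last by ring.
by apply: le_lt_trans (ler_normB _ _) _; exact: ltrD.
Qed.

Lemma linear_error {R : realType} (e U V d a b a' b' : R) :
  `|d - (a' * U + b' * V)| < e -> `|a - a'| < e -> `|b - b'| < e ->
  `|d - (U * a + V * b)| < e * (`|U| + `|V| + 2).
Proof.
move=> h1 h2 h3.
rewrite (_ : d - (U * a + V * b) =
  (d - (a' * U + b' * V)) - U * (a - a') - V * (b - b')); last by ring.
have := ler_normB (d - (a' * U + b' * V) - U * (a - a')) (V * (b - b')).
have := ler_normB (d - (a' * U + b' * V)) (U * (a - a')).
rewrite !normrM.
have : `|U| * `|a - a'| <= `|U| * e by rewrite ler_wpM2l// ltW.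
have : `|V| * `|b - b'| <= `|V| * e by rewrite ler_wpM2l// ltW.
have := normr_ge0 (a - a'); lra.
Qed.

Section Directional.
Context {R : realType} {E : normedModType R}.
Implicit Types (f g : E -> R) (p v : E) (a b t : R).

Lemma is_derive_add f g p v a b : is_derive p v f a -> is_derive p v g b ->
  is_derive p v (fun q => f q + g q) (a + b).
Proof. by move=> ? ?; apply: is_deriveD. Qed.

Lemma is_derive_sub f g p v a b : is_derive p v f a -> is_derive p v g b ->
  is_derive p v (fun q => f q - g q) (a - b).
Proof. by move=> ? ?; apply: is_deriveB. Qed.

Lemma is_derive_mul f g p v a b : is_derive p v f a -> is_derive p v g b ->
  is_derive p v (fun q => f q * g q) (f p * b + g p * a).
Proof. by move=> ? ?; apply: is_deriveM. Qed.

Lemma is_derive_scal f c p v a : is_derive p v f a ->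
  is_derive p v (fun q => c * f q) (c * a).
Proof. by move=> ?; exact: (is_deriveZ c). Qed.

Lemma is_derive_bigsum n (h : 'I_n -> E -> R) p v (dh : 'I_n -> R) :
  (forall i, is_derive p v (h i) (dh i)) ->
  is_derive p v (fun q => \sum_(i < n) h i q) (\sum_(i < n) dh i).
Proof.
move=> H.
have -> : (fun q => \sum_(i < n) h i q) = \sum_(i < n) h i.
  by apply/funext => q; rewrite fct_sumE.
exact: is_derive_sum.
Qed.

Lemma is_deriveP f p v a : is_derive p v f a <->
  ((fun h : R => h^-1 *: (f (h *: v + p) - f p)) @ 0^' --> a).
Proof.
split=> [[df <-]|H]; first exact: df.
by split; [apply/cvg_ex; exists a|exact: cvg_lim].
Qed.

Lemma is_derive_near f g p v a : (\forall q \near p, f q = g q) ->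
  is_derive p v f a -> is_derive p v g a.
Proof.
move=> fg /is_deriveP fa; apply/is_deriveP; apply: cvg_trans fa.
have fgp : f p = g p by exact: nbhs_singleton fg.
apply: near_eq_cvg.
have c : (fun h : R => h *: v + p) @ 0 --> p.
  rewrite -[X in _ --> X](add0r p) -(scale0r v).
  by apply: cvgD; [apply: cvgZr_tmp; exact: cvg_id|exact: cvg_cst].
have /nbhs_dnbhs : \forall h \near (0:R), f (h *: v + p) = g (h *: v + p).
  exact: c fg.
by apply: filterS => h ->; rewrite fgp.
Qed.

(** The directional quotient along a line is a one-variable quotient; this brings the chain rule and
    the mean value theorem of one variable to directional derivatives. *)
Lemma is_derive_line f p v t a :
  is_derive (p + t *: v) v f a <-> is_derive t 1 (fun s : R => f (p + s *: v)) a.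
Proof.
have -> : is_derive (p + t *: v) v f a <->
  ((fun h : R => h^-1 *: (f (h *: v + (p + t *: v)) - f (p + t *: v))) @ 0^' --> a).
  exact: is_deriveP.
have E1 : (fun h : R => h^-1 *: (f (h *: v + (p + t *: v)) - f (p + t *: v))) =
   (fun h : R => h^-1 *: (f (p + (h *: 1 + t) *: v) - f (p + t *: v))).
  by apply/funext => h; rewrite [h *: 1]mulr1 scalerDl addrCA.
rewrite E1; split => [H|[H <-]]; last exact: H.
by split; [apply/cvg_ex; exists a; exact: H|exact: cvg_lim].
Qed.

Lemma line_cvg p v t : (fun s : R => p + s *: v) @ t --> p + t *: v.
Proof. by apply: cvgD; [exact: cvg_cst|apply: cvgZr_tmp; exact: cvg_id]. Qed.

Lemma mvt_line f p v (h : R) :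
  (forall s : R, 0 <= s <= 1 -> {for p + (s * h) *: v, continuous f} /\
     derivable f (p + (s * h) *: v) v) ->
  exists2 s : R, 0 <= s <= 1 & f (p + h *: v) - f p = h * 'D_v f (p + (s * h) *: v).
Proof.
move=> H; pose g (s : R) := f (p + s *: (h *: v)).
have dg (s : R) : 0 <= s <= 1 -> is_derive s 1 g (h * 'D_v f (p + (s * h) *: v)).
  move=> s01; have [_ /derivableP d] := H s s01.
  move: d => /is_derive_line d.
  have -> : g = (fun s => f (p + s *: v)) \o ( *%R^~ h).
    by apply/funext => x; rewrite /g /= scalerA.
  by apply: is_derive_eq; rewrite scaler0 add0r [h%:A]mulr1 mulrC.
have [||x x01] := @MVT_segment R g (fun s => h * 'D_v f (p + (s * h) *: v)) 0 1 ler01.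
- by move=> x; rewrite in_itv /= => /andP[/ltW x0 /ltW x1]; apply: dg; rewrite x0.
- apply: derivable_within_continuous => x; rewrite in_itv /= => x01.
  by have [] := dg x x01.
rewrite /g scale1r scale0r addr0 subr0 mulr1 => ->.
by exists x.
Qed.

(** Only directional derivatives and their continuity, for each direction separately; linearity in
    [v] is not built in and is recovered in the plane by [derive_linear2]. Equivalent to [Ck_on 1],
    but free of lists of directions. *)
Definition C1 (D : set E) f := forall x, D x ->
  {for x, continuous f} /\
  forall v, derivable f x v /\ {for x, continuous ('D_v f)}.

Lemma Ck1_C1 D f : Ck_on 1 D f <-> C1 D f.
Proof.
split=> [H x Dx|H].
  split; first exact: (H [::] x Dx isT).1.
  by move=> v; split; [exact: (H [::] x Dx isT).2|exact: (H [:: v] x Dx isT).1].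
case=> [|v [|//]] x Dx _; split => //=.
- by have [] := H x Dx.
- by move=> _ v; have [_ /(_ v)[]] := H x Dx.
- by have [_ /(_ v)[]] := H x Dx.
Qed.

Lemma Ck2_C1 D f : Ck_on 2 D f -> C1 D f.
Proof.
move=> H x Dx; split; first exact: (H [::] x Dx isT).1.
by move=> v; split; [exact: (H [::] x Dx isT).2|exact: (H [:: v] x Dx isT).1].
Qed.

Lemma Ck2_D_C1 D f v : Ck_on 2 D f -> C1 D ('D_v f).
Proof.
move=> H x Dx; split; first exact: (H [:: v] x Dx isT).1.
by move=> w; split; [exact: (H [:: v] x Dx isT).2|exact: (H [:: w; v] x Dx isT).1].
Qed.

Lemma C1_subset D D' f : D' `<=` D -> C1 D f -> C1 D' f.
Proof. by move=> DD' H x /DD'; exact: H. Qed.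

Section C1_ops.
Variable (D : set E).
Hypothesis oD : open D.

(* the derivative of f is only known on D, so openness is used to transfer
   continuity of the derivative *)
Lemma C1_intro f (df : E -> E -> R) :
  (forall x, D x -> {for x, continuous f}) ->
  (forall x v, D x -> is_derive x v f (df v x) /\ {for x, continuous (df v)}) ->
  C1 D f.
Proof.
move=> cf H x Dx; split; first exact: cf.
move=> v; have [[df1 df2] c] := H x v Dx; split => //.
rewrite /prop_for /continuous_at df2; apply: cvg_trans c; apply: near_eq_cvg.
have : nbhs x D by exact: open_nbhs_nbhs.
by apply: filterS => y /(H _ v)[[_ ->]].
Qed.

Lemma C1_cst c : C1 D (fun=> c).
Proof.
apply: (@C1_intro _ (fun _ _ => 0)) => [x _|x v _]; first exact: cvg_cst.
by split; [exact: is_derive_cst|exact: cvg_cst].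
Qed.

Lemma C1_add f g : C1 D f -> C1 D g -> C1 D (fun q => f q + g q).
Proof.
move=> Hf Hg.
apply: (@C1_intro _ (fun v q => 'D_v f q + 'D_v g q)) => [x Dx|x v Dx].
  by apply: cvgD; [have [] := Hf x Dx|have [] := Hg x Dx].
have [_ /(_ v)[/derivableP df cf]] := Hf x Dx.
have [_ /(_ v)[/derivableP dg cg]] := Hg x Dx.
by split; [exact: is_derive_add|apply: cvgD].
Qed.

Lemma C1_mul f g : C1 D f -> C1 D g -> C1 D (fun q => f q * g q).
Proof.
move=> Hf Hg.
apply: (@C1_intro _ (fun v q => f q * 'D_v g q + g q * 'D_v f q)) => [x Dx|x v Dx].
  by apply: cvgM; [have [] := Hf x Dx|have [] := Hg x Dx].
have [f0 /(_ v)[/derivableP df cf]] := Hf x Dx.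
have [g0 /(_ v)[/derivableP dg cg]] := Hg x Dx.
by split; [exact: is_derive_mul|apply: cvgD; exact: cvgM].
Qed.

Lemma C1_opp f : C1 D f -> C1 D (fun q => - f q).
Proof.
move=> Hf; rewrite (_ : (fun q => - f q) = (fun q => (-1) * f q)); last first.
  by apply/funext => q; rewrite mulN1r.
apply: C1_mul; [exact: C1_cst|exact: Hf].
Qed.

Lemma C1_sub f g : C1 D f -> C1 D g -> C1 D (fun q => f q - g q).
Proof. by move=> Hf Hg; apply: C1_add; [exact: Hf|exact: C1_opp]. Qed.

Lemma C1_sum n (F : 'I_n -> E -> R) : (forall i, C1 D (F i)) ->
  C1 D (fun q => \sum_(i < n) F i q).
Proof.
elim: n F => [|n IH] F H.
  rewrite (_ : (fun q => _) = fun=> 0); first exact: C1_cst.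
  by apply/funext => q; rewrite big_ord0.
rewrite (_ : (fun q => _) = fun q => F ord0 q + \sum_(i < n) F (lift ord0 i) q).
  by apply: C1_add => //; apply: IH.
by apply/funext => q; rewrite big_ord_recl.
Qed.

Lemma is_derive_comp1 (phi : R -> R) f p v a b :
  is_derive p v f a -> is_derive (f p) 1 phi b ->
  is_derive p v (fun q => phi (f q)) (b * a).
Proof.
move=> fa phib; rewrite -[p]addr0 -(scale0r v); apply/is_derive_line.
rewrite -[p]addr0 -(scale0r v) in fa; move/is_derive_line in fa.
rewrite (_ : (fun s => _) = phi \o (fun s : R => f (p + s *: v))) //.
have phib' : is_derive (f (p + (0:R) *: v)) 1 phi b by rewrite scale0r addr0.
exact: is_derive1_comp.
Qed.

Lemma C1_comp (phi dphi : R -> R) f : C1 D f ->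
  (forall x, D x -> is_derive (f x) 1 phi (dphi (f x)) /\
     {for f x, continuous dphi}) ->
  C1 D (fun q => phi (f q)).
Proof.
move=> Hf Hphi.
apply: (@C1_intro _ (fun v q => dphi (f q) * 'D_v f q)) => [x Dx|x v Dx].
  have [cf _] := Hf x Dx; have [[dp _] _] := Hphi x Dx.
  apply: continuous_comp => //.
  exact/differentiable_continuous/derivable1_diffP.
have [cf /(_ v)[/derivableP df cdf]] := Hf x Dx.
have [dp cdp] := Hphi x Dx.
split; first exact: is_derive_comp1.
by apply: cvgM => //; apply: continuous_comp.
Qed.

End C1_ops.

Lemma C1_linear (D : set E) (l : E -> R) : open D -> continuous l ->
  (forall x y, l (x + y) = l x + l y) -> (forall a x, l (a *: x) = a * l x) ->
  C1 D l /\ forall x v, is_derive x v l (l v).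
Proof.
move=> oD cl lD lZ.
have dl x v : is_derive x v l (l v).
  apply/is_deriveP; apply: cvg_near_cst; near=> h.
  rewrite lD lZ addrK [LHS]mulrA mulVf ?mul1r//.
  by near: h; exact: nbhs_dnbhs_neq.
split=> //; apply: (@C1_intro _ _ _ (fun v _ => l v)); first exact: oD.
  by move=> x _; exact: cl.
by move=> x v _; split; [exact: dl|exact: cvg_cst].
Unshelve. all: by end_near. Qed.

(** The second difference of [f] over a small parallelogram is symmetric in [u] and [v]. Two
    applications of the mean value theorem write it as h^2 times either mixed derivative at some
    nearby point, so the two mixed derivatives agree at points close to [p]. If they differed at
    [p], continuity with tolerance [e], half of the gap, would be contradicted. *)
Lemma schwarz (D : set E) f p u v : open D -> Ck_on 2 D f -> D p ->
  'D_u ('D_v f) p = 'D_v ('D_u f) p.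
Proof.
move=> oD f2 Dp.
apply/eqP/negP => /negP ne.
pose e := `|'D_u ('D_v f) p - 'D_v ('D_u f) p| / 2.
have e0 : 0 < e by rewrite divr_gt0// normr_gt0 subr_eq0.
have c1 := (f2 [:: u; v] p Dp isT).1; have c2 := (f2 [:: v; u] p Dp isT).1.
rewrite /= in c1 c2.
have n1 : \forall x \near p, `|'D_u ('D_v f) p - 'D_u ('D_v f) x| < e.
  by move/cvgr_dist_lt : c1; apply.
have n2 : \forall x \near p, `|'D_v ('D_u f) p - 'D_v ('D_u f) x| < e.
  by move/cvgr_dist_lt : c2; apply.
have n3 : \forall x \near p, D x by exact: open_nbhs_nbhs.
have : \forall x \near p, `|'D_u ('D_v f) p - 'D_u ('D_v f) x| < e /\
    `|'D_v ('D_u f) p - 'D_v ('D_u f) x| < e /\ D x.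
  exact: filter_and3 n1 n2 n3.
move=> /nbhs_ballP[r /= r0 Hr].
have k0 : 0 < `|u| + `|v| + 1 by rewrite ltr_wpDl// addr_ge0.
(* With this [h] the parallelogram with sides h u and h v stays in the ball where both mixed
   derivatives are within [e] of their values at [p]. *)
have [h h0 hk] : exists2 h : R, 0 < h & h * (2 * (`|u| + `|v| + 1)) = r.
  exists (r / (2 * (`|u| + `|v| + 1))); first by rewrite divr_gt0// mulr_gt0.
  by rewrite mulfVK// gt_eqF// mulr_gt0.
have inb (a b : R) : 0 <= a <= 1 -> 0 <= b <= 1 ->
    ball p r (p + (a * h) *: u + (b * h) *: v).
  move=> /andP[a0 a1] /andP[b0 b1]; rewrite -ball_normE /ball_/=.
  rewrite -addrA opprD addrA subrr add0r normrN.
  apply: le_lt_trans (ler_normD _ _) _; rewrite (normrZ (a * h) u) (normrZ (b * h) v).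
  have ah : `|a * h : R| = a * h by rewrite ger0_norm// mulr_ge0// ltW.
  have bh : `|b * h : R| = b * h by rewrite ger0_norm// mulr_ge0// ltW.
  rewrite ah bh.
  by apply: (@convex_lt R h `|u| `|v|).
(* Mean value theorem for x -> f (x + h v') - f x along u', then for the derivative of [f] in
   direction u' along v'. *)
have key (u' v' : E) : (forall a b : R, 0 <= a <= 1 -> 0 <= b <= 1 ->
    ball p r (p + (a * h) *: u' + (b * h) *: v')) ->
  exists2 x, ball p r x & f (p + h *: u' + h *: v') - f (p + h *: u')
     - (f (p + h *: v') - f p) = h ^+ 2 * 'D_v' ('D_u' f) x.
  move=> inb'.
  have i1 : 0 <= (1:R) <= 1 by rewrite ler01 lexx.
  have i0 : 0 <= (0:R) <= 1 by rewrite ler01 lexx.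
  have inb1 a : 0 <= a <= 1 -> ball p r (p + (a * h) *: u' + h *: v').
    by move=> /inb' /(_ i1); rewrite mul1r.
  have inb0 a : 0 <= a <= 1 -> ball p r (p + (a * h) *: u').
    by move=> /inb' /(_ i0); rewrite mul0r scale0r addr0.
  pose F x := f (x + h *: v') - f x.
  have dF (a : R) : 0 <= a <= 1 -> {for p + (a * h) *: u', continuous F} /\
     is_derive (p + (a * h) *: u') u' F
       ('D_u' f (p + (a * h) *: u' + h *: v') - 'D_u' f (p + (a * h) *: u')).
    move=> a01.
    have [_ [_ D1]] := Hr _ (inb1 a a01); have [_ [_ D0]] := Hr _ (inb0 a a01).
    have [cf1 /(_ u')[df1 _]] := Ck2_C1 f2 D1.
    have [cf0 /(_ u')[df0 _]] := Ck2_C1 f2 D0.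
    split.
      apply: cvgB => //.
      apply: continuous_comp => //.
      by apply: cvgD; [exact: cvg_id|exact: cvg_cst].
    apply: is_derive_sub; last exact: derivableP.
    apply/is_deriveP; move/derivableP/is_deriveP : df1.
    by under eq_fun do rewrite addrA.
  have [s s01 Hs] := @mvt_line F p u' h (fun a a01 => conj (dF a a01).1
     (@ex_derive _ _ _ _ _ _ _ (dF a a01).2)).
  have [t t01 Ht] := @mvt_line ('D_u' f) (p + (s * h) *: u') v' h (fun t t01 =>
    let: conj _ (conj _ Dt) := Hr _ (inb' s t s01 t01) in
    conj (Ck2_D_C1 u' f2 Dt).1 ((Ck2_D_C1 u' f2 Dt).2 v').1).
  exists (p + (s * h) *: u' + (t * h) *: v'); first exact: inb'.
  rewrite -[LHS]/(F (p + h *: u') - F p) Hs.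
  have [_ [_ ->]] := dF s s01.
  by rewrite Ht mulrA expr2.
have [x xp Hx] := key u v inb.
have [|y yp Hy] := key v u.
  by move=> a b a01 b01; rewrite -addrA [X in p + X]addrC addrA; exact: inb.
have xy : 'D_v ('D_u f) x = 'D_u ('D_v f) y.
  rewrite -[p + h *: v + _]addrA [h *: v + _]addrC addrA in Hy.
  by apply: double_difference Hx Hy; rewrite expf_neq0// gt_eqF.
have [_ [yx _]] := Hr _ xp; have [xx _] := Hr _ yp.
rewrite -xy in xx.
have : `|'D_u ('D_v f) p - 'D_v ('D_u f) p| < e + e by apply: dist_lt2 xx yx.
by rewrite /e -splitr ltxx.
Qed.

End Directional.

Section Sections.
Context {R : realType} {E F : normedModType R}.

Lemma is_derive_sec2 (u : E * F -> R) b x w a :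
  is_derive (b, x) (0, w) u a <-> is_derive x w (fun y => u (b, y)) a.
Proof.
rewrite !is_deriveP.
have -> // : (fun h : R => h^-1 *: (u (h *: (0, w) + (b, x)) - u (b, x))) =
   (fun h : R => h^-1 *: (u (b, h *: w + x) - u (b, x))).
by apply/funext => h; congr (_ *: (u _ - _)); congr (_, _); rewrite /= scaler0 add0r.
Qed.

Lemma is_derive_sec1 (u : E * F -> R) b x w a :
  is_derive (b, x) (w, 0) u a <-> is_derive b w (fun c => u (c, x)) a.
Proof.
rewrite !is_deriveP.
have -> // : (fun h : R => h^-1 *: (u (h *: (w, 0) + (b, x)) - u (b, x))) =
   (fun h : R => h^-1 *: (u (h *: w + b, x) - u (b, x))).
by apply/funext => h; congr (_ *: (u _ - _)); congr (_, _); rewrite /= scaler0 add0r.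
Qed.

Lemma derive_sec2 (u : E * F -> R) b x w :
  'D_w (fun y => u (b, y)) x = 'D_(0, w) u (b, x).
Proof.
rewrite /derive; set d := (fun h : R => _); set d' := (fun h : R => _).
suff -> : d = d' by [].
apply/funext => h; rewrite /d /d' /=.
by congr (_ *: (u _ - _)); congr (_, _); rewrite /= scaler0 add0r.
Qed.

Lemma derive_sec1 (u : E * F -> R) b x w :
  'D_w (fun c => u (c, x)) b = 'D_(w, 0) u (b, x).
Proof.
rewrite /derive; set d := (fun h : R => _); set d' := (fun h : R => _).
suff -> : d = d' by [].
apply/funext => h; rewrite /d /d' /=.
by congr (_ *: (u _ - _)); congr (_, _); rewrite /= scaler0 add0r.
Qed.

Lemma cvg_pair2 (b : E) (x : F) : (fun y : F => (b, y)) @ x --> (b, x).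
Proof. by apply: cvg_pair; [exact: cvg_cst|exact: cvg_id]. Qed.

Lemma cvg_pair1 (b : E) (x : F) : (fun c : E => (c, x)) @ b --> (b, x).
Proof. by apply: cvg_pair; [exact: cvg_id|exact: cvg_cst]. Qed.

Lemma C1_sec2 (D : set (E * F)) u b : C1 D u ->
  C1 [set x | D (b, x)] (fun y => u (b, y)).
Proof.
move=> H x Dx; have [cu du] := H _ Dx; split.
  by apply: (@continuous_comp _ _ _ (pair b) u) => //; exact: cvg_pair2.
move=> v; have [dv cv] := du (0, v); split.
  by have [] := (is_derive_sec2 u b x v _).1 (derivableP dv).
rewrite (_ : 'D_v (fun y => u (b, y)) = fun y => 'D_(0, v) u (b, y)).
  by apply: (@continuous_comp _ _ _ (pair b) ('D_(0, v) u)) => //; exact: cvg_pair2.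
by apply/funext => y; rewrite derive_sec2.
Qed.

Lemma C1_sec1 (D : set (E * F)) u x : C1 D u ->
  C1 [set b | D (b, x)] (fun c => u (c, x)).
Proof.
move=> H b Dx; have [cu du] := H _ Dx; split.
  by apply: (@continuous_comp _ _ _ (fun c => (c, x)) u) => //; exact: cvg_pair1.
move=> v; have [dv cv] := du (v, 0); split.
  by have [] := (is_derive_sec1 u b x v _).1 (derivableP dv).
rewrite (_ : 'D_v (fun c => u (c, x)) = fun c => 'D_(v, 0) u (c, x)).
  by apply: (@continuous_comp _ _ _ (fun c => (c, x)) ('D_(v, 0) u)) => //; exact: cvg_pair1.
by apply/funext => y; rewrite derive_sec1.
Qed.

End Sections.

(** * Mean value theorem in the plane and linearity of the derivative *)

Section Plane.
Context {R : realType}.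
Implicit Types (f : R * R -> R) (p x : R * R).

Definition sq p (r : R) : set (R * R) :=
  [set x | `|x.1 - p.1| < r /\ `|x.2 - p.2| < r].

Lemma nbhs_sq p (A : set (R * R)) :
  nbhs p A <-> exists2 r : R, 0 < r & sq p r `<=` A.
Proof.
split.
  move=> /nbhs_ballP[r /= r0 H]; exists r => // x [x1 x2]; apply: H.
  by split; rewrite /ball /= distrC.
move=> [r r0 H]; apply/nbhs_ballP; exists r => //= x [].
by rewrite /ball /= => x1 x2; apply: H; split; rewrite distrC.
Qed.

(** The path runs parallel to the first axis and then to the second, inside the square. Each leg has
    its own intermediate point, which is why two points appear. *)
Lemma mvt2 f p r x y : C1 (sq p r) f -> sq p r x -> sq p r y ->
  exists z1, exists z2, [/\ sq p r z1, sq p r z2 &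
    f y - f x = 'D_(1, 0) f z1 * (y.1 - x.1) + 'D_(0, 1) f z2 * (y.2 - x.2)].
Proof.
move=> Hf [x1 x2] [y1 y2].
have conv (a b c s : R) : `|a - c| < r -> `|b - c| < r -> 0 <= s <= 1 ->
    `|a + s * (b - a) - c| < r.
  move=> ac bc /andP[s0 s1].
  rewrite (_ : _ - c = (1 - s) * (a - c) + s * (b - c)); last by lra.
  apply: le_lt_trans (ler_normD _ _) _; rewrite !normrM (ger0_norm s0) ger0_norm ?subr_ge0//.
  have [->|sn] := eqVneq s 0; first by rewrite subr0 mul1r mul0r addr0.
  have sp : 0 < s by rewrite lt0r sn.
  have : (1 - s) * `|a - c| <= (1 - s) * r by rewrite ler_wpM2l ?subr_ge0// ltW.
  have : s * `|b - c| < s * r by rewrite ltr_pM2l.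
  lra.
have sq1 (s : R) : 0 <= s <= 1 -> sq p r (x + (s * (y.1 - x.1)) *: (1, 0)).
  by move=> s01; split; rewrite /= ?scaler0 ?addr0// [_%:A]mulr1; exact: conv.
have sq2 (s : R) : 0 <= s <= 1 -> sq p r ((y.1, x.2) + (s * (y.2 - x.2)) *: (0, 1)).
  by move=> s01; split; rewrite /= ?scaler0 ?addr0// [_%:A]mulr1; exact: conv.
have [s s01 Hs] := @mvt_line _ _ f x (1, 0) (y.1 - x.1)
  (fun s s01 => conj (Hf _ (sq1 s s01)).1 ((Hf _ (sq1 s s01)).2 _).1).
have [t t01 Ht] := @mvt_line _ _ f (y.1, x.2) (0, 1) (y.2 - x.2)
  (fun s s01 => conj (Hf _ (sq2 s s01)).1 ((Hf _ (sq2 s s01)).2 _).1).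
exists (x + (s * (y.1 - x.1)) *: (1, 0)), ((y.1, x.2) + (t * (y.2 - x.2)) *: (0, 1)).
split; [exact: sq1|exact: sq2|].
have e1 : x + (y.1 - x.1) *: (1, 0) = (y.1, x.2).
  by rewrite [x]surjective_pairing /=; congr (_, _); rewrite /= ?scaler0 ?addr0// [_%:A]mulr1 subrKC.
have e2 : (y.1, x.2) + (y.2 - x.2) *: (0, 1) = y.
  by rewrite [RHS]surjective_pairing /=; congr (_, _); rewrite /= ?scaler0 ?addr0// [_%:A]mulr1 subrKC.
rewrite e1 in Hs; rewrite e2 in Ht.
rewrite -(subrKA (f (y.1, x.2))) Hs Ht.
by rewrite addrC; congr (_ + _); rewrite [LHS]mulrC.
Qed.

(** By [mvt2] the quotient in direction [w] is the asserted combination with the partial derivatives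
    taken at two points near [p]; their continuity rules out any gap. The denominator of [e] is the
    factor lost in [linear_error]. *)
Lemma derive_linear2 f p (D : set (R * R)) w : open D -> C1 D f -> D p ->
  'D_w f p = w.1 * 'D_(1, 0) f p + w.2 * 'D_(0, 1) f p.
Proof.
move=> oD Hf Dp; apply/eqP/negP => /negP ne.
set d := 'D_w f p in ne *; set a := 'D_(1, 0) f p; set b := 'D_(0, 1) f p.
pose e := `|d - (w.1 * a + w.2 * b)| / (`|w.1| + `|w.2| + 2).
have k0 : 0 < `|w.1| + `|w.2| + 2 by rewrite ltr_wpDl// addr_ge0.
have e0 : 0 < e by rewrite divr_gt0// normr_gt0 subr_eq0.
have [_ H] := Hf p Dp.
have n1 : \forall x \near p, `|a - 'D_(1, 0) f x| < e.
  by have [_ /cvgr_dist_lt] := H (1, 0); apply.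
have n2 : \forall x \near p, `|b - 'D_(0, 1) f x| < e.
  by have [_ /cvgr_dist_lt] := H (0, 1); apply.
have n3 : \forall x \near p, D x by exact: open_nbhs_nbhs.
have : \forall x \near p, `|a - 'D_(1, 0) f x| < e /\
    `|b - 'D_(0, 1) f x| < e /\ D x.
  exact: filter_and3 n1 n2 n3.
move=> /nbhs_sq[r /= r0 Hr].
have /derivableP/is_deriveP/cvgr_dist_lt/(_ e e0) q1 := (H w).1.
have q2 : \forall h \near 0^', sq p r (h *: w + p).
  apply: nbhs_dnbhs.
  have := @line_cvg R _ p w 0; rewrite scale0r addr0 => H0.
  have nq : nbhs p (sq p r) by apply/nbhs_sq; exists r.
  have H1 : \forall h \near (0:R), sq p r (p + h *: w) by exact: (H0 _ nq).
  by apply: filterS H1 => h; rewrite addrC.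
have [h [h1 [h2 h0]]] : exists h, `|d - h^-1 *: (f (h *: w + p) - f p)| < e /\
    (sq p r (h *: w + p) /\ h != 0).
  apply: (@filter_ex _ (0^')); apply: filter_and3 q1 q2 _.
  exact: (nbhs_dnbhs_neq (0:R)).
have sqp : sq p r p by split; rewrite subrr normr0.
have [z1 [z2 [s1 s2]]] := @mvt2 f p r _ _ (C1_subset (fun x Hx => (Hr x Hx).2.2) Hf) sqp h2.
move=> E; rewrite E /= !addrK in h1.
have {}h1 : `|d - ('D_(1, 0) f z1 * w.1 + 'D_(0, 1) f z2 * w.2)| < e.
  apply: le_lt_trans h1; rewrite le_eqVlt; apply/orP; left; apply/eqP.
  congr (`|_ - _|); rewrite /GRing.scale /=.
  rewrite (mulrCA _ h) (mulrCA _ h) -mulrDr mulrA mulVf// mul1r.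
  by congr (_ * _ + _ * _).
have [a1 _] := Hr _ s1; have [_ [b1 _]] := Hr _ s2.
have := linear_error h1 a1 b1.
by rewrite /e mulfVK ?gt_eqF// ltxx.
Qed.

End Plane.

(** * Integration over boxes *)

Section Base.

(** A countable neighbourhood base with measurable members. The notion is stable under products, so
    the product of the Borel structures contains the open sets of the product topology; [toE] is the
    identity from the measurable space to the normed space. *)
Definition measurable_base d (X : measurableType d) (E : topologicalType)
    (toE : X -> E) (I : countType) (B : I -> set E) : Prop :=
  (forall i, measurable (toE @^-1` B i)) /\
  (forall x A, nbhs x A -> exists i, B i x /\ B i `<=` A).

Lemma open_measurable_base d (X : measurableType d) (E : topologicalType)
    (toE : X -> E) (I : countType) (B : I -> set E) (U : set E) :
  measurable_base toE B -> open U -> measurable (toE @^-1` U).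
Proof.
move=> [mB HB] oU.
have -> : toE @^-1` U =
    \bigcup_n (if unpickle n is Some i then
                 if `[< B i `<=` U >] then toE @^-1` B i else set0 else set0).
  apply/seteqP; split=> [x Ux|x [n _]]; last first.
    by case: (unpickle n) => [i|//]; case: asboolP => // BU /BU.
  have [i [Bx BU]] := HB (toE x) U (open_nbhs_nbhs (conj oU Ux)).
  by exists (pickle i) => //; rewrite pickleK; case: asboolP.
apply: bigcupT_measurable => n; case: (unpickle n) => [i|//].
by case: asboolP.
Qed.

Context {R : realType}.

Lemma measurable_baseR : measurable_base (id : measurableTypeR R -> R)
  (fun q : rat * rat => ball (ratr q.1 : R) (ratr q.2 : R)).
Proof.
split=> [q|x A /nbhs_ballP[e /= e0 He]].
  by rewrite preimage_id; apply: open_measurable; exact: ball_open.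
have [q2] := rat_in_itvoo (divr_gt0 e0 (ltr0Sn R 1)).
rewrite in_itv /= => /andP[q20 q2e].
have [|q1] := @rat_in_itvoo R (x - ratr q2) (x + ratr q2); first by lra.
rewrite in_itv /= => /andP[q1a q1b].
exists (q1, q2); split; rewrite /ball /=.
  by rewrite ltr_norml; apply/andP; split; lra.
move=> y; rewrite /ball /= ltr_norml => /andP[h1 h2]; apply: He.
by rewrite /ball /= ltr_norml; apply/andP; split; lra.
Qed.

Lemma measurable_baseM d1 (X1 : measurableType d1) (E1 : topologicalType)
    (to1 : X1 -> E1) (I1 : countType) (B1 : I1 -> set E1)
    d2 (X2 : measurableType d2) (E2 : topologicalType)
    (to2 : X2 -> E2) (I2 : countType) (B2 : I2 -> set E2) :
  measurable_base to1 B1 -> measurable_base to2 B2 ->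
  measurable_base (fun x : X1 * X2 => (to1 x.1, to2 x.2))
    (fun i : I1 * I2 => B1 i.1 `*` B2 i.2).
Proof.
move=> [m1 H1] [m2 H2]; split=> [i|[x1 x2] A].
  exact: (measurableX (m1 i.1) (m2 i.2)).
move=> [[A1 A2] /= [/H1[i1 [a1 b1]] /H2[i2 [a2 b2]]] H].
exists (i1, i2); split => // -[y1 y2] [/= /b1 ? /b2 ?].
exact: H.
Qed.

Definition measurable_base2 := measurable_baseM measurable_baseR measurable_baseR.
Definition measurable_base3 := measurable_baseM measurable_baseR measurable_base2.
Definition measurable_base4 := measurable_baseM measurable_base2 measurable_base2.

Local Notation mR := (measurableTypeR R).

Lemma open_measurable2 (U : set (R * R)) : open U -> measurable (U : set (mR * mR)).
Proof.
move=> /(open_measurable_base measurable_base2); congr (measurable _).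
by apply/seteqP; split=> -[].
Qed.

Lemma open_measurable3 (U : set (R * (R * R))) : open U ->
  measurable (U : set (mR * (mR * mR))).
Proof.
move=> /(open_measurable_base measurable_base3); congr (measurable _).
by apply/seteqP; split=> -[? []].
Qed.

Lemma open_measurable4 (U : set ((R * R) * (R * R))) : open U ->
  measurable (U : set ((mR * mR) * (mR * mR))).
Proof.
move=> /(open_measurable_base measurable_base4); congr (measurable _).
by apply/seteqP; split=> -[[? ?] []].
Qed.

Lemma continuous_on_measurable d (X : measurableType d) (E : topologicalType)
    (D : set E) (toE : X -> E) (f : E -> R) :
  (forall U, open U -> measurable (toE @^-1` U)) -> open D ->
  (forall x, D x -> {for x, continuous f}) ->
  measurable_fun (toE @^-1` D) (f \o toE).
Proof.
move=> mo oD cf; apply: (measurability _ (RGenOpens.measurableE R)).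
move=> _ [_ [a [b ->] <-]].
have -> : toE @^-1` D `&` (f \o toE) @^-1` `]a, b[%classic =
    toE @^-1` (D `&` f @^-1` `]a, b[%classic) by [].
apply: mo; rewrite openE => x [Dx fx]; apply: filterI.
  exact: open_nbhs_nbhs.
by apply: (cf x Dx); apply: open_nbhs_nbhs; split => //; exact: interval_open.
Qed.

End Base.

Section Bounded.
Context {R : realType}.

(** On a set of finite measure this implies integrability, and it is closed under sums and products.
    All side conditions of Fubini and of linearity of the integral on compact boxes are discharged
    through it. *)
Definition bm d (X : measurableType d) (A : set X) (f : X -> R) : Prop :=
  measurable_fun A f /\ exists M : R, forall x, A x -> `|f x| <= M.

Section OneSpace.
Context d (X : measurableType d).
Implicit Types (A : set X) (f g : X -> R).

Lemma bm_integrable (mu : {measure set X -> \bar R}) A f : measurable A ->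
  (mu A < +oo)%E -> bm A f -> mu.-integrable A (EFin \o f).
Proof.
move=> mA fA [mf [M HM]]; apply: measurable_bounded_integrable => //.
exists M; split; first exact: num_real.
by move=> N MN x Ax; apply: le_trans (HM x Ax) _; exact: ltW.
Qed.

Lemma bm_add A f g : bm A f -> bm A g -> bm A (fun x => f x + g x).
Proof.
move=> [mf [M HM]] [mg [N HN]]; split; first exact: measurable_funD.
exists (M + N) => x Ax; apply: le_trans (ler_normD _ _) _.
by apply: lerD; [exact: HM|exact: HN].
Qed.

Lemma bm_mul A f g : bm A f -> bm A g -> bm A (fun x => f x * g x).
Proof.
move=> [mf [M HM]] [mg [N HN]]; split; first exact: measurable_funM.
exists (M * N) => x Ax; rewrite normrM.
by apply: ler_pM => //; [exact: HM|exact: HN].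
Qed.

Lemma bm_cst A c : bm A (fun=> c).
Proof. by split; [exact: measurable_cst|exists `|c|]. Qed.

Lemma bm_opp A f : bm A f -> bm A (fun x => - f x).
Proof.
move=> [mf [M HM]]; split; first exact: measurableT_comp.
by exists M => x Ax; rewrite normrN; exact: HM.
Qed.

Lemma bm_sub A f g : bm A f -> bm A g -> bm A (fun x => f x - g x).
Proof. by move=> bf bg; apply: bm_add => //; exact: bm_opp. Qed.

Lemma bm_sum A n (F : 'I_n -> X -> R) : (forall i, bm A (F i)) ->
  bm A (fun x => \sum_(i < n) F i x).
Proof.
elim: n F => [|n IH] F H.
  rewrite (_ : (fun x => _) = fun=> 0); first exact: bm_cst.
  by apply/funext => x; rewrite big_ord0.
rewrite (_ : (fun x => _) = fun x => F ord0 x + \sum_(i < n) F (lift ord0 i) x).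
  by apply: bm_add => //; exact: IH.
by apply/funext => x; rewrite big_ord_recl.
Qed.

Lemma bm_subset A A' f : measurable A -> measurable A' -> A' `<=` A ->
  bm A f -> bm A' f.
Proof.
move=> mA mA' AA' [mf [M HM]]; split; first exact: measurable_funS mf.
by exists M => x /AA'; exact: HM.
Qed.

End OneSpace.

Context d1 d2 (T1 : measurableType d1) (T2 : measurableType d2).
Variable m1 : {sigma_finite_measure set T1 -> \bar R}.
Variable m2 : {sigma_finite_measure set T2 -> \bar R}.
Variables (A : set T1) (B : set T2).
Hypotheses (mA : measurable A) (mB : measurable B).

Lemma bm_sec2 f x : bm (A `*` B) f -> A x -> bm B (fun y => f (x, y)).
Proof.
move=> [mf [M HM]] Ax; split; last by exists M => y By; apply: HM.
apply: (@measurable_comp _ _ _ _ _ _ (A `*` B) f B (pair x)) => //.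
- exact: measurableX.
- by move=> _ [y By <-].
- by apply: measurable_funTS.
Qed.

Lemma bm_sec1 f y : bm (A `*` B) f -> B y -> bm A (fun x => f (x, y)).
Proof.
move=> [mf [M HM]] By; split; last by exists M => x Ax; apply: HM.
apply: (@measurable_comp _ _ _ _ _ _ (A `*` B) f A (fun x => (x, y))) => //.
- exact: measurableX.
- by move=> _ [x Ax <-].
- by apply: measurable_funTS.
Qed.

Lemma restrict_sec2 (f : T1 * T2 -> \bar R) x :
  (fun y => (f \_ (A `*` B)) (x, y)) =
  (if x \in A then (fun y => f (x, y)) \_ B else cst 0%E).
Proof.
apply/funext => y; rewrite patchE in_setX /=.
by case: (x \in A) => //=; rewrite patchE.
Qed.

Lemma restrict_sec1 (f : T1 * T2 -> \bar R) y :
  (fun x => (f \_ (A `*` B)) (x, y)) =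
  (if y \in B then (fun x => f (x, y)) \_ A else cst 0%E).
Proof.
apply/funext => x; rewrite patchE in_setX /= andbC.
by case: (y \in B) => //=; rewrite patchE.
Qed.

Lemma tonelli_rect (f : T1 * T2 -> \bar R) :
  measurable_fun (A `*` B) f -> (forall z, (A `*` B) z -> 0 <= f z)%E ->
  (\int[m1 \x m2]_(z in A `*` B) f z = \int[m1]_(x in A) \int[m2]_(y in B) f (x, y) /\
   \int[m1 \x m2]_(z in A `*` B) f z = \int[m2]_(y in B) \int[m1]_(x in A) f (x, y))%E.
Proof.
move=> mf f0; have mAB := measurableX mA mB.
have mg : measurable_fun setT (f \_ (A `*` B)) by apply/(measurable_restrictT _ _).1.
have g0 z : (0 <= (f \_ (A `*` B)) z)%E by rewrite patchE; case: ifPn => // /set_mem; exact: f0.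
rewrite integral_mkcond fubini_tonelli1//; split.
  rewrite [RHS]integral_mkcond; apply: eq_integral => x _; rewrite /fubini_F patchE.
  rewrite -[LHS]/(\int[m2]_y ((fun y => (f \_ (A `*` B)) (x, y)) y))%E.
  rewrite restrict_sec2; case: ifPn => // _; last by rewrite integral0.
  by rewrite -integral_mkcond.
rewrite -fubini_tonelli1// fubini_tonelli2// [RHS]integral_mkcond; apply: eq_integral => y _; rewrite /fubini_G patchE.
rewrite -[LHS]/(\int[m1]_x ((fun x => (f \_ (A `*` B)) (x, y)) x))%E.
rewrite restrict_sec1; case: ifPn => // _; last by rewrite integral0.
by rewrite -integral_mkcond.
Qed.

Hypotheses (fA : (m1 A < +oo)%E) (fB : (m2 B < +oo)%E).

Lemma finite_rect : ((m1 \x m2) (A `*` B) < +oo)%E.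
Proof. by rewrite product_measure1E// lte_mul_pinfty// ge0_fin_numE. Qed.

Section RFubini.
Variable f : T1 * T2 -> R.
Hypothesis bf : bm (A `*` B) f.

Let mAB := measurableX mA mB.

Let integrable_f : (m1 \x m2)%E.-integrable (A `*` B) (EFin \o f).
Proof. by apply: bm_integrable => //; exact: finite_rect. Qed.

Let g := (EFin \o f) \_ (A `*` B).

Let integrable_g : (m1 \x m2)%E.-integrable setT g.
Proof. by apply/(integrable_mkcond _ mAB).1. Qed.

Lemma Rintegral_sec2 x : A x ->
  (\int[m2]_(y in B) f (x, y))%:E = (\int[m2]_(y in B) (f (x, y))%:E)%E.
Proof.
move=> Ax; rewrite /Rintegral fineK//; apply: integrable_fin_num => //.
by apply: bm_integrable => //; exact: bm_sec2.
Qed.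

Lemma Rintegral_sec1 y : B y ->
  (\int[m1]_(x in A) f (x, y))%:E = (\int[m1]_(x in A) (f (x, y))%:E)%E.
Proof.
move=> By; rewrite /Rintegral fineK//; apply: integrable_fin_num => //.
by apply: bm_integrable => //; exact: bm_sec1.
Qed.

Let gF x : (\int[m2]_y g (x, y) =
  ((fun x => (\int[m2]_(y in B) f (x, y))%:E) \_ A) x)%E.
Proof.
rewrite -[LHS]/(\int[m2]_y ((fun y => g (x, y)) y))%E /g.
rewrite restrict_sec2 patchE; case: ifPn => [/set_mem Ax|_]; last by rewrite integral0.
by rewrite -integral_mkcond Rintegral_sec2.
Qed.

Let gG y : (\int[m1]_x g (x, y) =
  ((fun y => (\int[m1]_(x in A) f (x, y))%:E) \_ B) y)%E.
Proof.
rewrite -[LHS]/(\int[m1]_x ((fun x => g (x, y)) x))%E /g.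
rewrite restrict_sec1 patchE; case: ifPn => [/set_mem By|_]; last by rewrite integral0.
by rewrite -integral_mkcond Rintegral_sec1.
Qed.

Lemma Rfubini1 : \int[(m1 \x m2)%E]_(z in A `*` B) f z =
  \int[m1]_(x in A) \int[m2]_(y in B) f (x, y).
Proof.
rewrite {1 2}/Rintegral; congr fine.
rewrite integral_mkcond -(integral12_prod_meas1 integrable_g).
rewrite [RHS]integral_mkcond; apply: eq_integral => x _.
exact: gF.
Qed.

Lemma Rfubini2 : \int[(m1 \x m2)%E]_(z in A `*` B) f z =
  \int[m2]_(y in B) \int[m1]_(x in A) f (x, y).
Proof.
rewrite {1 2}/Rintegral; congr fine.
rewrite integral_mkcond -(integral21_prod_meas1 integrable_g).
rewrite [RHS]integral_mkcond; apply: eq_integral => x _.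
exact: gG.
Qed.

End RFubini.

End Bounded.

Section ContinuousPairs.
Context {T U V : topologicalType}.

Lemma pt_pair (f : T -> U) (g : T -> V) (x : T) :
  {for x, continuous f} -> {for x, continuous g} ->
  {for x, continuous (fun y => (f y, g y))}.
Proof. by move=> cf cg; apply: cvg_pair. Qed.

Lemma pt_fst (x : U * V) : {for x, continuous fst}.
Proof. by case: x => a b; exact: cvg_fst. Qed.

Lemma pt_snd (x : U * V) : {for x, continuous snd}.
Proof. by case: x => a b; exact: cvg_snd. Qed.

End ContinuousPairs.

Section Boxes.
Context {R : realType}.
Local Notation mR := (measurableTypeR R).
Local Notation leb := (@lebesgue_measure R).
Local Notation E2 := (R * R)%type.
Local Notation E3 := (R * (R * R))%type.
Local Notation E4 := ((R * R) * (R * R))%type.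

Lemma ftc1 (F f : R -> R) (a b : R) : a < b ->
  (forall x, a <= x <= b -> {for x, continuous f} /\ is_derive x 1 F (f x)) ->
  \int[leb]_(x in `[a, b]) f x = F b - F a.
Proof.
move=> ab H.
have cF x : a <= x <= b -> {for x, continuous F}.
  by move=> /H[_ [dF _]]; exact/differentiable_continuous/derivable1_diffP.
rewrite /Rintegral (@continuous_FTC2 _ f F)//.
- apply: continuous_in_subspaceT => x; rewrite inE /= in_itv /=.
  by move=> /H[].
- split.
  + by move=> x; rewrite in_itv /= => /andP[/ltW ax /ltW xb]; have [|_ []] := H x; rewrite ?ax.
  + by apply: cvg_at_right_filter; apply: cF; rewrite lexx ltW.
  + by apply: cvg_at_left_filter; apply: cF; rewrite lexx ltW.
- move=> x; rewrite in_itv /= => /andP[/ltW ax /ltW xb].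
  by rewrite derive1E; have [|_ []] := H x; rewrite ?ax.
Qed.

Lemma Rintegral_eq0 d (X : measurableType d) (mu : {measure set X -> \bar R})
    (D : set X) (f : X -> R) : (forall x, D x -> f x = 0) ->
  \int[mu]_(x in D) f x = 0.
Proof.
move=> H; rewrite /Rintegral (@eq_integral _ _ _ mu D (cst 0%E)) ?integral0//.
by move=> x /set_mem /H ->.
Qed.

Lemma itv_finite (a b : R) : (leb `[a, b]%classic < +oo)%E.
Proof. exact/compact_finite_measure/segment_compact. Qed.

Lemma itv_measurable (a b : R) : measurable (`[a, b]%classic : set mR).
Proof. exact: measurable_itv. Qed.

Definition box2 (a2 b2 a3 b3 : R) : set E2 := `[a2, b2]%classic `*` `[a3, b3]%classic.

Lemma box2_compact a2 b2 a3 b3 : compact (box2 a2 b2 a3 b3).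
Proof. by apply: compact_setX; exact: segment_compact. Qed.

Lemma box2_measurable a2 b2 a3 b3 : measurable (box2 a2 b2 a3 b3 : set (mR * mR)).
Proof. by apply: measurableX; exact: itv_measurable. Qed.

Lemma leb2_finite (A B : set mR) : measurable A -> measurable B ->
  (leb A < +oo)%E -> (leb B < +oo)%E -> (leb2 (A `*` B) < +oo)%E.
Proof. by move=> mA mB fA fB; exact: (finite_rect mA mB fA fB). Qed.

Lemma box2_finite a2 b2 a3 b3 : (leb2 (box2 a2 b2 a3 b3) < +oo)%E.
Proof. by apply: leb2_finite; do ?exact: itv_measurable; exact: itv_finite. Qed.

Lemma leb3_finite (A : set mR) (B : set (mR * mR)) : measurable A -> measurable B ->
  (leb A < +oo)%E -> (leb2 B < +oo)%E -> (leb3 (A `*` B) < +oo)%E.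
Proof. by move=> mA mB fA fB; exact: (finite_rect mA mB fA fB). Qed.

Lemma leb4_finite (A B : set (mR * mR)) : measurable A -> measurable B ->
  (leb2 A < +oo)%E -> (leb2 B < +oo)%E -> (leb4 (A `*` B) < +oo)%E.
Proof. by move=> mA mB fA fB; exact: (finite_rect mA mB fA fB). Qed.

Lemma compact_bounded_on (E : topologicalType) (D K : set E) (f : E -> R) :
  compact K -> K `<=` D -> (forall x, D x -> {for x, continuous f}) ->
  exists M : R, forall x, K x -> `|f x| <= M.
Proof.
move=> cK KD cf.
have cfK : {within K, continuous f}.
  by apply: continuous_in_subspaceT => x /set_mem /KD; exact: cf.
have /compact_bounded[M [_ HM]] := continuous_compact cfK cK.
exists (M + 1) => x Kx; apply: HM; first by rewrite ltrDl.
by exists x.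
Qed.

Lemma bm_compact2 (D K : set E2) (f : E2 -> R) : open D -> compact K -> K `<=` D ->
  measurable (K : set (mR * mR)) -> (forall x, D x -> {for x, continuous f}) ->
  bm (K : set (mR * mR)) f.
Proof.
move=> oD cK KD mK cf; split; last exact: compact_bounded_on cK KD cf.
apply: (@measurable_funS _ _ _ _ (D : set (mR * mR))) => //.
  exact: open_measurable2.
by apply: (@continuous_on_measurable R _ (mR * mR)%type E2 D id f) => // U; exact: open_measurable2.
Qed.

Lemma bm_compact3 (D K : set E3) (f : E3 -> R) : open D -> compact K -> K `<=` D ->
  measurable (K : set (mR * (mR * mR))) -> (forall x, D x -> {for x, continuous f}) ->
  bm (K : set (mR * (mR * mR))) f.
Proof.
move=> oD cK KD mK cf; split; last exact: compact_bounded_on cK KD cf.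
apply: (@measurable_funS _ _ _ _ (D : set (mR * (mR * mR)))) => //.
  exact: open_measurable3.
by apply: (@continuous_on_measurable R _ (mR * (mR * mR))%type E3 D id f) => // U; exact: open_measurable3.
Qed.

Lemma bm_compact4 (D K : set E4) (f : E4 -> R) : open D -> compact K -> K `<=` D ->
  measurable (K : set ((mR * mR) * (mR * mR))) ->
  (forall x, D x -> {for x, continuous f}) ->
  bm (K : set ((mR * mR) * (mR * mR))) f.
Proof.
move=> oD cK KD mK cf; split; last exact: compact_bounded_on cK KD cf.
apply: (@measurable_funS _ _ _ _ (D : set ((mR * mR) * (mR * mR)))) => //.
  exact: open_measurable4.
by apply: (@continuous_on_measurable R _ ((mR * mR) * (mR * mR))%type E4 D id f) => // U; exact: open_measurable4.
Qed.

Lemma ftc_sec1 (F : normedModType R) (D : set (R * F)) (Phi : R * F -> R) (a b : R) (y : F) :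
  a < b -> C1 D Phi -> (forall t, a <= t <= b -> D (t, y)) ->
  \int[leb]_(t in `[a, b]) 'D_(1, 0) Phi (t, y) = Phi (b, y) - Phi (a, y).
Proof.
move=> ab H HD; apply: (ftc1 (F := fun t => Phi (t, y)) (f := fun t => 'D_(1, 0) Phi (t, y))) => // t /HD Dt.
have [_ /(_ (1, 0))[d c]] := H _ Dt; split.
  by apply: (@continuous_comp _ _ _ (fun t => (t, y)) ('D_(1, 0) Phi)) => //; exact: cvg_pair1.
exact/(is_derive_sec1 Phi t y 1 _).1/derivableP.
Qed.

Lemma ftc_sec2 (F : normedModType R) (D : set (F * R)) (Phi : F * R -> R) (a b : R) (x : F) :
  a < b -> C1 D Phi -> (forall t, a <= t <= b -> D (x, t)) ->
  \int[leb]_(t in `[a, b]) 'D_(0, 1) Phi (x, t) = Phi (x, b) - Phi (x, a).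
Proof.
move=> ab H HD; apply: (ftc1 (F := fun t => Phi (x, t)) (f := fun t => 'D_(0, 1) Phi (x, t))) => // t /HD Dt.
have [_ /(_ (0, 1))[d c]] := H _ Dt; split.
  by apply: (@continuous_comp _ _ _ (pair x) ('D_(0, 1) Phi)) => //; exact: cvg_pair2.
exact/(is_derive_sec2 Phi x t 1 _).1/derivableP.
Qed.

Section Box2.
Variables (a b c d : R) (D : set E2) (Phi : E2 -> R).
Hypotheses (ab : a < b) (cd : c < d) (oD : open D) (C1P : C1 D Phi).
Hypothesis BD : box2 a b c d `<=` D.

Let bm_derive w : bm (box2 a b c d : set (mR * mR)) ('D_w Phi).
Proof.
apply: (bm_compact2 oD) => //; [exact: box2_compact|exact: box2_measurable|].
by move=> x /C1P[_ /(_ w)[]].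
Qed.

Let BDi t s : a <= t <= b -> c <= s <= d -> D (t, s).
Proof. by move=> ? ?; apply: BD; split; rewrite /= in_itv. Qed.

Lemma ibp2_0 : \int[leb2]_(x in box2 a b c d) 'D_(1, 0) Phi x =
  \int[leb]_(s in `[c, d]) (Phi (b, s) - Phi (a, s)).
Proof.
have := Rfubini2 (itv_measurable a b) (itv_measurable c d) (itv_finite a b)
  (itv_finite c d) (bm_derive (1, 0)).
rewrite -[LHS]/(\int[leb2]_(x in box2 a b c d) 'D_(1, 0) Phi x) => ->.
apply: eq_Rintegral => s; rewrite inE /= in_itv /= => cs.
by apply: (ftc_sec1 ab C1P) => t abt; exact: BDi.
Qed.

Lemma ibp2_1 : \int[leb2]_(x in box2 a b c d) 'D_(0, 1) Phi x =
  \int[leb]_(t in `[a, b]) (Phi (t, d) - Phi (t, c)).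
Proof.
have := Rfubini1 (itv_measurable a b) (itv_measurable c d) (itv_finite a b)
  (itv_finite c d) (bm_derive (0, 1)).
rewrite -[LHS]/(\int[leb2]_(x in box2 a b c d) 'D_(0, 1) Phi x) => ->.
apply: eq_Rintegral => s; rewrite inE /= in_itv /= => cs.
by apply: (ftc_sec2 cd C1P) => t abt; exact: BDi.
Qed.

Lemma ibp2_zero w : w = (1, 0) \/ w = (0, 1) ->
  (forall x, box2 a b c d x -> x.1 = a \/ x.1 = b \/ x.2 = c \/ x.2 = d -> Phi x = 0) ->
  \int[leb2]_(x in box2 a b c d) 'D_w Phi x = 0.
Proof.
move=> H Z; case: H => ->.
  rewrite ibp2_0; apply: Rintegral_eq0 => s; rewrite /= in_itv /= => /andP[cs sd].
  have [e1 e2] : Phi (b, s) = 0 /\ Phi (a, s) = 0.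
    by split; apply: Z => /=; rewrite ?in_itv; [split; rewrite /= in_itv /= ?lexx ?(ltW ab) ?cs|right; left|split; rewrite /= in_itv /= ?lexx ?(ltW ab) ?cs|left].
  by rewrite e1 e2 subrr.
rewrite ibp2_1; apply: Rintegral_eq0 => s; rewrite /= in_itv /= => /andP[cs sd].
have [e1 e2] : Phi (s, d) = 0 /\ Phi (s, c) = 0.
  by split; apply: Z => /=; [split; rewrite /= in_itv /= ?lexx ?(ltW cd) ?cs|right; right; right|split; rewrite /= in_itv /= ?lexx ?(ltW cd) ?cs|right; right; left].
by rewrite e1 e2 subrr.
Qed.

End Box2.

Definition box3 (a b : R) (S : set E2) : set E3 := `[a, b]%classic `*` S.

Section Box3.
Variables (a b a2 b2 a3 b3 : R) (D : set E3) (Phi : E3 -> R).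
Local Notation S := (box2 a2 b2 a3 b3).
Hypotheses (ab : a < b) (ab2 : a2 < b2) (ab3 : a3 < b3) (oD : open D) (C1P : C1 D Phi).
Hypothesis BD : box3 a b S `<=` D.

Lemma box3_compact : compact (box3 a b S).
Proof. by apply: compact_setX; [exact: segment_compact|exact: box2_compact]. Qed.

Lemma box3_measurable : measurable (box3 a b S : set (mR * (mR * mR))).
Proof. by apply: measurableX; [exact: itv_measurable|exact: box2_measurable]. Qed.

Let bm_derive w : bm (box3 a b S : set (mR * (mR * mR))) ('D_w Phi).
Proof.
apply: (bm_compact3 oD) => //; [exact: box3_compact|exact: box3_measurable|].
by move=> x /C1P[_ /(_ w)[]].
Qed.

Lemma open_sec2 (E F : topologicalType) (U : set (E * F)) (x : E) : open U -> open [set y | U (x, y)].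
Proof.
move=> oU; rewrite openE => y Uy.
have c : (fun y : F => (x, y)) @ y --> (x, y) by apply: cvg_pair; [exact: cvg_cst|exact: cvg_id].
exact: (c _ (open_nbhs_nbhs (conj oU Uy))).
Qed.

Lemma open_sec1 (E F : topologicalType) (U : set (E * F)) (y : F) : open U -> open [set x | U (x, y)].
Proof.
move=> oU; rewrite openE => x Ux.
have c : (fun x : E => (x, y)) @ x --> (x, y) by apply: cvg_pair; [exact: cvg_id|exact: cvg_cst].
exact: (c _ (open_nbhs_nbhs (conj oU Ux))).
Qed.

Lemma ibp3_zero w : w = (1, (0, 0)) \/ w = (0, (1, 0)) \/ w = (0, (0, 1)) ->
  (forall x, box3 a b S x -> x.1 = a \/ x.1 = b \/ x.2.1 = a2 \/ x.2.1 = b2 \/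
     x.2.2 = a3 \/ x.2.2 = b3 -> Phi x = 0) ->
  \int[leb3]_(x in box3 a b S) 'D_w Phi x = 0.
Proof.
move=> H Z.
have [->|{}H] : w = (1, (0, 0)) \/ exists w', w = (0, w') /\ (w' = (1, 0) \/ w' = (0, 1)).
- by case: H => [->|[->|->]]; [left|right; exists (1, 0); split => //; left|
    right; exists (0, 1); split => //; right].
- have := Rfubini2 (itv_measurable a b) (box2_measurable a2 b2 a3 b3) (itv_finite a b)
    (box2_finite a2 b2 a3 b3) (bm_derive (1, (0, 0))).
  rewrite -[LHS]/(\int[leb3]_(x in box3 a b S) 'D_(1, (0, 0)) Phi x) => ->.
  apply: Rintegral_eq0 => s Ss.
  have -> := @ftc_sec1 _ D Phi a b s ab C1P; last by move=> t abt; apply: BD; split; rewrite /= ?in_itv.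
  have [e1 e2] : Phi (b, s) = 0 /\ Phi (a, s) = 0.
    by split; apply: Z => /=; [split; rewrite /= ?in_itv /= ?lexx ?(ltW ab)|right; left|split; rewrite /= ?in_itv /= ?lexx ?(ltW ab)|left].
  by rewrite e1 e2 subrr.
have [w' [-> {}H]] := H.
have := Rfubini1 (itv_measurable a b) (box2_measurable a2 b2 a3 b3) (itv_finite a b)
    (box2_finite a2 b2 a3 b3) (bm_derive (0, w')).
rewrite -[LHS]/(\int[leb3]_(x in box3 a b S) 'D_(0, w') Phi x) => ->.
apply: Rintegral_eq0 => s; rewrite /= in_itv /= => abs.
have := @ibp2_zero a2 b2 a3 b3 [set y | D (s, y)] (fun y => Phi (s, y)) ab2 ab3
  (open_sec2 _ oD) (C1_sec2 C1P) _ w' H.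
have -> : 'D_w' (fun y => Phi (s, y)) = (fun y => 'D_(0, w') Phi (s, y)).
  by apply/funext => y; rewrite derive_sec2.
apply => [y Sy|[y1 y2] Sy /= Hy]; first by apply: BD; split; rewrite /= ?in_itv.
apply: Z; first by split; rewrite /= ?in_itv.
by move: Hy => /=; tauto.
Qed.

End Box3.

Section Box4.
Variables (a0 b0 a1 b1 a2 b2 a3 b3 : R) (D : set E4) (Phi : E4 -> R).
Local Notation S := (box2 a2 b2 a3 b3).
Local Notation B := (box2 a0 b0 a1 b1 `*` S).
Hypotheses (ab0 : a0 < b0) (ab1 : a1 < b1) (ab2 : a2 < b2) (ab3 : a3 < b3).
Hypotheses (oD : open D) (C1P : C1 D Phi) (BD : B `<=` D).

Lemma box4_compact : compact B.
Proof. by apply: compact_setX; exact: box2_compact. Qed.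

Lemma box4_measurable : measurable (B : set ((mR * mR) * (mR * mR))).
Proof. by apply: measurableX; exact: box2_measurable. Qed.

Lemma box4_bm (f : E4 -> R) : (forall x, D x -> {for x, continuous f}) ->
  bm (B : set ((mR * mR) * (mR * mR))) f.
Proof.
by move=> cf; apply: (bm_compact4 oD) => //; [exact: box4_compact|exact: box4_measurable].
Qed.

Let bm_derive w : bm (B : set ((mR * mR) * (mR * mR))) ('D_w Phi).
Proof. by apply: box4_bm => x /C1P[_ /(_ w)[]]. Qed.

Let BDi t z x : a0 <= t <= b0 -> a1 <= z <= b1 -> S x -> D ((t, z), x).
Proof. by move=> ? ? ?; apply: BD; split => //; split; rewrite /= in_itv. Qed.

Lemma face_bm0 (f : E4 -> R) t : (forall x, D x -> {for x, continuous f}) ->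
  a0 <= t <= b0 ->
  bm (box3 a1 b1 S : set (mR * (mR * mR))) (fun y => f ((t, y.1), y.2)).
Proof.
move=> cf abt; have ct (y : E3) : (fun y : E3 => ((t, y.1), y.2)) @ y --> ((t, y.1), y.2).
  apply: (@pt_pair _ _ _ (fun y : E3 => (t, y.1)) (fun y => y.2)); last exact: pt_snd.
  by apply: (@pt_pair _ _ _ (fun y : E3 => t) (fun y => y.1)); [exact: cvg_cst|exact: pt_fst].
apply: (@bm_compact3 [set y : E3 | D ((t, y.1), y.2)]).
- rewrite openE => y Dy; exact: (ct y _ (open_nbhs_nbhs (conj oD Dy))).
- exact: box3_compact.
- by move=> [z x] [/=]; rewrite in_itv /= => ? ?; exact: BDi.
- exact: box3_measurable.
- by move=> y Dy; apply: (@continuous_comp _ _ _ (fun y : E3 => ((t, y.1), y.2)) f); [exact: ct|exact: cf].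
Qed.

Lemma face_bm1 (f : E4 -> R) z : (forall x, D x -> {for x, continuous f}) ->
  a1 <= z <= b1 ->
  bm (box3 a0 b0 S : set (mR * (mR * mR))) (fun y => f ((y.1, z), y.2)).
Proof.
move=> cf abt; have ct (y : E3) : (fun y : E3 => ((y.1, z), y.2)) @ y --> ((y.1, z), y.2).
  apply: (@pt_pair _ _ _ (fun y : E3 => (y.1, z)) (fun y => y.2)); last exact: pt_snd.
  by apply: (@pt_pair _ _ _ (fun y : E3 => y.1) (fun y => z)); [exact: pt_fst|exact: cvg_cst].
apply: (@bm_compact3 [set y : E3 | D ((y.1, z), y.2)]).
- rewrite openE => y Dy; exact: (ct y _ (open_nbhs_nbhs (conj oD Dy))).
- exact: box3_compact.
- by move=> [t x] [/=]; rewrite in_itv /= => ? ?; exact: BDi.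
- exact: box3_measurable.
- by move=> y Dy; apply: (@continuous_comp _ _ _ (fun y : E3 => ((y.1, z), y.2)) f); [exact: ct|exact: cf].
Qed.

(** Fubini freezes the point of the square [S], and the planar formula is applied in the (tau,
    z)-rectangle; a second use of Fubini reassembles the face integral. *)
Lemma ibp4_0 : \int[leb4]_(q in B) 'D_((1, 0), (0, 0)) Phi q =
  \int[leb3]_(y in box3 a1 b1 S) (Phi ((b0, y.1), y.2) - Phi ((a0, y.1), y.2)).
Proof.
have bs x : S x -> bm (box2 a0 b0 a1 b1 : set (mR * mR)) (fun c => 'D_((1, 0), (0, 0)) Phi (c, x)).
  by move=> Sx; apply: bm_sec1 (bm_derive _) Sx; [exact: box2_measurable|exact: box2_measurable].
have := Rfubini2 (box2_measurable a0 b0 a1 b1) (box2_measurable a2 b2 a3 b3)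
   (box2_finite a0 b0 a1 b1) (box2_finite a2 b2 a3 b3) (bm_derive ((1, 0), (0, 0))).
rewrite -[LHS]/(\int[leb4]_(q in B) 'D_((1, 0), (0, 0)) Phi q) => ->.
have cP x : D x -> {for x, continuous Phi} by move=> /C1P[].
have b3m : bm (box3 a1 b1 S : set (mR * (mR * mR)))
   (fun y => Phi ((b0, y.1), y.2) - Phi ((a0, y.1), y.2)).
  by apply: bm_sub; apply: face_bm0; rewrite ?lexx ?ltW.
have := Rfubini2 (itv_measurable a1 b1) (box2_measurable a2 b2 a3 b3)
   (itv_finite a1 b1) (box2_finite a2 b2 a3 b3) b3m.
rewrite -[LHS]/(\int[leb3]_(y in box3 a1 b1 S) (Phi ((b0, y.1), y.2) - Phi ((a0, y.1), y.2))) => ->.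
apply: eq_Rintegral => x /set_mem Sx.
have := @ibp2_0 a0 b0 a1 b1 [set c | D (c, x)] (fun c => Phi (c, x)) ab0
  (open_sec1 _ oD) (C1_sec1 C1P).
have -> : 'D_(1, 0) (fun c => Phi (c, x)) = (fun c => 'D_((1, 0), (0, 0)) Phi (c, x)).
  by apply/funext => c; rewrite derive_sec1.
by apply => -[t z] [] /=; rewrite !in_itv /= => ? ?; exact: BDi.
Qed.

Lemma ibp4_1 : \int[leb4]_(q in B) 'D_((0, 1), (0, 0)) Phi q =
  \int[leb3]_(y in box3 a0 b0 S) (Phi ((y.1, b1), y.2) - Phi ((y.1, a1), y.2)).
Proof.
have := Rfubini2 (box2_measurable a0 b0 a1 b1) (box2_measurable a2 b2 a3 b3)
   (box2_finite a0 b0 a1 b1) (box2_finite a2 b2 a3 b3) (bm_derive ((0, 1), (0, 0))).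
rewrite -[LHS]/(\int[leb4]_(q in B) 'D_((0, 1), (0, 0)) Phi q) => ->.
have cP x : D x -> {for x, continuous Phi} by move=> /C1P[].
have b3m : bm (box3 a0 b0 S : set (mR * (mR * mR)))
   (fun y => Phi ((y.1, b1), y.2) - Phi ((y.1, a1), y.2)).
  by apply: bm_sub; apply: face_bm1; rewrite ?lexx ?ltW.
have := Rfubini2 (itv_measurable a0 b0) (box2_measurable a2 b2 a3 b3)
   (itv_finite a0 b0) (box2_finite a2 b2 a3 b3) b3m.
rewrite -[LHS]/(\int[leb3]_(y in box3 a0 b0 S) (Phi ((y.1, b1), y.2) - Phi ((y.1, a1), y.2))) => ->.
apply: eq_Rintegral => x /set_mem Sx.
have := @ibp2_1 a0 b0 a1 b1 [set c | D (c, x)] (fun c => Phi (c, x)) ab1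
  (open_sec1 _ oD) (C1_sec1 C1P).
have -> : 'D_(0, 1) (fun c => Phi (c, x)) = (fun c => 'D_((0, 1), (0, 0)) Phi (c, x)).
  by apply/funext => c; rewrite derive_sec1.
by apply => -[t z] [] /=; rewrite !in_itv /= => ? ?; exact: BDi.
Qed.

Lemma ibp4_zero w : w = (1, 0) \/ w = (0, 1) ->
  (forall c x, box2 a0 b0 a1 b1 c -> S x -> x.1 = a2 \/ x.1 = b2 \/ x.2 = a3 \/ x.2 = b3 ->
     Phi (c, x) = 0) ->
  \int[leb4]_(q in B) 'D_((0, 0), w) Phi q = 0.
Proof.
move=> H Z.
have := Rfubini1 (box2_measurable a0 b0 a1 b1) (box2_measurable a2 b2 a3 b3)
   (box2_finite a0 b0 a1 b1) (box2_finite a2 b2 a3 b3) (bm_derive ((0, 0), w)).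
rewrite -[LHS]/(\int[leb4]_(q in B) 'D_((0, 0), w) Phi q) => ->.
apply: Rintegral_eq0 => c Bc.
have := @ibp2_zero a2 b2 a3 b3 [set y | D (c, y)] (fun y => Phi (c, y)) ab2 ab3
  (open_sec2 _ oD) (C1_sec2 C1P) _ w H.
have -> : 'D_w (fun y => Phi (c, y)) = (fun y => 'D_((0, 0), w) Phi (c, y)).
  by apply/funext => y; rewrite derive_sec2.
apply => [y Sy|x Sx Hx]; first by apply: BD.
exact: Z.
Qed.

End Box4.

End Boxes.

(** * Charts and comparison of integrals *)

Section LipschitzMeasure.
Context {R : realType}.
Local Notation mR := (measurableTypeR R).
Local Notation leb := (@lebesgue_measure R).
Local Notation E2 := (R * R)%type.

Definition cell (s : R) (m : int * int) : set E2 :=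
  `[m.1%:~R * s, (m.1 + 1)%:~R * s[%classic `*` `[m.2%:~R * s, (m.2 + 1)%:~R * s[%classic.

Lemma cell_measurable s m : measurable (cell s m : set (mR * mR)).
Proof. by apply: measurableX; exact: measurable_itv. Qed.

Lemma leb2_rect (A B : set mR) : measurable A -> measurable B ->
  leb2 (A `*` B) = (leb A * leb B)%E.
Proof. by move=> mA mB; exact: (product_measure1E _ _ mA mB). Qed.

Lemma cell_measure s m : 0 < s -> leb2 (cell s m : set (mR * mR)) = (s ^+ 2)%:E.
Proof.
move=> s0; rewrite /cell leb2_rect; [|exact: measurable_itv..].
have E (k : int) : leb `[k%:~R * s, (k + 1)%:~R * s[%classic = s%:E.
  rewrite lebesgue_measure_itv /= lte_fin ifT; last by rewrite ltr_pM2r// ltr_int ltrDl.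
  by rewrite -EFinD -mulrBl intrD addrAC subrr add0r mul1r.
by rewrite !E -EFinM expr2.
Qed.

Lemma mem_cell s (y : E2) : 0 < s -> cell s (Num.floor (y.1 / s), Num.floor (y.2 / s)) y.
Proof.
move=> s0; have E (x : R) : x \in `[(Num.floor (x / s))%:~R * s, (Num.floor (x / s) + 1)%:~R * s[.
  rewrite in_itv /=; rewrite -ler_pdivlMr// -ltr_pdivrMr//.
  by rewrite ge_floor floorD1_gt.
by split; exact: E.
Qed.

Lemma cell_uniq s m (y : E2) : 0 < s -> cell s m y ->
  m = (Num.floor (y.1 / s), Num.floor (y.2 / s)).
Proof.
move=> s0; have E (k : int) (x : R) : x \in `[k%:~R * s, (k + 1)%:~R * s[ -> k = Num.floor (x / s).
  rewrite in_itv /=; rewrite -ler_pdivlMr// -ltr_pdivrMr// => H.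
  by apply/esym/floor_def.
by case: m => m1 m2 [/= /E -> /E ->].
Qed.

Lemma cell_sq s m (y y' : E2) : 0 < s -> cell s m y -> cell s m y' ->
  `|y - y'| <= s.
Proof.
move=> s0 [/= y1 y2] [/= z1 z2].
rewrite /Num.norm /= ge_max; move: y1 y2 z1 z2; rewrite !in_itv /= !intrD !mulrDl !mul1r.
move=> /andP[? ?] /andP[? ?] /andP[? ?] /andP[? ?].
by apply/andP; split; rewrite ler_norml; apply/andP; split; lra.
Qed.

Definition sqc (x : E2) (r : R) : set E2 := box2 (x.1 - r) (x.1 + r) (x.2 - r) (x.2 + r).

Lemma sqc_norm x r y : sqc x r y <-> `|x - y| <= r.
Proof.
rewrite {1}/Num.norm /= ge_max; split.
  move=> [/=]; rewrite !in_itv /= => /andP[? ?] /andP[? ?].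
  by apply/andP; split; rewrite ler_norml; apply/andP; split; lra.
move=> /andP[]; rewrite !ler_norml => /andP[? ?] /andP[? ?].
by split; rewrite /= in_itv /=; apply/andP; split; lra.
Qed.

Lemma sqc_measure x r : 0 <= r -> leb2 (sqc x r : set (mR * mR)) = ((2 * r) ^+ 2)%:E.
Proof.
move=> r0; rewrite /sqc /box2 leb2_rect; [|exact: measurable_itv..].
have E (a : R) : leb `[a - r, a + r]%classic = (2 * r)%:E.
  rewrite lebesgue_measure_itv /= lte_fin; case: ifPn => [_|].
    by rewrite -EFinD; congr EFin; ring.
  rewrite -leNgt => ar; have -> : r = 0 by lra.
  by rewrite mulr0.
by rewrite !E -EFinM expr2.
Qed.

(* At every small scale D is covered by squares that correspond to the grid
   cells contained in U, and only finite additivity is needed. *)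
Lemma lipschitz_measure_le (D U : set E2) (rel : E2 -> E2 -> Prop) (L : R) :
  0 < L -> open U -> measurable (D : set (mR * mR)) ->
  (forall x, D x -> exists2 y, U y & rel x y) ->
  (forall x x' y y', D x -> D x' -> U y -> U y' -> rel x y -> rel x' y' ->
     `|x - x'| <= L * `|y - y'|) ->
  (leb2 (D : set (mR * mR)) <= ((2 * L) ^+ 2)%:E * leb2 (U : set (mR * mR)))%E.
Proof.
move=> L0 oU mD DU rL.
pose s (n : nat) : R := 2^-1 ^+ n.
have s0 n : 0 < s n by rewrite exprn_gt0// invr_gt0.
pose P n m := cell (s n) m `<=` U /\ exists x y, [/\ D x, cell (s n) m y & rel x y].
(* One point of [D] related to the cell is selected for each cell satisfying [P]; for the other
   cells the value 0 is a dummy. *)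
have ctr n m : {x | P n m -> exists y, [/\ D x, cell (s n) m y & rel x y]}.
  apply: cid; case: (pselect (P n m)) => [[_ [x [y H]]]|nP]; last by exists 0.
  by exists x => _; exists y.
(* The cell has diameter at most [s n] in the maximum norm, so the square of radius [L * s n] about
   the selected point contains every point of [D] related to the cell. *)
pose B n m : set (mR * mR) := if `[< P n m >] then sqc (sval (ctr n m)) (L * s n) else set0.
pose C n m : set (mR * mR) := if `[< P n m >] then cell (s n) m else set0.
pose B' n k := if @pickle_inv (int * int)%type k is Some m then B n m else set0.
pose C' n k := if @pickle_inv (int * int)%type k is Some m then C n m else set0.
have mB n k : measurable (B' n k).
  by rewrite /B'; case: pickle_inv => [m|//]; rewrite /B; case: asboolP => // _; exact: box2_measurable.
have mC n k : measurable (C' n k).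
  by rewrite /C'; case: pickle_inv => [m|//]; rewrite /C; case: asboolP => // _; exact: cell_measurable.
have BC n k : leb2 (B' n k) = (((2 * L) ^+ 2)%:E * leb2 (C' n k))%E.
  rewrite /B' /C'; case: pickle_inv => [m|]; last by rewrite !measure0 mule0.
  rewrite /B /C; case: asboolP => _; last by rewrite !measure0 mule0.
  rewrite sqc_measure ?cell_measure//; last by rewrite mulr_ge0// ltW.
  by rewrite -EFinM; congr EFin; ring.
pose V n := \bigcup_k B' n k.
have mV n : measurable (V n) by apply: bigcupT_measurable => k; exact: mB.
have VU n : (leb2 (V n) <= ((2 * L) ^+ 2)%:E * leb2 (U : set (mR * mR)))%E.
  apply: (@le_trans _ _ (\sum_(k <oo) leb2 (B' n k))%E).
    by apply: measure_sigma_subadditive => //; exact: mV.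
  under eq_eseriesr do rewrite BC.
  rewrite nneseriesZl; last by move=> k _; exact: measure_ge0.
  apply: lee_wpmul2l; first by rewrite lee_fin sqr_ge0.
  have tC : trivIset setT (C' n).
    apply/trivIsetP => i j _ _ ij; apply/seteqP; split => // y [].
    rewrite /C'; have := @pickle_invK (int * int)%type i; have := @pickle_invK (int * int)%type j.
    case: (pickle_inv i) => [m|//]; case: (pickle_inv j) => [m'|//] /= Ej Ei.
    rewrite /C; case: asboolP => // _; case: asboolP => // _.
    move=> /(cell_uniq (s0 n)) mE /(cell_uniq (s0 n)) mE'.
    by move: ij; rewrite -Ei -Ej mE mE' eqxx.
  rewrite -measure_semi_bigcup//; last by apply: bigcupT_measurable => k; exact: mC.
  apply: le_measure; rewrite ?inE; [by apply: bigcupT_measurable => k; exact: mC|exact: open_measurable2|].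
  move=> y [k _]; rewrite /C'; case: pickle_inv => [m|//]; rewrite /C.
  by case: asboolP => // -[cU _] /cU.
(* A point of [D] is covered at scale [k] only once the cell of its partner fits inside the open set
   [U], that is for all large [k]. The sets of points covered from scale [n] on increase to [D], and
   continuity of the measure concludes. *)
pose Dn n : set (mR * mR) := D `&` \bigcap_(k in [set k | (n <= k)%N]) V k.
have mDn n : measurable (Dn n).
  by apply: measurableI => //; apply: bigcap_measurable => [|k _]; [exists n => /=|exact: mV].
have DE : D = \bigcup_n Dn n.
  apply/seteqP; split=> [x Dx|x [n _ []]//].
  have [y Uy rxy] := DU x Dx.
  have /nbhs_sq[r r0 Hr] : nbhs y U by exact: open_nbhs_nbhs.
  have [N HN] : exists N, forall n, (N <= n)%N -> s n < r.
    have : s n @[n --> \oo] --> (0 : R).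
      by apply: cvg_expr; rewrite ger0_norm ?invr_ge0// invf_lt1// ltr1n.
    move=> /cvgr_dist_lt/(_ r r0)[N _ HN]; exists N => n /HN.
    by rewrite sub0r normrN ger0_norm// ltW.
  exists N => //; split => // n /= Nn.
  pose m := (Num.floor (y.1 / s n), Num.floor (y.2 / s n)).
  have cm : cell (s n) m y by exact: mem_cell.
  have Pm : P n m.
    split; last by exists x, y.
    move=> z cz; apply: Hr.
    have := cell_sq (s0 n) cm cz; rewrite /Num.norm /= ge_max => /andP[h1 h2].
    by split; rewrite distrC; [exact: le_lt_trans h1 (HN _ Nn)|exact: le_lt_trans h2 (HN _ Nn)].
  exists (pickle m); first exact: I.
  rewrite /B' pickleK_inv /B; case: asboolP => [_|nP]; last by case: (nP Pm).
  case: (ctr n m) => /= x' /(_ Pm) [y' [Dx' cy' r']].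
  apply/sqc_norm.
  have Uy' : U y' by have [cU _] := Pm; exact: cU.
  apply: le_trans (rL _ _ _ _ Dx' Dx Uy' Uy r' rxy) _.
  by rewrite ler_pM2l//; exact: cell_sq cy' cm.
have nd : nondecreasing_seq Dn.
  move=> i j ij; apply/subsetPset => x [Dx H]; split => // k /= jk.
  by apply: H => /=; exact: leq_trans jk.
have mDU : measurable (\bigcup_n Dn n) by rewrite -DE.
have lim : leb2 (Dn n) @[n --> \oo] --> leb2 (D : set (mR * mR)).
  by rewrite [in X in _ --> X]DE; exact: (nondecreasing_cvg_mu mDn mDU nd).
rewrite -(cvg_lim _ lim)//; apply: lime_le; first by apply/cvg_ex; exists (leb2 (D : set (mR * mR))).
near=> n; apply: le_trans (VU n); apply: le_measure; rewrite ?inE//.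
by move=> x [_ /(_ n)]; apply => /=.
Unshelve. all: by end_near. Qed.

End LipschitzMeasure.

Section TonelliMeasurable.
Context {R : realType} d1 d2 (T1 : measurableType d1) (T2 : measurableType d2).
Variable m1 : {sigma_finite_measure set T1 -> \bar R}.
Variable m2 : {sigma_finite_measure set T2 -> \bar R}.
Variables (A : set T1) (B : set T2).
Hypotheses (mA : measurable A) (mB : measurable B).
Variable f : T1 * T2 -> \bar R.
Hypotheses (mf : measurable_fun (A `*` B) f).
Hypothesis f0 : (forall z, (A `*` B) z -> 0 <= f z)%E.

Let mg : measurable_fun setT (f \_ (A `*` B)).
Proof. by apply/(measurable_restrictT _ _).1 => //; exact: measurableX. Qed.

Let g0 z : (0 <= (f \_ (A `*` B)) z)%E.
Proof. by rewrite patchE; case: ifPn => // /set_mem; exact: f0. Qed.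

Lemma tonelli_measurable2 : measurable_fun B (fun y => \int[m1]_(x in A) f (x, y))%E.
Proof.
have := measurable_fun_fubini_tonelli_G (m1 := m1) _ mg g0; move/(@measurable_funTS _ _ _ _ B).
apply: eq_measurable_fun => y yB; rewrite /fubini_G.
rewrite -[LHS]/(\int[m1]_x ((fun x => (f \_ (A `*` B)) (x, y)) x))%E.
by rewrite restrict_sec1 yB -integral_mkcond.
Qed.

Lemma tonelli_measurable1 : measurable_fun A (fun x => \int[m2]_(y in B) f (x, y))%E.
Proof.
have := measurable_fun_fubini_tonelli_F (m2 := m2) _ mg g0; move/(@measurable_funTS _ _ _ _ A).
apply: eq_measurable_fun => x xA; rewrite /fubini_F.
rewrite -[LHS]/(\int[m2]_y ((fun y => (f \_ (A `*` B)) (x, y)) y))%E.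
by rewrite restrict_sec2 xA -integral_mkcond.
Qed.

End TonelliMeasurable.

(** * Layer-cake formula and comparison of integrals under Lipschitz relations *)

Section LayerCake.
Context d (X : measurableType d) {R : realType}.
Variable mu : {sigma_finite_measure set X -> \bar R}.
Local Notation leb := (@lebesgue_measure R).

(** Tonelli for the indicator of the subgraph {(x, t) : t < G x}: the section at [x] is an interval
    of length G x, the section at [t] is a superlevel set. [G] is first extended by 0 outside [D] to
    make the subgraph measurable. *)
Lemma layer_cake (D : set X) (G : X -> R) : measurable D -> measurable_fun D G ->
  (forall x, D x -> 0 <= G x) ->
  (\int[mu]_(x in D) (G x)%:E =
     \int[leb]_(t in `[0%R, +oo[) mu (D `&` [set x | (t < G x)%R]))%E /\
  measurable_fun (`[0%R, +oo[%classic : set (measurableTypeR R))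
    (fun t => mu (D `&` [set x | (t < G x)%R])).
Proof.
move=> mD mG G0.
pose B := (`[0%R, +oo[%classic : set (measurableTypeR R)).
have mB : measurable B by exact: measurable_itv.
pose Gd := G \_ D.
have mGd : measurable_fun setT Gd by apply/(measurable_restrictT _ mD).1.
pose S : set (X * measurableTypeR R) := [set z | (z.2 < Gd z.1)%R].
have mS : measurable S.
  have mb : measurable_fun setT (fun z : X * measurableTypeR R => (z.2 < Gd z.1)%R).
    apply: measurable_fun_ltr; first exact: measurable_snd.
    by apply: (@measurableT_comp _ _ _ _ _ _ Gd); [exact: mGd|exact: measurable_fst].
  have := mb measurableT [set true] (I : measurable [set true]).
  rewrite setTI (_ : _ @^-1` [set true] = S)//.
pose f (z : X * measurableTypeR R) : \bar R := (\1_S z)%:E.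
have mf : measurable_fun (D `*` B) f.
  by apply/measurable_EFinP; exact: measurable_indic.
have f0 z : (D `*` B) z -> (0 <= f z)%E by rewrite lee_fin.
have [H1 H2] := tonelli_rect mu leb mD mB mf f0.
have fE x t : D x -> f (x, t) = (t < G x)%R%:R%:E.
  move=> Dx; rewrite /f indicE; congr ((nat_of_bool _)%:R%:E).
  by apply/idP/idP; rewrite inE /S /= /Gd patchE mem_set.
have E1 x : D x -> (\int[leb]_(t in B) f (x, t) = (G x)%:E)%E.
  move=> Dx.
  rewrite (_ : (fun t => f (x, t)) = (fun t => (\1_(`]-oo, G x[%classic) t)%:E)); last first.
    apply/funext => t; rewrite fE// indicE; congr ((nat_of_bool _)%:R%:E).
    by apply/idP/idP; rewrite inE /= in_itv.
  rewrite integral_indic//.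
  rewrite (_ : _ `&` _ = `[0%R, G x[%classic).
    rewrite -[LHS]/(lebesgue_measure `[0%R, G x[%classic) lebesgue_measure_itv /= lte_fin.
    case: ifPn => [_|]; first by rewrite sube0.
    rewrite -leNgt => Gx; congr EFin; apply/eqP; rewrite eq_le Gx andbT; exact: G0.
  apply/seteqP; split=> t /=; rewrite /B /= !in_itv /= ?andbT; first by move=> [-> ->].
  by move=> /andP[-> ->].
have E2 t : B t -> (\int[mu]_(x in D) f (x, t) = mu (D `&` [set x | (t < G x)%R]))%E.
  move=> Bt.
  rewrite (_ : \int[mu]_(x in D) f (x, t) = \int[mu]_(x in D) (\1_(D `&` [set x | (t < G x)%R]) x)%:E)%E.
    rewrite integral_indic//; first by rewrite setIAC setIid.
    rewrite (_ : _ `&` _ = D `&` Gd @^-1` `]t, +oo[%classic).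
      by apply: measurableI => //; rewrite -[X in measurable X]setTI; exact: mGd.
    by apply/seteqP; split=> x [Dx]; rewrite /= in_itv /= andbT /Gd patchE mem_set//.
  apply: eq_integral => x /set_mem Dx; rewrite fE// indicE; congr ((nat_of_bool _)%:R%:E).
  by apply/idP/idP; rewrite inE /=; [split|case].
split.
  transitivity (\int[mu]_(x in D) \int[leb]_(t in B) f (x, t))%E.
    by apply: eq_integral => x /set_mem Dx; rewrite E1.
  by rewrite -H1 H2; apply: eq_integral => t /set_mem; exact: E2.
have := tonelli_measurable2 mu mD mB mf f0.
by apply: eq_measurable_fun => t /set_mem; exact: E2.
Qed.

End LayerCake.

Section Comparison.
Context {R : realType}.
Local Notation mR := (measurableTypeR R).
Local Notation leb := (@lebesgue_measure R).
Local Notation E2 := (R * R)%type.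

Lemma open_superlevel (D : set E2) (G : E2 -> R) t : open D ->
  (forall x, D x -> {for x, continuous G}) -> open (D `&` [set x | t < G x]).
Proof.
move=> oD cG; rewrite openE => x [Dx tG]; apply: filterI; first exact: open_nbhs_nbhs.
have : nbhs (G x) `]t, +oo[%classic by apply: open_nbhs_nbhs; split; [exact: interval_open|rewrite /= in_itv /= tG].
move=> /(cG x Dx); rewrite /nbhs /=; apply: filterS => y.
by rewrite /= in_itv /= andbT.
Qed.

Lemma measurable_open2 (D : set E2) (G : E2 -> R) : open D ->
  (forall x, D x -> {for x, continuous G}) -> measurable_fun (D : set (mR * mR)) G.
Proof.
by move=> oD cG; apply: (@continuous_on_measurable R _ (mR * mR)%type E2 D id G) => // U; exact: open_measurable2.
Qed.

(** Replaces the change of variables. The relation sends {G > t} into {c H > t}, so the measures of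
    the superlevel sets compare for each [t] with the factor (2 L)^2, and integration in [t] gives
    the integrals. *)
Lemma lipschitz_integral_le (D U : set E2) (rel : E2 -> E2 -> Prop) (G H : E2 -> R) (L c : R) :
  0 < L -> 0 <= c -> open U -> open D ->
  (forall x, D x -> exists2 y, U y & rel x y) ->
  (forall x x' y y', D x -> D x' -> U y -> U y' -> rel x y -> rel x' y' ->
     `|x - x'| <= L * `|y - y'|) ->
  (forall x, D x -> {for x, continuous G}) ->
  (forall y, U y -> {for y, continuous H}) ->
  (forall x, D x -> 0 <= G x) -> (forall y, U y -> 0 <= H y) ->
  (forall x y, D x -> U y -> rel x y -> G x <= c * H y) ->
  (\int[leb2]_(x in (D : set (mR * mR))) (G x)%:E <=
    ((2 * L) ^+ 2 * c)%:E * \int[leb2]_(y in (U : set (mR * mR))) (H y)%:E)%E.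
Proof.
move=> L0 c0 oU oD DU rL cG cH G0 H0 GH.
have mD := open_measurable2 oD; have mU := open_measurable2 oU.
have cH' y : U y -> {for y, continuous (fun y => c * H y)}.
  by move=> Uy; apply: cvgM; [exact: cvg_cst|exact: cH].
have mG := measurable_open2 oD cG; have mH := measurable_open2 oU cH'.
have [-> m1] := layer_cake leb2 mD mG G0.
rewrite EFinM -muleA -ge0_integralZl_EFin//; last first.
  by apply/measurable_EFinP; exact: measurable_open2.
have cH0 y : U y -> 0 <= c * H y by move=> Uy; rewrite mulr_ge0// H0.
have [E2 m2] := layer_cake leb2 mU mH cH0.
have -> : (\int[leb2]_(y in (U : set (mR * mR))) (c%:E * (H y)%:E) =
  \int[leb2]_(y in (U : set (mR * mR))) (c * H y)%:E)%E by [].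
rewrite E2 -ge0_integralZl_EFin//; last first.
  by rewrite sqr_ge0.
apply: ge0_le_integral => //.
- exact: measurable_funeM.
move=> t _; apply: (lipschitz_measure_le (rel := rel)) => //.
- exact: open_superlevel.
- by apply: open_measurable2; exact: (open_superlevel oD cG).
- move=> x [Dx tG]; have [y Uy r] := DU x Dx; exists y => //; split => //=.
  exact: lt_le_trans tG (GH _ _ Dx Uy r).
- by move=> x x' y y' [? _] [? _] [? _] [? _]; exact: rL.
Qed.

End Comparison.

Section CompactUniform.
Context {R : realType} {X : topologicalType}.

(** Local constants on a compact set are bounded by one constant because [P] is monotone in it.
    Later [P] expresses a Lipschitz bound, a bound on a function, or the reciprocal of a modulus of
    continuity. *)
Lemma compact_uniform (K : set X) (P : R -> X -> Prop) : compact K ->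
  (forall A B x, A <= B -> P A x -> P B x) ->
  (forall x, K x -> exists A, \forall y \near x, P A y) ->
  exists A, forall x, K x -> P A x.
Proof.
move=> /compact_near_coveringP cK mono loc.
have [|A [_ HA]] := cK R (+oo)%R P _; last first.
  by exists (A + 1) => x Kx; apply: HA => //; rewrite ltrDl.
move=> x /loc[A HA].
exists ([set y | P A y], [set B | A <= B]) => /=.
  split => //; exists A; split; first exact: num_real.
  by move=> B /= /ltW.
by move=> [y B] [/= PA AB]; exact: mono AB PA.
Qed.

End CompactUniform.

Section RowNorm.
Context {R : realType} {n : nat}.

Lemma row_coord_le (v : 'rV[R]_n) i : `|v 0 i| <= `|v|.
Proof.
rewrite [leRHS]/Num.norm /= mx_normrE.
exact: (le_bigmax _ (fun k : 'I_1 * 'I_n => `|v k.1 k.2|) (0, i)).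
Qed.

Lemma row_norm_le (v : 'rV[R]_n) (M : R) : 0 <= M -> (forall i, `|v 0 i| <= M) -> `|v| <= M.
Proof.
move=> M0 H; rewrite [leLHS]/Num.norm /= mx_normrE.
by apply: bigmax_le => // -[a b] _ /=; rewrite (ord1 a).
Qed.

End RowNorm.

Section RealEstimates.
Context {R : realType}.
Implicit Types a b c d m M N : R.

(** Each of the two products moves by at most 3 dl M, so the determinant moves by at most 6 dl M,
    which is m / 2 at most; this is the origin of the factor 12. *)
Lemma det_perturb (a b c d a' b' c' d' dl M m : R) :
  `|a| <= M -> `|b| <= M -> `|c| <= M -> `|d| <= M ->
  `|a - a'| < dl -> `|b - b'| < dl -> `|c - c'| < dl -> `|d - d'| < dl ->
  0 < dl -> dl <= M -> dl * M * 12 <= m -> m <= `|a * d - b * c| ->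
  m / 2 <= `|a' * d' - b' * c'|.
Proof.
move=> aM bM cM dM a1 b1 c1 d1 dl0 dlM dm mdet.
have M0 : 0 <= M by apply: le_trans aM.
have B (x x' : R) : `|x| <= M -> `|x - x'| < dl -> `|x'| <= 2 * M.
  move=> h1 h2; have := ler_normD x (x' - x); rewrite addrC subrK distrC.
  by move=> h3; lra.
have P (x x' y y' : R) : `|x| <= M -> `|y| <= M -> `|x - x'| < dl -> `|y - y'| < dl ->
    `|x * y - x' * y'| <= 3 * (dl * M).
  move=> hx hy h1 h2; have -> : x * y - x' * y' = (x - x') * y + x' * (y - y') by ring.
  apply: le_trans (ler_normD _ _) _; rewrite !normrM.
  have q1 : `|x - x'| * `|y| <= dl * M by apply: ler_pM => //; exact: ltW.
  have q2 : `|x'| * `|y - y'| <= (2 * M) * dl.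
    by apply: ler_pM => //; [exact: B h1|exact: ltW].
  lra.
have p1 := P _ _ _ _ aM dM a1 d1; have p2 := P _ _ _ _ bM cM b1 c1.
have := ler_normD (a' * d' - b' * c') ((a * d - a' * d') - (b * c - b' * c')).
have -> : a' * d' - b' * c' + (a * d - a' * d' - (b * c - b' * c')) = a * d - b * c by ring.
have := ler_normB (a * d - a' * d') (b * c - b' * c').
lra.
Qed.

Lemma cramer_bound (a b c d x y u v M m N : R) :
  `|a| <= M -> `|b| <= M -> `|c| <= M -> `|d| <= M -> 0 < m ->
  m <= `|a * d - b * c| -> u = a * x + b * y -> v = c * x + d * y ->
  `|u| <= N -> `|v| <= N ->
  `|x| <= 2 * M / m * N /\ `|y| <= 2 * M / m * N.
Proof.
move=> aM bM cM dM m0 mdet uE vE uN vN.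
have main (p q z : R) : `|p| <= M -> `|q| <= M -> (a * d - b * c) * z = p * u - q * v ->
    `|z| <= 2 * M / m * N.
  move=> pM qM E; have : m * `|z| <= 2 * M * N.
    apply: (@le_trans _ _ (`|a * d - b * c| * `|z|)); first exact: ler_wpM2r.
    rewrite -normrM E; apply: le_trans (ler_normB _ _) _; rewrite !normrM.
    have : `|p| * `|u| <= M * N by apply: ler_pM.
    have : `|q| * `|v| <= M * N by apply: ler_pM.
    lra.
  by move=> H; rewrite mulrAC ler_pdivlMr// mulrC.
split.
  by apply: (main d b) => //; rewrite uE vE; ring.
rewrite -[y]opprK normrN; apply: (main c a) => //; rewrite uE vE; ring.
Qed.

Lemma small_scale a b c d m : 0 < m -> exists M dl : R,
  [/\ [/\ `|a| <= M, `|b| <= M, `|c| <= M & `|d| <= M],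
   0 < dl, dl <= 1, 1 <= M & dl * M * 12 <= m].
Proof.
move=> m0; pose M := `|a| + `|b| + `|c| + `|d| + 1.
have a0 := normr_ge0 a; have b0 := normr_ge0 b; have c0 := normr_ge0 c; have d0 := normr_ge0 d.
have M1 : 1 <= M by rewrite /M; lra.
exists M, (Num.min 1 (m / (12 * M))); split => //.
- by rewrite /M; split; lra.
- by rewrite lt_min ltr01/= divr_gt0// mulr_gt0//; lra.
- by rewrite ge_min lexx.
have : Num.min 1 (m / (12 * M)) <= m / (12 * M) by rewrite ge_min lexx orbT.
by rewrite ler_pdivlMr ?mulr_gt0//; lra.
Qed.

Lemma perturb_le a b dl M : `|a| <= M -> `|a - b| < dl -> dl <= 1 -> 1 <= M ->
  `|b| <= 2 * M.
Proof.
move=> h1 h2 h3 h4; have := ler_normD a (b - a); rewrite addrC subrK distrC; lra.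
Qed.

Lemma lip_bound (a b a' b' u v N : R) : `|a - a'| < 1 -> `|b - b'| < 1 ->
  `|u| <= N -> `|v| <= N -> `|a' * u + b' * v| <= (`|a| + 1 + (`|b| + 1)) * N.
Proof.
move=> h1 h2 uN vN; apply: le_trans (ler_normD _ _) _; rewrite !normrM mulrDl.
have B (p q : R) : `|p - q| < 1 -> `|q| <= `|p| + 1.
  by move=> h; have := ler_normD p (q - p); rewrite addrC subrK distrC; lra.
by apply: lerD; apply: ler_pM => //; exact: B.
Qed.

Lemma le_all_eps c L M : 0 < L -> (forall eta : R, 0 < eta -> c <= L * (M + (eta + eta))) -> c <= L * M.
Proof.
move=> L0 H; apply/ler_addgt0Pr => e e0.
have := H (e / L / 2) (divr_gt0 (divr_gt0 e0 L0) (ltr0Sn R 1)).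
by rewrite -splitr mulrDr (mulrC L (e / L)) mulfVK// gt_eqF.
Qed.

Lemma quotient_bound a b a' b' u v h L eta : 0 < L -> 0 < eta -> h != 0 ->
  `|a - a'| < eta -> `|b - b'| < eta ->
  `|u| <= L * `|h| -> `|v| <= L * `|h| ->
  `|h^-1 * (a' * u + b' * v)| <= L * (`|a| + `|b| + (eta + eta)).
Proof.
move=> L0 eta0 h0 h1 h2 hu hv; rewrite normrM normfV mulrC ler_pdivrMr ?normr_gt0//.
apply: le_trans (ler_normD _ _) _; rewrite !normrM.
have B (p q : R) : `|p - q| < eta -> `|q| <= `|p| + eta.
  by move=> h'; have := ler_normD p (q - p); rewrite addrC subrK distrC; lra.
have q1 : `|a'| * `|u| <= (`|a| + eta) * (L * `|h|) by apply: ler_pM => //; exact: B.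
have q2 : `|b'| * `|v| <= (`|b| + eta) * (L * `|h|) by apply: ler_pM => //; exact: B.
lra.
Qed.

Lemma scale_le1 (L h e : R) : 0 < L -> e <= 1 -> L * (`|h| * e) <= L * `|h|.
Proof. by move=> L0 e1; rewrite ler_pM2l// ler_piMr. Qed.

Lemma cross0 a b c d : a * b = c * d -> c * d + - a * b = 0.
Proof. by move=> <-; rewrite mulNr subrr. Qed.

Lemma lip_const_ge0 a b : 0 <= `|a| + 1 + (`|b| + 1).
Proof. by rewrite !addr_ge0. Qed.

Lemma ratio_le (u v U V : R) : u < U -> V < v -> 0 < V -> 0 <= u -> u <= U / V * v.
Proof.
move=> uU Vv V0 u0; apply: le_trans (ltW uU) _.
rewrite mulrAC ler_pdivlMr// ler_wpM2l//; last exact: ltW.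
exact: ltW (le_lt_trans u0 uU).
Qed.

Lemma lip_comp (u v w A B : R) : 0 <= v -> 0 <= w -> u <= A * v -> v <= B * w ->
  u <= (`|A| * `|B| + 1) * w.
Proof.
move=> v0 w0 h1 h2; have := ler_norm A; have := ler_norm B => hB hA.
have q1 : A * v <= `|A| * v by rewrite ler_wpM2r.
have q2 : B * w <= `|B| * w by rewrite ler_wpM2r.
have q3 : `|A| * v <= `|A| * (`|B| * w) by rewrite ler_wpM2l//; exact: le_trans q2.
by rewrite mulrDl mul1r -mulrA; lra.
Qed.

End RealEstimates.

Lemma le_minl {R : realType} (a b : R) : Num.min a b <= a.
Proof. by rewrite ge_min lexx. Qed.

Lemma le_minr {R : realType} (a b : R) : Num.min a b <= b.
Proof. by rewrite ge_min lexx orbT. Qed.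

Lemma sq_le {R : realType} (p : R * R) (r r' : R) x : r <= r' -> sq p r x -> sq p r' x.
Proof. by move=> rr [h1 h2]; split; [exact: lt_le_trans h1 rr|exact: lt_le_trans h2 rr]. Qed.

Lemma sq_open {R : realType} (p : R * R) (r : R) : open (sq p r).
Proof.
rewrite openE => x [h1 h2]; apply/nbhs_sq.
exists (Num.min (r - `|x.1 - p.1|) (r - `|x.2 - p.2|)); first by rewrite lt_min !subr_gt0 h1.
move=> y [/= g1 g2]; rewrite !lt_min in g1 g2.
have /andP[g11 _] := g1; have /andP[_ g22] := g2.
have t1 := ler_distD x.1 y.1 p.1; have t2 := ler_distD x.2 y.2 p.2.
by split; lra.
Qed.

Lemma sq_sqc {R : realType} (p : R * R) (r : R) : 0 < r -> sq p (r / 2) `<=` sqc p r.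
Proof.
move=> r0 x [h1 h2]; apply/sqc_norm; rewrite [leLHS]/Num.norm /= ge_max.
by rewrite (distrC p.1) (distrC p.2); apply/andP; split; lra.
Qed.

Lemma sqc_sq {R : realType} (p : R * R) (r : R) x : 0 < r -> sqc p (r / 2) x -> sq p r x.
Proof.
move=> r0 /sqc_norm; rewrite [leLHS]/Num.norm /= ge_max => /andP[h1 h2].
by split; rewrite distrC; lra.
Qed.

Lemma measurable_restrict_EFin d (X : measurableType d) (R : realType) (A : set X)
  (f : X -> R) : measurable A -> measurable_fun A f ->
  measurable_fun setT ((EFin \o f) \_ A).
Proof. by move=> mA mf; apply/(measurable_restrictT _ mA).1/measurable_EFinP. Qed.

(** * Bi-Lipschitz bounds and comparison of gradients between charts *)

Section Charts.
Context {R : realType} (At : sphere_atlas R).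
Local Notation mR := (measurableTypeR R).
Local Notation E2 := (R * R)%type.
Local Notation K := (chart_index At).
Implicit Types (k l : K) (x y : E2).

Definition chart_coord k (i : 'I_3) (x : E2) : R := chart k x 0 i.

Lemma chart_coord_C1 k i : C1 (chart_ext k) (chart_coord k i) /\
  forall x w, chart_ext k x -> 'D_w (chart_coord k i) x = ('D_w (chart k) x) 0 i.
Proof.
have H := @chart_smooth R At k 1.
have dE x w : chart_ext k x -> derivable (chart_coord k i) x w /\
    'D_w (chart_coord k i) x = ('D_w (chart k) x) 0 i.
  move=> Dx; have [_ /(_ isT w) dc] := H [::] x Dx isT.
  have dm := (derivable_mxP _ _ _).1 dc.
  split; first exact: dm.
  by rewrite (derive_mx dc) mxE.
split; last by move=> x w /(dE x w)[].
apply: (@C1_intro _ _ _ (@chart_ext_open R At k) _ (fun w x => ('D_w (chart k) x) 0 i)).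
  move=> x Dx; have [c _] := H [::] x Dx isT.
  by apply: (@continuous_comp _ _ _ (chart k) (fun M : 'rV[R]_3 => M 0 i)) => //; exact: coord_continuous.
move=> x v Dx; have [d1 d2] := dE x v Dx; split; first by split.
have [c _] := H [:: v] x Dx isT.
by apply: (@continuous_comp _ _ _ ('D_v (chart k)) (fun M : 'rV[R]_3 => M 0 i)) => //; exact: coord_continuous.
Qed.

Lemma chart_continuous k x : chart_ext k x -> {for x, continuous (chart k)}.
Proof. by move=> Dx; have [] := @chart_smooth R At k 0 [::] x Dx isT. Qed.

Lemma chart_dom_ext k : chart_dom k `<=` chart_ext k.
Proof. by move=> x Dx; apply: (chart_dom_closure k).2; exact: subset_closure. Qed.

(** If all 2 x 2 minors of the Jacobian vanished, each vector (b i, - a i) would lie in the kernel;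
    the immersion property would give a = 0, and then (1, 0) would lie in the kernel too. *)
Lemma chart_minor k x : chart_ext k x -> exists i j,
  'D_(1, 0) (chart_coord k i) x * 'D_(0, 1) (chart_coord k j) x -
  'D_(0, 1) (chart_coord k i) x * 'D_(1, 0) (chart_coord k j) x != 0.
Proof.
move=> Dx; apply: contrapT => nE.
set a := fun i => 'D_(1, 0) (chart_coord k i) x; set b := fun i => 'D_(0, 1) (chart_coord k i) x.
have Z i j : a i * b j = b i * a j.
  apply/eqP; rewrite -subr_eq0; apply: contrapT => /negP ne; apply: nE.
  by exists i, j.
have imm (w : E2) : (forall j, w.1 * a j + w.2 * b j = 0) -> w = 0.
  move=> H; apply: (chart_immersion Dx); apply/rowP => j; rewrite mxE.
  have [C dE] := chart_coord_C1 k j.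
  rewrite -dE// (derive_linear2 _ (@chart_ext_open R At k) C Dx); exact: H.
have a0 i : a i = 0.
  apply: contrapT => ai; suff /imm [_ /eqP] : forall j, (b i, - a i).1 * a j + (b i, - a i).2 * b j = 0.
    by rewrite oppr_eq0 => /eqP.
  by move=> j; exact: cross0 (Z i j).
have E : (1, 0) = 0 :> E2 by apply: imm => j; rewrite /= a0 mulr0 mul0r addr0.
by case: E => /eqP; rewrite oner_eq0.
Qed.

Lemma chart_near_derive k i x e : chart_ext k x -> 0 < e ->
  \forall y \near x, `|'D_(1, 0) (chart_coord k i) x - 'D_(1, 0) (chart_coord k i) y| < e /\
    `|'D_(0, 1) (chart_coord k i) x - 'D_(0, 1) (chart_coord k i) y| < e /\ chart_ext k y.
Proof.
move=> Dx e0; have [C _] := chart_coord_C1 k i.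
have [_ H] := C x Dx.
apply: filter_and3.
- by have [_ /cvgr_dist_lt] := H (1, 0); apply.
- by have [_ /cvgr_dist_lt] := H (0, 1); apply.
- by apply: open_nbhs_nbhs; split => //; exact: (@chart_ext_open R At k).
Qed.

(** Two components of the chart with a nonzero minor suffice. The mean value theorem produces a 2 x
    2 system whose four coefficients are taken at four different points; near [x0] its determinant
    is still at least m / 2, and Cramer's rule bounds the coordinate differences. *)
Lemma chart_lower_local k x0 : chart_ext k x0 ->
  exists A : R, \forall p \near (x0, x0), `|p.1 - p.2| <= A * `|chart k p.1 - chart k p.2|.
Proof.
move=> Dx; have [i [j ne]] := chart_minor Dx.
set a := 'D_(1, 0) (chart_coord k i) x0 in ne *; set d := 'D_(0, 1) (chart_coord k j) x0 in ne *.
set b := 'D_(0, 1) (chart_coord k i) x0 in ne *; set c := 'D_(1, 0) (chart_coord k j) x0 in ne *.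
pose m := `|a * d - b * c|; have m0 : 0 < m by rewrite normr_gt0.
have [M [dl [[aM bM cM dM] dl0 dl1 M1 dlm]]] := small_scale a b c d m0.
have n1 := chart_near_derive i Dx dl0; have n2 := chart_near_derive j Dx dl0.
move/nbhs_sq: n1 => [r1 r10 H1]; move/nbhs_sq: n2 => [r2 r20 H2].
pose r := Num.min r1 r2; have r0 : 0 < r by rewrite lt_min r10.
have Hr z : sq x0 r z -> _ := fun Hz => conj (H1 z (sq_le (le_minl r1 r2) Hz)) (H2 z (sq_le (le_minr r1 r2) Hz)).
exists (2 * (2 * M) / (m / 2)).
have nr : nbhs x0 (sq x0 r) by apply/nbhs_sq; exists r.
exists (sq x0 r, sq x0 r) => //= -[x y] [/= sx sy].
have Ci := C1_subset (fun z Hz => (Hr z Hz).1.2.2) (chart_coord_C1 k i).1.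
have Cj := C1_subset (fun z Hz => (Hr z Hz).2.2.2) (chart_coord_C1 k j).1.
have [z1 [z2 [s1 s2 E1]]] := mvt2 Ci sx sy.
have [z3 [z4 [s3 s4 E2]]] := mvt2 Cj sx sy.
have [[a1 _] _] := Hr _ s1; have [[_ [b1 _]] _] := Hr _ s2.
have [_ [c1 _]] := Hr _ s3; have [_ [_ [d1 _]]] := Hr _ s4.
have det := det_perturb aM bM cM dM a1 b1 c1 d1 dl0 (le_trans dl1 M1) dlm (lexx m).
have big (u u' : R) : `|u| <= M -> `|u - u'| < dl -> `|u'| <= 2 * M.
  by move=> h1 h2; exact: perturb_le h1 h2 dl1 M1.
have m2 : 0 < m / 2 by rewrite divr_gt0.
have Ni (q : 'I_3) : `|chart_coord k q y - chart_coord k q x| <= `|chart k x - chart k y|.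
  rewrite distrC (_ : _ - _ = (chart k x - chart k y) 0 q) ?row_coord_le//.
  by rewrite !mxE.
have [X Y] := cramer_bound (big _ _ aM a1) (big _ _ bM b1) (big _ _ cM c1) (big _ _ dM d1)
  m2 det E1 E2 (Ni i) (Ni j).
by rewrite distrC [leLHS]/Num.norm /= ge_max X Y.
Qed.

Lemma chart_upper_local k x0 : chart_ext k x0 ->
  exists A : R, \forall p \near (x0, x0), `|chart k p.1 - chart k p.2| <= A * `|p.1 - p.2|.
Proof.
move=> Dx.
have loc (i : 'I_3) : exists A r : R, [/\ 0 <= A, 0 < r & forall x y, sq x0 r x -> sq x0 r y ->
    `|chart_coord k i x - chart_coord k i y| <= A * `|x - y|].
  have n1 := chart_near_derive i Dx ltr01.
  move/nbhs_sq: n1 => [r r0 Hr].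
  set a := 'D_(1, 0) (chart_coord k i) x0 in Hr; set b := 'D_(0, 1) (chart_coord k i) x0 in Hr.
  exists ((`|a| + 1) + (`|b| + 1)), r; split; [exact: lip_const_ge0|exact: r0|].
  move=> x y sx sy.
  have [z1 [z2 [s1 s2 E]]] := mvt2 (C1_subset (fun z Hz => (Hr z Hz).2.2) (chart_coord_C1 k i).1) sx sy.
  have [a1 _] := Hr _ s1; have [_ [b1 _]] := Hr _ s2.
  rewrite distrC E; apply: lip_bound a1 b1 _ _.
    by rewrite distrC [leRHS]/Num.norm /= le_max lexx.
  by rewrite distrC [leRHS]/Num.norm /= le_max lexx orbT.
have [A0 [r0 [A00 r00 H0]]] := loc ord0.
have [A1 [r1 [A10 r10 H1]]] := loc (inord 1).
have [A2 [r2 [A20 r20 H2]]] := loc (inord 2).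
exists (A0 + (A1 + A2)); pose r := Num.min r0 (Num.min r1 r2).
have rp : 0 < r by rewrite !lt_min r00 r10.
have nr : nbhs x0 (sq x0 r) by apply/nbhs_sq; exists r.
exists (sq x0 r, sq x0 r) => //= -[x y] [/= sx sy].
have rr0 : r <= r0 by exact: le_minl.
have rr1 : r <= r1 by apply: le_trans (le_minr _ _) (le_minl _ _).
have rr2 : r <= r2 by apply: le_trans (le_minr _ _) (le_minr _ _).
have xy0 : 0 <= `|x - y| by exact: normr_ge0.
apply: row_norm_le; first by rewrite mulr_ge0// !addr_ge0.
have h0 := H0 _ _ (sq_le rr0 sx) (sq_le rr0 sy).
have h1 := H1 _ _ (sq_le rr1 sx) (sq_le rr1 sy).
have h2 := H2 _ _ (sq_le rr2 sx) (sq_le rr2 sy).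
move=> i; rewrite !mxE -!/(chart_coord k i _).
have [->|[->|->]] : i = ord0 \/ i = inord 1 \/ i = inord 2.
- case: i => -[|[|[|//]]] Hi; [left|right; left|right; right]; apply/val_inj => //=; by rewrite inordK.
- by apply: le_trans h0 _; rewrite ler_wpM2r// lerDl addr_ge0.
- by apply: le_trans h1 _; rewrite ler_wpM2r// addrCA lerDl addr_ge0.
- by apply: le_trans h2 _; rewrite ler_wpM2r// addrA lerDr addr_ge0.
Qed.

Lemma chart_pair_continuous k (p : E2 * E2) : chart_ext k p.1 -> chart_ext k p.2 ->
  {for p, continuous (fun p : E2 * E2 => `|chart k p.1 - chart k p.2| : R)}.
Proof.
move=> D1 D2; apply: cvg_norm; apply: cvgB.
  by apply: (@continuous_comp _ _ _ fst (chart k)); [exact: pt_fst|exact: chart_continuous].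
by apply: (@continuous_comp _ _ _ snd (chart k)); [exact: pt_snd|exact: chart_continuous].
Qed.

Lemma pair_norm_continuous (p : E2 * E2) :
  {for p, continuous (fun p : E2 * E2 => `|p.1 - p.2| : R)}.
Proof. by apply: cvg_norm; apply: cvgB; [exact: pt_fst|exact: pt_snd]. Qed.

Lemma chart_uniform k (P : R -> E2 * E2 -> Prop) :
  (forall A B p, A <= B -> P A p -> P B p) ->
  (forall x y, chart_ext k x -> chart_ext k y -> exists A, \forall p \near (x, y), P A p) ->
  exists A, forall x y, chart_dom k x -> chart_dom k y -> P A (x, y).
Proof.
have [cK sub] := @chart_dom_closure R At k => mono loc.
have [|A HA] := compact_uniform (compact_setX cK cK) mono.
  by move=> [x y] [/= /sub Dx /sub Dy]; exact: loc.
by exists A => x y Dx Dy; apply: (HA (x, y)); split; exact: subset_closure.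
Qed.

(** Near the diagonal the immersion gives the bound. Near a pair x0 != y0 injectivity keeps the
    images apart, and a quotient of the two distances serves as constant. Compactness of the closure
    of the domain inside [chart_ext] makes the constant uniform. *)
Lemma chart_lower k : exists A : R, forall x y, chart_dom k x -> chart_dom k y ->
  `|x - y| <= A * `|chart k x - chart k y|.
Proof.
apply: (@chart_uniform k (fun A p => `|p.1 - p.2| <= A * `|chart k p.1 - chart k p.2|)).
  by move=> A B p AB H; apply: le_trans H (ler_wpM2r (normr_ge0 _) AB).
move=> x0 y0 Dx Dy.
have [e|/eqP ne] := pselect (x0 = y0); first by rewrite -e; exact: chart_lower_local.
have e0 : 0 < `|chart k x0 - chart k y0|.
  rewrite normr_gt0 subr_eq0; apply/eqP => /(chart_inj Dx Dy) xy.
  by move: ne; rewrite xy eqxx.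
exists ((`|x0 - y0| + 1) / (`|chart k x0 - chart k y0| / 2)).
have n1 : \forall p \near (x0, y0), `|chart k x0 - chart k y0| / 2 < `|chart k p.1 - chart k p.2|.
  have c := @chart_pair_continuous k (x0, y0) Dx Dy.
  by move/cvgr_gt: c; apply; rewrite /= ltr_pdivrMr// mulr2n mulrDr mulr1 ltrDl.
have n2 : \forall p \near (x0, y0), `|p.1 - p.2| < `|x0 - y0| + 1.
  by have c := @pair_norm_continuous (x0, y0); move/cvgr_lt: c; apply; rewrite /= ltrDl.
near=> p; have p1 : `|chart k x0 - chart k y0| / 2 < `|chart k p.1 - chart k p.2| by near: p.
have p2 : `|p.1 - p.2| < `|x0 - y0| + 1 by near: p.
by apply: ratio_le p2 p1 _ (normr_ge0 _); rewrite divr_gt0.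
Unshelve. all: by end_near. Qed.

Lemma chart_upper k : exists A : R, forall x y, chart_dom k x -> chart_dom k y ->
  `|chart k x - chart k y| <= A * `|x - y|.
Proof.
apply: (@chart_uniform k (fun A p => `|chart k p.1 - chart k p.2| <= A * `|p.1 - p.2|)).
  by move=> A B p AB H; apply: le_trans H (ler_wpM2r (normr_ge0 _) AB).
move=> x0 y0 Dx Dy.
have [e|/eqP ne] := pselect (x0 = y0); first by rewrite -e; exact: chart_upper_local.
have e0 : 0 < `|x0 - y0| by rewrite normr_gt0 subr_eq0.
exists ((`|chart k x0 - chart k y0| + 1) / (`|x0 - y0| / 2)).
have n1 : \forall p \near (x0, y0), `|x0 - y0| / 2 < `|p.1 - p.2|.
  have c := @pair_norm_continuous (x0, y0).
  by move/cvgr_gt: c; apply; rewrite /= ltr_pdivrMr// mulr2n mulrDr mulr1 ltrDl.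
have n2 : \forall p \near (x0, y0), `|chart k p.1 - chart k p.2| < `|chart k x0 - chart k y0| + 1.
  by have c := @chart_pair_continuous k (x0, y0) Dx Dy; move/cvgr_lt: c; apply; rewrite /= ltrDl.
near=> p; have p1 : `|x0 - y0| / 2 < `|p.1 - p.2| by near: p.
have p2 : `|chart k p.1 - chart k p.2| < `|chart k x0 - chart k y0| + 1 by near: p.
by apply: ratio_le p2 p1 _ (normr_ge0 _); rewrite divr_gt0.
Unshelve. all: by end_near. Qed.

Lemma finite_bound (P : K -> R -> Prop) : (forall k A B, A <= B -> P k A -> P k B) ->
  (forall k, exists A, P k A) -> exists A, forall k, P k A.
Proof.
move=> mono /choice[f Hf]; exists (\sum_k `|f k|) => k; apply: mono (Hf k).
apply: le_trans (ler_norm _) _; rewrite (bigD1 k)//= lerDl.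
by apply: sumr_ge0 => i _; exact: normr_ge0.
Qed.

Definition chart_rel k l x y := chart k x = chart l y.

(** A chart change is the lower bound of one chart composed with the upper bound of the other
    through the common point of the sphere; no differentiability of the chart change is involved. *)
Lemma chart_lipschitz : exists2 L : R, 0 < L & forall k l x x' y y',
  chart_dom k x -> chart_dom k x' -> chart_dom l y -> chart_dom l y' ->
  chart_rel k l x y -> chart_rel k l x' y' -> `|x - x'| <= L * `|y - y'|.
Proof.
have [A HA] := @finite_bound (fun k A => forall x y, chart_dom k x -> chart_dom k y ->
  `|x - y| <= A * `|chart k x - chart k y|) (fun k A B AB H x y Dx Dy =>
     le_trans (H x y Dx Dy) (ler_wpM2r (normr_ge0 _) AB)) chart_lower.
have [B HB] := @finite_bound (fun k A => forall x y, chart_dom k x -> chart_dom k y ->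
  `|chart k x - chart k y| <= A * `|x - y|) (fun k A B AB H x y Dx Dy =>
     le_trans (H x y Dx Dy) (ler_wpM2r (normr_ge0 _) AB)) chart_upper.
exists (`|A| * `|B| + 1); first by rewrite ltr_wpDl// mulr_ge0.
move=> k l x x' y y' Dx Dx' Dy Dy' r r'.
have h1 := HA k x x' Dx Dx'; have h2 := HB l y y' Dy Dy'.
by rewrite r r' in h1; exact: lip_comp (normr_ge0 _) (normr_ge0 _) h1 h2.
Qed.

Lemma chart_dom_continuous k x : chart_dom k x -> {for x, continuous (chart k)}.
Proof. by move=> /chart_dom_ext; exact: chart_continuous. Qed.

(** The image of a small neighbourhood of [y] under the chart [l] is relatively open in the sphere,
    so nearby points of the chart [k] have partners close to [y]. *)
Lemma chart_lift k l x y (N : set E2) : chart_dom k x -> chart_dom l y ->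
  chart_rel k l x y -> nbhs y N ->
  \forall x' \near x, exists y', N y' /\ chart_dom l y' /\ chart_rel k l x' y'.
Proof.
move=> Dx Dy r nN.
have : nbhs y (N `&` chart_dom l).
  by apply: filterI => //; apply: open_nbhs_nbhs; split => //; exact: (@chart_dom_open R At l).
rewrite nbhsE => -[B [oB By] BN].
have Be : B `<=` chart_ext l by move=> z /BN[_ /chart_dom_ext].
have [Q [oQ QE]] := @chart_open_map R At l B oB Be.
have Qx : Q (chart k x).
  have : (chart l @` B) (chart l y) by exists y.
  by rewrite QE -r => -[].
have nQ : nbhs x (chart k @^-1` Q).
  by apply: (chart_dom_continuous Dx); exact: open_nbhs_nbhs.
have nD : nbhs x (chart_dom k) by apply: open_nbhs_nbhs; split => //; exact: (@chart_dom_open R At k).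
apply: filterS (filterI nQ nD) => x' [Qx' Dx'].
have : (Q `&` sphere) (chart k x') by split => //; apply: chart_sphere; exact: chart_dom_ext.
by rewrite -QE => -[y' By' E]; exists y'; have [] := BN y' By'.
Qed.

(** The increment of [f] from x to x + h e equals the increment of [g] between the partners, whose
    distance is at most L |h|. The mean value theorem bounds it by the partial derivatives of [g]
    near [y], and the limit in [h], then in [eta], gives the claim without a chain rule for the
    chart change. *)
Lemma gradient_compare L (F : 'rV[R]_3 -> R) k l x y e : 0 < L ->
  (forall x x' y y', chart_dom k x -> chart_dom k x' -> chart_dom l y -> chart_dom l y' ->
    chart_rel k l x y -> chart_rel k l x' y' -> `|y - y'| <= L * `|x - x'|) ->
  C1 (chart_dom k) (fun x => F (chart k x)) -> C1 (chart_dom l) (fun y => F (chart l y)) ->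
  chart_dom k x -> chart_dom l y -> chart_rel k l x y -> `|e| <= 1 ->
  `|'D_e (fun x => F (chart k x)) x| <=
    L * (`|'D_(1, 0) (fun y => F (chart l y)) y| + `|'D_(0, 1) (fun y => F (chart l y)) y|).
Proof.
move=> L0 HL Ck Cl Dx Dy r e1.
set f := fun x => F (chart k x) in Ck *; set g := fun y => F (chart l y) in Cl *.
set a := 'D_(1, 0) g y; set b := 'D_(0, 1) g y.
apply: (le_all_eps L0) => eta eta0.
have [_ Hy] := Cl y Dy.
have n1 : \forall z \near y, `|a - 'D_(1, 0) g z| < eta.
  by have [_ /cvgr_dist_lt] := Hy (1, 0); apply.
have n2 : \forall z \near y, `|b - 'D_(0, 1) g z| < eta.
  by have [_ /cvgr_dist_lt] := Hy (0, 1); apply.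
have n3 : \forall z \near y, chart_dom l z.
  by apply: open_nbhs_nbhs; split => //; exact: (@chart_dom_open R At l).
have : \forall z \near y, `|a - 'D_(1, 0) g z| < eta /\ `|b - 'D_(0, 1) g z| < eta /\ chart_dom l z.
  exact: filter_and3 n1 n2 n3.
move=> /nbhs_sq[d d0 Hd].
have nN : nbhs y (sq y d) by apply/nbhs_sq; exists d.
have lift := chart_lift Dx Dy r nN.
have nD : nbhs x (chart_dom k) by apply: open_nbhs_nbhs; split => //; exact: (@chart_dom_open R At k).
have [_ /(_ e)[dfe _]] := Ck x Dx.
have /is_deriveP lim := derivableP dfe.
have bnd : \forall h \near 0^', `|h^-1 *: (f (h *: e + x) - f x)| <= L * (`|a| + `|b| + (eta + eta)).
  have cl : (fun h : R => h *: e + x) @ 0 --> x.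
    have := @line_cvg R _ x e 0; rewrite scale0r addr0.
    by under eq_fun do rewrite addrC.
  have H1 : \forall h \near (0:R), exists y', sq y d y' /\ chart_dom l y' /\ chart_rel k l (h *: e + x) y' by exact: (cl _ lift).
  have H2 : \forall h \near (0:R), chart_dom k (h *: e + x) by exact: (cl _ nD).
  have H3 := nbhs_dnbhs_neq (0:R).
  apply: filterS (filter_and3 (nbhs_dnbhs H1) (nbhs_dnbhs H2) H3) => h [[y' [sy [Dy' r']]] [Dx' h0]].
  have sqy : sq y d y by split; rewrite subrr normr0.
  have [z1 [z2 [s1 s2 E]]] := mvt2 (C1_subset (fun z Hz => (Hd z Hz).2.2) Cl) sqy sy.
  have [a1 _] := Hd _ s1; have [_ [b1 _]] := Hd _ s2.
  have yy : `|y' - y| <= L * `|h|.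
    apply: le_trans (HL _ _ _ _ Dx' Dx Dy' Dy r' r) _.
    have -> : h *: e + x - x = h *: e by rewrite addrK.
    by have := scale_le1 h L0 e1; rewrite -(normrZ h e).
  have fE : f (h *: e + x) - f x = g y' - g y by rewrite /f /g r r'.
  rewrite fE E; apply: quotient_bound h0 a1 b1 _ _ => //.
    by apply: le_trans yy; rewrite [leRHS]/Num.norm /= le_max lexx.
  by apply: le_trans yy; rewrite [leRHS]/Num.norm /= le_max lexx orbT.
have lim' : (fun h : R => `|h^-1 *: (f (h *: e + x) - f x)|) @ 0^' --> `|'D_e f x|.
  exact: cvg_norm.
exact: cvgr_to_le lim' bnd.
Qed.

Lemma sphere_compact : compact (@sphere R).
Proof.
apply: bounded_closed_compact.
  exists 1; split; first exact: num_real.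
  move=> M M1 p /= Hp; apply: row_norm_le; first exact: ltW (lt_trans ltr01 M1).
  move=> i; apply: le_trans (ltW M1).
  rewrite -[1]sqrtr1 -sqrtr_sqr ler_wsqrtr// -Hp (bigD1 i)//= lerDl.
  by apply: sumr_ge0 => j _; exact: sqr_ge0.
have -> : sphere = (fun p : 'rV[R]_3 => \sum_(i < 3) p 0 i ^+ 2) @^-1` [set 1] by [].
apply: closed_comp; last exact: closed_eq.
have cc i : continuous (fun p : 'rV[R]_3 => p 0 i ^+ 2).
  have ci : continuous (fun p : 'rV[R]_3 => p 0 i) by exact: coord_continuous.
  by move=> p; apply: (@continuous_comp _ _ _ (fun p : 'rV[R]_3 => p 0 i) (fun x : R => x ^+ 2)); [exact: ci|exact: exprn_continuous].
have cS : continuous (fun p : 'rV[R]_3 => p 0 ord0 ^+ 2 + (p 0 (inord 1) ^+ 2 + p 0 (inord 2) ^+ 2)).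
  move=> p; apply: (@continuousD _ _ _ (fun p : 'rV[R]_3 => p 0 ord0 ^+ 2)).
    exact: cc.
  by apply: (@continuousD _ _ _ (fun p : 'rV[R]_3 => p 0 (inord 1) ^+ 2)); exact: cc.
rewrite (_ : (fun p => _) = (fun p : 'rV[R]_3 => p 0 ord0 ^+ 2 + (p 0 (inord 1) ^+ 2 + p 0 (inord 2) ^+ 2))).
  by move=> p _; exact: cS.
apply/funext => p; rewrite !big_ord_recl big_ord0 addr0.
by congr (_ + (_ ^+ 2 + _ ^+ 2)); congr (p 0 _); apply/val_inj; rewrite /= inordK.
Qed.

(** Chart index, centre and half side length of a coordinate square. *)
Definition bump_box := (K * E2 * R)%type.

(** Images of the open half-size squares are relatively open because charts are open maps into the
    sphere, so compactness of the sphere leaves finitely many. Around a point whose chart domain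
    contains the open square of radius [r], the closed square of radius r / 2 is used. *)
Lemma box_cover : exists J : seq bump_box,
  (forall j, j \in J -> 0 < j.2 /\ sqc j.1.2 j.2 `<=` chart_dom j.1.1) /\
  (forall p, sphere p -> exists2 j, j \in J &
     exists2 y, sq j.1.2 (j.2 / 2) y & chart j.1.1 y = p).
Proof.
pose good (j : bump_box) := 0 < j.2 /\ sqc j.1.2 j.2 `<=` chart_dom j.1.1.
have sqj (j : bump_box) : exists Q : set 'rV[R]_3, good j ->
   open Q /\ chart j.1.1 @` sq j.1.2 (j.2 / 2) = Q `&` sphere.
  have [gj|nj] := pselect (good j); last by exists set0.
  have [j0 jd] := gj.
  have oB : open (sq j.1.2 (j.2 / 2)) by exact: sq_open.
  have Be : sq j.1.2 (j.2 / 2) `<=` chart_ext j.1.1.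
    by move=> z /(sq_sqc j0) /jd; exact: chart_dom_ext.
  by have [Q HQ] := chart_open_map oB Be; exists Q.
have [Qf HQ] := choice sqj.
have cS := sphere_compact; rewrite compact_cover in cS.
have [||J Jg Jc] := cS _ [set j | good j] Qf.
- by move=> j gj; have [] := HQ j gj.
- move=> p Sp; have [k [x Dx xp]] := chart_cover At Sp.
  have /nbhs_sq[r r0 Hr] : nbhs x (chart_dom k).
    by apply: open_nbhs_nbhs; split => //; exact: (@chart_dom_open R At k).
  have gj : good (k, x, r / 2).
    split; first by rewrite /= divr_gt0.
    by move=> z Hz; apply: Hr; exact: sqc_sq r0 Hz.
  exists (k, x, r / 2) => //.
  have [_ E] := HQ _ gj.
  suff : (Qf (k, x, r / 2) `&` sphere) p by case.
  rewrite -E /=; exists x => //; split; rewrite subrr normr0 !divr_gt0//.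
exists (finmap.enum_fset J); split.
  by move=> j jJ; have := Jg j jJ; rewrite inE.
move=> p Sp; have [j jJ Qp] := Jc p Sp; exists j => //.
have gj : good j by have := Jg j jJ; rewrite inE.
have [_ E] := HQ j gj.
have : (Qf j `&` sphere) p by split.
by rewrite -E => -[y sy yp]; exists y.
Qed.

(** The domain of the chart [k] is the union of the open sets [D j] of points whose image is met by
    the half-size square of [j]. The integral over the domain is at most the sum over the [D j], and
    each is compared with its square by [lipschitz_integral_le]. *)
Lemma chart_integral_le (J : seq bump_box) (L c : R) (G : K -> E2 -> R) k :
  (forall j, j \in J -> 0 < j.2 /\ sqc j.1.2 j.2 `<=` chart_dom j.1.1) ->
  (forall p, sphere p -> exists2 j, j \in J &
     exists2 y, sq j.1.2 (j.2 / 2) y & chart j.1.1 y = p) ->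
  0 < L -> 0 <= c ->
  (forall k l x x' y y',
    chart_dom k x -> chart_dom k x' -> chart_dom l y -> chart_dom l y' ->
    chart_rel k l x y -> chart_rel k l x' y' -> `|x - x'| <= L * `|y - y'|) ->
  (forall l x, chart_dom l x -> {for x, continuous (G l)}) ->
  (forall l x, chart_dom l x -> 0 <= G l x) ->
  (forall l x y, chart_dom k x -> chart_dom l y -> chart_rel k l x y -> G k x <= c * G l y) ->
  (\int[leb2]_(x in (chart_dom k : set (mR * mR))) (G k x)%:E <=
    ((2 * L) ^+ 2 * c)%:E * \sum_(j <- J)
      \int[leb2]_(y in (sq j.1.2 (j.2 / 2) : set (mR * mR))) (G j.1.1 y)%:E)%E.
Proof.
move=> HJ cov L0 c0 HL cG G0 Gc.
pose B (j : bump_box) := sq j.1.2 (j.2 / 2).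
pose D (j : bump_box) := chart_dom k `&` [set x | exists2 y, B j y & chart_rel k j.1.1 x y].
have Bd j : j \in J -> B j `<=` chart_dom j.1.1.
  by move=> /HJ[j0 jd] z /(sq_sqc j0) /jd.
have oD j : j \in J -> open (D j).
  move=> jJ; rewrite openE => x [Dx [y By r]].
  have nB : nbhs y (B j) by apply: open_nbhs_nbhs; split => //; exact: sq_open.
  apply: filterI; first by apply: open_nbhs_nbhs; split => //; exact: (@chart_dom_open R At k).
  by apply: filterS (chart_lift Dx (Bd _ jJ _ By) r nB) => x' [y' [By' [_ r']]]; exists y'.
have mdk : measurable (chart_dom k : set (mR * mR)) by apply: open_measurable2; exact: (@chart_dom_open R At k).
have mG A : open A -> A `<=` chart_dom k -> measurable_fun (A : set (mR * mR)) (G k).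
  by move=> oA Ak; apply: measurable_open2 => // x /Ak; exact: cG.
pose g (j : bump_box) : mR * mR -> \bar R := (EFin \o G k) \_ (D j).
(* Openness of [D j] is known only for members of [J], whereas the sum lemmas quantify over all [j];
   hence the value 0 for the others. *)
have mg j : measurable_fun setT (fun x => if j \in J then g j x else 0%E).
  case: (boolP (j \in J)) => jJ; last exact: measurable_cst.
  apply: (measurable_restrict_EFin (open_measurable2 (oD _ jJ))).
  by apply: mG; [exact: oD|move=> x []].
have le1 : (\int[leb2]_(x in (chart_dom k : set (mR * mR))) (G k x)%:E <=
    \int[leb2]_x (\sum_(j <- J) if j \in J then g j x else 0))%E.
  rewrite integral_mkcond; apply: ge0_le_integral => //.
  - by move=> x _; rewrite patchE; case: ifPn => // /set_mem Dx; rewrite lee_fin; exact: G0.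
  - apply: (measurable_restrict_EFin mdk); apply: mG => //.
    exact: (@chart_dom_open R At k).
  - by apply: emeasurable_sum => j; exact: mg.
  - move=> x _; rewrite patchE; case: ifPn => [/set_mem Dx|_]; last first.
      by apply: sume_ge0 => j _; case: ifPn => // jJ; rewrite /g patchE;
        case: ifPn => // /set_mem[Dx _]; rewrite lee_fin; exact: G0.
    have [j jJ [y By yx]] := cov _ (chart_sphere (chart_dom_ext Dx)).
    have Djx : D j x by split => //; exists y.
    rewrite (big_rem j)//= jJ /g patchE mem_set// leeDl//.
    apply: sume_ge0 => i _; case: ifPn => // iJ; rewrite patchE.
    by case: ifPn => // /set_mem[Dx' _]; rewrite lee_fin; exact: G0.
apply: le_trans le1 _.
rewrite ge0_integral_sum//; last first.
  move=> j x _; case: ifPn => // jJ; rewrite /g patchE.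
  by case: ifPn => // /set_mem[Dx _]; rewrite lee_fin; exact: G0.
rewrite big_seq [X in (_ <= _ * X)%E]big_seq ge0_sume_distrr; last first.
  by move=> j jJ; apply: integral_ge0 => y By; rewrite lee_fin; apply: G0; exact: Bd By.
apply: lee_sum => j jJ.
rewrite jJ -integral_mkcond.
apply: (lipschitz_integral_le (rel := chart_rel k j.1.1)) => //.
- exact: sq_open.
- exact: oD.
- by move=> x [].
- by move=> x x' y y' [? _] [? _] /(Bd _ jJ) ? /(Bd _ jJ) ?; exact: HL.
- by move=> x [Dx _]; exact: cG.
- by move=> y /(Bd _ jJ); exact: cG.
- by move=> x [Dx _]; exact: G0.
- by move=> y /(Bd _ jJ); exact: G0.
- by move=> x y [Dx _] /(Bd _ jJ) Dy; exact: Gc.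
Qed.

End Charts.

(** * The inverse metric and the wave operator *)

Lemma det_mx22 (R : comNzRingType) (A : 'M[R]_2) : \det A = A ord0 ord0 * A ord_max ord_max - A ord0 ord_max * A ord_max ord0.
Proof.
rewrite (expand_det_row _ ord0) !big_ord_recl big_ord0 /cofactor !det_mx11 !mxE /=.
rewrite (_ : lift ord0 0 = ord_max); last exact/val_inj.
rewrite (_ : lift ord_max 0 = ord0); last exact/val_inj.
by rewrite /bump /= expr0 expr1 addr0; ring.
Qed.

Lemma det_null4 (R : comNzRingType) (A : 'M[R]_4) :
  A (inord 0) (inord 0) = 0 -> A (inord 0) (inord 1) = 1 -> A (inord 0) (inord 2) = 0 -> A (inord 0) (inord 3) = 0 ->
  A (inord 1) (inord 0) = 1 -> A (inord 2) (inord 0) = 0 -> A (inord 3) (inord 0) = 0 ->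
  \det A = A (inord 2) (inord 3) * A (inord 3) (inord 2) - A (inord 2) (inord 2) * A (inord 3) (inord 3).
Proof.
have i0 : inord 0 = ord0 :> 'I_4 by apply/val_inj; rewrite /= inordK.
have i1 : inord 1 = lift ord0 ord0 :> 'I_4 by apply/val_inj; rewrite /= inordK.
have i2 : inord 2 = lift ord0 (lift ord0 ord0) :> 'I_4 by apply/val_inj; rewrite /= inordK.
have i3 : inord 3 = lift ord0 (lift ord0 (lift ord0 ord0)) :> 'I_4 by apply/val_inj; rewrite /= inordK.
move=> a00 a01 a02 a03 a10 a20 a30.
rewrite (expand_det_row _ (inord 0)) (bigD1 (inord 1))//= big1 ?addr0; last first.
  move=> i; rewrite -(inord_val i); case: i => -[|[|[|[|//]]]] /= _.
  - by rewrite a00 mul0r.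
  - by rewrite eqxx.
  - by rewrite a02 mul0r.
  - by rewrite a03 mul0r.
rewrite a01 mul1r /cofactor !inordK// (expand_det_col _ ord0) !big_ord_recl big_ord0 !mxE.
have l0 : lift (inord 1) 0 = inord 0 :> 'I_4 by apply/val_inj; rewrite /= !inordK.
have j0 : lift (inord 0) 0 = inord 1 :> 'I_4 by apply/val_inj; rewrite /= !inordK.
have j1 : lift (inord 0) (lift ord0 0) = inord 2 :> 'I_4 by apply/val_inj; rewrite /= !inordK.
have j2 : lift (inord 0) (lift ord0 (lift ord0 0)) = inord 3 :> 'I_4 by apply/val_inj; rewrite /= !inordK.
rewrite l0 j0 j1 j2 a10 a20 a30 /cofactor det_mx22 !mxE.
have m0 : lift (inord 0) (lift 0 ord0) = inord 2 :> 'I_4 by apply/val_inj; rewrite /= !inordK.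
have m1 : lift (inord 0) (lift 0 ord_max) = inord 3 :> 'I_4 by apply/val_inj; rewrite /= !inordK.
have n0 : lift (inord 1) (lift 0 ord0) = inord 2 :> 'I_4 by apply/val_inj; rewrite /= !inordK.
have n1 : lift (inord 1) (lift 0 ord_max) = inord 3 :> 'I_4 by apply/val_inj; rewrite /= !inordK.
rewrite m0 m1 n0 n1 /=; ring.
Qed.

Section FormBounds.
Context {R : realType}.
Implicit Types a b c x y l L : R.

Lemma form_disc a b c : (forall x y, 0 <= a * x ^+ 2 + 2 * b * x * y + c * y ^+ 2) ->
  0 <= a /\ 0 <= c /\ b ^+ 2 <= a * c.
Proof.
move=> H.
have a0 : 0 <= a by have := H 1 0; rewrite expr1n !mulr1 mulr0 expr0n /= mulr0 !addr0.
have c0 : 0 <= c by have := H 0 1; rewrite !(mulr0,mul0r,expr0n,expr1n,mulr1,add0r).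
split=> //; split => //.
have [a1|a1] := eqVneq a 0.
  have [->|b1] := eqVneq b 0; first by rewrite a1 expr0n mul0r.
  (* With a = 0 and b != 0 this point gives the form the value - c - 2, negative since c >= 0. *)
  have := H (- (c + 1) / b) 1; rewrite a1 mul0r add0r expr1n !mulr1.
  have -> : 2 * b * (- (c + 1) / b) = - 2 * (c + 1) by field.
  lra.
have ap : 0 < a by rewrite lt0r a1.
(* At (- b, a) the form equals a (a c - b^2). *)
have := H (- b) a; have -> : a * (- b) ^+ 2 + 2 * b * - b * a + c * a ^+ 2 = a * (a * c - b ^+ 2) by ring.
by rewrite pmulr_rge0// subr_ge0.
Qed.

(** With d the determinant of h, the matrix d (L h^{-1} - 1) has diagonal entries L c - d and L a -
    d, and its determinant is d times that of L - h. Both facts come from the discriminant test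
    applied to h - l and L - h, so the matrix is nonnegative and h^{-1} >= 1 / L. *)
Lemma form_inverse a b c l L x y : 0 < l ->
  (forall x y, l * (x ^+ 2 + y ^+ 2) <= a * x ^+ 2 + 2 * b * x * y + c * y ^+ 2
    <= L * (x ^+ 2 + y ^+ 2)) ->
  [/\ 0 < a * c - b ^+ 2, a * c - b ^+ 2 <= L ^+ 2 &
    L^-1 * (x ^+ 2 + y ^+ 2) <= (c * x ^+ 2 - 2 * b * x * y + a * y ^+ 2) / (a * c - b ^+ 2)].
Proof.
move=> l0 H.
have [a0 [c0 d0]] : 0 <= a - l /\ 0 <= c - l /\ b ^+ 2 <= (a - l) * (c - l).
  by apply: form_disc => s t; have /andP[+ _] := H s t; lra.
have [a1 [c1 d1]] : 0 <= L - a /\ 0 <= L - c /\ (- b) ^+ 2 <= (L - a) * (L - c).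
  by apply: form_disc => s t; have /andP[_ +] := H s t; lra.
rewrite sqrrN in d1.
have L0 : 0 < L by lra.
have dp : 0 < a * c - b ^+ 2.
  have : l * l <= a * c - (a - l) * (c - l) by nra.
  have := mulr_gt0 l0 l0; lra.
have acL : a * c <= L ^+ 2 by rewrite expr2; apply: ler_pM; lra.
split => //; first by have := sqr_ge0 b; lra.
rewrite ler_pdivlMr// mulrC mulrA -[_ / L]/(_ * L^-1) mulrAC ler_pdivrMr//.
set d := a * c - b ^+ 2 in dp *.
have P : 0 <= L * c - d by rewrite /d; nra.
have Q : 0 <= L * a - d by rewrite /d; nra.
have D : (L * b) ^+ 2 <= (L * c - d) * (L * a - d).
  rewrite -subr_ge0; have -> : (L * c - d) * (L * a - d) - (L * b) ^+ 2 = d * ((L - a) * (L - c) - b ^+ 2).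
    by rewrite /d; ring.
  by rewrite mulr_ge0 ?(ltW dp)// subr_ge0.
have F : 0 <= (L * c - d) * x ^+ 2 - 2 * (L * b) * x * y + (L * a - d) * y ^+ 2.
  have [P0|P0] := eqVneq (L * c - d) 0.
    have : (L * b) ^+ 2 <= 0 by move: D; rewrite P0 mul0r.
    have := sqr_ge0 (L * b) => h1 h2.
    have /eqP : (L * b) ^+ 2 == 0 by rewrite eq_le h2 h1.
    move/eqP; rewrite sqrf_eq0 => /eqP ->; rewrite P0 mul0r mulr0 !mul0r subr0 add0r.
    by rewrite mulr_ge0// sqr_ge0.
  have Pp : 0 < L * c - d by rewrite lt0r P0.
  rewrite -(pmulr_rge0 _ Pp).
  have -> : (L * c - d) * ((L * c - d) * x ^+ 2 - 2 * (L * b) * x * y + (L * a - d) * y ^+ 2) =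
    ((L * c - d) * x - L * b * y) ^+ 2 + ((L * c - d) * (L * a - d) - (L * b) ^+ 2) * y ^+ 2 by ring.
  by rewrite addr_ge0 ?sqr_ge0// mulr_ge0 ?sqr_ge0 ?subr_ge0.
lra.
Qed.

End FormBounds.

Section MetricInverse.
Context {R : realType} (At : sphere_atlas R).
Local Notation E2 := (R * R)%type.
Local Notation E4 := ((R * R) * (R * R))%type.
Local Notation K := (chart_index At).

Lemma sum4 (F : 'I_4 -> R) : \sum_(i < 4) F i =
  F (inord 0) + F (inord 1) + F (inord 2) + F (inord 3).
Proof.
rewrite !big_ord_recl big_ord0 addr0 !addrA.
by congr (F _ + F _ + F _ + F _); apply/val_inj; rewrite /= inordK.
Qed.

Lemma ord4_ind (P : 'I_4 -> Prop) : P (inord 0) -> P (inord 1) -> P (inord 2) ->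
  P (inord 3) -> forall i, P i.
Proof.
move=> P0 P1 P2 P3 i; rewrite -(inord_val i); by case: i => -[|[|[|[|//]]]] /=.
Qed.

Lemma sum2 (F : 'I_2 -> R) : \sum_(i < 2) F i = F ord0 + F ord_max.
Proof.
by rewrite !big_ord_recl big_ord0 addr0; congr (_ + F _); apply/val_inj.
Qed.

Lemma quad2 (h : 'M[R]_2) (w : E2) : h^T = h ->
  quad h w = h ord0 ord0 * w.1 ^+ 2 + 2 * h ord0 ord_max * w.1 * w.2 + h ord_max ord_max * w.2 ^+ 2.
Proof.
move=> hs; have hE : h ord_max ord0 = h ord0 ord_max by rewrite -[in LHS]hs mxE.
by rewrite /quad !sum2 /coord2 /= hE; ring.
Qed.

(** Determinant of the sphere block (g^{AB}) of the inverse metric; it equals 1 / |det g| by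
    [metric_inverse]. *)
Definition minor2 (G : 'M[R]_4) : R := G (inord 2) (inord 2) * G (inord 3) (inord 3) -
  G (inord 2) (inord 3) * G (inord 3) (inord 2).

(** What the energy argument uses of the inverse metric: tau is a null coordinate with g^{01} = 1,
    the sphere block is bounded below by 1 / L, and the bound on the minor controls the logarithmic
    derivative of the density. *)
Record null_inverse (L : R) (G : 'M[R]_4) : Prop := NullInverse {
  null_row : [/\ G (inord 0) (inord 0) = 0, G (inord 0) (inord 1) = 1,
    G (inord 0) (inord 2) = 0 & G (inord 0) (inord 3) = 0] ;
  null_sym : G^T = G ;
  null_form : forall x y, L^-1 * (x ^+ 2 + y ^+ 2) <=
    G (inord 2) (inord 2) * x ^+ 2 + 2 * G (inord 2) (inord 3) * x * y +
    G (inord 3) (inord 3) * y ^+ 2 ;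
  null_minor : L ^- 2 <= minor2 G }.

Section AtPoint.
Variables (V : E2 -> 'rV[R]_3 -> R) (U : K -> E4 -> E2) (h : K -> E4 -> 'M[R]_2).
Variables (k : K) (q : E4) (l L : R).
Hypotheses (l0 : 0 < l) (hs : (h k q)^T = h k q).
Hypothesis hb : forall w, l * (w.1 ^+ 2 + w.2 ^+ 2) <= quad (h k q) w <= L * (w.1 ^+ 2 + w.2 ^+ 2).
Let a := h k q ord0 ord0.
Let b := h k q ord0 ord_max.
Let c := h k q ord_max ord_max.
Let d := a * c - b ^+ 2.
Let g := metric V U h k q.

Let form x y := @form_inverse R a b c l L x y l0.

Let formH x y : [/\ 0 < a * c - b ^+ 2, a * c - b ^+ 2 <= L ^+ 2 &
    L^-1 * (x ^+ 2 + y ^+ 2) <= (c * x ^+ 2 - 2 * b * x * y + a * y ^+ 2) / (a * c - b ^+ 2)].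
Proof. by apply: form => s t; have := hb (s, t); rewrite quad2. Qed.

Let d0 : d != 0.
Proof. by have [+ _ _] := formH 0 0; move/lt0r_neq0. Qed.

(** The inverse written out, with rows (0, 1, 0), (1, z^2 V, U) and (0, U^T, h^{-1}) in block
    form. *)
Let Gx : 'M[R]_4 := \matrix_(i, j)
  nth 0 (nth [::] [:: [:: 0; 1; 0; 0];
   [:: 1; q.1.2 ^+ 2 * pull k V q; (U k q).1; (U k q).2];
   [:: 0; (U k q).1; c / d; - b / d];
   [:: 0; (U k q).2; - b / d; a / d]] i) j.

Let gG : g *m Gx = 1%:M.
Proof.
have hE : h k q ord_max ord0 = b by rewrite -[in LHS]hs mxE.
have D0 : a * c - b ^+ 2 != 0 := d0.
apply/matrixP => i j; rewrite !mxE sum4 /d.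
elim/ord4_ind: i; elim/ord4_ind: j; rewrite !mxE !sum2 /coord2 -?val_eqE /= ?inordK//= ?hE -?/a -?/b -?/c.
all: rewrite ?mulr0n ?mulr1n ?/d; field; by rewrite ?D0.
Qed.

(** A right inverse of a square matrix is its inverse, so all entries are read off from [Gx]. Its
    determinant is - 1 / d, which determines det g = - d without expanding the metric. *)
Lemma metric_inverse : null_inverse L (invmx g) /\
  `|\det g| = (minor2 (invmx g))^-1 /\
  invmx g (inord 1) (inord 1) = q.1.2 ^+ 2 * pull k V q.
Proof.
have [gu _] := mulmx1_unit gG.
have gE : invmx g = Gx by rewrite -[LHS]mulmx1 -gG mulKmx.
have dE : d = a * c - b ^+ 2 by [].
have [dp dL _] := formH 0 0; rewrite -/d in dp dL.
have G22 : Gx (inord 2) (inord 2) = c / d by rewrite mxE /= !inordK.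
have G23 : Gx (inord 2) (inord 3) = - b / d by rewrite mxE /= !inordK.
have G32 : Gx (inord 3) (inord 2) = - b / d by rewrite mxE /= !inordK.
have G33 : Gx (inord 3) (inord 3) = a / d by rewrite mxE /= !inordK.
have mE : minor2 Gx = d^-1.
  by rewrite /minor2 G22 G33 G23 G32 dE; field; rewrite -dE d0.
rewrite gE; split; [split|split].
- by split; rewrite mxE /= !inordK.
- by apply/matrixP; elim/ord4_ind; elim/ord4_ind; rewrite !mxE /= !inordK.
- move=> x y; have [_ _] := formH x y; rewrite G22 G23 G33 -/d => /le_trans; apply.
  by rewrite [leLHS](_ : _ = c / d * x ^+ 2 + 2 * (- b / d) * x * y + a / d * y ^+ 2) //; field; rewrite d0.
- by rewrite mE lef_pV2// posrE; exact: lt_le_trans dp dL.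
- have : \det g * \det Gx = 1 by rewrite -det_mulmx gG det1.
  rewrite (@det_null4 _ Gx); try by rewrite mxE /= !inordK.
  rewrite G22 G33 G23 G32 mE invrK => H.
  have -> : \det g = - d.
    rewrite -[LHS]mulr1 -[X in _ * X](_ : (- b / d * (- b / d) - c / d * (a / d)) * (- d) = 1).
      by rewrite [LHS]mulrA H mul1r.
    by rewrite dE; field; rewrite -dE d0.
  by rewrite normrN gtr0_norm.
- by rewrite mxE /= !inordK.
Qed.

End AtPoint.
End MetricInverse.

Lemma is_derive_inv (R : realType) (f : R -> R) (y a : R) : f y != 0 ->
  is_derive y 1 f a -> is_derive y 1 (fun x => (f x)^-1) (- (f y) ^- 2 * a).
Proof.
move=> f0 [df <-]; apply: DeriveDef; first exact: derivableV.
by rewrite deriveV.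
Qed.

Lemma is_derive_inv_sqrt (R : realType) (y : R) : 0 < y ->
  is_derive y 1 (fun x : R => (Num.sqrt x)^-1) (- (Num.sqrt y) ^- 2 * (2 * Num.sqrt y)^-1).
Proof.
move=> y0; apply: is_derive_inv; last exact: is_derive1_sqrt.
by rewrite lt0r_neq0// sqrtr_gt0.
Qed.

Lemma inv_sqrt_derive (R : realType) (y d : R) : 0 < y ->
  - (Num.sqrt y) ^- 2 * (2 * Num.sqrt y)^-1 * d = - 2^-1 * (d / y) * (Num.sqrt y)^-1.
Proof.
move=> y0; have s0 : Num.sqrt y != 0 by rewrite lt0r_neq0// sqrtr_gt0.
have -> : d / y = d / (Num.sqrt y) ^+ 2 by rewrite sqr_sqrtr// ltW.
by field.
Qed.

Lemma inv_sqrt_product (R : realType) (y a b d : R) : 0 < y ->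
  Num.sqrt y * ((Num.sqrt y)^-1 * a + b * (- 2^-1 * d * (Num.sqrt y)^-1)) = a - 2^-1 * d * b.
Proof.
move=> y0; have s0 : Num.sqrt y != 0 by rewrite lt0r_neq0// sqrtr_gt0.
by field.
Qed.

Lemma minor2_bound (R : realType) (a b c d a' b' c' d' M : R) :
  `|a| <= M -> `|b| <= M -> `|c| <= M -> `|d| <= M ->
  `|a'| <= M -> `|b'| <= M -> `|c'| <= M -> `|d'| <= M ->
  `|a * b' + b * a' - (c * d' + d * c')| <= 4 * M ^+ 2.
Proof.
have P x y : `|x| <= M -> `|y| <= M -> `|x * y| <= M ^+ 2.
  by move=> ? ?; rewrite normrM expr2 ler_pM.
move=> a1 b1 c1 d1 a2 b2 c2 d2.
have h1 := P _ _ a1 b2; have h2 := P _ _ b1 a2; have h3 := P _ _ c1 d2; have h4 := P _ _ d1 c2.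
apply: (le_trans (ler_normB _ _)).
have := ler_normD (a * b') (b * a'); have := ler_normD (c * d') (d * c'); lra.
Qed.

Lemma box_term_bound (R : realType) (p d f M L S : R) : 0 <= M -> 0 < L -> L ^- 2 <= p ->
  `|f| <= M * S -> `|d| <= 4 * M ^+ 2 ->
  `|2^-1 * (d / p) * f| <= 2 * M ^+ 3 * L ^+ 2 * S.
Proof.
move=> M0 L0 pL fM dM.
have L20 : 0 < L ^- 2 by rewrite invr_gt0 exprn_gt0.
have p0 : 0 < p := lt_le_trans L20 pL.
have pV : p^-1 <= L ^+ 2 by rewrite -[leRHS]invrK lef_pV2.
rewrite !normrM (ger0_norm (_ : 0 <= 2^-1)) ?invr_ge0// (ger0_norm (_ : 0 <= p^-1)) ?invr_ge0 ?(ltW p0)//.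
have h : `|d| * p^-1 * `|f| <= 4 * M ^+ 2 * L ^+ 2 * (M * S).
  by apply: ler_pM => //; [rewrite mulr_ge0 // invr_ge0 ltW|apply: ler_pM => //; rewrite invr_ge0 ltW].
have -> : 2 * M ^+ 3 * L ^+ 2 * S = 2^-1 * (4 * M ^+ 2 * L ^+ 2 * (M * S)) by field.
by rewrite -[leLHS]mulrA ler_pM2l// invr_gt0.
Qed.

(** * Expansion of the wave operator *)

Section BoxExpansion.
Context {R : realType}.
Local Notation E4 := ((R * R) * (R * R))%type.
Variables (g : E4 -> 'M[R]_4) (D : set E4) (u : E4 -> R) (q : E4).
Local Notation G i j := (fun q' => invmx (g q') i j).
Local Notation p := (fun q' => minor2 (invmx (g q'))).
Hypotheses (oD : open D) (G1 : forall i j, C1 D (G i j)) (u2 : Ck_on 2 D u) (Dq : D q).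
Hypotheses (p0 : forall q', D q' -> 0 < p q') (gp : forall q', D q' -> `|\det (g q')| = (p q')^-1).

Definition flux (i : 'I_4) (q' : E4) : R := \sum_(j < 4) invmx (g q') i j * 'D_(e4 j) u q'.

Lemma flux_C1 i : C1 D (flux i).
Proof. by apply: (C1_sum oD) => j; apply: (C1_mul oD) => //; exact: Ck2_D_C1. Qed.

Lemma minor2_C1 : C1 D p.
Proof. by apply: (C1_sub oD); apply: (C1_mul oD). Qed.

Lemma C1_is_derive f v : C1 D f -> is_derive q v f ('D_v f q).
Proof. by move=> /(_ q Dq)[_ /(_ v)[/derivableP]]. Qed.

(** On [D] the density is p^{-1/2}, with logarithmic derivative - p_i / (2 p). Thus only the entries
    of the inverse metric are differentiated, which are the ones assumed C^1. *)
Lemma box_expand : box g u q =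
  \sum_(i < 4) ('D_(e4 i) (flux i) q - 2^-1 * ('D_(e4 i) p q / p q) * flux i q).
Proof.
rewrite /box mulr_sumr; apply: eq_bigr => i _.
have pq := p0 Dq.
have sp : 0 < Num.sqrt (p q) by rewrite sqrtr_gt0.
pose s q' := (Num.sqrt (p q'))^-1.
have nD : \forall q' \near q, D q' by exact: open_nbhs_nbhs.
have ds : is_derive q (e4 i) s (- 2^-1 * ('D_(e4 i) p q / p q) * s q).
  have h1 : is_derive (p q) 1 (fun y : R => (Num.sqrt y)^-1) (- (Num.sqrt (p q)) ^- 2 * (2 * Num.sqrt (p q))^-1).
    exact: is_derive_inv_sqrt.
  have := is_derive_comp1 (C1_is_derive (e4 i) minor2_C1) h1.
  by rewrite inv_sqrt_derive.
have dW := C1_is_derive (e4 i) (flux_C1 i).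
have -> : 'D_(e4 i) (fun q' => Num.sqrt `|\det (g q')| * flux i q') q =
   s q * 'D_(e4 i) (flux i) q + flux i q * (- 2^-1 * ('D_(e4 i) p q / p q) * s q).
  suff [_ ->] : is_derive q (e4 i) (fun q' => Num.sqrt `|\det (g q')| * flux i q') (s q * 'D_(e4 i) (flux i) q + flux i q * (- 2^-1 * ('D_(e4 i) p q / p q) * s q)) by [].
  apply: (is_derive_near _ (is_derive_mul ds dW)).
  by apply: filterS nD => q' Dq'; rewrite gp// sqrtrV// ltW// p0.
by rewrite gp// sqrtrV ?(ltW pq)// invrK; apply: inv_sqrt_product.
Qed.

Lemma minor2_derive_le M v : (forall i j, `|invmx (g q) i j| <= M) ->
  (forall i j, `|'D_v (G i j) q| <= M) -> `|'D_v p q| <= 4 * M ^+ 2.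
Proof.
move=> GM dGM; have dG i j := C1_is_derive v (G1 i j).
have [_ ->] := is_derive_sub (is_derive_mul (dG (inord 2) (inord 2)) (dG (inord 3) (inord 3)))
  (is_derive_mul (dG (inord 2) (inord 3)) (dG (inord 3) (inord 2))).
exact: minor2_bound.
Qed.

(** The divergence of the flux and the wave operator differ by first-order terms, so the energy
    method can be run on the divergence alone. Each of the four terms contributes at most 2 M^3 L^2
    times the sum of the first derivatives. *)
Lemma box_principal_le M L : 0 <= M -> (forall i j, `|invmx (g q) i j| <= M) ->
  (forall i j l, `|'D_(e4 l) (G i j) q| <= M) -> 0 < L -> L ^- 2 <= p q ->
  `|\sum_(i < 4) 'D_(e4 i) (flux i) q| <=
    `|box g u q| + 8 * M ^+ 3 * L ^+ 2 * \sum_(j < 4) `|'D_(e4 j) u q|.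
Proof.
move=> M0 GM dGM L0 pL; set S := \sum_(j < 4) `|_|.
have fM i : `|flux i q| <= M * S.
  rewrite /flux /S mulr_sumr; apply: (le_trans (ler_norm_sum _ _ _)).
  by apply: ler_sum => j _; rewrite normrM ler_wpM2r.
have -> : \sum_(i < 4) 'D_(e4 i) (flux i) q =
    box g u q + \sum_(i < 4) 2^-1 * ('D_(e4 i) p q / p q) * flux i q.
  by rewrite box_expand -big_split /=; apply: eq_bigr => i _; rewrite subrK.
apply: (le_trans (ler_normD _ _)); rewrite lerD2l.
apply: (le_trans (ler_norm_sum _ _ _)).
have -> : 8 * M ^+ 3 * L ^+ 2 * S = \sum_(i < 4) (2 * M ^+ 3 * L ^+ 2 * S).
  by rewrite sumr_const card_ord -mulr_natl; ring.
apply: ler_sum => i _.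
have dp := minor2_derive_le GM (fun i' j' => dGM i' j' i).
exact: (box_term_bound M0 L0 pL (fM i) dp).
Qed.

End BoxExpansion.

(** * The energy current *)

Section CurrentReal.
Context {R : realType}.
Implicit Types u x y g s V B h m beta K z : R.

(** The components F^0 and F^1 of the current in terms of u0 = v_tau, u1 = v_z, g = g^{11}, B =
    g^{1A} v_A and h = g^{AB} v_A v_B; [current01] proves the agreement. *)
Let F0 beta u1 g B h := - (beta * u1 ^+ 2) - g * u1 ^+ 2 / 2 - B * u1 - h / 2.
Let F1 beta u0 u1 g B h :=
  u0 ^+ 2 + g * u0 * u1 + B * u0 - beta * g * u1 ^+ 2 / 2 + beta * h / 2.

(** Expand (beta u1 + B)^2 >= 0 and use B^2 <= m h with 4 m <= beta: a large beta makes the cross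
    term small against both squares. *)
Lemma current_cross beta u1 B h m : 4 * m + 1 <= beta -> 0 <= m -> B ^+ 2 <= m * h -> 0 <= h ->
  - (beta * u1 ^+ 2) / 2 - h / 8 <= B * u1.
Proof.
move=> bm m0 Bm h0; have b0 : 0 < beta by lra.
have h5 := sqr_ge0 (beta * u1 + B).
have h6 : 4 * m * h <= beta * h by rewrite ler_wpM2r//; lra.
suff : 0 <= beta * (B * u1 + beta * u1 ^+ 2 / 2 + h / 8) by rewrite pmulr_rge0//; lra.
have -> : beta * (B * u1 + beta * u1 ^+ 2 / 2 + h / 8) =
  ((beta * u1 + B) ^+ 2) / 2 - B ^+ 2 / 2 + beta * h / 8 by field.
lra.
Qed.

Lemma current_F0 beta u1 g B h m : 4 * m + 1 <= beta -> 0 <= m -> B ^+ 2 <= m * h -> 0 <= h ->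
  0 <= g -> beta * u1 ^+ 2 / 2 + 3 * h / 8 <= - F0 beta u1 g B h.
Proof.
move=> bm m0 Bm h0 g0; have := current_cross u1 bm m0 Bm h0.
have := mulr_ge0 g0 (sqr_ge0 u1); rewrite /F0; lra.
Qed.

(** Here s stands for z^2 and z for an upper bound of s. All negative terms in u1^2 carry a factor
    s, because g <= 3 s / 2 and g^2 <= (9/4) z s; they are absorbed by K s beta u1^2 / 2 from - K s
    F^0, and 2 + 9 z is what this costs. The cross terms with u0 use two eighths of u0^2, and 2 B^2
    is absorbed by beta h / 2. *)
Lemma current_F1 beta u0 u1 g B h m s V z K : 4 * m + 1 <= beta -> 0 <= m ->
  B ^+ 2 <= m * h -> 0 <= h -> g = s * V -> 0 <= s -> s <= z -> 1 / 2 <= V -> V <= 3 / 2 ->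
  2 + 9 * z <= K ->
  u0 ^+ 2 / 2 <= F1 beta u0 u1 g B h - K * s * F0 beta u1 g B h.
Proof.
move=> bm m0 Bm h0 gE s0 sz V1 V2 KE; have z0 : 0 <= z by lra.
have g0 : 0 <= g by rewrite gE mulr_ge0//; lra.
have h1 := sqr_ge0 (u0 + 4 * g * u1); have h2 := sqr_ge0 (u0 + 4 * B).
have su : 0 <= s * u1 ^+ 2 by rewrite mulr_ge0// sqr_ge0.
have gV : g <= 3 / 2 * s by rewrite gE mulrC ler_wpM2r.
have gg : g ^+ 2 <= 9 / 4 * z * s.
  have : g * g <= (3 / 2 * z) * (3 / 2 * s) by apply: ler_pM => //; lra.
  by rewrite expr2; lra.
have h3 : g ^+ 2 * u1 ^+ 2 <= 9 / 4 * z * s * u1 ^+ 2 by rewrite ler_wpM2r// sqr_ge0.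
have h4 : beta * (g * u1 ^+ 2) <= beta * (3 / 2 * s * u1 ^+ 2).
  by rewrite ler_wpM2l ?ler_wpM2r ?sqr_ge0//; lra.
have h5 := current_F0 u1 bm m0 Bm h0 g0.
have h6 : K * s * (beta * u1 ^+ 2 / 2 + 3 * h / 8) <= K * s * (- F0 beta u1 g B h).
  by rewrite ler_wpM2l// mulr_ge0//; lra.
have h7 : 0 <= (K - (2 + 9 * z)) * (s * (beta * u1 ^+ 2)).
  rewrite mulr_ge0//; first by lra.
  by rewrite mulr_ge0// mulr_ge0 ?sqr_ge0//; lra.
have h8 : 0 <= (beta - 1) * (z * s * u1 ^+ 2).
  by rewrite mulr_ge0//; [lra|rewrite -mulrA mulr_ge0].
have h9 : 0 <= K * s * h by rewrite !mulr_ge0//; lra.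
have h10 : 0 <= (beta - (4 * m + 1)) * h by rewrite mulr_ge0//; lra.
have h11 : 0 <= s * (beta * u1 ^+ 2) by rewrite mulr_ge0// mulr_ge0 ?sqr_ge0//; lra.
rewrite mulrN in h6; have h12 := sqr_ge0 u0.
suff : 0 <= F1 beta u0 u1 g B h - u0 ^+ 2 / 2 + K * s * (beta * u1 ^+ 2 / 2 + 3 * h / 8) by lra.
rewrite /F1; lra.
Qed.

(** From g (u1 - 2 u0)^2 >= 0 the cross term takes only half of the negative term - g u1^2 / 2
    contained in - beta g u1^2 / 2. What is left is at most - s u1^2 / 8 since g >= s / 2; on the
    lateral face this is the term that yields the normal derivative. *)
Lemma current_F1_upper beta u0 u1 g B h s V z m : 4 * m + 1 <= beta -> 0 <= m ->
  B ^+ 2 <= m * h -> 0 <= h -> g = s * V -> 0 <= s -> s <= z -> 1 / 2 <= V -> V <= 3 / 2 ->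
  F1 beta u0 u1 g B h + s * u1 ^+ 2 / 8 <= (2 + 2 * z) * u0 ^+ 2 + (m + beta) * h.
Proof.
move=> bm m0 Bm h0 gE s0 sz V1 V2; have z0 : 0 <= z by lra.
have g0 : 0 <= g by rewrite gE mulr_ge0//; lra.
have gs : s / 2 <= g by rewrite gE ler_wpM2l//; lra.
have gV : g <= 3 / 2 * s by rewrite gE mulrC ler_wpM2r.
have h1 : 0 <= g * (u1 - 2 * u0) ^+ 2 by rewrite mulr_ge0// sqr_ge0.
have h2 := sqr_ge0 (u0 - B).
have h3 : (s / 2) * u1 ^+ 2 <= g * u1 ^+ 2 by rewrite ler_wpM2r// sqr_ge0.
have b1 : 0 <= beta - 1 by lra.
have h4 : 0 <= (beta - 1) * (g * u1 ^+ 2) by rewrite mulr_ge0// mulr_ge0 ?sqr_ge0.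
have h5 : g * u0 ^+ 2 <= (3 / 2 * z) * u0 ^+ 2 by rewrite ler_wpM2r ?sqr_ge0//; lra.
have h6 : 0 <= beta * h by rewrite mulr_ge0//; lra.
have h7 : 0 <= u0 ^+ 2 := sqr_ge0 _.
have h8 : 0 <= z * u0 ^+ 2 by rewrite mulr_ge0// sqr_ge0.
have h9 : 0 <= m * h by rewrite mulr_ge0.
rewrite /F1; lra.
Qed.

End CurrentReal.

Section Current.
Context {R : realType}.
Implicit Types (G : 'M[R]_4) (w : 'I_4 -> R).

Definition raise G w (i : 'I_4) : R := \sum_(j < 4) G i j * w j.
Definition mult (beta : R) (i : 'I_4) : R := nth 0 [:: 1; - beta; 0; 0] i.
Definition mult_dir (beta : R) w : R := w (inord 0) - beta * w (inord 1).
Definition current (beta : R) G w (i : 'I_4) : R :=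
  raise G w i * mult_dir beta w - mult beta i * (\sum_(j < 4) raise G w j * w j) / 2.

Lemma mult_norm_le beta i : 0 < beta -> `|mult beta i| <= 1 + beta.
Proof.
move=> b0; rewrite /mult; case: i => -[|[|[|[|//]]]] /= _.
- by rewrite normr1 lerDl ltW.
- by rewrite normrN gtr0_norm// lerDr.
- by rewrite normr0 addr_ge0// ltW.
- by rewrite normr0 addr_ge0// ltW.
Qed.

Lemma form_square (a b M x y L h : R) : `|a| <= M -> `|b| <= M -> 0 < L ->
  L^-1 * (x ^+ 2 + y ^+ 2) <= h -> (a * x + b * y) ^+ 2 <= 2 * M ^+ 2 * L * h.
Proof.
move=> aM bM L0 hl.
have a2 : a ^+ 2 <= M ^+ 2 by rewrite -(real_normK (num_real a)) ler_pXn2r// nnegrE; have := normr_ge0 a; lra.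
have b2 : b ^+ 2 <= M ^+ 2 by rewrite -(real_normK (num_real b)) ler_pXn2r// nnegrE; have := normr_ge0 b; lra.
have h1 : x ^+ 2 + y ^+ 2 <= L * h by rewrite -ler_pdivrMl.
have h2 : M ^+ 2 * (x ^+ 2 + y ^+ 2) <= M ^+ 2 * (L * h) by rewrite ler_wpM2l ?sqr_ge0.
have h3 : a ^+ 2 * x ^+ 2 <= M ^+ 2 * x ^+ 2 by rewrite ler_wpM2r ?sqr_ge0.
have h4 : b ^+ 2 * y ^+ 2 <= M ^+ 2 * y ^+ 2 by rewrite ler_wpM2r ?sqr_ge0.
have := sqr_ge0 (a * x - b * y); lra.
Qed.

Lemma form_upper (a b c M x y : R) : `|a| <= M -> `|b| <= M -> `|c| <= M ->
  a * x ^+ 2 + 2 * b * x * y + c * y ^+ 2 <= 2 * M * (x ^+ 2 + y ^+ 2).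
Proof.
move=> /ler_normlP[_ aM] /ler_normlP[bM1 bM2] /ler_normlP[_ cM].
have h1 : a * x ^+ 2 <= M * x ^+ 2 by rewrite ler_wpM2r ?sqr_ge0.
have h2 : c * y ^+ 2 <= M * y ^+ 2 by rewrite ler_wpM2r ?sqr_ge0.
have h3 : 0 <= (M - b) * (x - y) ^+ 2 by rewrite mulr_ge0 ?sqr_ge0//; lra.
have h4 : 0 <= (M + b) * (x + y) ^+ 2 by rewrite mulr_ge0 ?sqr_ge0//; lra.
have h5 : 0 <= (M - b) * (x + y) ^+ 2 by rewrite mulr_ge0 ?sqr_ge0//; lra.
have h6 : 0 <= (M + b) * (x - y) ^+ 2 by rewrite mulr_ge0 ?sqr_ge0//; lra.
lra.
Qed.

Lemma current01 (L beta : R) G w : null_inverse L G ->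
  let B := G (inord 1) (inord 2) * w (inord 2) + G (inord 1) (inord 3) * w (inord 3) in
  let h := G (inord 2) (inord 2) * w (inord 2) ^+ 2 +
    2 * G (inord 2) (inord 3) * w (inord 2) * w (inord 3) + G (inord 3) (inord 3) * w (inord 3) ^+ 2 in
  let g := G (inord 1) (inord 1) in
  current beta G w (inord 0) =
    - (beta * w (inord 1) ^+ 2) - g * w (inord 1) ^+ 2 / 2 - B * w (inord 1) - h / 2 /\
  current beta G w (inord 1) = w (inord 0) ^+ 2 + g * w (inord 0) * w (inord 1) + B * w (inord 0)
    - beta * g * w (inord 1) ^+ 2 / 2 + beta * h / 2.
Proof.
move=> [[G00 G01 G02 G03] Gs _ _] B h g.
have S i j : G i j = G j i by rewrite -[in LHS]Gs mxE.
rewrite /current /mult_dir /mult !sum4 /raise !sum4 !inordK//=.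
rewrite (S (inord 1) (inord 0)) (S (inord 2) (inord 0)) (S (inord 3) (inord 0)).
rewrite (S (inord 2) (inord 1)) (S (inord 3) (inord 1)) (S (inord 3) (inord 2)) G00 G01 G02 G03 /B /h /g.
by split; field.
Qed.

Lemma current_norm_bounds (M beta : R) G w : 0 <= M -> 0 < beta -> (forall i j, `|G i j| <= M) ->
  let S := \sum_(i < 4) w i ^+ 2 in
  (forall i, `|current beta G w i| <= 6 * M * (1 + beta) * S) /\
  mult_dir beta w ^+ 2 <= 4 * (1 + beta) ^+ 2 * S.
Proof.
move=> M0 b0 GM S.
have sgS : (\sum_(i < 4) `|w i|) ^+ 2 <= 4 * S.
  rewrite /S !sum4 -!(real_normK (num_real (w _))).
  move: `|w (inord 0)| `|w (inord 1)| `|w (inord 2)| `|w (inord 3)| => p q r s.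
  have := sqr_ge0 (p - q); have := sqr_ge0 (p - r); have := sqr_ge0 (p - s).
  have := sqr_ge0 (q - r); have := sqr_ge0 (q - s); have := sqr_ge0 (r - s); lra.
set sg := \sum_(i < 4) `|w i| in sgS.
have sg0 : 0 <= sg by rewrite /sg sumr_ge0.
have wsg i : `|w i| <= sg by rewrite /sg (bigD1 i)//= lerDl sumr_ge0.
have rM i : `|raise G w i| <= M * sg.
  rewrite /raise /sg mulr_sumr; apply: (le_trans (ler_norm_sum _ _ _)).
  by apply: ler_sum => j _; rewrite normrM ler_wpM2r.
have QM : `|\sum_(j < 4) raise G w j * w j| <= M * sg * sg.
  rewrite [leRHS]mulr_sumr; apply: (le_trans (ler_norm_sum _ _ _)).
  by apply: ler_sum => j _; rewrite normrM ler_wpM2r.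
have XM : `|mult_dir beta w| <= (1 + beta) * sg.
  rewrite /mult_dir; have := ler_normB (w (inord 0)) (beta * w (inord 1)).
  rewrite normrM (gtr0_norm b0) => /le_trans; apply; rewrite [leRHS]mulrDl mul1r.
  by apply: lerD; [exact: wsg|rewrite ler_wpM2l// ltW].
have S0 : 0 <= S by rewrite /S sumr_ge0// => i _; exact: sqr_ge0.
split.
- move=> i;  have mM' := mult_norm_le i b0.
  have e1 : `|raise G w i * mult_dir beta w| <= (M * sg) * ((1 + beta) * sg).
    by rewrite normrM ler_pM.
  have e2 : `|mult beta i * (\sum_(j < 4) raise G w j * w j) / 2| <= (1 + beta) * (M * sg * sg) / 2.
    by rewrite normrM (ger0_norm (_ : 0 <= 2^-1)) ?invr_ge0// ler_wpM2r ?invr_ge0// normrM ler_pM.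
  have e3 : M * (1 + beta) * sg ^+ 2 <= M * (1 + beta) * (4 * S).
    by rewrite ler_wpM2l// mulr_ge0//; lra.
  have := ler_normB (raise G w i * mult_dir beta w) (mult beta i * (\sum_(j < 4) raise G w j * w j) / 2).
  rewrite -/(current _ _ _ _); lra.
- rewrite -(real_normK (num_real (mult_dir beta w))).
  have e1 : `|mult_dir beta w| ^+ 2 <= ((1 + beta) * sg) ^+ 2.
    by rewrite ler_pXn2r// nnegrE mulr_ge0//; lra.
  have e2 : (1 + beta) ^+ 2 * sg ^+ 2 <= (1 + beta) ^+ 2 * (4 * S) by rewrite ler_wpM2l ?sqr_ge0.
  lra.
Qed.

Lemma current_bounds (M L z0 : R) : 0 <= M -> 0 < L -> 0 < z0 ->
  exists beta K N c C : R, [/\ 0 < beta, 0 < K, 0 < N, 0 < c & c <= N] /\ 0 < C /\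
  forall G w z V, null_inverse L G -> (forall i j, `|G i j| <= M) ->
  G (inord 1) (inord 1) = z ^+ 2 * V -> 0 <= z <= z0 -> 1 / 2 <= V <= 3 / 2 ->
  let F := current beta G w in let S := \sum_(i < 4) w i ^+ 2 in
  [/\ 0 <= F (inord 1) - K * z ^+ 2 * F (inord 0),
      c * S <= F (inord 1) - N * F (inord 0),
      0 <= - F (inord 0) /\
        - F (inord 0) <= C * (w (inord 1) ^+ 2 + w (inord 2) ^+ 2 + w (inord 3) ^+ 2),
      F (inord 1) + c * z ^+ 2 * w (inord 1) ^+ 2 <=
        C * (w (inord 0) ^+ 2 + w (inord 2) ^+ 2 + w (inord 3) ^+ 2) &
      (forall i, `|F i| <= C * S) /\ mult_dir beta w ^+ 2 <= C * S].
Proof.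
move=> M0 L0 z00.
(* [m] is the constant in B^2 <= m h. Writing F^1 - N F^0 as (F^1 - K z^2 F^0) + (N - K z^2) (-
   F^0), the choice of [N] leaves a factor of at least 2 before - F^0, which supplies u1^2 and h. *)
pose m := 2 * M ^+ 2 * L; have m0 : 0 <= m by rewrite !mulr_ge0 ?exprn_ge0// ltW.
pose beta := 4 * m + 1; pose K := 2 + 9 * z0 ^+ 2; pose N := K * z0 ^+ 2 + 2.
have b0 : 0 < beta by rewrite /beta; lra.
(* 1/8 is the constant of the lateral bound and also suffices for u0^2 and u1^2; 3 / (4 L) comes
   from 2 (3 h / 8) and the lower bound of h by the sphere derivatives. *)
pose c := Num.min (1 / 8) (3 / 4 * L^-1).
have c0 : 0 < c by rewrite lt_min; apply/andP; split; [lra|rewrite mulr_gt0 ?invr_gt0//; lra].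
have z2 : 0 < z0 ^+ 2 by rewrite exprn_gt0.
pose Ca := beta + M + 1 + (m + 1) * M; pose Cb := 2 + 2 * z0 ^+ 2 + (m + beta) * (2 * M).
pose Cc := 6 * M * (1 + beta); pose Cd := 4 * (1 + beta) ^+ 2.
have mM : 0 <= m * M by rewrite mulr_ge0.
have bM : 0 <= beta * M by rewrite mulr_ge0// ltW.
have Ca0 : 0 < Ca by rewrite /Ca; lra.
have Cb0 : 0 < Cb by rewrite /Cb; lra.
have Cc0 : 0 <= Cc by rewrite /Cc; lra.
have Cd0 : 0 <= Cd by rewrite mulr_ge0 ?sqr_ge0.
pose C := Ca + Cb + Cc + Cd; have C0 : 0 < C by rewrite /C; lra.
have CaC : Ca <= C by rewrite /C; lra.
have CbC : Cb <= C by rewrite /C; lra.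
have CcC : Cc <= C by rewrite /C; lra.
have CdC : Cd <= C by rewrite /C; lra.
have c1 : c <= 1 / 8 by exact: le_minl.
have N2 : 2 <= N by have := mulr_ge0 (ltW z2) (ltW z2); rewrite /N /K mulrDl; lra.
exists beta, K, N, c, C; split; first by split => //; rewrite ?/K; lra.
split => // G w z V HG GM G11 /andP[zp zz] /andP[V1 V2] F S.
have [F0E F1E] := current01 beta w HG.
have [_ _ hlow _] := HG.
move: F0E F1E; set B := _ * w (inord 2) + _ * w (inord 3); set h := _ * w (inord 2) ^+ 2 + _ + _.
set u0 := w (inord 0); set u1 := w (inord 1); set g := G _ _ => /= F0E F1E.
have hb := hlow (w (inord 2)) (w (inord 3)); rewrite -/h in hb.
have Li : 0 < L^-1 by rewrite invr_gt0.
set t := w (inord 2) ^+ 2 + w (inord 3) ^+ 2 in hb.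
have t0 : 0 <= t by rewrite addr_ge0 ?sqr_ge0.
have h0 : 0 <= h by apply: le_trans hb; rewrite mulr_ge0// ltW.
have hM : h <= 2 * M * t := form_upper _ _ (GM _ _) (GM _ _) (GM _ _).
have Bm : B ^+ 2 <= m * h := form_square (GM _ _) (GM _ _) L0 hb.
have bm : 4 * m + 1 <= beta by [].
have s0 : 0 <= z ^+ 2 := sqr_ge0 z.
have sz : z ^+ 2 <= z0 ^+ 2 by rewrite ler_pXn2r// nnegrE//; lra.
have g0 : 0 <= g by rewrite /g G11 mulr_ge0//; lra.
have KE : 2 + 9 * z0 ^+ 2 <= K by [].
have h1 := current_F1 u0 u1 bm m0 Bm h0 G11 s0 sz V1 V2 KE.
have h2 := current_F0 u1 bm m0 Bm h0 g0.
have h3 := current_F1_upper u0 u1 bm m0 Bm h0 G11 s0 sz V1 V2.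
rewrite -/g -F0E -F1E in h1 h2 h3; rewrite -/F in h1 h2 h3.
have SE : S = u0 ^+ 2 + u1 ^+ 2 + t by rewrite /S sum4 /t addrA.
have c2 : c <= 3 / 4 * L^-1 by exact: le_minr.
have b1 : u1 ^+ 2 <= beta * u1 ^+ 2 by rewrite ler_peMl ?sqr_ge0//; lra.
have gM : g <= M by have /ler_normlP[] := GM (inord 1) (inord 1).
have F0ge : 0 <= - F (inord 0) by have := sqr_ge0 u1; lra.
split.
- by have := sqr_ge0 u0; lra.
- have k1 : 0 <= (N - K * z ^+ 2 - 2) * - F (inord 0).
    rewrite mulr_ge0//; have : K * z ^+ 2 <= K * z0 ^+ 2 by rewrite ler_wpM2l// /K; lra.
    rewrite /N; lra.
  have k2 : c * u0 ^+ 2 <= 1 / 8 * u0 ^+ 2 by rewrite ler_wpM2r ?sqr_ge0.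
  have k3 : c * u1 ^+ 2 <= 1 / 8 * u1 ^+ 2 by rewrite ler_wpM2r ?sqr_ge0.
  have k4 : c * t <= 3 / 4 * L^-1 * t by rewrite ler_wpM2r.
  rewrite SE; have := sqr_ge0 u0; have := sqr_ge0 u1; lra.
- split => //; rewrite -addrA -/t.
  apply: (@le_trans _ _ (Ca * (u1 ^+ 2 + t))); last first.
    by rewrite ler_wpM2r// addr_ge0 ?sqr_ge0.
  have k1 := sqr_ge0 (B + u1).
  have k2 : g * u1 ^+ 2 <= M * u1 ^+ 2 by rewrite ler_wpM2r ?sqr_ge0.
  have k3 : 0 <= M * u1 ^+ 2 by rewrite mulr_ge0 ?sqr_ge0.
  have k4 : m * h <= m * (2 * M * t) by rewrite ler_wpM2l.
  have k5 : 0 <= m * M * u1 ^+ 2 by rewrite mulr_ge0 ?sqr_ge0.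
  have k6 : 0 <= beta * t by rewrite mulr_ge0// ltW.
  have k7 := sqr_ge0 u1; have k8 := sqr_ge0 (B - u1).
  have k9 : 0 <= M * t by rewrite mulr_ge0.
  by rewrite /F F0E /Ca; lra.
- rewrite -[X in _ <= _ * X]addrA -/t.
  apply: (@le_trans _ _ (Cb * (u0 ^+ 2 + t))); last first.
    by rewrite ler_wpM2r// addr_ge0 ?sqr_ge0.
  have k1 : c * (z ^+ 2 * u1 ^+ 2) <= 1 / 8 * (z ^+ 2 * u1 ^+ 2).
    by rewrite ler_wpM2r// mulr_ge0 ?sqr_ge0.
  have k2 : (m + beta) * h <= (m + beta) * (2 * M * t) by rewrite ler_wpM2l//; lra.
  have k3 : 0 <= m * M * u0 ^+ 2 by rewrite mulr_ge0 ?sqr_ge0.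
  have k4 : 0 <= beta * M * u0 ^+ 2 by rewrite mulr_ge0 ?sqr_ge0.
  have k5 : 0 <= z0 ^+ 2 * t by rewrite mulr_ge0 ?sqr_ge0.
  by rewrite /Cb; lra.
have S0 : 0 <= S by rewrite /S sumr_ge0// => i _; exact: sqr_ge0.
have [nF nX] := current_norm_bounds w M0 b0 GM.
split=> [i|]; first by apply: le_trans (nF i) _; rewrite ler_wpM2r.
by apply: le_trans nX _; rewrite ler_wpM2r.
Qed.

End Current.

(** * Divergence of the weighted current *)

Section Divergence.
Context {R : realType}.
Local Notation E4 := ((R * R) * (R * R))%type.

(** Pointwise algebra with [H] the Hessian and [dG] the derivatives of the inverse metric. Symmetry
    of [H] makes the Hessian terms of W^i d_i(Xv) cancel against those of X^i d_i(g^{jk} v_j v_k) /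
    2; only the divergence of W times Xv and the derivative of the metric along X remain. *)
Lemma divergence_identity (beta : R) (G : 'M[R]_4) (w : 'I_4 -> R) (H : 'I_4 -> 'I_4 -> R)
    (dG : 'I_4 -> 'I_4 -> 'I_4 -> R) : G^T = G -> (forall i j, H i j = H j i) ->
  let W := raise G w in let dW k i := \sum_(j < 4) (G i j * H k j + w j * dG k i j) in
  \sum_(i < 4) (W i * (H i (inord 0) - beta * H i (inord 1)) + mult_dir beta w * dW i i
     - mult beta i * (\sum_(j < 4) (W j * H i j + w j * dW i j)) / 2) =
  (\sum_(i < 4) dW i i) * mult_dir beta w -
  (\sum_(i < 4) \sum_(j < 4) (dG (inord 0) i j - beta * dG (inord 1) i j) * w i * w j) / 2.
Proof.
move=> Gs Hs W dW.
have S i j : G i j = G j i by rewrite -[in LHS]Gs mxE.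
(* The derivative of g^{ij} v_i v_j in direction k, with the two Hessian contributions merged by
   symmetry of [G]. *)
have A k : \sum_(j < 4) (W j * H k j + w j * dW k j) =
    2 * (\sum_(j < 4) W j * H k j) + \sum_(i < 4) \sum_(j < 4) dG k i j * w i * w j.
  rewrite big_split /= mulr_natl mulr2n -addrA; congr (_ + _).
  rewrite /dW; under eq_bigr do rewrite big_split /= mulrDr.
  rewrite big_split /=; congr (_ + _).
    rewrite /W /raise; under eq_bigr do rewrite mulr_sumr.
    rewrite exchange_big /=; apply: eq_bigr => j _; rewrite mulr_suml.
    by apply: eq_bigr => i _; rewrite (S j i); ring.
  by apply: eq_bigr => i _; rewrite mulr_sumr; apply: eq_bigr => j _; ring.
have B : \sum_(i < 4) (W i * (H i (inord 0) - beta * H i (inord 1))) =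
    (\sum_(j < 4) W j * H (inord 0) j) - beta * (\sum_(j < 4) W j * H (inord 1) j).
  by rewrite mulr_sumr -sumrB; apply: eq_bigr => i _; rewrite !(Hs i); ring.
have C : \sum_(i < 4) \sum_(j < 4) (dG (inord 0) i j - beta * dG (inord 1) i j) * w i * w j =
    (\sum_(i < 4) \sum_(j < 4) dG (inord 0) i j * w i * w j)
    - beta * \sum_(i < 4) \sum_(j < 4) dG (inord 1) i j * w i * w j.
  rewrite mulr_sumr -sumrB; apply: eq_bigr => i _; rewrite mulr_sumr -sumrB.
  by apply: eq_bigr => j _; ring.
rewrite sumrB big_split /= B -mulr_sumr C [X in _ - X]sum4 /mult !inordK//= !A.
move: (\sum_(i < 4) dW i i) (mult_dir beta w) => p X.
move: (\sum_(j < 4) W j * H (inord 0) j) (\sum_(j < 4) W j * H (inord 1) j) => a b.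
by field.
Qed.

Variables (D : set E4) (G : E4 -> 'M[R]_4) (u : E4 -> R) (beta : R).
Hypotheses (oD : open D) (G1 : forall i j, C1 D (fun q => G q i j)) (u2 : Ck_on 2 D u).
Hypothesis Gs : forall q, D q -> (G q)^T = G q.

Definition grad (q : E4) (i : 'I_4) : R := 'D_(e4 i) u q.
Definition energy (q : E4) : R := u q ^+ 2 + \sum_(i < 4) grad q i ^+ 2.
Definition cur (i : 'I_4) (q : E4) : R := current beta (G q) (grad q) i.
(** The divergence d_i (g^{ij} v_j) without the density |det g|^{1/2}; it differs from the wave
    operator by first-order terms. *)
Definition principal (q : E4) : R := \sum_(i < 4) 'D_(e4 i) (fun q' => raise (G q') (grad q') i) q.

Lemma raise_C1 i : C1 D (fun q => raise (G q) (grad q) i).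
Proof. by apply: (C1_sum oD) => j; apply: (C1_mul oD) => //; exact: Ck2_D_C1. Qed.

Lemma mult_dir_C1 : C1 D (fun q => mult_dir beta (grad q)).
Proof.
apply: (C1_sub oD); first exact: Ck2_D_C1.
by apply: (C1_mul oD); [exact: C1_cst|exact: Ck2_D_C1].
Qed.

Lemma C1_half (f : E4 -> R) : C1 D f -> C1 D (fun q => f q / 2).
Proof. by move=> f1; apply: (C1_mul oD) => //; exact: C1_cst. Qed.

Lemma cur_C1 i : C1 D (cur i).
Proof.
apply: (C1_sub oD); first by apply: (C1_mul oD); [exact: raise_C1|exact: mult_dir_C1].
apply: C1_half; apply: (C1_mul oD); first exact: C1_cst.
apply: (C1_sum oD) => j; apply: (C1_mul oD); [exact: raise_C1|exact: Ck2_D_C1].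
Qed.

Lemma C1_is_deriveP (f : E4 -> R) (q v : E4) : C1 D f -> D q -> is_derive q v f ('D_v f q).
Proof. by move=> f1 /f1[_ /(_ v)[/derivableP]]. Qed.

Lemma is_derive_half (f : E4 -> R) (q v : E4) (a : R) : is_derive q v f a -> is_derive q v (fun q => f q / 2) (a / 2).
Proof.
move=> fa; rewrite [X in is_derive _ _ X _](_ : _ = (fun q => 2^-1 * f q)) 1?mulrC.
  exact: is_derive_scal.
by apply/funext => x; rewrite mulrC.
Qed.

Lemma divergence_cur q : D q ->
  \sum_(i < 4) 'D_(e4 i) (cur i) q = principal q * mult_dir beta (grad q) -
  (\sum_(i < 4) \sum_(j < 4) ('D_(e4 (inord 0)) (fun q => G q i j) q
     - beta * 'D_(e4 (inord 1)) (fun q => G q i j) q) * grad q i * grad q j) / 2.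
Proof.
move=> Dq.
pose H i j := 'D_(e4 i) ('D_(e4 j) u) q.
have Hs i j : H i j = H j i by exact: schwarz oD u2 Dq.
pose dG k i j := 'D_(e4 k) (fun q => G q i j) q.
have dGr k i : is_derive q (e4 k) (fun q => raise (G q) (grad q) i)
    (\sum_(j < 4) (G q i j * H k j + grad q j * dG k i j)).
  apply: is_derive_bigsum => j; apply: is_derive_mul; apply: C1_is_deriveP => //.
  exact: Ck2_D_C1.
have dg k j : is_derive q (e4 k) (fun q => grad q j) (H k j).
  by apply: C1_is_deriveP => //; exact: Ck2_D_C1.
have := divergence_identity beta (grad q) dG (Gs Dq) Hs.
rewrite /principal => /= E; under [in RHS]eq_bigr do rewrite (@derive_val _ _ _ _ _ _ _ (dGr _ _)).
rewrite -E; apply: eq_bigr => i _.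
have dX : is_derive q (e4 i) (fun q => mult_dir beta (grad q)) (H i (inord 0) - beta * H i (inord 1)).
  by apply: is_derive_sub => //; exact: is_derive_scal.
have dQ := is_derive_bigsum (fun j => is_derive_mul (dGr i j) (dg i j)).
by have [_ ->] := is_derive_sub (is_derive_mul (dGr i i) dX) (is_derive_half (is_derive_scal (mult beta i) dQ)).
Qed.

(** The term - u^2 in the tau-component produces - u^2 d_tau(om), which for the exponential weight
    is mu N u^2 om. This is how the zero-order part of the energy is controlled, at the price of the
    harmless - 2 u u_tau. *)
Lemma weighted_divergence (om : E4 -> R) q : C1 D om -> D q ->
  \sum_(i < 4) 'D_(e4 i) (fun q => om q * (cur i q - (i == inord 0)%:R * u q ^+ 2)) q =
  om q * (\sum_(i < 4) 'D_(e4 i) (cur i) q - 2 * u q * grad q (inord 0)) +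
  \sum_(i < 4) (cur i q - (i == inord 0)%:R * u q ^+ 2) * 'D_(e4 i) om q.
Proof.
move=> om1 Dq.
have -> : 2 * u q * grad q (inord 0) = \sum_(i < 4) (i == inord 0)%:R * (2 * u q * grad q i).
  rewrite (bigD1 (inord 0))//= eqxx mul1r big1 ?addr0// => i /negPf ->.
  by rewrite mul0r.
rewrite -sumrB mulr_sumr -big_split /=; apply: eq_bigr => i _.
have du : is_derive q (e4 i) u (grad q i) by apply: C1_is_deriveP => //; exact: Ck2_C1.
have dF := C1_is_deriveP (e4 i) (cur_C1 i) Dq.
have dom := C1_is_deriveP (e4 i) om1 Dq.
have [_ ->] := is_derive_mul dom (is_derive_sub dF (is_derive_scal (i == inord 0)%:R (is_derive_mul du du))).
rewrite -expr2; ring.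
Qed.

End Divergence.

Section WeightedPointwise.
Context {R : realType}.

Lemma divergence_bound (beta M C P X dc : R) (w : 'I_4 -> R) (dG : 'I_4 -> 'I_4 -> 'I_4 -> R) :
  0 < beta -> 0 <= M ->
  X ^+ 2 <= C * \sum_(i < 4) w i ^+ 2 -> (forall k i j, `|dG k i j| <= M) ->
  dc = P * X - (\sum_(i < 4) \sum_(j < 4) (dG (inord 0) i j - beta * dG (inord 1) i j) * w i * w j) / 2 ->
  `|dc| <= P ^+ 2 / 2 + (C / 2 + 2 * (1 + beta) * M) * \sum_(i < 4) w i ^+ 2.
Proof.
move=> b0 M0 XC dM ->; set S' := \sum_(i < 4) w i ^+ 2 in XC *.
have h : `|\sum_(i < 4) \sum_(j < 4) (dG (inord 0) i j - beta * dG (inord 1) i j) * w i * w j| <=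
    4 * ((1 + beta) * M) * S'.
  apply: (@le_trans _ _ (\sum_(i < 4) \sum_(j < 4) ((1 + beta) * M * ((w i ^+ 2 + w j ^+ 2) / 2)))).
    apply: (le_trans (ler_norm_sum _ _ _)); apply: ler_sum => i _.
    apply: (le_trans (ler_norm_sum _ _ _)); apply: ler_sum => j _.
    rewrite -mulrA normrM ler_pM//.
      apply: (le_trans (ler_normB _ _)); rewrite normrM (gtr0_norm b0) mulrDl mul1r.
      by apply: lerD => //; rewrite ler_wpM2l// ltW.
    by rewrite ler_norml; have := sqr_ge0 (w i + w j); have := sqr_ge0 (w i - w j); lra.
  have -> : \sum_(i < 4) \sum_(j < 4) ((1 + beta) * M * ((w i ^+ 2 + w j ^+ 2) / 2)) = 4 * ((1 + beta) * M) * S'.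
    by rewrite /S' !sum4; field.
  exact: lexx.
apply: (le_trans (ler_normB _ _)).
have : `|P * X| <= P ^+ 2 / 2 + X ^+ 2 / 2.
  by rewrite ler_norml; have := sqr_ge0 (P + X); have := sqr_ge0 (P - X); lra.
rewrite [`|_ / 2|]normrM (ger0_norm (_ : 0 <= 2^-1)) ?invr_ge0//; lra.
Qed.

(** [W] is the time weight with tau- and z-derivatives [W0] and [W1], [a] the slope of the cutoff,
    [rho] the weight on the square with derivatives [rho2] and [rho3] bounded by [r]. The terms with
    mu give the coercive quantity (c <= N serves u^2), those with [a] are nonnegative, and the rest
    has no factor mu. The rest is bounded with [r] and not with [rho], as the derivatives of [rho]
    need not vanish where [rho] does. *)
Lemma weighted_bound (mu N K c C C' a z W W0 W1 rho rho2 rho3 r dc P S u u0 F0 F1 F2 F3 : R) :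
  0 <= mu -> 0 < K -> c <= N -> 0 <= C -> 0 <= a -> 0 <= W -> 0 <= rho -> rho <= r ->
  `|rho2| <= r -> `|rho3| <= r -> u0 ^+ 2 <= S -> 0 <= C' ->
  W0 = - (mu * N * W) - K * z ^+ 2 * a -> W1 = mu * W + a ->
  0 <= F1 - K * z ^+ 2 * F0 -> c * S <= F1 - N * F0 -> `|F2| <= C * S -> `|F3| <= C * S ->
  `|dc| <= P ^+ 2 / 2 + C' * S ->
  mu * c * (W * rho * (u ^+ 2 + S)) <=
    W * rho * (dc - 2 * u * u0) + ((F0 - u ^+ 2) * (W0 * rho) + F1 * (W1 * rho)
      + F2 * (W * rho2) + F3 * (W * rho3)) + (2 * C + C' + 1) * r * (W * (u ^+ 2 + S + P ^+ 2)).
Proof.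
move=> mu0 K0 cN C0 a0 W_ge rho0 rr r2 r3 uS C'0 W0E W1E h1 h2 f2 f3 hd.
have r0 : 0 <= r := le_trans rho0 rr.
have S0 : 0 <= S := le_trans (sqr_ge0 u0) uS.
have WR : 0 <= W * rho by rewrite mulr_ge0.
have k1 : 0 <= (mu * (W * rho)) * (F1 - N * F0 - c * S) by rewrite mulr_ge0 ?subr_ge0// mulr_ge0.
have k2 : 0 <= (mu * (W * rho)) * ((N - c) * u ^+ 2).
  by apply: mulr_ge0; [exact: mulr_ge0|rewrite mulr_ge0 ?sqr_ge0 ?subr_ge0].
have k3 : 0 <= (a * rho) * (F1 - K * z ^+ 2 * F0) by rewrite mulr_ge0// mulr_ge0.
have k4 : 0 <= (a * rho) * (K * z ^+ 2 * u ^+ 2).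
  exact: mulr_ge0 (mulr_ge0 a0 rho0) (mulr_ge0 (mulr_ge0 (ltW K0) (sqr_ge0 z)) (sqr_ge0 u)).
have k5 : - (W * (C * S * r)) <= F2 * (W * rho2).
  have -> : F2 * (W * rho2) = W * (F2 * rho2) by ring.
  rewrite -mulrN ler_wpM2l//; have : `|F2 * rho2| <= C * S * r by rewrite normrM ler_pM.
  by rewrite ler_norml => /andP[].
have k6 : - (W * (C * S * r)) <= F3 * (W * rho3).
  have -> : F3 * (W * rho3) = W * (F3 * rho3) by ring.
  rewrite -mulrN ler_wpM2l//; have : `|F3 * rho3| <= C * S * r by rewrite normrM ler_pM.
  by rewrite ler_norml => /andP[].
have k7 : - (P ^+ 2 / 2 + C' * S + u ^+ 2 + S) <= dc - 2 * u * u0.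
  move: hd; rewrite ler_norml => /andP[+ _]; have := sqr_ge0 (u - u0); lra.
have k8 : W * rho * - (P ^+ 2 / 2 + C' * S + u ^+ 2 + S) <= W * rho * (dc - 2 * u * u0).
  by rewrite ler_wpM2l.
have Y0 : 0 <= P ^+ 2 / 2 + C' * S + u ^+ 2 + S.
  have := sqr_ge0 P; have := sqr_ge0 u; have := mulr_ge0 C'0 S0; lra.
have k9 : W * rho * (P ^+ 2 / 2 + C' * S + u ^+ 2 + S) <= W * r * (P ^+ 2 / 2 + C' * S + u ^+ 2 + S).
  by rewrite ler_wpM2r// ler_wpM2l.
have rW : 0 <= r * W by rewrite mulr_ge0.
have k10 : 0 <= r * W * P ^+ 2 by rewrite mulr_ge0 ?sqr_ge0.
have k11 : 0 <= r * W * u ^+ 2 by rewrite mulr_ge0 ?sqr_ge0.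
have k12 : 0 <= C * (r * W * P ^+ 2) by rewrite mulr_ge0.
have k13 : 0 <= C' * (r * W * P ^+ 2) by rewrite mulr_ge0.
have k14 : 0 <= C * (r * W * u ^+ 2) by rewrite mulr_ge0.
have k15 : 0 <= C' * (r * W * u ^+ 2) by rewrite mulr_ge0.
rewrite W0E W1E; lra.
Qed.

End WeightedPointwise.

(** * Weights *)

Section Flat.
Context {R : realType}.
Implicit Types (p : {poly R}) (s x : R).

(* The family p(1/s) exp(-1/s), extended by 0 to s <= 0, is stable under
   differentiation; this makes exp(-1/s) smooth. *)
Definition flat p s : R := if 0 < s then p.[s^-1] * expR (- s^-1) else 0.

(** Take the power n + 2 of x / (n + 2) <= exp (x / (n + 2)). *)
Lemma power_exp_bound n x : 0 < x -> x ^+ n * expR (- x) <= n.+2%:R ^+ n.+2 / x ^+ 2.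
Proof.
move=> x0; rewrite ler_pdivlMr ?exprn_gt0//.
have e0 : 0 < expR x := expR_gt0 x.
have h : (x / n.+2%:R) ^+ n.+2 <= expR x.
  have -> : expR x = expR (x / n.+2%:R) ^+ n.+2.
    by rewrite -expRM_natr divfK// pnatr_eq0.
  rewrite lerXn2r ?nnegrE ?expR_ge0//; first by rewrite divr_ge0// ltW.
  by apply: le_trans (expR_ge1Dx _); rewrite lerDr.
have -> : x ^+ n * expR (- x) * x ^+ 2 = x ^+ n.+2 / expR x.
  by rewrite expRN mulrAC -exprD addn2.
rewrite ler_pdivrMr//; move: h; rewrite expr_div_n ler_pdivrMr ?exprn_gt0 ?ltr0n//.
by rewrite mulrC.
Qed.

(** With x = 1 / s each monomial is O(s^2). The quadratic rate is what makes the extension by 0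
    differentiable at the origin, with derivative 0. *)
Lemma flat_bound p : exists2 C : R, 0 <= C & forall s, `|flat p s| <= C * s ^+ 2.
Proof.
exists (\sum_(i < size p) `|p`_i| * i.+2%:R ^+ i.+2).
  by apply: sumr_ge0 => i _; rewrite mulr_ge0// exprn_ge0.
move=> s; rewrite /flat; case: ifPn => [s0|_]; last first.
  by rewrite normr0 mulr_ge0 ?sqr_ge0// sumr_ge0// => i _; rewrite mulr_ge0// exprn_ge0.
rewrite horner_coef mulr_suml mulr_suml.
apply: (le_trans (ler_norm_sum _ _ _)); apply: ler_sum => i _.
rewrite -mulrA normrM -mulrA ler_wpM2l// ger0_norm; last first.
  by rewrite mulr_ge0 ?expR_ge0// exprn_ge0// invr_ge0 ltW.
have si : 0 < s^-1 by rewrite invr_gt0.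
by have := power_exp_bound i si; rewrite [X in _ / X]exprVn invrK.
Qed.

Lemma flat_derive p s : is_derive s 1 (flat p) (flat ((p - p^`()) * 'X^2) s).
Proof.
have [s0|s0|->] := ltgtP s 0.
- have -> : flat ((p - p^`()) * 'X^2) s = 0 by rewrite /flat ltNge ltW.
  apply: (is_derive_near _ (is_derive_cst (0 : R) s 1)).
  by near=> t; rewrite /flat ltNge ltW//; near: t; exact: lt_nbhsl.
- have sn : s != 0 by rewrite lt0r_neq0.
  have -> : flat ((p - p^`()) * 'X^2) s =
      p.[s^-1] * (expR (- s^-1) * (- (- s ^- 2 * 1))) + expR (- s^-1) * (p^`().[s^-1] * (- s ^- 2 * 1)).
    by rewrite /flat s0 hornerM hornerXn hornerD hornerN exprVn; ring.
  have dV : is_derive s 1 (fun t : R => t^-1) (- s ^- 2 * 1).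
    exact: (is_derive_inv sn (is_derive_id s 1)).
  have dN : is_derive s 1 (fun t : R => - t^-1) (- (- s ^- 2 * 1)) by exact: is_deriveN.
  have dE := is_derive_comp1 dN (is_derive_expR (- s^-1)).
  have dp : is_derive s^-1 1 (horner p) p^`().[s^-1].
    by apply: DeriveDef; [exact: derivable_horner|rewrite -derive1E -derivE].
  have dP := is_derive_comp1 dV dp.
  apply: (is_derive_near _ (is_derive_mul dP dE)).
  by near=> t; rewrite /flat ifT//; near: t; exact: lt_nbhsr.
- have [C C0 HC] := flat_bound p.
  rewrite {2}/flat ltxx; apply/is_deriveP.
  apply/cvgr0Pnorm_lt => e e0.
  have ce0 : 0 < e / (C + 1) by rewrite divr_gt0//; lra.
  have hd : \forall h \near (0 : R)^', `|h| < e / (C + 1).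
    apply: (@dnbhs0_lt R R); exact: ce0.
  have hn : \forall h \near (0 : R)^', h != 0 by exact: nbhs_dnbhs_neq.
  apply: filterS2 hd hn => h hC h0.
  have -> : h^-1 *: (flat p (h *: 1 + 0) - flat p 0) = h^-1 * flat p h.
    by rewrite /flat ltxx subr0 addr0 [h *: 1]mulr1.
  rewrite normrM normfV mulrC ltr_pdivrMr ?normr_gt0//.
  apply: (le_lt_trans (HC h)); rewrite -[h ^+ 2]real_normK ?num_real// expr2 mulrA.
  rewrite ltr_pM2r ?normr_gt0//; move: hC; rewrite ltr_pdivlMr//; last by lra.
  by have := normr_ge0 h; lra.
Unshelve. all: by end_near. Qed.

Lemma flat_continuous p s : {for s, continuous (flat p)}.
Proof.
have [df _] := flat_derive p s.
exact/differentiable_continuous/derivable1_diffP.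
Qed.

Definition ramp s : R := flat 1 s.
Definition ramp' s : R := flat 'X^2 s.

Lemma ramp_derive s : is_derive s 1 ramp (ramp' s).
Proof.
have E : (1 - 1^`()) * 'X^2 = 'X^2 :> {poly R} by rewrite -polyC1 derivC subr0 polyC1 mul1r.
by have := flat_derive 1 s; rewrite E.
Qed.

Lemma ramp'_ge0 s : 0 <= ramp' s.
Proof.
rewrite /ramp' /flat; case: ifPn => // s0.
by rewrite mulr_ge0 ?expR_ge0// hornerXn exprn_ge0// invr_ge0 ltW.
Qed.

Lemma rampE s : 0 < s -> ramp s = expR (- s^-1).
Proof. by move=> s0; rewrite /ramp /flat s0 hornerC mul1r. Qed.

Lemma ramp0 s : s <= 0 -> ramp s = 0.
Proof. by move=> s0; rewrite /ramp /flat ltNge s0. Qed.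

Lemma ramp_ge0 s : 0 <= ramp s.
Proof. by rewrite /ramp /flat; case: ifPn => // s0; rewrite mulr_ge0 ?expR_ge0// hornerC. Qed.

Lemma ramp_le1 s : ramp s <= 1.
Proof.
have [s0|s0] := ltP 0 s; last by rewrite ramp0.
by rewrite rampE// expR_le1 oppr_le0 invr_ge0 ltW.
Qed.

Lemma ramp_le s t : s <= t -> ramp s <= ramp t.
Proof.
move=> st; have [s0|s0] := ltP 0 s; last by rewrite ramp0// ramp_ge0.
have t0 := lt_le_trans s0 st.
by rewrite !rampE// ler_expR lerN2 lef_pV2.
Qed.

Lemma ramp_cvg1 (x : R) : 0 < x -> (fun n : nat => ramp (n%:R * x - 1)) @ \oo --> (1 : R).
Proof.
move=> x0; apply/cvgrPdist_le => e e0.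
have : \forall n \near \oo, (e^-1 + 1) / x <= n%:R by exact: nbhs_infty_ger.
apply: filterS => n; rewrite ler_pdivrMr// => nx.
have ei : 0 < e^-1 by rewrite invr_gt0.
have y0 : 0 < n%:R * x - 1 by lra.
rewrite rampE// ger0_norm ?subr_ge0 ?expR_le1 ?oppr_le0 ?invr_ge0 ?(ltW y0)//.
have h : (n%:R * x - 1)^-1 <= e by rewrite -[leRHS]invrK lef_pV2 ?posrE//; lra.
by rewrite lerBlDr; apply: le_trans (_ : e + (1 - e) <= _); [lra|rewrite lerD2l; apply: le_trans (expR_ge1Dx _); rewrite lerD2l lerN2].
Qed.

End Flat.

(** * A class of smooth functions stable under differentiation *)

Section SmoothClass.
Context {R : realType} {E : normedModType R}.

Definition affine_fun (f : E -> R) : Prop := continuous f /\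
  exists df : E -> R, forall x v, is_derive x v f (df v).

(** Since the generators differentiate into the class, every iterated derivative stays in it and is
    continuous; smoothness of the bump functions follows by induction on the list of directions. *)
Inductive elementary : (E -> R) -> Prop :=
| elementary_cst c : elementary (fun=> c)
| elementary_flat p f : affine_fun f -> elementary (fun x => flat p (f x))
| elementary_add f g : elementary f -> elementary g -> elementary (fun x => f x + g x)
| elementary_mul f g : elementary f -> elementary g -> elementary (fun x => f x * g x).

Lemma elementary_derive f v : elementary f ->
  exists2 g, elementary g & forall x, is_derive x v f (g x).
Proof.
elim=> [c|p l [cl [dl Hl]]|g1 g2 e1 [d1 E1 D1] e2 [d2 E2 D2]|g1 g2 e1 [d1 E1 D1] e2 [d2 E2 D2]].
- by exists (fun=> 0); [exact: elementary_cst|move=> x; exact: is_derive_cst].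
- exists (fun x => flat ((p - p^`()) * 'X^2) (l x) * dl v).
    apply: elementary_mul; last exact: elementary_cst.
    by apply: elementary_flat; split => //; exists dl.
  by move=> x; exact: is_derive_comp1 (Hl x v) (flat_derive p (l x)).
- by exists (fun x => d1 x + d2 x); [exact: elementary_add|move=> x; exact: is_derive_add].
- exists (fun x => g1 x * d2 x + g2 x * d1 x); last by move=> x; exact: is_derive_mul.
  by apply: elementary_add; exact: elementary_mul.
Qed.

Lemma elementary_continuous f : elementary f -> continuous f.
Proof.
elim=> [c|p l [cl _]|g1 g2 _ c1 _ c2|g1 g2 _ c1 _ c2] x.
- exact: cvg_cst.
- by apply: continuous_comp; [exact: cl|exact: flat_continuous].
- by apply: cvgD; [exact: c1|exact: c2].
- by apply: cvgM; [exact: c1|exact: c2].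
Qed.

Lemma elementary_smooth D f : elementary f -> smooth_on D f.
Proof.
move=> ef k s x _ _.
have es : elementary (Defs.iterD s f).
  elim: s => [//|v s IH] /=; have [g eg Hg] := elementary_derive v IH.
  rewrite (_ : 'D_v (Defs.iterD s f) = g)//; apply/funext => y.
  by rewrite (@derive_val _ _ _ _ _ _ _ (Hg y)).
split; first exact: elementary_continuous.
by move=> _ v; have [g _ Hg] := elementary_derive v es; have [] := Hg x.
Qed.

End SmoothClass.

Section BoundedIntegrals.
Context {R : realType} d (X : measurableType d) (mu : {measure set X -> \bar R}).
Variable A : set X.
Hypotheses (mA : measurable A) (fA : (mu A < +oo)%E).
Implicit Types f g : X -> R.

Lemma bm_RintegralD f g : bm A f -> bm A g ->
  \int[mu]_(x in A) (f x + g x) = \int[mu]_(x in A) f x + \int[mu]_(x in A) g x.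
Proof. by move=> bf bg; rewrite RintegralD//; exact: bm_integrable. Qed.

Lemma bm_RintegralB f g : bm A f -> bm A g ->
  \int[mu]_(x in A) (f x - g x) = \int[mu]_(x in A) f x - \int[mu]_(x in A) g x.
Proof. by move=> bf bg; rewrite RintegralB//; exact: bm_integrable. Qed.

Lemma bm_RintegralZ c f : bm A f ->
  \int[mu]_(x in A) (c * f x) = c * \int[mu]_(x in A) f x.
Proof. by move=> bf; rewrite RintegralZl//; exact: bm_integrable. Qed.

Lemma bm_le_Rintegral f g : bm A f -> bm A g -> (forall x, A x -> f x <= g x) ->
  \int[mu]_(x in A) f x <= \int[mu]_(x in A) g x.
Proof. by move=> bf bg fg; apply: le_Rintegral => //; exact: bm_integrable. Qed.

Lemma bm_RintegralE f : bm A f ->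
  (\int[mu]_(x in A) f x)%:E = (\int[mu]_(x in A) (f x)%:E)%E.
Proof.
move=> bf; rewrite /Rintegral fineK//.
exact: (integrable_fin_num mA (bm_integrable mA fA bf)).
Qed.

Lemma bm_Rintegral_sum n (F : 'I_n -> X -> R) : (forall i, bm A (F i)) ->
  \int[mu]_(x in A) (\sum_(i < n) F i x) = \sum_(i < n) \int[mu]_(x in A) F i x.
Proof.
elim: n F => [|n IH] F bF.
  rewrite big_ord0 (_ : (fun x => _) = fun=> 0) ?Rintegral_eq0//.
  by apply/funext => x; rewrite big_ord0.
rewrite big_ord_recl -IH// -bm_RintegralD//; last by apply: bm_sum.
by apply: eq_Rintegral => x _; rewrite big_ord_recl.
Qed.

End BoundedIntegrals.

Section Weights.
Context {R : realType}.
Local Notation E2 := (R * R)%type.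
Local Notation E4 := ((R * R) * (R * R))%type.

(* The ramp vanishes for z <= eps, so that no boundary term arises at z = 0,
   and the sign of its derivatives is that of F^1 - K z^2 F^0. *)
Definition time_weight (mu N K eps : R) (b : E2) : R :=
  expR (mu * (b.2 - N * b.1)) * ramp (1 - eps * b.2^-1 - K * eps * b.1).

Definition box_weight (c : E2) (r : R) (x : E2) : R :=
  (r ^+ 2 - (x.1 - c.1) ^+ 2) * (r ^+ 2 - (x.2 - c.2) ^+ 2).

Lemma C1_fst (D : set E2) : open D -> C1 D (fun b : E2 => b.1) /\
  forall x v : E2, is_derive x v (fun b : E2 => b.1) v.1.
Proof. by move=> oD; apply: C1_linear => // x; exact: pt_fst. Qed.

Lemma C1_snd (D : set E2) : open D -> C1 D (fun b : E2 => b.2) /\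
  forall x v : E2, is_derive x v (fun b : E2 => b.2) v.2.
Proof. by move=> oD; apply: C1_linear => // x; exact: pt_snd. Qed.

Let Z : set E2 := [set b | 0 < b.2].

Lemma open_upper : open Z.
Proof. by rewrite openE => b b0; have := lt_nbhsr b0; exact: pt_snd. Qed.

Section TimeWeight.
Variables mu N K eps : R.
Local Notation W := (time_weight mu N K eps).

(** The common factor in the derivatives of the cutoff: d_z gives this function and d_tau gives - K
    z^2 times it. Paired with the current it produces the combination F^1 - K z^2 F^0. *)
Definition time_slope (b : E2) : R := expR (mu * (b.2 - N * b.1)) *
  ramp' (1 - eps * b.2^-1 - K * eps * b.1) * eps * b.2 ^- 2.

Lemma time_weight_C1 : C1 Z W.
Proof.
have oZ := open_upper; have [f1 _] := C1_fst oZ; have [s1 _] := C1_snd oZ.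
have scal c f : C1 Z f -> C1 Z (fun b => c * f b).
  by move=> f'1; exact: (C1_mul oZ (C1_cst oZ c) f'1).
apply: (C1_mul oZ).
  apply: (@C1_comp _ _ _ oZ expR expR (fun b => mu * (b.2 - N * b.1))).
    apply: (scal _ (fun b : E2 => b.2 - N * b.1)); exact: (C1_sub oZ s1 (scal N _ f1)).
  by move=> b _; split; [exact: is_derive_expR|exact: continuous_expR].
apply: (@C1_comp _ _ _ oZ ramp ramp' (fun b => 1 - eps * b.2^-1 - K * eps * b.1)).
  apply: (C1_sub oZ _ (scal _ _ f1)); apply: (C1_sub oZ (C1_cst oZ 1)).
  apply: (scal _ (fun b : E2 => b.2^-1)); apply: (@C1_comp _ _ _ oZ GRing.inv (fun t => - t ^- 2) (fun b : E2 => b.2)) => // b b0.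
  have bn : b.2 != 0 by rewrite lt0r_neq0.
  split; first by have := is_derive_inv bn (is_derive_id b.2 1); rewrite mulr1.
  apply: cvgN; apply: cvgV; first by rewrite sqrf_eq0.
  exact: exprn_continuous.
by move=> b _; split; [exact: ramp_derive|exact: flat_continuous].
Qed.

Lemma time_weight_derive b v : 0 < b.2 -> 'D_v W b =
  mu * (v.2 - N * v.1) * W b + time_slope b * (v.2 - K * b.2 ^+ 2 * v.1).
Proof.
move=> b0; have bn : b.2 != 0 by rewrite lt0r_neq0.
have oZ := open_upper; have [_ /(_ b v) f1] := C1_fst oZ; have [_ /(_ b v) s1] := C1_snd oZ.
have dE := is_derive_comp1 (is_derive_scal mu (is_derive_sub s1 (is_derive_scal N f1)))
  (is_derive_expR (mu * (b.2 - N * b.1))).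
have dV : is_derive b v (fun b : E2 => b.2^-1) (- b.2 ^- 2 * 1 * v.2).
  exact: is_derive_comp1 s1 (is_derive_inv bn (is_derive_id b.2 1)).
have dR := is_derive_comp1 (is_derive_sub (is_derive_sub (is_derive_cst (1 : R) b v) (is_derive_scal eps dV)) (is_derive_scal (K * eps) f1))
  (ramp_derive (1 - eps * b.2^-1 - K * eps * b.1)).
have [_ ->] := is_derive_mul dE dR.
by rewrite /time_weight /time_slope; field.
Qed.

Lemma time_weight_ge0 b : 0 <= W b.
Proof. by rewrite mulr_ge0 ?expR_ge0 ?ramp_ge0. Qed.

Lemma time_slope_ge0 b : 0 <= eps -> 0 <= time_slope b.
Proof.
by move=> e0; rewrite !mulr_ge0 ?expR_ge0 ?ramp'_ge0// invr_ge0 exprn_even_ge0.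
Qed.

Lemma time_weight0 t : 0 < eps -> 0 <= K -> 0 <= t -> W (t, eps) = 0.
Proof.
move=> e0 K0 t0; rewrite /time_weight /= ramp0 ?mulr0// divff ?lt0r_neq0// subrr add0r oppr_le0.
by rewrite mulr_ge0// mulr_ge0// ltW.
Qed.

Lemma time_weight_le b z0 : 0 <= mu -> 0 <= N -> 0 <= b.1 -> b.2 <= z0 -> W b <= expR (mu * z0).
Proof.
move=> mu0 N0 b1 b2; rewrite -[leRHS]mulr1 ler_pM ?expR_ge0 ?ramp_ge0 ?ramp_le1// ler_expR.
by rewrite ler_wpM2l//; have := mulr_ge0 N0 b1; lra.
Qed.

(** Where the cutoff argument is at least 1/2 the ramp is at least exp(-2). The resulting bound does
    not involve [eps], so the weight can be removed from the estimate afterwards. *)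
Lemma time_weight_ge b T : 0 <= mu -> 0 <= N -> 0 <= b.2 -> b.1 <= T ->
  eps * b.2^-1 + K * eps * b.1 <= 1 / 2 -> expR (- (mu * N * T) - 2) <= W b.
Proof.
move=> mu0 N0 b2 b1 eb; rewrite expRD ler_pM ?expR_ge0//.
  rewrite ler_expR -mulrA -mulrN ler_wpM2l//; have : N * b.1 <= N * T by rewrite ler_wpM2l.
  lra.
apply: (@le_trans _ _ (ramp (1 / 2))); last by apply: ramp_le; lra.
rewrite rampE; last by lra.
by rewrite ler_expR div1r invrK.
Qed.

End TimeWeight.

Section BoxWeight.
Variables (c : E2) (r : R).
Hypothesis r0 : 0 < r.
Local Notation rho := (box_weight c r).

Lemma box_weight_C1 : C1 setT rho.
Proof.
have oT := @openT E2; have [f1 _] := C1_fst oT; have [s1 _] := C1_snd oT.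
have cst a : C1 setT (fun=> a : R) := C1_cst oT a.
have d1 := C1_sub oT f1 (cst c.1); have d2 := C1_sub oT s1 (cst c.2).
exact: (C1_mul oT (C1_sub oT (cst (r ^+ 2)) (C1_mul oT d1 d1)) (C1_sub oT (cst (r ^+ 2)) (C1_mul oT d2 d2))).
Qed.

Lemma box_weight_derive x v : 'D_v rho x =
  - (2 * (x.1 - c.1) * v.1) * (r ^+ 2 - (x.2 - c.2) ^+ 2)
  - 2 * (x.2 - c.2) * v.2 * (r ^+ 2 - (x.1 - c.1) ^+ 2).
Proof.
have oT := @openT E2; have [_ /(_ x v) f1] := C1_fst oT; have [_ /(_ x v) s1] := C1_snd oT.
have d1 := is_derive_sub f1 (is_derive_cst c.1 x v).
have d2 := is_derive_sub s1 (is_derive_cst c.2 x v).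
have q1 := is_derive_sub (is_derive_cst (r ^+ 2) x v) (is_derive_mul d1 d1).
have q2 := is_derive_sub (is_derive_cst (r ^+ 2) x v) (is_derive_mul d2 d2).
have [_ ->] := is_derive_mul q1 q2.
by rewrite /=; ring.
Qed.

Lemma coord_sq (a : R) : `|a| <= r -> 0 <= r ^+ 2 - a ^+ 2 <= r ^+ 2.
Proof.
move=> ar; have : `|a| ^+ 2 <= r ^+ 2 by rewrite ler_pXn2r ?nnegrE// ltW.
by rewrite real_normK ?num_real// => h; have := sqr_ge0 a; lra.
Qed.

Lemma sqc_coord x : sqc c r x -> `|x.1 - c.1| <= r /\ `|x.2 - c.2| <= r.
Proof. by case=> /=; rewrite !in_itv /= => h1 h2; split; rewrite ler_norml; lra. Qed.

(** The weight alone is at most r^4; the larger constant is used because it also bounds the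
    gradient, whose entries are at most 2 r^3. *)
Lemma box_weight_bound x : sqc c r x -> 0 <= rho x <= r ^+ 4 + 2 * r ^+ 3.
Proof.
move=> /sqc_coord[/coord_sq/andP[a0 a1] /coord_sq/andP[b0 b1]].
rewrite mulr_ge0//=; apply: (@le_trans _ _ (r ^+ 2 * r ^+ 2)); first exact: ler_pM.
by rewrite -exprD lerDl mulr_ge0// exprn_ge0// ltW.
Qed.

Lemma box_weight_derive_le x v : sqc c r x -> v = (1, 0) \/ v = (0, 1) ->
  `|'D_v rho x| <= r ^+ 4 + 2 * r ^+ 3.
Proof.
move=> /sqc_coord[h1 h2].
have /andP[a0 a1] := coord_sq h1; have /andP[b0 b1] := coord_sq h2.
have P s t : `|s| <= r -> 0 <= t -> t <= r ^+ 2 -> `|2 * s * t| <= 2 * r ^+ 3.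
  move=> sr t0 tr; rewrite !normrM (ger0_norm t0) (ger0_norm (_ : 0 <= 2 :> R))// -mulrA.
  by rewrite ler_wpM2l// exprS ler_pM.
have r4 : 0 <= r ^+ 4 by rewrite exprn_ge0// ltW.
case=> ->; rewrite box_weight_derive /= !(mulr0, mulr1, oppr0, mul0r, subr0, add0r, sub0r) ?mulNr normrN.
  by apply: le_trans (P _ _ h1 b0 b1) _; rewrite lerDr.
by apply: le_trans (P _ _ h2 a0 a1) _; rewrite lerDr.
Qed.

Lemma box_weight_boundary x : x.1 = c.1 - r \/ x.1 = c.1 + r \/ x.2 = c.2 - r \/ x.2 = c.2 + r ->
  rho x = 0.
Proof. by rewrite /box_weight; case=> [->|[->|[->|->]]]; ring. Qed.

Lemma box_weight_ge x : sq c (r / 2) x -> (3 / 4 * r ^+ 2) ^+ 2 <= rho x.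
Proof.
have P a : `|a| < r / 2 -> 3 / 4 * r ^+ 2 <= r ^+ 2 - a ^+ 2.
  move=> ar; have : `|a| ^+ 2 <= (r / 2) ^+ 2 by rewrite ler_pXn2r ?nnegrE// ?(ltW ar)// divr_ge0// ltW.
  by rewrite real_normK ?num_real// expr_div_n; lra.
have r2 : 0 <= 3 / 4 * r ^+ 2 by rewrite mulr_ge0 ?sqr_ge0//; lra.
by case=> /P h1 /P h2; rewrite expr2 ler_pM.
Qed.

End BoxWeight.
End Weights.

(** * The energy inequality in a coordinate box *)

Section Lifts.
Context {R : realType} {E F : normedModType R}.

Lemma is_derive_fst (f : E -> R) (q v : E * F) a :
  is_derive q.1 v.1 f a -> is_derive q v (fun q => f q.1) a.
Proof. by move=> /is_deriveP H; apply/is_deriveP. Qed.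

Lemma is_derive_snd (f : F -> R) (q v : E * F) a :
  is_derive q.2 v.2 f a -> is_derive q v (fun q => f q.2) a.
Proof. by move=> /is_deriveP H; apply/is_deriveP. Qed.

Lemma C1_lift1 (D : set (E * F)) (A : set E) f : open D -> (forall q, D q -> A q.1) ->
  C1 A f -> C1 D (fun q => f q.1).
Proof.
move=> oD DA f1; apply: (@C1_intro _ _ _ oD _ (fun v q => 'D_(v.1) f q.1)) => [q|q v] /DA /f1[cf].
  by move=> _; apply: continuous_comp; [exact: pt_fst|exact: cf].
move=> /(_ v.1)[/derivableP df cdf]; split; first exact: is_derive_fst.
by apply: (@continuous_comp _ _ _ (@fst E F) ('D_(v.1) f)); [exact: pt_fst|exact: cdf].
Qed.

Lemma C1_lift2 (D : set (E * F)) (A : set F) f : open D -> (forall q, D q -> A q.2) ->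
  C1 A f -> C1 D (fun q => f q.2).
Proof.
move=> oD DA f1; apply: (@C1_intro _ _ _ oD _ (fun v q => 'D_(v.2) f q.2)) => [q|q v] /DA /f1[cf].
  by move=> _; apply: continuous_comp; [exact: pt_snd|exact: cf].
move=> /(_ v.2)[/derivableP df cdf]; split; first exact: is_derive_snd.
by apply: (@continuous_comp _ _ _ (@snd E F) ('D_(v.2) f)); [exact: pt_snd|exact: cdf].
Qed.

End Lifts.

Section Basis.
Context {R : realType}.

Lemma e4_0 : e4 (inord 0) = ((1, 0), (0, 0)) :> (R * R) * (R * R).
Proof. by rewrite /e4 inordK. Qed.
Lemma e4_1 : e4 (inord 1) = ((0, 1), (0, 0)) :> (R * R) * (R * R).
Proof. by rewrite /e4 inordK. Qed.
Lemma e4_2 : e4 (inord 2) = ((0, 0), (1, 0)) :> (R * R) * (R * R).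
Proof. by rewrite /e4 inordK. Qed.
Lemma e4_3 : e4 (inord 3) = ((0, 0), (0, 1)) :> (R * R) * (R * R).
Proof. by rewrite /e4 inordK. Qed.

End Basis.

(** At the later time both - F^0 and u^2 have the favourable sign, so this face is dropped; only the
    earlier one remains. *)
Lemma face0_bound (R : realType) (o2 o1 F2 F1 u2 u1 Y : R) : 0 <= o2 -> 0 <= o1 ->
  0 <= - F2 -> - F1 <= Y -> o2 * (F2 - (inord 0 == inord 0 :> 'I_4)%:R * u2 ^+ 2)
    - o1 * (F1 - (inord 0 == inord 0 :> 'I_4)%:R * u1 ^+ 2) <= o1 * (Y + u1 ^+ 2).
Proof.
rewrite eqxx !mul1r => h2 h1 f2 f1.
have : 0 <= o2 * (- F2 + u2 ^+ 2) by rewrite mulr_ge0// addr_ge0// sqr_ge0.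
have : 0 <= o1 * (Y + F1) by rewrite mulr_ge0//; lra.
lra.
Qed.

Lemma face1_bound (R : realType) (o1 F1 c z w u Y C : R) : 0 <= o1 ->
  F1 + c * z ^+ 2 * w ^+ 2 <= C * Y -> o1 * (F1 - (inord 1 == inord 0 :> 'I_4)%:R * u ^+ 2)
    + c * z ^+ 2 * (o1 * w ^+ 2) <= C * (o1 * Y).
Proof.
have -> : (inord 1 == inord 0 :> 'I_4) = false by rewrite -val_eqE /= !inordK.
rewrite mul0r subr0 => o0 h; have : 0 <= o1 * (C * Y - F1 - c * z ^+ 2 * w ^+ 2).
  by rewrite mulr_ge0//; lra.
lra.
Qed.

Lemma combine_faces (R : realType) (A I E P Q X Y Z : R) : A <= I + E -> I = P + Q -> P <= X ->
  Q + Z <= Y -> A + Z <= X + Y + E.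
Proof. by move=> + IE; rewrite IE => ? ? ?; lra. Qed.

Section BoxEnergy.
Context {R : realType}.
Local Notation mR := (measurableTypeR R).
Local Notation E2 := (R * R)%type.
Local Notation E3 := (R * (R * R))%type.
Local Notation E4 := ((R * R) * (R * R))%type.

Variables (M L z0 beta K N c C : R).
Hypotheses (M0 : 0 <= M) (b0 : 0 < beta) (K0 : 0 < K) (N0 : 0 < N) (c0 : 0 < c) (cN : c <= N) (C0 : 0 < C).
Hypothesis current_bound : forall (G : 'M[R]_4) (w : 'I_4 -> R) z V, null_inverse L G -> (forall i j, `|G i j| <= M) ->
  G (inord 1) (inord 1) = z ^+ 2 * V -> 0 <= z <= z0 -> 1 / 2 <= V <= 3 / 2 ->
  let F := current beta G w in let S := \sum_(i < 4) w i ^+ 2 in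
  [/\ 0 <= F (inord 1) - K * z ^+ 2 * F (inord 0),
      c * S <= F (inord 1) - N * F (inord 0),
      0 <= - F (inord 0) /\
        - F (inord 0) <= C * (w (inord 1) ^+ 2 + w (inord 2) ^+ 2 + w (inord 3) ^+ 2),
      F (inord 1) + c * z ^+ 2 * w (inord 1) ^+ 2 <=
        C * (w (inord 0) ^+ 2 + w (inord 2) ^+ 2 + w (inord 3) ^+ 2) &
      (forall i, `|F i| <= C * S) /\ mult_dir beta w ^+ 2 <= C * S].

Variables (D : set E4) (G : E4 -> 'M[R]_4) (V u : E4 -> R).
Hypotheses (oD : open D) (G1 : forall i j, C1 D (fun q => G q i j)) (u2 : Ck_on 2 D u).
Hypothesis Dz : forall q, D q -> 0 < q.1.2 <= z0.
Hypothesis GN : forall q, D q -> null_inverse L (G q).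
Hypothesis GM : forall q i j, D q -> `|G q i j| <= M.
Hypothesis dGM : forall q i j l, D q -> `|'D_(e4 l) (fun q => G q i j) q| <= M.
Hypothesis GV : forall q, D q -> G q (inord 1) (inord 1) = q.1.2 ^+ 2 * V q.
Hypothesis VB : forall q, D q -> 1 / 2 <= V q <= 3 / 2.

Variables (mu eps t1 t2 z1 r : R) (x0 : E2).
Hypotheses (mu0 : 0 <= mu) (eps0 : 0 < eps) (t10 : 0 <= t1) (t12 : t1 < t2) (ez : eps < z1) (r0 : 0 < r).
Local Notation S := (sqc x0 r).
Local Notation B := (box2 t1 t2 eps z1 `*` S).
Hypothesis BD : B `<=` D.

Local Notation W := (time_weight mu N K eps).
Local Notation rho := (box_weight x0 r).
Local Notation rr := (r ^+ 4 + 2 * r ^+ 3).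
Local Notation w i := (fun q => 'D_(e4 (inord i)) u q).
Let om (q : E4) : R := W q.1 * rho q.2.
Let C' := C / 2 + 2 * (1 + beta) * M.
Let Phi (i : 'I_4) (q : E4) : R := om q * (cur G u beta i q - (i == inord 0)%:R * u q ^+ 2).

Let om_C1 : C1 D om.
Proof.
have W1 : C1 [set b : E2 | 0 < b.2] W := @time_weight_C1 R mu N K eps.
have r1 := @box_weight_C1 R x0 r.
apply: (C1_mul oD); last exact: (C1_lift2 oD _ r1).
by apply: (C1_lift1 oD _ W1) => q /Dz /andP[].
Qed.

Let Phi_C1 i : C1 D (Phi i).
Proof.
have uu : C1 D (fun q => u q * u q) := C1_mul oD (Ck2_C1 u2) (Ck2_C1 u2).
apply: (C1_mul oD om_C1); apply: (C1_sub oD (cur_C1 beta oD G1 u2 i)).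
exact: (C1_mul oD (C1_cst oD _) uu).
Qed.

Let om_derive q : D q ->
  [/\ 'D_(e4 (inord 0)) om q = (- (mu * N * W q.1) - K * q.1.2 ^+ 2 * time_slope mu N K eps q.1) * rho q.2,
      'D_(e4 (inord 1)) om q = (mu * W q.1 + time_slope mu N K eps q.1) * rho q.2,
      'D_(e4 (inord 2)) om q = W q.1 * 'D_(1, 0) rho q.2 &
      'D_(e4 (inord 3)) om q = W q.1 * 'D_(0, 1) rho q.2].
Proof.
move=> Dq; have /andP[z0q _] := Dz Dq.
have dW v : is_derive q v (fun q => W q.1) ('D_(v.1) W q.1).
  have [_ /(_ v.1)[/derivableP h _]] := @time_weight_C1 R mu N K eps q.1 z0q; exact: is_derive_fst.
have dr v : is_derive q v (fun q => rho q.2) ('D_(v.2) rho q.2).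
  have [_ /(_ v.2)[/derivableP h _]] := @box_weight_C1 R x0 r q.2 Logic.I; exact: is_derive_snd.
have dom v : 'D_v om q = W q.1 * 'D_(v.2) rho q.2 + rho q.2 * 'D_(v.1) W q.1.
  by have [_ ->] := is_derive_mul (dW v) (dr v).
split; rewrite dom ?time_weight_derive// ?box_weight_derive /e4 inordK//=; ring.
Qed.

Let pointwise q : B q -> mu * c * (om q * energy u q) <=
  \sum_(i < 4) 'D_(e4 i) (Phi i) q +
  (2 * C + C' + 1) * rr * (W q.1 * (energy u q + principal G u q ^+ 2)).
Proof.
move=> Bq; have Dq := BD Bq; have Sq : S q.2 by case: Bq.
have Gs q' : D q' -> (G q')^T = G q' by case/GN.
rewrite (weighted_divergence beta oD G1 u2 om_C1 Dq).
set dc := \sum_(i < 4) 'D_(e4 i) (cur G u beta i) q.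
have zq : 0 <= q.1.2 <= z0 by have /andP[/ltW -> ->] := Dz Dq.
have [h1 h2 _ _ [h3 h4]] := current_bound (grad u q) (GN Dq) (fun i j => GM i j Dq) (GV Dq) zq (VB Dq).
have dcE := divergence_cur beta oD G1 u2 Gs Dq.
have hd := @divergence_bound _ _ _ _ _ _ _ _ (fun k i j => 'D_(e4 k) (fun q => G q i j) q) b0 M0 h4 (fun k i j => dGM i j k Dq) dcE.
have [d0 d1 d2 d3] := om_derive Dq.
rewrite sum4 d0 d1 d2 d3 !eqxx.
have -> : (inord 1 == inord 0 :> 'I_4) = false by rewrite -val_eqE /= !inordK.
have -> : (inord 2 == inord 0 :> 'I_4) = false by rewrite -val_eqE /= !inordK.
have -> : (inord 3 == inord 0 :> 'I_4) = false by rewrite -val_eqE /= !inordK.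
rewrite mul1r !mul0r !subr0.
have /andP[rho0 rhor] := box_weight_bound r0 Sq.
have rho2 : `|'D_(1, 0) rho q.2| <= rr by apply: box_weight_derive_le => //; left.
have rho3 : `|'D_(0, 1) rho q.2| <= rr by apply: box_weight_derive_le => //; right.
have W0 := time_weight_ge0 mu N K eps q.1.
have a0 := time_slope_ge0 mu N K q.1 (ltW eps0).
have uS : grad u q (inord 0) ^+ 2 <= \sum_(i < 4) grad u q i ^+ 2.
  by rewrite (bigD1 (inord 0))//= lerDl sumr_ge0// => i _; exact: sqr_ge0.
have C'0 : 0 <= C' by rewrite /C' addr_ge0// ?mulr_ge0 ?invr_ge0 ?addr_ge0// ltW.
exact: (weighted_bound (u q) mu0 K0 cN (ltW C0) a0 W0 rho0 rhor rho2 rho3 uS C'0 erefl erefl h1 h2 (h3 _) (h3 _) hd).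
Qed.

Let mB : measurable (B : set ((mR * mR) * (mR * mR))) := box4_measurable _ _ _ _ _ _ _ _.
Let fB : (leb4 (B : set ((mR * mR) * (mR * mR))) < +oo)%E :=
  leb4_finite (box2_measurable _ _ _ _) (box2_measurable _ _ _ _) (box2_finite _ _ _ _) (box2_finite _ _ _ _).
Let face_measurable a b : measurable (box3 a b S : set (mR * (mR * mR))) := box3_measurable _ _ _ _ _ _.
Let face_finite a b : (leb3 (box3 a b S : set (mR * (mR * mR))) < +oo)%E :=
  leb3_finite (itv_measurable _ _) (box2_measurable _ _ _ _) (itv_finite _ _) (box2_finite _ _ _ _).
Let ab2 : x0.1 - r < x0.1 + r. Proof. by rewrite ltrBlDr -addrA ltrDl addr_gt0. Qed.
Let ab3 : x0.2 - r < x0.2 + r. Proof. by rewrite ltrBlDr -addrA ltrDl addr_gt0. Qed.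

Let bmB f : C1 D f -> bm (B : set ((mR * mR) * (mR * mR))) f.
Proof. by move=> f1; apply: (box4_bm oD BD) => x /f1[]. Qed.

Let bmB' f v : C1 D f -> bm (B : set ((mR * mR) * (mR * mR))) ('D_v f).
Proof. by move=> f1; apply: (box4_bm oD BD) => x /f1[_ /(_ v)[]]. Qed.

(** The polynomial weight removes the faces of the sphere square and the ramp removes z = eps, so
    only the two time faces and the face z = z1 survive. *)
Let divergence_theorem : \int[leb4]_(q in B) (\sum_(i < 4) 'D_(e4 i) (Phi i) q) =
  \int[leb3]_(y in box3 eps z1 S) (Phi (inord 0) ((t2, y.1), y.2) - Phi (inord 0) ((t1, y.1), y.2)) +
  \int[leb3]_(y in box3 t1 t2 S) (Phi (inord 1) ((y.1, z1), y.2)).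
Proof.
rewrite (bm_Rintegral_sum mB fB) => [|i]; last exact: bmB'.
have boundary i w' : w' = (1, 0) \/ w' = (0, 1) -> \int[leb4]_(q in B) 'D_((0, 0), w') (Phi i) q = 0.
  move=> hw; have Z := ibp4_zero ab2 ab3 oD (Phi_C1 i) BD hw; apply: Z => b x Bb Sx hx.
  by rewrite /Phi /om box_weight_boundary ?mulr0 ?mul0r.
have I0 : \int[leb4]_(q in B) 'D_(e4 (inord 0)) (Phi (inord 0)) q =
    \int[leb3]_(y in box3 eps z1 S) (Phi (inord 0) ((t2, y.1), y.2) - Phi (inord 0) ((t1, y.1), y.2)).
  by rewrite e4_0; exact: (ibp4_0 t12 oD (Phi_C1 (inord 0)) BD).
have I1 : \int[leb4]_(q in B) 'D_(e4 (inord 1)) (Phi (inord 1)) q =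
    \int[leb3]_(y in box3 t1 t2 S) (Phi (inord 1) ((y.1, z1), y.2) - Phi (inord 1) ((y.1, eps), y.2)).
  by rewrite e4_1; exact: (ibp4_1 ez oD (Phi_C1 (inord 1)) BD).
have I2 : \int[leb4]_(q in B) 'D_(e4 (inord 2)) (Phi (inord 2)) q = 0.
  by rewrite e4_2; apply: boundary; left.
have I3 : \int[leb4]_(q in B) 'D_(e4 (inord 3)) (Phi (inord 3)) q = 0.
  by rewrite e4_3; apply: boundary; right.
rewrite [LHS]sum4 I0 I1 I2 I3 !addr0.
congr (_ + _); apply: eq_Rintegral => y /set_mem[/= yt _].
rewrite in_itv /= in yt; case/andP: yt => yt _.
have o0 : om ((y.1, eps), y.2) = 0.
  by rewrite -[LHS]/(W (y.1, eps) * rho y.2) (time_weight0 _ _ eps0 (ltW K0) (le_trans t10 yt)) mul0r.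
have P0 : Phi (inord 1) ((y.1, eps), y.2) = 0.
  by rewrite -[LHS]/(om _ * _) o0 mul0r.
by rewrite P0 subr0.
Qed.

Let energy_C1 : C1 D (energy u).
Proof.
have sq f : C1 D f -> C1 D (fun q => f q ^+ 2) by move=> f1; exact: (C1_mul oD f1 f1).
apply: (C1_add oD (sq _ (Ck2_C1 u2))); apply: (C1_sum oD) => i.
by apply: (sq (fun q => grad u q i)); exact: Ck2_D_C1.
Qed.

Let principal_bm : bm (B : set ((mR * mR) * (mR * mR))) (principal G u).
Proof.
apply: bm_sum => i; apply: (@bmB' (fun q' => raise (G q') (grad u q') i)).
exact: (raise_C1 oD G1 u2).
Qed.

Let W_C1 : C1 D (fun q => W q.1).
Proof.
have W1 : C1 [set b : E2 | 0 < b.2] W := @time_weight_C1 R mu N K eps.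
by apply: (C1_lift1 oD _ W1) => q /Dz /andP[].
Qed.

Let C1_cont f : C1 D f -> forall q, D q -> {for q, continuous f}.
Proof. by move=> f1 q /f1[]. Qed.

Let wsq i : C1 D (fun q => w i q ^+ 2).
Proof. by have d := @Ck2_D_C1 R _ D u (e4 (inord i)) u2; exact: (C1_mul oD d d). Qed.

Let tangential i j k : C1 D (fun q => w i q ^+ 2 + w j q ^+ 2 + w k q ^+ 2).
Proof. exact: (C1_add oD (C1_add oD (wsq i) (wsq j)) (wsq k)). Qed.

Let initial_C1 : C1 D (fun q => om q * (C * (w 1 q ^+ 2 + w 2 q ^+ 2 + w 3 q ^+ 2) + u q ^+ 2)).
Proof.
apply: (C1_mul oD om_C1); apply: (C1_add oD); last exact: (C1_mul oD (Ck2_C1 u2) (Ck2_C1 u2)).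
exact: (C1_mul oD (C1_cst oD C) (tangential 1 2 3)).
Qed.

Let trace_C1 : C1 D (fun q => om q * w 1 q ^+ 2).
Proof. exact: (C1_mul oD om_C1 (wsq 1)). Qed.

Let lateral_C1 : C1 D (fun q => om q * (w 0 q ^+ 2 + w 2 q ^+ 2 + w 3 q ^+ 2)).
Proof. exact: (C1_mul oD om_C1 (tangential 0 2 3)). Qed.

Let om_ge0 q : B q -> 0 <= om q.
Proof.
case=> _ Sq; have /andP[h _] := box_weight_bound r0 Sq.
by apply: mulr_ge0 => //; exact: time_weight_ge0.
Qed.

Let cur_facts q : B q ->
  [/\ 0 <= - cur G u beta (inord 0) q,
      - cur G u beta (inord 0) q <= C * (w 1 q ^+ 2 + w 2 q ^+ 2 + w 3 q ^+ 2) &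
      cur G u beta (inord 1) q + c * q.1.2 ^+ 2 * w 1 q ^+ 2 <=
        C * (w 0 q ^+ 2 + w 2 q ^+ 2 + w 3 q ^+ 2)].
Proof.
move=> Bq; have Dq := BD Bq.
have zq : 0 <= q.1.2 <= z0 by have /andP[/ltW -> ->] := Dz Dq.
have [_ _ [h1 h2] h3 _] := current_bound (grad u q) (GN Dq) (fun i j => GM i j Dq) (GV Dq) zq (VB Dq).
by split; [exact: h1|exact: h2|exact: h3].
Qed.

(** Integral form of [weighted_bound]. The last term is an energy over the whole square without the
    factor [rho] and without [mu]; it cannot be absorbed in this box alone, and is treated after
    summation over the cover. *)
Lemma box_energy :
  mu * c * \int[leb4]_(q in B) (W q.1 * rho q.2 * energy u q) +
  c * z1 ^+ 2 * \int[leb3]_(y in box3 t1 t2 S) (W (y.1, z1) * rho y.2 * w 1 ((y.1, z1), y.2) ^+ 2) <=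
  \int[leb3]_(y in box3 eps z1 S) (W (t1, y.1) * rho y.2 *
     (C * (w 1 ((t1, y.1), y.2) ^+ 2 + w 2 ((t1, y.1), y.2) ^+ 2 + w 3 ((t1, y.1), y.2) ^+ 2) + u ((t1, y.1), y.2) ^+ 2)) +
  C * \int[leb3]_(y in box3 t1 t2 S) (W (y.1, z1) * rho y.2 *
     (w 0 ((y.1, z1), y.2) ^+ 2 + w 2 ((y.1, z1), y.2) ^+ 2 + w 3 ((y.1, z1), y.2) ^+ 2)) +
  (2 * C + C' + 1) * rr * \int[leb4]_(q in B) (W q.1 * (energy u q + principal G u q ^+ 2)).
Proof.
have h1 : mu * c * \int[leb4]_(q in B) (W q.1 * rho q.2 * energy u q) <=
    \int[leb4]_(q in B) (\sum_(i < 4) 'D_(e4 i) (Phi i) q) +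
    (2 * C + C' + 1) * rr * \int[leb4]_(q in B) (W q.1 * (energy u q + principal G u q ^+ 2)).
  have b1 := bmB (C1_mul oD om_C1 energy_C1).
  have b2 : bm (B : set ((mR * mR) * (mR * mR))) (fun q => W q.1 * (energy u q + principal G u q ^+ 2)).
    apply: bm_mul; first exact: bmB W_C1.
    by apply: bm_add; [exact: bmB energy_C1|exact: (bm_mul principal_bm principal_bm)].
  have b3 : bm (B : set ((mR * mR) * (mR * mR))) (fun q => \sum_(i < 4) 'D_(e4 i) (Phi i) q).
    by apply: bm_sum => i; exact: bmB'.
  rewrite -(bm_RintegralZ mB fB _ b2) -(bm_RintegralZ mB fB _ b1).
  rewrite -(bm_RintegralD mB fB b3 (bm_mul (bm_cst _ _) b2)).
  apply: (bm_le_Rintegral mB fB) => [||q]; [exact: (bm_mul (bm_cst _ _) b1)| |exact: pointwise].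
  exact: (bm_add b3 (bm_mul (bm_cst _ _) b2)).
have h2 : \int[leb3]_(y in box3 eps z1 S) (Phi (inord 0) ((t2, y.1), y.2) - Phi (inord 0) ((t1, y.1), y.2)) <=
  \int[leb3]_(y in box3 eps z1 S) (W (t1, y.1) * rho y.2 *
     (C * (w 1 ((t1, y.1), y.2) ^+ 2 + w 2 ((t1, y.1), y.2) ^+ 2 + w 3 ((t1, y.1), y.2) ^+ 2) + u ((t1, y.1), y.2) ^+ 2)).
  have t1B : t1 <= t1 <= t2 by rewrite lexx ltW.
  have t2B : t1 <= t2 <= t2 by rewrite lexx ltW.
  have bP t : t1 <= t <= t2 -> bm _ _ := face_bm0 oD BD (C1_cont (Phi_C1 (inord 0))).
  apply: (bm_le_Rintegral (face_measurable _ _) (face_finite _ _)).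
  - exact: (bm_sub (bP _ t2B) (bP _ t1B)).
  - exact: (face_bm0 oD BD (C1_cont initial_C1) t1B).
  - move=> y [By1 By2].
    have B1 : B ((t1, y.1), y.2) by split => //; split => //=; rewrite in_itv.
    have B2 : B ((t2, y.1), y.2) by split => //; split => //=; rewrite in_itv.
    have [_ f1 _] := cur_facts B1; have [f2 _ _] := cur_facts B2.
    exact: (face0_bound (u ((t2, y.1), y.2)) (u ((t1, y.1), y.2)) (om_ge0 B2) (om_ge0 B1) f2 f1).
have h3 : \int[leb3]_(y in box3 t1 t2 S) (Phi (inord 1) ((y.1, z1), y.2)) + c * z1 ^+ 2 * \int[leb3]_(y in box3 t1 t2 S) (W (y.1, z1) * rho y.2 * w 1 ((y.1, z1), y.2) ^+ 2) <=
  C * \int[leb3]_(y in box3 t1 t2 S) (W (y.1, z1) * rho y.2 *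
     (w 0 ((y.1, z1), y.2) ^+ 2 + w 2 ((y.1, z1), y.2) ^+ 2 + w 3 ((y.1, z1), y.2) ^+ 2)).
  have zB : eps <= z1 <= z1 by rewrite lexx ltW.
  have b1 := face_bm1 oD BD (C1_cont (Phi_C1 (inord 1))) zB.
  have b2 := face_bm1 oD BD (C1_cont trace_C1) zB.
  have b3 := face_bm1 oD BD (C1_cont lateral_C1) zB.
  have mF := face_measurable t1 t2; have fF := face_finite t1 t2.
  rewrite -(bm_RintegralZ mF fF _ b2) -(bm_RintegralZ mF fF _ b3).
  rewrite -(bm_RintegralD mF fF b1 (bm_mul (bm_cst _ _) b2)).
  apply: (bm_le_Rintegral mF fF) => [||y By].
  - exact: (bm_add b1 (bm_mul (bm_cst _ _) b2)).
  - exact: (bm_mul (bm_cst _ _) b3).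
  - have B1 : B ((y.1, z1), y.2) by case: By => By1 By2; split => //; split => //=; rewrite in_itv.
    have [_ _ f1] := cur_facts B1.
    exact: (face1_bound (u ((y.1, z1), y.2)) (om_ge0 B1) f1).
exact: (combine_faces h1 divergence_theorem h2 h3).
Qed.

End BoxEnergy.

(** * Continuity up to the boundary *)

Lemma dist_half (R : realType) (a b c e : R) : `|a - b| < e / 2 -> `|a - c| < e / 2 -> `|b - c| < e.
Proof. by rewrite !ltr_norml => /andP[? ?] /andP[? ?]; lra. Qed.

Section ContinuousOn.
Context {R : realType}.

(** Pointwise form of continuity relative to [A]. It is the notion suited to the extended
    derivatives, which are continuous on Omega together with Sigma_0 and Sigma_1 but not on a
    neighbourhood. *)
Definition con (E : topologicalType) (A : set E) (f : E -> R) : Prop :=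
  forall x, A x -> f @ within A (nbhs x) --> f x.

Lemma con_near (E : topologicalType) (A : set E) (f : E -> R) x U : con A f -> A x ->
  nbhs (f x) U -> \forall y \near x, A y -> U (f y).
Proof. by move=> cf Ax nU; exact: (cf x Ax U nU). Qed.

Lemma within_con (E : topologicalType) (A : set E) (f : E -> R) : {within A, continuous f} -> con A f.
Proof. by move=> /subspace_continuousP. Qed.

Section Ops.
Context {E : topologicalType}.
Implicit Types (A : set E) (f g : E -> R).

Lemma con_cst A c : con A (fun=> c).
Proof. by move=> x _; exact: cvg_cst. Qed.

Lemma con_add A f g : con A f -> con A g -> con A (fun x => f x + g x).
Proof. by move=> cf cg x Ax; apply: cvgD; [exact: cf|exact: cg]. Qed.

Lemma con_mul A f g : con A f -> con A g -> con A (fun x => f x * g x).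
Proof. by move=> cf cg x Ax; apply: cvgM; [exact: cf|exact: cg]. Qed.

Lemma con_subset A A' f : A' `<=` A -> con A f -> con A' f.
Proof. by move=> s cf x /s Ax; apply: cvg_trans (cf x Ax); apply: cvg_app; exact: within_subset. Qed.

Lemma con_open A f : (forall x, A x -> {for x, continuous f}) -> con A f.
Proof. by move=> cf x Ax; apply: cvg_trans (cf x Ax); apply: cvg_app; exact: cvg_within. Qed.

Lemma con_measurable d (X : measurableType d) (toE : X -> E) A f :
  (forall U, open U -> measurable (toE @^-1` U)) -> measurable (toE @^-1` A) ->
  con A f -> measurable_fun (toE @^-1` A) (f \o toE).
Proof.
move=> mo mA cf; apply: (measurability _ (RGenOpens.measurableE R)).
move=> _ [_ [a [b ->] <-]].
pose P := [set y | A y -> `]a, b[%classic (f y)].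
have -> : toE @^-1` A `&` (f \o toE) @^-1` `]a, b[%classic = toE @^-1` A `&` toE @^-1` (P°).
  apply/seteqP; split=> x [Ax Hx]; split => //; last by have := interior_subset Hx; exact.
  by apply: (con_near cf Ax); apply: open_nbhs_nbhs; split => //; exact: interval_open.
by apply: measurableI => //; apply: mo; exact: open_interior.
Qed.

End Ops.

Lemma con_comp (E F : topologicalType) (A : set E) (A' : set F) (i : F -> E) (f : E -> R) :
  continuous i -> (forall y, A' y -> A (i y)) -> con A f -> con A' (f \o i).
Proof.
move=> ci iA cf y Ay P nP; have H := con_near cf (iA _ Ay) nP.
have : \forall t \near y, A (i t) -> P (f (i t)) := ci y _ H.
by move=> H'; suff : \forall t \near y, A' t -> P (f (i t)) by []; apply: filterS H' => t Ht /iA.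
Qed.

Lemma con_bounded (E : topologicalType) (K : set E) (f : E -> R) : compact K -> con K f ->
  exists M : R, forall x, K x -> `|f x| <= M.
Proof.
move=> cK cf; have [||M HM] := @compact_uniform R E K (fun M x => K x -> `|f x| <= M) cK.
- by move=> A B x AB H /H /le_trans; apply.
- move=> x Kx; exists (`|f x| + 1).
  have := con_near cf Kx (nbhsx_ballx (f x) 1 ltr01); apply: filterS => y H /H.
  rewrite -ball_normE /= => /ltW h; rewrite -{1}(subKr (f x) (f y)).
  by apply: (le_trans (ler_normB _ _)); rewrite lerD2l.
- by exists M => x Kx; exact: HM.
Qed.

Lemma con_uniform (E : normedModType R) (K : set E) (f : E -> R) (eta : R) : compact K -> con K f ->
  0 < eta -> exists2 dl : R, 0 < dl & forall x y, K x -> K y -> `|x - y| < dl -> `|f x - f y| < eta.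
Proof.
move=> cK cf e0.
(* The parameter plays the role of 1 / delta, so that the condition weakens as it grows and
   [compact_uniform] applies. *)
have [A HA] : exists A, forall x, K x -> forall y, K y -> `|x - y| * A < 1 -> `|f x - f y| < eta.
  have [||A HA] := @compact_uniform R E K (fun A x => K x -> forall y, K y -> `|x - y| * A < 1 -> `|f x - f y| < eta) cK.
  - move=> A B x AB H Kx y Ky h; apply: H => //; apply: le_lt_trans h.
    by rewrite ler_wpM2l.
  - move=> x Kx; have e2 : 0 < eta / 2 by rewrite divr_gt0.
    have /nbhs_ballP[r /= r0 Hr] := con_near cf Kx (nbhsx_ballx (f x) (eta / 2) e2).
    exists (2 / r); have r2 : 0 < r / 2 by rewrite divr_gt0.
    apply: filterS (nbhsx_ballx x (r / 2) r2) => y xy Ky t Kt.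
    rewrite mulrA ltr_pdivrMr// mul1r => yt.
    have h1 : ball (f x) (eta / 2) (f y).
      by apply: (Hr y _ Ky); apply: le_ball xy; rewrite ler_pdivrMr// ler_peMr ?ler1n// ltW.
    have h2 : ball (f x) (eta / 2) (f t).
      apply: (Hr t _ Kt); rewrite [r]splitr; apply: ball_triangle xy _.
      by rewrite -ball_normE /=; lra.
    by move: h1 h2; rewrite -!ball_normE /= => /dist_half; apply.
  by exists A => x Kx; exact: HA.
exists (`|A| + 1)^-1; first by rewrite invr_gt0 ltr_wpDl.
move=> x y Kx Ky xy; apply: HA => //.
have A1 : 0 < `|A| + 1 by rewrite ltr_wpDl.
move: xy; rewrite -(ltr_pM2r A1) mulVf ?lt0r_neq0//; apply: le_lt_trans.
by rewrite ler_wpM2l//; have := ler_norm A; lra.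
Qed.

End ContinuousOn.

(** * Weak derivatives and traces *)

Section NullIntegral.
Context {R : realType} d (X : measurableType d) (mu : {measure set X -> \bar R}).
Variable F : X -> \bar R.
Hypothesis iF : mu.-integrable setT F.

Let iFA A : measurable A -> mu.-integrable A F.
Proof. by move=> mA; exact: (integrableS measurableT mA (@subsetT _ A) iF). Qed.

(* Dynkin's lemma along a measurable map. *)
Lemma null_integral_sigma (Y : Type) (p : X -> Y) (C : set X) (G : set (set Y)) :
  (forall A, <<s G >> A -> measurable (p @^-1` A)) -> measurable C -> setI_closed G ->
  (\int[mu]_(x in C) F x = 0)%E ->
  (forall A, G A -> \int[mu]_(x in C `&` p @^-1` A) F x = 0)%E ->
  forall A, <<s G >> A -> (\int[mu]_(x in C `&` p @^-1` A) F x = 0)%E.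
Proof.
move=> mp mC GI C0 G0.
pose H := [set A : set Y | measurable (p @^-1` A) /\ (\int[mu]_(x in C `&` p @^-1` A) F x = 0)%E].
suff : <<s G >> `<=` H by move=> GH A /GH[].
rewrite -(setI_closed_g_dynkin_g_sigma_algebra GI).
apply: smallest_sub; last by move=> A GA; split; [apply: mp; exact: sub_sigma_algebra|exact: G0].
split.
- by split; [rewrite preimage_setT; exact: measurableT|rewrite preimage_setT setIT].
- move=> A [mA A0]; have mA' : measurable (p @^-1` (~` A)) by rewrite preimage_setC; exact: measurableC.
  split => //; have := C0.
  have CE : C = (C `&` p @^-1` A) `|` (C `&` p @^-1` (~` A)) by rewrite -setIUr preimage_setC setUCr setIT.
  rewrite {1}CE integral_setU ?A0 ?add0e//; try exact: measurableI.
    rewrite -CE; exact: (measurable_int _ (iFA mC)).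
  apply/disj_set2P; rewrite setIACA -preimage_setI setICr preimage_set0 setI0//.
- move=> A tA HA; have mA i : measurable (C `&` p @^-1` A i) by apply: measurableI => //; have [] := HA i.
  split; first by rewrite preimage_bigcup; apply: bigcup_measurable => i _; have [] := HA i.
  rewrite preimage_bigcup setI_bigcupr integral_bigcup//.
  - by apply: eseries0 => i _ _; have [] := HA i.
  - by apply: trivIset_setIl => i j _ _ [x [Aix Ajx]]; apply: tA => //; exists (p x).
  - by apply: iFA; exact: bigcup_measurable.
Qed.

Lemma integral_support (A B : set X) : A `<=` B -> (forall x, B x -> ~ A x -> F x = 0%E) ->
  (\int[mu]_(x in B) F x = \int[mu]_(x in A) F x)%E.
Proof.
move=> AB F0; rewrite [LHS]integral_mkcond [RHS]integral_mkcond; apply: eq_integral => x _.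
rewrite /restrict; case: ifPn => [/set_mem Bx|/negP nB].
  by case: ifPn => // /negP nA; apply: F0 => // Ax; apply: nA; exact: mem_set.
by rewrite ifF//; apply/negP => /set_mem/AB/mem_set.
Qed.

End NullIntegral.

Section NullIntegral3.
Context {R : realType}.
Local Notation mR := (measurableTypeR R).
Local Notation E3 := (mR * (mR * mR))%type.
Variable F : E3 -> \bar R.
Hypothesis iF : (@leb3 R).-integrable setT F.

Definition obox3 (a b : R * (R * R)) : set E3 :=
  `]a.1, b.1[%classic `*` (`]a.2.1, b.2.1[%classic `*` `]a.2.2, b.2.2[%classic).

Variables j k : R * (R * R).
Hypothesis F0 : forall y, ~ obox3 j k y -> F y = 0%E.
Hypothesis Fbox : forall a b, (\int[leb3]_(y in obox3 a b) F y = 0)%E.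

Let opens_sigma (A : set mR) : measurable A <-> <<s @RGenOpens.G R >> A.
Proof. by rewrite -[measurable A]/((@ocitv R).-sigma.-measurable A) RGenOpens.measurableE. Qed.

Let opensI : setI_closed (@RGenOpens.G R).
Proof.
move=> _ _ [a [b ->]] [c [d ->]]; exists (Num.max a c), (Num.min b d).
by apply/seteqP; split=> x /=; rewrite !in_itv /= gt_max lt_min; [move=> [/andP[-> ->] /andP[-> ->]]|case/andP => /andP[-> ->] /andP[-> ->]].
Qed.

Let mitv (a b : R) : measurable (`]a, b[%classic : set mR).
Proof. exact: measurable_itv. Qed.

Let m1 (A : set mR) : measurable A -> measurable ((@fst mR (mR * mR)) @^-1` A).
Proof. by move=> mA; rewrite -[X in measurable X]setTI; exact: measurable_fst. Qed.

Let m2 (A : set (mR * mR)) : measurable A -> measurable ((@snd mR (mR * mR)) @^-1` A).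
Proof. by move=> mA; rewrite -[X in measurable X]setTI; exact: measurable_snd. Qed.

(** One coordinate at a time, open intervals are replaced by Borel sets through the sigma-algebra
    they generate. The whole line is admissible as a factor because [F] vanishes outside the box
    from [j] to [k]. *)
Let step1 (A : set mR) a2 b2 a3 b3 : measurable A ->
  (\int[leb3]_(y in A `*` (`]a2, b2[%classic `*` `]a3, b3[%classic)) F y = 0)%E.
Proof.
move=> /opens_sigma sA.
have H := @null_integral_sigma R _ _ leb3 F iF mR fst (setT `*` (`]a2, b2[%classic `*` `]a3, b3[%classic)) (@RGenOpens.G R).
have E B : B `*` (`]a2, b2[%classic `*` `]a3, b3[%classic) =
    setT `*` (`]a2, b2[%classic `*` `]a3, b3[%classic) `&` fst @^-1` B.
  by apply/seteqP; split => -[x y] /=; tauto.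
rewrite E; apply: H => //.
- by move=> B /opens_sigma; exact: m1.
- by apply: measurableX => //; exact: measurableX.
- rewrite (@integral_support _ _ _ _ F (obox3 (j.1, (a2, a3)) (k.1, (b2, b3)))) ?Fbox//.
    by move=> y [/= ? ?].
  move=> [x y] [_ /= h] n; apply: F0 => -[/= jx _]; exact: n.
- move=> _ [a [b ->]]; rewrite -E; exact: (Fbox (a, (a2, a3)) (b, (b2, b3))).
Qed.

Let step2 (A A2 : set mR) a3 b3 : measurable A -> measurable A2 ->
  (\int[leb3]_(y in A `*` (A2 `*` `]a3, b3[%classic)) F y = 0)%E.
Proof.
move=> mA /opens_sigma sA.
have H := @null_integral_sigma R _ _ leb3 F iF mR (fun y => y.2.1) (A `*` (setT `*` `]a3, b3[%classic)) (@RGenOpens.G R).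
have E B : A `*` (B `*` `]a3, b3[%classic) = A `*` (setT `*` `]a3, b3[%classic) `&` (fun y => y.2.1) @^-1` B.
  by apply/seteqP; split => -[x y] /=; tauto.
rewrite E; apply: H => //.
- move=> B /opens_sigma mB; apply: (m2 (A := fst @^-1` B)).
  by rewrite -[X in measurable X]setTI; exact: measurable_fst.
- by apply: measurableX => //; exact: measurableX.
- rewrite (@integral_support _ _ _ _ F (A `*` (`]j.2.1, k.2.1[%classic `*` `]a3, b3[%classic))) ?step1//.
    by move=> y [? [? ?]].
  by move=> [x [y z]] [/= h1 [_ h2]] n; apply: F0 => -[/= jx [h3 _]]; exact: n.
- by move=> _ [a [b ->]]; rewrite -E; exact: step1.
Qed.

Let step3 (A A2 A3 : set mR) : measurable A -> measurable A2 -> measurable A3 ->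
  (\int[leb3]_(y in A `*` (A2 `*` A3)) F y = 0)%E.
Proof.
move=> mA mA2 /opens_sigma sA.
have H := @null_integral_sigma R _ _ leb3 F iF mR (fun y => y.2.2) (A `*` (A2 `*` setT)) (@RGenOpens.G R).
have E B : A `*` (A2 `*` B) = A `*` (A2 `*` setT) `&` (fun y => y.2.2) @^-1` B.
  by apply/seteqP; split => -[x y] /=; tauto.
rewrite E; apply: H => //.
- move=> B /opens_sigma mB; apply: (m2 (A := snd @^-1` B)).
  by rewrite -[X in measurable X]setTI; exact: measurable_snd.
- by apply: measurableX => //; exact: measurableX.
- rewrite (@integral_support _ _ _ _ F (A `*` (A2 `*` `]j.2.2, k.2.2[%classic))) ?step2//.
    by move=> y [? [? ?]].
  by move=> [x [y z]] [/= h1 [h2 _]] n; apply: F0 => -[/= jx [_ h3]]; exact: n.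
- by move=> _ [a [b ->]]; rewrite -E; exact: step2.
Qed.

Let rectI d1 d2 (T1 : measurableType d1) (T2 : measurableType d2) :
  setI_closed [set A `*` B | A in @measurable _ T1 & B in @measurable _ T2].
Proof.
move=> _ _ [A mA [B mB <-]] [C mC [D mD <-]]; rewrite -setXI.
by exists (A `&` C); [exact: measurableI|exists (B `&` D) => //; exact: measurableI].
Qed.

Let step4 (A : set mR) (B : set (mR * mR)) : measurable A -> measurable B ->
  (\int[leb3]_(y in A `*` B) F y = 0)%E.
Proof.
move=> mA mB; have mE := @measurable_prod_measurableType _ _ mR mR.
have H := @null_integral_sigma R _ _ leb3 F iF (mR * mR)%type snd (A `*` setT)
  [set A `*` B | A in @measurable _ mR & B in @measurable _ mR].
have E C : A `*` C = A `*` setT `&` snd @^-1` C.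
  by apply/seteqP; split => -[x y] /=; tauto.
rewrite E; apply: H; rewrite -?mE//.
- exact: measurableX.
- exact: rectI.
- by rewrite -setXTT; exact: step3.
- by move=> _ [A1 mA1 [A2 mA2 <-]]; rewrite -E; exact: step3.
Qed.

Lemma null_integral3 (A : set E3) : measurable A -> (\int[leb3]_(y in A) F y = 0)%E.
Proof.
move=> mA; have mE := @measurable_prod_measurableType _ _ mR (mR * mR)%type.
have H := @null_integral_sigma R _ _ leb3 F iF E3 id setT
  [set A `*` B | A in @measurable _ mR & B in @measurable _ (mR * mR)%type].
rewrite -(setTI A); apply: H; rewrite -?mE//.
- exact: rectI.
- by rewrite -setXTT; exact: step4.
- by move=> _ [A1 mA1 [A2 mA2 <-]]; rewrite setTI; exact: step4.
Qed.

End NullIntegral3.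

Lemma le_maxl (R : realType) (a b : R) : a <= Num.max a b.
Proof. by rewrite le_max lexx. Qed.

Lemma unit_mul (R : realType) (a b : R) : 0 <= a <= 1 -> 0 <= b <= 1 -> 0 <= a * b <= 1.
Proof. by move=> /andP[? ?] /andP[? ?]; rewrite mulr_ge0//= mulr_ile1. Qed.

Lemma itv_shrink (R : realType) (a b c d x : R) : c <= a -> b <= d -> a < x < b -> c < x < d.
Proof. by move=> ca bd /andP[ax xb]; rewrite (le_lt_trans ca ax) (lt_le_trans xb bd). Qed.

(** * Smooth approximations of indicators of boxes *)

Section Bumps.
Context {R : realType}.
Local Notation E3 := (R * (R * R))%type.

(** Smooth with values in [0, 1], supported in [a + 1/n, b - 1/n] and tending to 1 on the open
    interval; for n = 0 it vanishes identically because the ramp is 0 at -1. *)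
Definition bump (n : nat) (a b t : R) : R := ramp (n%:R * (t - a) - 1) * ramp (n%:R * (b - t) - 1).

Lemma bump_support n a b t : bump n a b t != 0 -> a + n%:R^-1 <= t <= b - n%:R^-1.
Proof.
rewrite /bump mulf_eq0 negb_or => /andP[h1 h2].
have P (s : R) : ramp s != 0 -> 0 < s.
  by move=> h; rewrite ltNge; apply/negP => /ramp0 r0; move/eqP: h.
have := P _ h1; have := P _ h2; rewrite !subr_gt0.
have [->|n0] := eqVneq n 0%N; first by rewrite mul0r ltr10.
have np : 0 < n%:R :> R by rewrite ltr0n lt0n.
move=> g2 g1; apply/andP; split.
  by rewrite -lerBrDl -(ler_pM2l np) mulfV ?lt0r_neq0// ltW.
by rewrite lerBrDl -lerBrDr -(ler_pM2l np) mulfV ?lt0r_neq0// ltW.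
Qed.

Lemma bump_ge0 n a b t : 0 <= bump n a b t <= 1.
Proof. by rewrite mulr_ge0 ?ramp_ge0//= mulr_ile1 ?ramp_ge0 ?ramp_le1. Qed.

Lemma bump_outside n a b t : ~ (a < t < b) -> bump n a b t = 0.
Proof.
move=> h; apply/eqP/negP => /negP nz; have := bump_support nz; apply/negP.
have [n0|n0] := eqVneq n 0%N; first by move: nz; rewrite /bump n0 !mul0r !sub0r !ramp0 ?mul0r ?eqxx// lerN10.
apply/negP => /andP[h1 h2]; apply: h.
have ni : 0 < n%:R^-1 :> R by rewrite invr_gt0 ltr0n lt0n.
apply/andP; split; [apply: lt_le_trans h1|apply: le_lt_trans h2 _]; [by rewrite ltrDl|by rewrite gtrBl].
Qed.

Lemma bump_cvg a b t : a < t < b -> (fun n => bump n a b t) @ \oo --> (1 : R).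
Proof.
case/andP=> h1 h2; rewrite -[1]mulr1.
by apply: cvgM; apply: ramp_cvg1; rewrite subr_gt0.
Qed.

Definition bump3 n (a b : E3) (y : E3) : R :=
  bump n a.1 b.1 y.1 * (bump n a.2.1 b.2.1 y.2.1 * bump n a.2.2 b.2.2 y.2.2).

Lemma elementary_ramp (l : E3 -> R) : affine_fun l -> elementary (fun y => ramp (l y)).
Proof. exact: elementary_flat. Qed.

Lemma affine_scal (l : E3 -> R) c d : affine_fun l -> affine_fun (fun y => c * (l y) + d).
Proof.
move=> [cl [dl Hl]]; split.
  by move=> y; apply: cvgD; [apply: cvgM; [exact: cvg_cst|exact: cl]|exact: cvg_cst].
exists (fun v => c * dl v + 0) => y v.
exact: (is_derive_add (is_derive_scal c (Hl y v)) (is_derive_cst d y v)).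
Qed.

Lemma affine_coord : [/\ affine_fun (fun y : E3 => y.1), affine_fun (fun y : E3 => y.2.1) &
  affine_fun (fun y : E3 => y.2.2)].
Proof.
have c1 : continuous (fun y : E3 => y.1) by move=> y; exact: pt_fst.
have c2 : continuous (fun y : E3 => y.2) by move=> y; exact: pt_snd.
have c21 : continuous (fun y : E3 => y.2.1) by move=> y; apply: continuous_comp; [exact: c2|exact: pt_fst].
have c22 : continuous (fun y : E3 => y.2.2) by move=> y; apply: continuous_comp; [exact: c2|exact: pt_snd].
have P (l : E3 -> R) : continuous l -> (forall x y, l (x + y) = l x + l y) ->
    (forall a x, l (a *: x) = a * l x) -> affine_fun l.
  move=> cl lD lZ; split => //; exists l => x v.
  by have [_] := @C1_linear R E3 setT l openT cl lD lZ; apply.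
by split; apply: P.
Qed.

Lemma elementary_bump3 n a b : elementary (bump3 n a b).
Proof.
have [a1 a2 a3] := affine_coord.
have P (l : E3 -> R) s t : affine_fun l -> elementary (fun y => bump n s t (l y)).
  move=> al; apply: elementary_mul; apply: elementary_ramp.
    have -> : (fun y => n%:R * (l y - s) - 1) = (fun y => n%:R * l y + (- n%:R * s - 1)) by apply/funext => y; ring.
    exact: affine_scal.
  have -> : (fun y => n%:R * (t - l y) - 1) = (fun y => (- n%:R) * l y + (n%:R * t - 1)) by apply/funext => y; ring.
  exact: affine_scal.
by apply: elementary_mul; [exact: P|apply: elementary_mul; exact: P].
Qed.

Lemma bump3_outside n a b y : ~ obox3 a b y -> bump3 n a b y = 0.
Proof.
move=> h; rewrite /bump3.
have [h1|h1] := boolP (a.1 < y.1 < b.1); last by rewrite bump_outside ?mul0r//; exact/negP.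
have [h2|h2] := boolP (a.2.1 < y.2.1 < b.2.1); last by rewrite (@bump_outside _ _ _ y.2.1) ?mul0r ?mulr0//; exact/negP.
have [h3|h3] := boolP (a.2.2 < y.2.2 < b.2.2); last by rewrite (@bump_outside _ _ _ y.2.2) ?mulr0//; exact/negP.
by case: h; split; [|split]; rewrite /= in_itv.
Qed.

Lemma bump3_bound n a b y : 0 <= bump3 n a b y <= 1.
Proof.
by apply: unit_mul; [|apply: unit_mul]; exact: bump_ge0.
Qed.

Lemma bump3_cvg a b y : obox3 a b y -> (fun n => bump3 n a b y) @ \oo --> (1 : R).
Proof.
move=> [/= + [/= + +]]; rewrite !in_itv /= => h1 h2 h3.
by rewrite -[1]mulr1; apply: cvgM; [exact: bump_cvg|rewrite -[1]mulr1; apply: cvgM; exact: bump_cvg].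
Qed.

Lemma bump3_test n a b (D : set E3) : (0 < n)%N -> obox3 a b `<=` D -> test_function D (bump3 n a b).
Proof.
move=> n0 aD; split; first by apply: elementary_smooth; exact: elementary_bump3.
have ni : 0 < n%:R^-1 :> R by rewrite invr_gt0 ltr0n.
exists (box3 (a.1 + n%:R^-1) (b.1 - n%:R^-1)
  (box2 (a.2.1 + n%:R^-1) (b.2.1 - n%:R^-1) (a.2.2 + n%:R^-1) (b.2.2 - n%:R^-1))); split.
- exact: box3_compact.
- move=> y [/= + [/= + +]]; rewrite !in_itv /= => h1 h2 h3; apply: aD.
  by split; [|split]; rewrite /= in_itv /=; lra.
- move=> y h; apply/eqP/negP => /negP; rewrite /bump3 mulf_eq0 negb_or => /andP[h1].
  rewrite mulf_eq0 negb_or => /andP[h2 h3].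
  by apply: h; split; [|split]; rewrite /= in_itv /=; exact: bump_support.
Qed.

End Bumps.

Lemma test_error (R : realType) (M vol e p q d h u u' : R) : 0 <= vol -> 0 <= M -> `|d| <= M ->
  0 <= h <= 1 -> `|u - p| <= e / ((M + 1) * (vol + 1)) -> `|u' - q| <= e / ((M + 1) * (vol + 1)) ->
  `|p * d + h * q - (u * d + h * u')| <= e / (vol + 1).
Proof.
move=> v0 M0 dM /andP[h0 h1] up uq.
have -> : p * d + h * q - (u * d + h * u') = - ((u - p) * d + h * (u' - q)) by ring.
rewrite normrN; apply: (le_trans (ler_normD _ _)); rewrite !normrM (ger0_norm h0).
have -> : e / (vol + 1) = e / ((M + 1) * (vol + 1)) * (M + 1).
  by field; rewrite !lt0r_neq0 ?ltr_wpDl.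
rewrite mulrDr mulr1; apply: lerD; first exact: ler_pM.
by rewrite -[leRHS]mul1r ler_pM.
Qed.

Lemma scale_vol (R : realType) (vol e : R) : 0 <= vol -> 0 < e -> e / (vol + 1) * vol <= e.
Proof.
by move=> v0 e0; rewrite mulrAC ler_pdivrMr ?ltr_wpDl// ler_pM2l// lerDl.
Qed.

Lemma norm_le_sq (R : realType) (x : R) : `|x| <= 1 + x ^+ 2.
Proof.
rewrite -(real_normK (num_real x)); have := normr_ge0 x; have := sqr_ge0 (`|x| - 1); lra.
Qed.

Lemma cvg_EFin_comp (R : realType) (f : nat -> R) (l : R) : f @ \oo --> l ->
  (fun n => (f n)%:E) @ \oo --> l%:E.
Proof. by move=> fl; apply/fine_cvgP; split; first exact: nearW. Qed.

(** * Boundary derivatives as weak derivatives of the data *)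

Section WeakTrace.
Context {R : realType}.
Local Notation mR := (measurableTypeR R).
Local Notation E3 := (R * (R * R))%type.
Variables (D : set E3) (psi psi' w G : E3 -> R) (v : E3) (j k : E3) (um : nat -> E3 -> R).
Local Notation B := (box3 j.1 k.1 (box2 j.2.1 k.2.1 j.2.2 k.2.2)).
Local Notation O' := (obox3 j k).
Hypotheses (oD : open D) (BD : B `<=` D).
Hypotheses (jk1 : j.1 < k.1) (jk2 : j.2.1 < k.2.1) (jk3 : j.2.2 < k.2.2).
Hypothesis vE : v = (1, (0, 0)) \/ v = (0, (1, 0)) \/ v = (0, (0, 1)).
Hypotheses (mG : measurable_on to3 D G) (mpsi : measurable_on to3 D psi).
Hypothesis G2 : (\int[leb3]_(y in to3 @^-1` D) ((G (to3 y)) ^+ 2)%:E < +oo)%E.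
Hypothesis wd : weak_derivative leb3 to3 D v psi G.
Hypothesis ae_psi : {ae leb3, forall y, D (to3 y) -> psi' (to3 y) = psi (to3 y)}.
Hypotheses (bpsi' : bm (B : set (mR * (mR * mR))) psi') (bw : bm (B : set (mR * (mR * mR))) w).
Hypothesis um1 : forall m, C1 D (um m).
Hypothesis um_cvg : forall eta : R, 0 < eta -> exists m, forall y, B y ->
  `|um m y - psi' y| <= eta /\ `|'D_v (um m) y - w y| <= eta.

Let mB : measurable (B : set (mR * (mR * mR))) := box3_measurable _ _ _ _ _ _.
Let fB : (leb3 (B : set (mR * (mR * mR))) < +oo)%E :=
  leb3_finite (itv_measurable _ _) (box2_measurable _ _ _ _) (itv_finite _ _) (box2_finite _ _ _ _).
Let mD : measurable (to3 @^-1` D : set (mR * (mR * mR))) := open_measurable3 oD.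
Let mO : measurable (O' : set (mR * (mR * mR))).
Proof. by apply: measurableX; [exact: measurable_itv|apply: measurableX; exact: measurable_itv]. Qed.
Let OB : O' `<=` B.
Proof.
move=> y [/= + [/= + +]]; rewrite !in_itv /= => h1 h2 h3.
by split; [|split]; rewrite /= in_itv /=; lra.
Qed.

Let bm_cont (f : E3 -> R) : continuous f -> bm (B : set (mR * (mR * mR))) f.
Proof.
move=> cf; exact: (@bm_compact3 R setT B f openT (@box3_compact _ _ _ _ _ _ _) (fun _ _ => Logic.I) mB (fun x _ => cf x)).
Qed.

Let mGO : measurable_fun (O' : set (mR * (mR * mR))) G.
Proof. exact: (measurable_funS mD (subset_trans OB BD) mG). Qed.

(** Square integrability gives integrability on the bounded box through |x| <= 1 + x^2. *)
Let iG : (@leb3 R).-integrable (O' : set (mR * (mR * mR))) (EFin \o G).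
Proof.
have m2 : measurable_fun (O' : set (mR * (mR * mR))) (fun y => (G y ^+ 2)%:E).
  by apply/measurable_EFinP; exact: measurable_funX.
have fO : (leb3 (O' : set (mR * (mR * mR))) < +oo)%E.
  by apply: le_lt_trans fB; apply: le_measure; rewrite ?inE.
have i2 : (@leb3 R).-integrable (O' : set (mR * (mR * mR))) (fun y => (G y ^+ 2)%:E).
  apply/integrableP; split => //; apply: le_lt_trans G2.
  under eq_integral => y _ do rewrite gee0_abs ?lee_fin ?sqr_ge0//.
  apply: ge0_subset_integral => //; last exact: subset_trans OB BD.
    by apply/measurable_EFinP; exact: measurable_funX.
  by move=> y _; rewrite lee_fin sqr_ge0.
have i1 : (@leb3 R).-integrable (O' : set (mR * (mR * mR))) (EFin \o (fun=> 1 : R)).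
  exact: (bm_integrable mO fO (bm_cst _ 1)).
apply: (le_integrable mO _ _ (integrableD mO i1 i2)); first exact/measurable_EFinP.
move=> y _; rewrite -[leLHS]/((`|G y|)%:E) -[leRHS]/((`|1 + G y ^+ 2|)%:E) lee_fin.
by rewrite [leRHS]ger0_norm ?addr_ge0 ?sqr_ge0//; exact: norm_le_sq.
Qed.

Section OneTest.
Variables (n : nat) (a b : E3).
Hypotheses (n0 : (0 < n)%N) (ja1 : j.1 <= a.1) (ja2 : j.2.1 <= a.2.1) (ja3 : j.2.2 <= a.2.2).
Hypotheses (bk1 : b.1 <= k.1) (bk2 : b.2.1 <= k.2.1) (bk3 : b.2.2 <= k.2.2).
Local Notation eta := (bump3 n a b).

Let abO : obox3 a b `<=` O'.
Proof.
move=> y [/= + [/= + +]]; rewrite !in_itv /= => h1 h2 h3.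
by split; [|split]; rewrite /= in_itv /=; [exact: itv_shrink h1|exact: itv_shrink h2|exact: itv_shrink h3].
Qed.

Let eta0 y : ~ O' y -> eta y = 0.
Proof. by move=> h; apply: bump3_outside => /abO. Qed.

Let eta_smooth : exists2 g, elementary g & forall y, is_derive y v eta (g y).
Proof. by apply: elementary_derive; exact: elementary_bump3. Qed.

Let deta : continuous ('D_v eta).
Proof.
have [g eg Hg] := eta_smooth; have -> : 'D_v eta = g.
  by apply/funext => y; rewrite (@derive_val _ _ _ _ _ _ _ (Hg y)).
exact: elementary_continuous.
Qed.

Let eta_C1 : C1 setT eta.
Proof. by apply/Ck1_C1; apply: elementary_smooth; exact: elementary_bump3. Qed.

Let boundary y : y.1 = j.1 \/ y.1 = k.1 \/ y.2.1 = j.2.1 \/ y.2.1 = k.2.1 \/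
     y.2.2 = j.2.2 \/ y.2.2 = k.2.2 -> eta y = 0.
Proof.
move=> h; apply: eta0 => -[/= + [/= + +]]; rewrite !in_itv /= => h1 h2 h3.
by move: h; case=> [|[|[|[|[|]]]]] h; rewrite h ?ltxx ?andbF in h1 h2 h3.
Qed.

Let classical m : \int[leb3]_(y in B) (um m y * 'D_v eta y + eta y * 'D_v (um m) y) = 0.
Proof.
have P1 : C1 D (fun y => um m y * eta y).
  by apply: (C1_mul oD) => //; apply: C1_subset eta_C1.
have := ibp3_zero jk1 jk2 jk3 oD P1 BD vE.
have -> : \int[leb3]_(y in B) 'D_v (fun y => um m y * eta y) y = \int[leb3]_(y in B) (um m y * 'D_v eta y + eta y * 'D_v (um m) y).
  apply: eq_Rintegral => y /set_mem/BD Dy.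
  have [_ /(_ v)[/derivableP d1 _]] := um1 m Dy.
  have [_ /(_ v)[/derivableP d2 _]] := eta_C1 (Logic.I : setT y).
  by have [_ ->] := is_derive_mul d1 d2.
by apply => y _ /boundary ->; rewrite mulr0.
Qed.

Let Db : exists2 M : R, 0 <= M & forall y, B y -> `|'D_v eta y| <= M.
Proof.
have [_ [M HM]] := bm_cont deta; exists `|M| => // y By.
exact: le_trans (HM y By) (ler_norm M).
Qed.

(** The face functions are not known to be differentiable, so integration by parts is done for the
    approximations [um m] and passed to the limit. The tolerance is divided by the bound on the
    derivative of the bump and by the volume of the box. *)
Let limit : \int[leb3]_(y in B) (psi' y * 'D_v eta y + eta y * w y) = 0.
Proof.
have [M M0 HM] := Db; have vol0 : 0 <= fine (leb3 (B : set (mR * (mR * mR)))) by exact: fine_ge0.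
have beta : bm (B : set (mR * (mR * mR))) eta by apply: bm_cont; exact: (elementary_continuous (elementary_bump3 n a b)).
have bl := bm_add (bm_mul bpsi' (bm_cont deta)) (bm_mul beta bw).
apply/eqP; rewrite -normr_le0; apply/ler_addgt0Pl => e e0; rewrite addr0.
set vol := fine _ in vol0.
have e1 : 0 < e / ((M + 1) * (vol + 1)) by rewrite divr_gt0// mulr_gt0 ?ltr_wpDl.
have [m Hm] := um_cvg e1.
have bu : bm (B : set (mR * (mR * mR))) (fun y => um m y * 'D_v eta y + eta y * 'D_v (um m) y).
  have c1 y : D y -> {for y, continuous (um m)} by move=> /(um1 m)[].
  have c2 y : D y -> {for y, continuous ('D_v (um m))} by move=> /(um1 m)[_ /(_ v)[]].
  have b1 := bm_compact3 oD (@box3_compact _ _ _ _ _ _ _) BD mB c1.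
  have b2 := bm_compact3 oD (@box3_compact _ _ _ _ _ _ _) BD mB c2.
  exact: (bm_add (bm_mul b1 (bm_cont deta)) (bm_mul beta b2)).
rewrite -[X in `|X|]subr0 -(classical m) -(bm_RintegralB mB fB bl bu).
apply: (le_trans (le_normr_Rintegral mB (bm_integrable mB fB (bm_sub bl bu)))).
have bn : bm (B : set (mR * (mR * mR))) (fun y => `|psi' y * 'D_v eta y + eta y * w y - (um m y * 'D_v eta y + eta y * 'D_v (um m) y)|).
  have [m1 [N HN]] := bm_sub bl bu; split; first exact: measurableT_comp.
  by exists N => y /HN; rewrite normr_id.
apply: (le_trans (bm_le_Rintegral mB fB bn (bm_cst _ (e / (vol + 1))) _)).
  move=> y By; have [h1 h2] := Hm y By.
  exact: (test_error vol0 M0 (HM y By) (bump3_bound n a b y) h1 h2).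
by rewrite Rintegral_cst//; exact: scale_vol.
Qed.

Let outside y : ~ B y -> 'D_v eta y = 0.
Proof.
move=> nB; have cB : closed B by apply: compact_closed; [exact: norm_hausdorff|exact: box3_compact].
have nb : \forall x \near y, ~ B x.
  by apply: open_nbhs_nbhs; split; [exact: closed_openC|].
have : is_derive y v eta 0.
  apply: (is_derive_near _ (is_derive_cst (0 : R) y v)).
  by apply: filterS nb => x nBx; rewrite eta0// => /OB.
by case.
Qed.

(** The bump vanishes outside the open box, so the defining identity of the weak derivative of [psi]
    and the classical one for [psi'] concern the same region. Their left sides agree since psi' =
    psi almost everywhere, hence so do the right sides. *)
Lemma weak_test : (\int[leb3]_(y in O') ((G y - w y) * eta y)%:E = 0)%E.
Proof.
have beta : bm (B : set (mR * (mR * mR))) eta by apply: bm_cont; exact: (elementary_continuous (elementary_bump3 n a b)).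
have b1 := bm_mul bpsi' (bm_cont deta); have b2 := bm_mul beta bw.
have tf : test_function D eta by apply: bump3_test => //; apply: subset_trans abO (subset_trans OB BD).
have H := wd tf.
have L1 : (\int[leb3]_(y in to3 @^-1` D) (psi (to3 y) * 'D_v eta (to3 y))%:E =
    (\int[leb3]_(y in B) (psi' y * 'D_v eta y))%:E)%E.
  rewrite (@integral_support _ _ _ leb3 _ B (to3 @^-1` D)) //; last first.
    by move=> y _ /outside h; rewrite /to3 h mulr0.
  rewrite (bm_RintegralE mB fB b1); apply: ae_eq_integral => //.
  - apply/measurable_EFinP; apply: measurable_funM; last by have [] := bm_cont deta.
    exact: (measurable_funS mD BD mpsi).
  - by apply/measurable_EFinP; have [] := b1.
  - by apply: filterS ae_psi => y h By; rewrite h//; exact: BD.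
have L2 : (\int[leb3]_(y in to3 @^-1` D) (G (to3 y) * eta (to3 y))%:E =
    \int[leb3]_(y in O') (G y * eta y)%:E)%E.
  apply: integral_support; first exact: subset_trans OB BD.
  by move=> y _ /eta0 h; rewrite /to3 h mulr0.
have L3 : (\int[leb3]_(y in O') (w y * eta y)%:E = (\int[leb3]_(y in B) (eta y * w y))%:E)%E.
  rewrite (bm_RintegralE mB fB b2) (@integral_support _ _ _ leb3 _ O' B)//; last first.
    by move=> y _ /eta0 ->; rewrite mul0r.
  by apply: eq_integral => y _; rewrite mulrC.
have L4 := limit; rewrite (bm_RintegralD mB fB b1 b2) in L4.
have iw : (@leb3 R).-integrable (O' : set (mR * (mR * mR))) (EFin \o (fun y => w y * eta y)).
  by apply: (integrableS mB mO OB); exact: (bm_integrable mB fB (bm_mul bw beta)).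
have iGe : (@leb3 R).-integrable (O' : set (mR * (mR * mR))) (EFin \o (fun y => G y * eta y)).
  apply: (le_integrable mO _ _ iG).
    apply/measurable_EFinP; apply: measurable_funM => //.
    by have [me _] := beta; exact: (measurable_funS mB OB me).
  move=> y _; rewrite /= lee_fin normrM; have /andP[h0 h1] := bump3_bound n a b y.
  by rewrite (ger0_norm h0) ler_piMr.
under eq_integral => y _ do rewrite mulrBl EFinB.
rewrite (integralB_EFin mO iGe iw) L3.
move: H; rewrite L1 L2 => H.
have -> : (\int[leb3]_(y in O') (G y * eta y)%:E = (\int[leb3]_(y in B) (eta y * w y))%:E)%E.
  rewrite -[LHS]oppeK -H -EFinN; congr (_%:E); apply/eqP.
  by rewrite eqr_oppLR -addr_eq0 L4.
by rewrite -EFinB subrr.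
Qed.

End OneTest.
Let h y := (G y - w y)%:E.

Let ih : (@leb3 R).-integrable (O' : set (mR * (mR * mR))) h.
Proof.
have iw : (@leb3 R).-integrable (O' : set (mR * (mR * mR))) (EFin \o w).
  by apply: (integrableS mB mO OB); exact: (bm_integrable mB fB bw).
exact: (integrableB mO iG iw).
Qed.

Let hbox a b : (\int[leb3]_(y in obox3 a b) (h \_ O') y = 0)%E.
Proof.
(* The box is first intersected with the one from [j] to [k], so that the bumps are admissible test
   functions; bumps are indexed from 1 because the support condition needs n > 0. *)
pose a' : E3 := (Num.max j.1 a.1, (Num.max j.2.1 a.2.1, Num.max j.2.2 a.2.2)).
pose b' : E3 := (Num.min b.1 k.1, (Num.min b.2.1 k.2.1, Num.min b.2.2 k.2.2)).
have T n := @weak_test n.+1 a' b' isT (le_maxl _ _) (le_maxl _ _) (le_maxl _ _)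
  (le_minr _ _) (le_minr _ _) (le_minr _ _).
have mab : measurable (obox3 a b : set (mR * (mR * mR))).
  by apply: measurableX; [exact: measurable_itv|apply: measurableX; exact: measurable_itv].
rewrite -integral_mkcondr setIC integral_mkcondr.
pose f_ n y := (h y * (bump3 n.+1 a' b' y)%:E)%E.
have T' n : (\int[leb3]_(y in O') f_ n y = 0)%E.
  by rewrite -(T n); apply: eq_integral => y _; rewrite /f_ /h -EFinM.
have mh : measurable_fun (O' : set (mR * (mR * mR))) h := measurable_int _ ih.
have mf n : measurable_fun (O' : set (mR * (mR * mR))) (f_ n).
  apply: emeasurable_funM => //; apply/measurable_EFinP.
  have [me _] := bm_cont (elementary_continuous (elementary_bump3 n.+1 a' b')).
  exact: (measurable_funS mB OB me).
have mfl : measurable_fun (O' : set (mR * (mR * mR))) (h \_ (obox3 a b)).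
  by apply/(measurable_restrict h mab mO); apply: (measurable_funS mO _ mh) => y [].
have iabs : (@leb3 R).-integrable (O' : set (mR * (mR * mR))) (abse \o h) := integrable_abse ih.
have c1 : {ae leb3, forall y, O' y -> f_ ^~ y @ \oo --> (h \_ (obox3 a b)) y}.
  apply: aeW => y Oy; rewrite /restrict; case: ifPn => [/set_mem ab|/negP nab].
    have aby : obox3 a' b' y.
      move: Oy ab => [/= + [/= + +]] [/= + [/= + +]]; rewrite !in_itv /= => /andP[? ?] /andP[? ?] /andP[? ?] /andP[? ?] /andP[? ?] /andP[? ?].
      by split; [|split]; rewrite /= in_itv /= gt_max lt_min; apply/andP; split; apply/andP.
    have c : (fun n => (G y - w y) * bump3 n.+1 a' b' y) @ \oo --> (G y - w y).
      rewrite -[X in _ --> X]mulr1; apply: cvgM; first exact: cvg_cst.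
      have := bump3_cvg aby; rewrite -(cvg_shiftS (fun n => bump3 n a' b' y)); exact.
    apply: (cvg_trans _ (cvg_EFin_comp c)) => //.
  have -> : (fun n => f_ n y) = cst 0%E.
    apply/funext => n; rewrite /f_ bump3_outside ?mule0// => -[/= + [/= + +]]; rewrite !in_itv /= => h1 h2 h3.
    apply: nab; apply: mem_set; move: h1 h2 h3; rewrite !gt_max !lt_min.
    by move=> /andP[/andP[_ ?] /andP[? _]] /andP[/andP[_ ?] /andP[? _]] /andP[/andP[_ ?] /andP[? _]]; split; [|split]; rewrite /= in_itv /=; apply/andP.
  exact: cvg_cst.
have c2 : {ae leb3, forall y n, O' y -> (`|f_ n y| <= (abse \o h) y)%E}.
  apply: aeW => y n Oy; rewrite /f_ abseM /=; have /andP[h0 h1] := bump3_bound n.+1 a' b' y.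
  by rewrite -EFinM lee_fin (ger0_norm h0) ler_piMr.
have [_ _] := dominated_convergence mO mf mfl c1 iabs c2.
have -> : [sequence (\int[leb3]_(y in O') f_ n y)%E]_n = cst 0%E by apply/funext => n; exact: T'.
by move=> /cvg_lim <- //; rewrite lim_cst.
Qed.

(* Products of ramps are test functions that increase to the indicator of an
   open box; they identify w with the weak derivative G almost everywhere. *)
Lemma weak_trace : (\int[leb3]_(y in O') ((w y) ^+ 2)%:E <= \int[leb3]_(y in to3 @^-1` D) ((G (to3 y)) ^+ 2)%:E)%E.
Proof.
have iF : (@leb3 R).-integrable setT (h \_ O') by apply/(integrable_mkcond _ mO).
have F0 y : ~ O' y -> (h \_ O') y = 0%E by move=> nO; rewrite /restrict ifF//; apply/negP => /set_mem.
have Z A mA := @null_integral3 R (h \_ O') iF j k F0 hbox A mA.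
have ae0 : ae_eq leb3 (O' : set (mR * (mR * mR))) h (cst 0%E).
  apply: (integral_ae_eq mO ih) => [|A AO mA]; first exact: measurable_cst.
  rewrite integral0 -(Z A mA) -integral_mkcondr; congr (integral _ _ _).
  by apply/esym/setIidPl.
have -> : (\int[leb3]_(y in O') (w y ^+ 2)%:E = \int[leb3]_(y in O') (G y ^+ 2)%:E)%E.
  have mw : measurable_fun (O' : set (mR * (mR * mR))) w by have [mw _] := bw; exact: (measurable_funS mB OB mw).
  apply: ae_eq_integral => //.
  - by apply/measurable_EFinP; exact: measurable_funX.
  - by apply/measurable_EFinP; exact: measurable_funX.
  - by apply: filterS ae0 => y H /H /eqP; rewrite /h /= eqe subr_eq0 => /eqP ->.
apply: ge0_subset_integral => //; last exact: subset_trans OB BD.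
  by apply/measurable_EFinP; exact: measurable_funX.
by move=> y _; rewrite lee_fin sqr_ge0.
Qed.

End WeakTrace.

(** * The estimate in a slab *)

Section CompareProduct.
Context {R : realType} (At : sphere_atlas R).
Local Notation mR := (measurableTypeR R).
Local Notation E2 := (R * R)%type.
Local Notation K := (chart_index At).
Context d1 (T1 : measurableType d1) (m1 : {sigma_finite_measure set T1 -> \bar R}).
Variables (J : seq (bump_box At)) (A : set T1) (GG : K -> T1 * (mR * mR) -> R) (c : R).
Hypotheses (mA : measurable A) (c0 : 0 <= c).
Hypothesis Jdom : forall j, j \in J -> 0 < j.2 /\ sqc j.1.2 j.2 `<=` chart_dom j.1.1.
Hypothesis mG : forall k, measurable_fun (A `*` (chart_dom k : set (mR * mR))) (GG k).
Hypothesis G0 : forall k q, (A `*` (chart_dom k : set (mR * mR))) q -> 0 <= GG k q.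

Local Notation half j := (sq j.1.2 (j.2 / 2)).

Lemma half_dom j : j \in J -> half j `<=` chart_dom j.1.1.
Proof.
by move=> /Jdom[r0 h] x hx; apply: h; apply: (sq_sqc r0).
Qed.

Lemma half_measurable (j : bump_box At) : measurable (half j : set (mR * mR)).
Proof. by apply: open_measurable2; exact: sq_open. Qed.

Lemma chart_dom_measurable (k : K) : measurable (chart_dom k : set (mR * mR)).
Proof. by apply: open_measurable2; exact: (@chart_dom_open R At k). Qed.

(** Tonelli integrates a comparison that holds on the sphere for each fixed parameter [b]. *)
Lemma compare_product k :
  (forall b, A b -> \int[leb2]_(x in (chart_dom k : set (mR * mR))) (GG k (b, x))%:E <=
    c%:E * \sum_(j <- J) \int[leb2]_(y in (half j : set (mR * mR))) (GG j.1.1 (b, y))%:E)%E ->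
  (\int[m1 \x leb2]_(q in A `*` (chart_dom k : set (mR * mR))) (GG k q)%:E <=
    c%:E * \sum_(j <- J) \int[m1 \x leb2]_(q in A `*` (half j : set (mR * mR))) (GG j.1.1 q)%:E)%E.
Proof.
move=> H.
have mH j : j \in J -> measurable_fun (A `*` (half j : set (mR * mR))) (GG j.1.1).
  move=> jJ; have mAD := measurableX mA (chart_dom_measurable j.1.1).
  have sub : (A `*` (half j : set (mR * mR))) `<=` (A `*` (chart_dom j.1.1 : set (mR * mR))).
    by move=> [x y] [/= ? ?]; split => //=; exact: half_dom.
  exact: (measurable_funS mAD sub (@mG j.1.1)).
have H0 j q : j \in J -> (A `*` (half j : set (mR * mR))) q -> 0 <= GG j.1.1 q.
  by move=> jJ [h1 h2]; apply: G0; split => //; exact: half_dom.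
have mE B (g : T1 * (mR * mR) -> R) : measurable_fun (A `*` B) g -> measurable_fun (A `*` B) (EFin \o g).
  by move=> mg; exact/measurable_EFinP.
have [-> _] := @tonelli_rect R _ _ _ _ m1 leb2 A _ mA (chart_dom_measurable k) (fun q => (GG k q)%:E)
  (mE _ _ (@mG k)) (fun z hz => (G0 hz : 0 <= (GG k z)%:E)%E).
have tj j : j \in J -> (\int[m1 \x leb2]_(q in A `*` (half j : set (mR * mR))) (GG j.1.1 q)%:E =
    \int[m1]_(b in A) \int[leb2]_(y in (half j : set (mR * mR))) (GG j.1.1 (b, y))%:E)%E.
  move=> jJ; have [-> //] := @tonelli_rect R _ _ _ _ m1 leb2 A _ mA (half_measurable j) (fun q => (GG j.1.1 q)%:E)
    (mE _ _ (@mH _ jJ)) (fun z hz => (H0 _ _ jJ hz : 0 <= (GG j.1.1 z)%:E)%E).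
have mj j : j \in J -> measurable_fun A (fun b => \int[leb2]_(y in (half j : set (mR * mR))) (GG j.1.1 (b, y))%:E)%E.
  move=> jJ; exact: (@tonelli_measurable1 R _ _ _ _ leb2 A _ mA (half_measurable j) (fun q => (GG j.1.1 q)%:E)
    (mE _ _ (@mH _ jJ)) (fun z hz => (H0 _ _ jJ hz : 0 <= (GG j.1.1 z)%:E)%E)).
have p0 j b : j \in J -> A b -> (0 <= \int[leb2]_(y in (half j : set (mR * mR))) (GG j.1.1 (b, y))%:E)%E.
  by move=> jJ Ab; apply: integral_ge0 => y hy; rewrite lee_fin; exact: H0.
(* Extended by 0 outside [J], since measurability and sign of the inner integral are available only
   for squares of the cover. *)
pose p j b := (if j \in J then \int[leb2]_(y in (half j : set (mR * mR))) (GG j.1.1 (b, y))%:E else 0)%E.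
have mp j : measurable_fun A (p j).
  by rewrite /p; case: (boolP (j \in J)) => [/mj //|_]; exact: measurable_cst.
have pp j b : A b -> (0 <= p j b)%E.
  by move=> Ab; rewrite /p; case: (boolP (j \in J)) => [jJ|//]; exact: p0.
rewrite (eq_big_seq (fun j => \int[m1]_(b in A) p j b)%E); last first.
  by move=> j jJ; rewrite tj//; apply: eq_integral => b _; rewrite /p jJ.
have mS : measurable_fun A (fun b => \sum_(j <- J) p j b)%E by exact: emeasurable_sum.
have S0 b : A b -> (0 <= \sum_(j <- J) p j b)%E by move=> Ab; apply: sume_ge0 => j _; exact: pp.
rewrite -(ge0_integral_sum m1 mA mp pp).
have -> : (c%:E * \int[m1]_(b in A) \sum_(j <- J) p j b = \int[m1]_(b in A) (c%:E * \sum_(j <- J) p j b))%E.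
  by rewrite ge0_integralZl_EFin.
apply: ge0_le_integral => //.
- by move=> b Ab; apply: integral_ge0 => x hx; rewrite lee_fin; exact: G0.
- exact: (@tonelli_measurable1 R _ _ _ _ leb2 A _ mA (chart_dom_measurable k) (fun q => (GG k q)%:E)
    (mE _ _ (@mG k)) (fun z hz => (G0 hz : 0 <= (GG k z)%:E)%E)).
- by apply: measurable_funeM.
- move=> b Ab; apply: (le_trans (H b Ab)); apply: lee_wpmul2l; first by rewrite lee_fin.
  by rewrite le_eqVlt; apply/orP; left; apply/eqP; apply: eq_big_seq => j jJ; rewrite /p jJ.
Qed.

End CompareProduct.

Lemma compare_squares (R : realType) (s u a b p q p' q' : R) :
  p ^+ 2 <= 2 * s ^+ 2 * (p' ^+ 2 + q' ^+ 2) -> q ^+ 2 <= 2 * s ^+ 2 * (p' ^+ 2 + q' ^+ 2) ->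
  u ^+ 2 + (a ^+ 2 + b ^+ 2 + p ^+ 2 + q ^+ 2) <=
  (1 + 4 * s ^+ 2) * (u ^+ 2 + (a ^+ 2 + b ^+ 2 + p' ^+ 2 + q' ^+ 2)).
Proof.
move=> h1 h2; have := mulr_ge0 (sqr_ge0 s) (sqr_ge0 u); have := mulr_ge0 (sqr_ge0 s) (sqr_ge0 a).
have := mulr_ge0 (sqr_ge0 s) (sqr_ge0 b); have := sqr_ge0 p'; have := sqr_ge0 q'; lra.
Qed.

Section EnergyCompare.
Context {R : realType} (At : sphere_atlas R).
Local Notation E2 := (R * R)%type.
Local Notation E4 := ((R * R) * (R * R))%type.
Local Notation K := (chart_index At).

Lemma sq_compare (Lip a p q : R) : 0 < Lip -> `|a| <= Lip * (`|p| + `|q|) ->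
  a ^+ 2 <= 2 * Lip ^+ 2 * (p ^+ 2 + q ^+ 2).
Proof.
move=> L0 h; rewrite -(real_normK (num_real a)) -(real_normK (num_real p)) -(real_normK (num_real q)).
have h2 : `|a| ^+ 2 <= (Lip * (`|p| + `|q|)) ^+ 2.
  by rewrite ler_pXn2r ?nnegrE// mulr_ge0 ?addr_ge0// ltW.
have := mulr_ge0 (sqr_ge0 Lip) (sqr_ge0 (`|p| - `|q|)); lra.
Qed.

Lemma base_Omega_open (T z0 : R) : open (base_Omega T z0).
Proof.
have op (f : E2 -> R) (a b : R) : continuous f -> open [set x | a < f x < b].
  move=> cf; have -> : [set x | a < f x < b] = f @^-1` `]a, b[%classic.
    by apply/seteqP; split=> x /=; rewrite in_itv.
  by apply: open_comp => [x _|]; [exact: cf|exact: interval_open].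
have -> : base_Omega T z0 = [set x | 0 < x.1 < T] `&` [set x | 0 < x.2 < z0] by [].
by apply: openI; apply: op => x; [exact: pt_fst|exact: pt_snd].
Qed.

Lemma cyl_open (A : set E2) (k : K) : open A -> open (cyl A k : set E4).
Proof.
move=> oA; have -> : cyl A k = fst @^-1` A `&` snd @^-1` (chart_dom k) by [].
apply: openI; (apply: open_comp; first by move=> x _; first [exact: pt_fst|exact: pt_snd]) => //.
exact: (@chart_dom_open R At k).
Qed.

Variables (A : set E2) (v : E2 -> 'rV[R]_3 -> R) (Lip : R).
Hypotheses (oA : open A) (L0 : 0 < Lip).
Hypothesis lip : forall (k l : K) x x' y y', chart_dom k x -> chart_dom k x' -> chart_dom l y -> chart_dom l y' ->
  chart_rel k l x y -> chart_rel k l x' y' -> `|x - x'| <= Lip * `|y - y'|.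
Hypothesis v1 : forall k : K, C1 (cyl A k) (pull k v).

Lemma pull_derive1 (k : K) b x w : 'D_(w, 0) (pull k v) (b, x) = 'D_w (fun c => v c (chart k x)) b.
Proof. by rewrite -derive_sec1. Qed.

Lemma pull_derive2 (k : K) b x w : 'D_(0, w) (pull k v) (b, x) = 'D_w (fun y => v b (chart k y)) x.
Proof. by rewrite -derive_sec2. Qed.

Lemma pull_derive1_rel (k l : K) b x y w : chart_rel k l x y ->
  'D_(w, 0) (pull k v) (b, x) = 'D_(w, 0) (pull l v) (b, y).
Proof. by move=> h; rewrite !pull_derive1 h. Qed.

(** The value and the tau- and z-derivatives are the same in both charts; only the two sphere
    derivatives change, and [gradient_compare] bounds each of them. *)
Lemma energy_compare (k l : K) b x y : A b -> chart_dom k x -> chart_dom l y -> chart_rel k l x y ->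
  energy (pull k v) (b, x) <= (1 + 4 * Lip ^+ 2) * energy (pull l v) (b, y).
Proof.
move=> Ab kx ly r.
have C1s (k' : K) : C1 (chart_dom k') (fun y => v b (chart k' y)).
  by move=> z kz; have h := @C1_sec2 R _ _ _ _ b (@v1 k'); apply: h; split.
have sec e : `|e| <= 1 -> `|'D_(0, e) (pull k v) (b, x)| <=
    Lip * (`|'D_(0, (1, 0)) (pull l v) (b, y)| + `|'D_(0, (0, 1)) (pull l v) (b, y)|).
  move=> e1; rewrite !pull_derive2.
  apply: (gradient_compare L0 _ (C1s k) (C1s l) kx ly r e1) => z z' t t' kz kz' lt lt' r1 r2.
  exact: lip lt lt' kz kz' (esym r1) (esym r2).
have [n1 n2] : `|(1, 0) : E2| <= 1 /\ `|(0, 1) : E2| <= 1.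
  by split; rewrite [leLHS]/Num.norm /= ge_max normr0 normr1 lexx ler01.
have g0 : grad (pull k v) (b, x) (inord 0) = grad (pull l v) (b, y) (inord 0).
  by rewrite /grad e4_0; exact: pull_derive1_rel.
have g1 : grad (pull k v) (b, x) (inord 1) = grad (pull l v) (b, y) (inord 1).
  by rewrite /grad e4_1; exact: pull_derive1_rel.
have g2 := sq_compare L0 (sec _ n1); have g3 := sq_compare L0 (sec _ n2).
have u : pull k v (b, x) = pull l v (b, y) by rewrite /pull /= r.
rewrite /energy !sum4 g0 g1 u /grad e4_2 e4_3.
move: g2 g3; rewrite -[((0, 0), _)]/((0 : E2), (_ : E2)).
move: ('D_(0, (1, 0)) (pull k v) (b, x)) ('D_(0, (0, 1)) (pull k v) (b, x)) => p q.
move: ('D_(0, (1, 0)) (pull l v) (b, y)) ('D_(0, (0, 1)) (pull l v) (b, y)) => p' q' g2 g3.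
apply: compare_squares g2 g3.
Qed.

End EnergyCompare.

Lemma error_bound (R : realType) (W E Cp e p f : R) : 0 <= W -> W <= E -> 0 <= Cp ->
  p ^+ 2 <= Cp * (f ^+ 2 + e) -> 0 <= e ->
  W * (e + p ^+ 2) <= (1 + Cp) * (W * e) + Cp * E * f ^+ 2.
Proof.
move=> W0 WE Cp0 h e0.
have h1 : W * p ^+ 2 <= W * (Cp * (f ^+ 2 + e)) by rewrite ler_wpM2l.
have h2 : (Cp * f ^+ 2) * W <= (Cp * f ^+ 2) * E by rewrite ler_wpM2l// mulr_ge0 ?sqr_ge0.
lra.
Qed.

Lemma sum_estimate (R : realType) (I : eqType) (J : seq I) (a l i t : I -> R) (k1 k2 k3 p q Q : R) :
  (forall j, j \in J -> k1 * a j + k2 * l j <= k3 * (p * i j + q * t j) + Q) ->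
  k1 * (\sum_(j <- J) a j) + k2 * (\sum_(j <- J) l j) <=
  k3 * (p * (\sum_(j <- J) i j) + q * (\sum_(j <- J) t j)) + (size J)%:R * Q.
Proof.
elim: J => [|x J IH] H; first by rewrite !big_nil !mulr0 !addr0 mul0r mulr0.
have := H x (mem_head _ _); have := IH (fun j jJ => H j (mem_behead (s := x :: J) jJ)).
rewrite !big_cons /= -natr1 => h1 h2; lra.
Qed.

Lemma bm_Rintegral_subset (R : realType) d (X : measurableType d) (mu : {measure set X -> \bar R})
  (A B : set X) (f : X -> R) : measurable A -> measurable B -> (mu B < +oo)%E -> A `<=` B ->
  bm B f -> (forall x, B x -> 0 <= f x) -> \int[mu]_(x in A) f x <= \int[mu]_(x in B) f x.
Proof.
move=> mA mB fB AB bf f0.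
have fA : (mu A < +oo)%E by apply: le_lt_trans fB; apply: le_measure; rewrite ?inE.
rewrite -lee_fin (bm_RintegralE mA fA (bm_subset mB mA AB bf)) (bm_RintegralE mB fB bf).
by apply: ge0_subset_integral => //; apply/measurable_EFinP; case: bf.
Qed.

Lemma weighted_le (R : realType) (W rho E RR C s u : R) : 0 <= W -> W <= E -> 0 <= rho -> rho <= RR ->
  0 <= C -> 0 <= s -> 0 <= u -> W * rho * (C * s + u) <= E * RR * ((C + 1) * (s + u)).
Proof.
move=> W0 WE r0 rR C0 s0 u0; apply: ler_pM => //; first exact: mulr_ge0.
- by rewrite addr_ge0// mulr_ge0.
- exact: ler_pM.
- by have := mulr_ge0 C0 u0; lra.
Qed.

Lemma combine_box (R : realType) (rate c mm z A A' Fc Fc' I I' T T' E RR C er rr X Y : R) :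
  0 <= rate * c -> 0 <= c * z -> mm * A' <= A -> mm * Fc' <= Fc ->
  I <= E * RR * ((C + 1) * I') -> C * T <= C * (E * RR * T') -> 0 <= er -> 0 <= X -> rr <= RR -> 0 <= RR -> X <= Y ->
  rate * c * A + c * z * Fc <= I + C * T + er * rr * X ->
  rate * c * mm * A' + c * z * mm * Fc' <= E * RR * ((C + 1) * I' + C * T') + er * RR * Y.
Proof.
move=> rc cz h1 h2 h3 h4 e0 X0 rR R0 XY.
have k1 : rate * c * (mm * A') <= rate * c * A by rewrite ler_wpM2l.
have k2 : c * z * (mm * Fc') <= c * z * Fc by rewrite ler_wpM2l.
have k3 : er * (rr * X) <= er * (RR * Y).
  rewrite ler_wpM2l//; apply: (@le_trans _ _ (RR * X)); first by rewrite ler_wpM2r.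
  by rewrite ler_wpM2l.
lra.
Qed.

Lemma final_sum (R : realType) (k er RR p n q A z L D Q : R) :
  k = er * RR * (p * (n * q)) + 1 ->
  k * A + z * L <= D + n * (er * RR * (p * (q * A) + Q)) ->
  A + z * L <= D + er * RR * n * Q.
Proof. by move=> -> h; lra. Qed.

Lemma eq_ler (R : realType) (a b : R) : a = b -> a <= b.
Proof. by move=> ->. Qed.

Section Global.
Context {R : realType} (At : sphere_atlas R).
Local Notation mR := (measurableTypeR R).
Local Notation E2 := (R * R)%type.
Local Notation E3 := (R * (R * R))%type.
Local Notation E4 := ((R * R) * (R * R))%type.
Local Notation K := (chart_index At).

Definition null_current_bound (M L z0 beta K N c C : R) : Prop :=
  forall (G : 'M[R]_4) (w : 'I_4 -> R) z V, null_inverse L G -> (forall i j, `|G i j| <= M) ->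
  G (inord 1) (inord 1) = z ^+ 2 * V -> 0 <= z <= z0 -> 1 / 2 <= V <= 3 / 2 ->
  let F := current beta G w in let S := \sum_(i < 4) w i ^+ 2 in
  [/\ 0 <= F (inord 1) - K * z ^+ 2 * F (inord 0),
      c * S <= F (inord 1) - N * F (inord 0),
      0 <= - F (inord 0) /\
        - F (inord 0) <= C * (w (inord 1) ^+ 2 + w (inord 2) ^+ 2 + w (inord 3) ^+ 2),
      F (inord 1) + c * z ^+ 2 * w (inord 1) ^+ 2 <=
        C * (w (inord 0) ^+ 2 + w (inord 2) ^+ 2 + w (inord 3) ^+ 2) &
      (forall i, `|F i| <= C * S) /\ mult_dir beta w ^+ 2 <= C * S].

(* mm bounds box_weight from below on the half-size squares, RR bounds it and
   its gradient on the full ones. *)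
Record good_cover (J : seq (bump_box At)) (mm RR Lip : R) : Prop := GoodCover {
  cover_dom : forall j, j \in J -> 0 < j.2 /\ sqc j.1.2 j.2 `<=` chart_dom j.1.1 ;
  cover_sphere : forall p, sphere p -> exists2 j, j \in J &
     exists2 y, sq j.1.2 (j.2 / 2) y & chart j.1.1 y = p ;
  cover_lower : 0 < mm /\ forall j, j \in J -> mm <= (3 / 4 * j.2 ^+ 2) ^+ 2 ;
  cover_upper : 0 <= RR /\ forall j, j \in J -> j.2 ^+ 4 + 2 * j.2 ^+ 3 <= RR ;
  cover_lip : 0 < Lip /\ forall (k l : K) x x' y y',
    chart_dom k x -> chart_dom k x' -> chart_dom l y -> chart_dom l y' ->
    chart_rel k l x y -> chart_rel k l x' y' -> `|x - x'| <= Lip * `|y - y'| }.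

Variables (T z0 M L Lip beta Kc N c C Cp mm RR : R) (J : seq (bump_box At)).
Hypotheses (T0 : 0 < T) (z00 : 0 < z0) (M0 : 0 <= M) (b0 : 0 < beta) (K0 : 0 < Kc) (N0 : 0 < N)
  (c0 : 0 < c) (cN : c <= N) (C0 : 0 < C) (Cp0 : 0 <= Cp).
Hypothesis Hcur : null_current_bound M L z0 beta Kc N c C.
Hypothesis HJ : good_cover J mm RR Lip.

(** The coefficient 2 C + C' + 1 of the error in [weighted_bound], with C' the constant of
    [divergence_bound]. *)
Definition err_const : R := 2 * C + (C / 2 + 2 * (1 + beta) * M) + 1.
(** The first factor is the loss in the measure comparison, the second the loss in the pointwise
    comparison of energies. *)
Definition cmp_const : R := (2 * Lip) ^+ 2 * (1 + 4 * Lip ^+ 2).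
(** The exponent mu. It is chosen so that rate c mm exceeds by exactly 1 the coefficient with which
    the energies on the half-size squares return in the summed error. *)
Definition rate : R :=
  (err_const * RR * ((1 + Cp) * ((size J)%:R * cmp_const)) + 1) / (c * mm).
Definition weight_max : R := expR (rate * z0).

Local Notation Om := (base_Omega T z0).
Local Notation S j := (sqc j.1.2 j.2).
Local Notation half j := (sq j.1.2 (j.2 / 2)).

Variables (G : K -> E4 -> 'M[R]_4) (v : E2 -> 'rV[R]_3 -> R) (V f : K -> E4 -> R) (F : R).
Hypothesis G1 : forall (k : K) i j, C1 (cyl Om k) (fun q => G k q i j).
Hypothesis v2 : forall (k : K), Ck_on 2 (cyl Om k) (pull k v).
Hypothesis GN : forall (k : K) q, cyl Om k q -> null_inverse L (G k q).
Hypothesis GM : forall (k : K) q i j, cyl Om k q -> `|G k q i j| <= M.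
Hypothesis dGM : forall (k : K) q i j l, cyl Om k q -> `|'D_(e4 l) (fun q => G k q i j) q| <= M.
Hypothesis GV : forall (k : K) q, cyl Om k q -> G k q (inord 1) (inord 1) = q.1.2 ^+ 2 * V k q.
Hypothesis VB : forall (k : K) q, cyl Om k q -> 1 / 2 <= V k q <= 3 / 2.
Hypothesis mf : forall (k : K), measurable_on to4 (cyl Om k) (f k).
Hypothesis F0 : 0 <= F.
Hypothesis fF : forall (k : K), (\int[leb4]_(q in to4 @^-1` (cyl Om k)) ((f k (to4 q)) ^+ 2)%:E <= F%:E)%E.
Hypothesis Pf : forall (k : K), {ae leb4, forall q, cyl Om k (to4 q) ->
  principal (G k) (pull k v) (to4 q) ^+ 2 <= Cp * (f k (to4 q) ^+ 2 + energy (pull k v) (to4 q))}.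

Lemma cmp_const_ge0 : 0 <= cmp_const.
Proof.
apply: mulr_ge0; first exact: sqr_ge0.
by apply: addr_ge0 => //; apply: mulr_ge0 => //; exact: sqr_ge0.
Qed.

Lemma rate_ge0 : 0 <= rate.
Proof.
have [mm0 _] := cover_lower HJ; have [R0 _] := cover_upper HJ; have [L0 _] := cover_lip HJ.
have e0 : 0 <= err_const.
  by rewrite /err_const !addr_ge0// ?mulr_ge0 ?addr_ge0 ?invr_ge0// ltW.
apply: divr_ge0; last by rewrite mulr_ge0// ltW.
apply: addr_ge0 => //; apply: mulr_ge0; first exact: mulr_ge0.
apply: mulr_ge0; first by rewrite addr_ge0.
by apply: mulr_ge0 => //; exact: cmp_const_ge0.
Qed.

Lemma cylOm_open (k : K) : open (cyl Om k : set E4).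
Proof. by apply: cyl_open; exact: base_Omega_open. Qed.

Lemma energy_C1 (k : K) : C1 (cyl Om k) (energy (pull k v)).
Proof.
have oD := @cylOm_open k.
have sq (g : E4 -> R) : C1 (cyl Om k) g -> C1 (cyl Om k) (fun q => g q ^+ 2) by move=> f1; exact: (C1_mul oD f1 f1).
apply: (C1_add oD (sq _ (Ck2_C1 (@v2 k)))); apply: (C1_sum oD) => i.
by apply: (sq (fun q => grad (pull k v) q i)); exact: Ck2_D_C1.
Qed.

Lemma energy_ge0 (u : E4 -> R) q : 0 <= energy u q.
Proof. by rewrite addr_ge0 ?sqr_ge0// sumr_ge0// => i _; exact: sqr_ge0. Qed.

Section Slab.
Variables (eps t1 t2 z1 : R).
Hypotheses (eps0 : 0 < eps) (t10 : 0 < t1) (t12 : t1 < t2) (t2T : t2 < T) (ez : eps < z1) (zz : z1 < z0).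
Local Notation W := (time_weight rate N Kc eps).
Local Notation base := (box2 t1 t2 eps z1).

Let base_Om : base `<=` Om.
Proof. move=> b [/=]; rewrite !in_itv /= => /andP[h1 h2] /andP[h3 h4]; split.
  by rewrite (lt_le_trans t10 h1) (le_lt_trans h2 t2T).
by rewrite (lt_le_trans eps0 h3) (le_lt_trans h4 zz). Qed.

Let W_C1 (k : K) : C1 (cyl Om k) (fun q => W q.1).
Proof.
apply: (C1_lift1 (@cylOm_open k) _ (@time_weight_C1 R rate N Kc eps)) => q [[_ /andP[h _]] _]; exact: h.
Qed.

Let WE_C1 (k : K) : C1 (cyl Om k) (fun q => W q.1 * energy (pull k v) q).
Proof. exact: (C1_mul (@cylOm_open k) (@W_C1 k) (@energy_C1 k)). Qed.

Let base_meas : measurable (base : set (mR * mR)) := box2_measurable _ _ _ _.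
Let boxm A : measurable (A : set (mR * mR)) -> measurable (base `*` A : set ((mR * mR) * (mR * mR))).
Proof. by move=> mA; exact: measurableX. Qed.

Definition slab_energy (j : bump_box At) : R :=
  \int[leb4]_(q in base `*` half j) (W q.1 * energy (pull j.1.1 v) q).

Let boxS_dom (j : bump_box At) : j \in J -> base `*` S j `<=` cyl Om j.1.1.
Proof. by move=> jJ [b x] [/base_Om h1 h2]; split => //=; exact: (cover_dom HJ jJ).2. Qed.

Let bmS (j : bump_box At) (g : E4 -> R) : j \in J -> C1 (cyl Om j.1.1) g ->
  bm (base `*` S j : set ((mR * mR) * (mR * mR))) g.
Proof. by move=> jJ g1; apply: (box4_bm (@cylOm_open _) (boxS_dom jJ)) => x /g1[]. Qed.

Let mS (j : bump_box At) : measurable (base `*` S j : set ((mR * mR) * (mR * mR))) := boxm (box2_measurable _ _ _ _).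
Let fS (j : bump_box At) : (leb4 (base `*` S j : set ((mR * mR) * (mR * mR))) < +oo)%E :=
  leb4_finite base_meas (box2_measurable _ _ _ _) (box2_finite _ _ _ _) (box2_finite _ _ _ _).
Let mH (j : bump_box At) : measurable (base `*` half j : set ((mR * mR) * (mR * mR))) := boxm (half_measurable j).
Let HS (j : bump_box At) : j \in J -> base `*` half j `<=` base `*` S j.
Proof. by move=> jJ [b x] [h1 h2]; split => //; apply: sq_sqc h2; exact: (cover_dom HJ jJ).1. Qed.
Let fH (j : bump_box At) : j \in J -> (leb4 (base `*` half j : set ((mR * mR) * (mR * mR))) < +oo)%E.
Proof. by move=> jJ; apply: le_lt_trans (fS j); apply: le_measure; rewrite ?inE//; exact: HS. Qed.

Let bmH (j : bump_box At) (g : E4 -> R) : j \in J -> C1 (cyl Om j.1.1) g ->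
  bm (base `*` half j : set ((mR * mR) * (mR * mR))) g.
Proof. by move=> jJ g1; apply: (bm_subset (mS j) (mH j) (HS jJ)); exact: bmS. Qed.

Let slab_energyE (j : bump_box At) : j \in J -> (slab_energy j)%:E =
  (\int[leb4]_(q in base `*` half j) (W q.1 * energy (pull j.1.1 v) q)%:E)%E.
Proof. by move=> jJ; apply: (bm_RintegralE (mH j) (fH jJ)); exact: bmH. Qed.

(** At fixed (tau, z) the time weight is a constant, so [chart_integral_le] applies to the weighted
    energy on the sphere; the result is then integrated over the rectangle. *)
Lemma slab_compare (k : K) : (\int[leb4]_(q in base `*` (chart_dom k : set (mR * mR))) (W q.1 * energy (pull k v) q)%:E <=
  (cmp_const * \sum_(j <- J) slab_energy j)%:E)%E.
Proof.
have [L0 lip] := cover_lip HJ.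
have meas (l : K) : measurable_fun (base `*` (chart_dom l : set (mR * mR)) : set ((mR * mR) * (mR * mR)))
    (fun q => W q.1 * energy (pull l v) q).
  have oD := @cylOm_open l.
  have := @continuous_on_measurable R _ _ _ (cyl Om l) (@to4 R) _ (@open_measurable4 R) oD (fun x Dx => (@WE_C1 l x Dx).1).
  apply: measurable_funS; first exact: open_measurable4.
  by move=> [b x] [/base_Om h1 h2]; split.
have pos (l : K) q : (base `*` (chart_dom l : set (mR * mR)) : set ((mR * mR) * (mR * mR))) q -> 0 <= W q.1 * energy (pull l v) q.
  by move=> _; apply: mulr_ge0; [exact: time_weight_ge0|exact: energy_ge0].
have H := @compare_product R At _ (mR * mR)%type leb2 J base (fun k q => W q.1 * energy (pull k v) q) cmp_const
  base_meas cmp_const_ge0 (cover_dom HJ) meas pos k.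
rewrite EFinM -sumEFin (eq_big_seq _ slab_energyE); apply: H => b Ab.
have Ob := base_Om Ab.
have e1 (l : K) x : chart_dom l x -> {for x, continuous (fun x => W b * energy (pull l v) (b, x))}.
  by move=> lx; have [] := @C1_sec2 R _ _ _ _ b (@WE_C1 l) x (conj Ob lx).
apply: (chart_integral_le (G := fun l x => W b * energy (pull l v) (b, x)) (cover_dom HJ) (cover_sphere HJ) L0) => //.
- by apply: addr_ge0 => //; apply: mulr_ge0 => //; exact: sqr_ge0.
- by move=> l x lx; apply: mulr_ge0; [exact: time_weight_ge0|exact: energy_ge0].
- move=> l x y kx ly r; rewrite mulrCA; apply: ler_wpM2l; first exact: time_weight_ge0.
  exact: (energy_compare L0 lip (fun k => Ck2_C1 (@v2 k)) Ob kx ly r).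
Qed.

Let bm_principal (j : bump_box At) : j \in J ->
  bm (base `*` S j : set ((mR * mR) * (mR * mR))) (principal (G j.1.1) (pull j.1.1 v)).
Proof.
move=> jJ; have oD := @cylOm_open j.1.1.
apply: bm_sum => i; apply: (box4_bm oD (boxS_dom jJ)) => x Dx.
have h := raise_C1 oD (@G1 j.1.1) (@v2 j.1.1) i.
by have [_ /(_ (e4 i))[]] := h x Dx.
Qed.

Lemma W_bounds b : base b -> 0 <= W b <= weight_max.
Proof.
move=> Bb; rewrite time_weight_ge0 /=; have [/andP[b1 _] /andP[_ b2]] := base_Om Bb.
by apply: time_weight_le; [exact: rate_ge0|exact: ltW|exact: ltW|exact: ltW].
Qed.

(** The energy on a full square is at most that on its chart domain, hence at most a multiple of the
    energies on the half-size squares, which is the quantity to be estimated. The divergence term is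
    replaced by the source and the energy through [Pf], which holds almost everywhere. *)
Lemma slab_error (j : bump_box At) : j \in J ->
  \int[leb4]_(q in base `*` S j) (W q.1 * (energy (pull j.1.1 v) q + principal (G j.1.1) (pull j.1.1 v) q ^+ 2)) <=
  (1 + Cp) * (cmp_const * \sum_(j <- J) slab_energy j) + Cp * weight_max * F.
Proof.
move=> jJ; set k := j.1.1; have oD := @cylOm_open k.
have bWE := bmS jJ (@WE_C1 k); have bE := bmS jJ (@energy_C1 k); have bW := bmS jJ (@W_C1 k).
have bP := bm_principal jJ; have bX := bm_mul bW (bm_add bE (bm_mul bP bP)).
have wm0 : 0 <= weight_max := expR_ge0 _.
have mfS : measurable_fun (base `*` S j : set ((mR * mR) * (mR * mR))) (f k).
  exact: (measurable_funS (open_measurable4 oD) (boxS_dom jJ) (@mf k)).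
have A1 : (\int[leb4]_(q in base `*` S j) (W q.1 * energy (pull k v) q)%:E <= (cmp_const * \sum_(j <- J) slab_energy j)%:E)%E.
  apply: le_trans (slab_compare k); apply: ge0_subset_integral => //.
  - by apply: boxm; exact: chart_dom_measurable.
  - apply/measurable_EFinP.
    have := @continuous_on_measurable R _ _ _ (cyl Om k) (@to4 R) _ (@open_measurable4 R) oD (fun x Dx => (@WE_C1 k x Dx).1).
    apply: measurable_funS; first exact: open_measurable4.
    by move=> [b x] [/base_Om h1 h2]; split.
  - by move=> q _; rewrite lee_fin; apply: mulr_ge0; [exact: time_weight_ge0|exact: energy_ge0].
  - by move=> [b x] [h1 h2]; split => //; exact: (cover_dom HJ jJ).2.
have mWE : measurable_fun (base `*` S j : set ((mR * mR) * (mR * mR))) (fun q => ((1 + Cp) * (W q.1 * energy (pull k v) q))%:E).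
  by apply/measurable_EFinP; have [] := bm_mul (bm_cst _ (1 + Cp)) bWE.
have mff : measurable_fun (base `*` S j : set ((mR * mR) * (mR * mR))) (fun q => (Cp * weight_max * f k q ^+ 2)%:E).
  by apply/measurable_EFinP; apply: measurable_funM => //; exact: measurable_funX.
have Cp1 : 0 <= 1 + Cp by rewrite addr_ge0.
have pWE q : (0 <= ((1 + Cp) * (W q.1 * energy (pull k v) q))%:E)%E.
  by rewrite lee_fin mulr_ge0// mulr_ge0 ?time_weight_ge0 ?energy_ge0.
have pff q : (0 <= (Cp * weight_max * f k q ^+ 2)%:E)%E.
  by rewrite lee_fin mulr_ge0 ?sqr_ge0// mulr_ge0.
rewrite -lee_fin (bm_RintegralE (mS j) (fS j) bX).
apply: (@le_trans _ _ (\int[leb4]_(q in base `*` S j) (((1 + Cp) * (W q.1 * energy (pull k v) q))%:E + (Cp * weight_max * f k q ^+ 2)%:E))%E).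
  apply: ae_ge0_le_integral => //.
  - move=> q _; rewrite lee_fin mulr_ge0 ?time_weight_ge0// addr_ge0 ?energy_ge0//.
    by rewrite -expr2 sqr_ge0.
  - by apply/measurable_EFinP; have [] := bX.
  - by move=> q _; rewrite adde_ge0.
  - exact: emeasurable_funD.
  - apply: filterS (@Pf k) => q + Bq; move=> /(_ (boxS_dom jJ Bq)) h.
    have /W_bounds/andP[W0 W1] : base q.1 by case: Bq.
    by rewrite -EFinD lee_fin; exact: (error_bound W0 W1 Cp0 h (energy_ge0 _ _)).
rewrite ge0_integralD//; try by move=> q _.
rewrite EFinD; apply: leeD.
  under eq_integral => q _ do rewrite EFinM.
  rewrite ge0_integralZl_EFin//.
  - by rewrite EFinM lee_pmul2l ?lte_fin// ltr_wpDr.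
  - by move=> q _; rewrite lee_fin mulr_ge0 ?time_weight_ge0 ?energy_ge0.
  - by apply/measurable_EFinP; have [] := bWE.
under eq_integral => q _ do rewrite EFinM.
rewrite ge0_integralZl_EFin//; last 3 first.
- by move=> q _; rewrite lee_fin sqr_ge0.
- by apply/measurable_EFinP; exact: measurable_funX.
- by rewrite mulr_ge0.
rewrite [in leRHS]EFinM; apply: lee_wpmul2l; first by rewrite lee_fin mulr_ge0.
apply: le_trans (@fF k); apply: ge0_subset_integral => //; last exact: boxS_dom.
- exact: open_measurable4.
- by apply/measurable_EFinP; apply: measurable_funX; exact: mf.
- by move=> q _; rewrite lee_fin sqr_ge0.
Qed.

Local Notation w k i q := ('D_(e4 (inord i)) (pull k v) q).

Definition initial_energy (j : bump_box At) : R := \int[leb3]_(y in box3 eps z1 (S j))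
  (w j.1.1 1 ((t1, y.1), y.2) ^+ 2 + w j.1.1 2 ((t1, y.1), y.2) ^+ 2 + w j.1.1 3 ((t1, y.1), y.2) ^+ 2 + pull j.1.1 v ((t1, y.1), y.2) ^+ 2).
Definition lateral_energy (j : bump_box At) : R := \int[leb3]_(y in box3 t1 t2 (S j))
  (w j.1.1 0 ((y.1, z1), y.2) ^+ 2 + w j.1.1 2 ((y.1, z1), y.2) ^+ 2 + w j.1.1 3 ((y.1, z1), y.2) ^+ 2).
Definition lateral_normal (j : bump_box At) : R := \int[leb3]_(y in box3 t1 t2 (half j))
  (W (y.1, z1) * w j.1.1 1 ((y.1, z1), y.2) ^+ 2).

(** In each square the weight [rho] is bounded below on the half-size square and above on the full
    one. After summation the error contains the total energy, and the choice of [rate] absorbs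
    it. *)
Lemma slab_estimate :
  \sum_(j <- J) slab_energy j + c * z1 ^+ 2 * mm * \sum_(j <- J) lateral_normal j <=
  weight_max * RR * ((C + 1) * \sum_(j <- J) initial_energy j + C * \sum_(j <- J) lateral_energy j)
  + err_const * RR * (size J)%:R * (Cp * weight_max * F).
Proof.
have [L0 _] := cover_lip HJ; have [mm0 mmJ] := cover_lower HJ; have [RR0 RRJ] := cover_upper HJ.
have e0 : 0 <= err_const by rewrite /err_const !addr_ge0// ?mulr_ge0 ?addr_ge0 ?invr_ge0// ltW.
have z10 : 0 < z1 := lt_trans eps0 ez.
have step (j : bump_box At) : j \in J -> rate * c * mm * slab_energy j + c * z1 ^+ 2 * mm * lateral_normal j <=
  weight_max * RR * ((C + 1) * initial_energy j + C * lateral_energy j)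
  + err_const * RR * ((1 + Cp) * (cmp_const * \sum_(j <- J) slab_energy j) + Cp * weight_max * F).
  move=> jJ; have [r0 jdom] := cover_dom HJ jJ; set k := j.1.1; have oD := @cylOm_open k.
  have Dz q : cyl Om k q -> 0 < q.1.2 <= z0 by case=> [[_ /andP[h1 h2]] _]; rewrite h1 ltW.
  have be := box_energy M0 b0 K0 cN C0 Hcur oD (@G1 k) (@v2 k) Dz (@GN k) (@GM k) (@dGM k) (@GV k) (@VB k)
    rate_ge0 eps0 (ltW t10) t12 ez r0 (boxS_dom jJ).
  have r1 : C1 (cyl Om k) (fun q => box_weight j.1.2 j.2 q.2).
    exact: (C1_lift2 oD _ (@box_weight_C1 R j.1.2 j.2)).
  have WR1 := C1_mul oD (@W_C1 k) r1.
  have rhoS x : S j x -> 0 <= box_weight j.1.2 j.2 x <= RR.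
    move=> Sx; have /andP[-> h] := box_weight_bound r0 Sx; exact: le_trans h (RRJ _ jJ).
  have rhoH x : half j x -> mm <= box_weight j.1.2 j.2 x.
    by move=> hx; apply: le_trans (mmJ _ jJ) _; exact: box_weight_ge.
  have zB : eps <= z1 <= z1 by rewrite lexx ltW.
  have tB : t1 <= t1 <= t2 by rewrite lexx ltW.
  have wsq i : C1 (cyl Om k) (fun q => w k i q ^+ 2).
    have d := @Ck2_D_C1 R _ _ (pull k v) (e4 (inord i)) (@v2 k); exact: (C1_mul oD d d).
  have tang a b d := C1_add oD (C1_add oD (wsq a) (wsq b)) (wsq d).
  have usq : C1 (cyl Om k) (fun q => pull k v q ^+ 2) := C1_mul oD (Ck2_C1 (@v2 k)) (Ck2_C1 (@v2 k)).
  have cont g : C1 (cyl Om k) g -> forall q, cyl Om k q -> {for q, continuous g} by move=> g1 q /g1[].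
  have face1 g (g1 : C1 (cyl Om k) g) := face_bm1 oD (boxS_dom jJ) (cont _ g1) zB.
  have face0 g (g1 : C1 (cyl Om k) g) := face_bm0 oD (boxS_dom jJ) (cont _ g1) tB.
  have mF a b : measurable (box3 a b (S j) : set (mR * (mR * mR))) := box3_measurable _ _ _ _ _ _.
  have fF' a b : (leb3 (box3 a b (S j) : set (mR * (mR * mR))) < +oo)%E :=
    leb3_finite (itv_measurable _ _) (box2_measurable _ _ _ _) (itv_finite _ _) (box2_finite _ _ _ _).
  move: be; apply: combine_box => //.
  - by rewrite mulr_ge0// ?rate_ge0// ltW.
  - by rewrite mulr_ge0 ?sqr_ge0// ltW.
  - have bg := bmS jJ (C1_mul oD WR1 (@energy_C1 k)).
    rewrite -(bm_RintegralZ (mH j) (fH jJ) _ (bmH jJ (@WE_C1 k))).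
    apply: (@le_trans _ _ (\int[leb4]_(q in base `*` half j) (W q.1 * box_weight j.1.2 j.2 q.2 * energy (pull k v) q))).
      apply: (bm_le_Rintegral (mH j) (fH jJ)).
      - exact: (bm_mul (bm_cst _ mm) (bmH jJ (@WE_C1 k))).
      - exact: (bm_subset (mS j) (mH j) (HS jJ) bg).
      - move=> q [_ hq]; rewrite [leRHS]mulrAC mulrC; apply: ler_wpM2l; last exact: rhoH.
        by rewrite mulr_ge0 ?time_weight_ge0 ?energy_ge0.
    apply: (bm_Rintegral_subset (mH j) (mS j) (fS j) (HS jJ) bg) => q [_ Sq].
    have /andP[h _] := rhoS _ Sq; by rewrite mulr_ge0 ?energy_ge0// mulr_ge0 ?time_weight_ge0.
  - have bg := face1 _ (C1_mul oD WR1 (wsq 1)); have bg' := face1 _ (C1_mul oD (@W_C1 k) (wsq 1)).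
    have mFh : measurable (box3 t1 t2 (half j) : set (mR * (mR * mR))).
      by apply: measurableX; [exact: itv_measurable|exact: half_measurable].
    have sub : box3 t1 t2 (half j) `<=` box3 t1 t2 (S j).
      by move=> y [h1 h2]; split => //; exact: sq_sqc h2.
    have fFh : (leb3 (box3 t1 t2 (half j) : set (mR * (mR * mR))) < +oo)%E.
      by apply: le_lt_trans (fF' t1 t2); apply: le_measure; rewrite ?inE.
    have bh' := bm_subset (mF t1 t2) mFh sub bg'.
    rewrite -(bm_RintegralZ mFh fFh _ bh').
    apply: (le_trans (bm_le_Rintegral mFh fFh (bm_mul (bm_cst _ mm) bh') (bm_subset (mF t1 t2) mFh sub bg) _)).
      move=> y [_ hy] /=; rewrite [leRHS]mulrAC mulrC; apply: ler_wpM2l; last exact: rhoH.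
      by rewrite mulr_ge0 ?time_weight_ge0 ?sqr_ge0.
    apply: (bm_Rintegral_subset mFh (mF t1 t2) (fF' t1 t2) sub bg) => y [_ Sy] /=.
    have /andP[h _] := rhoS _ Sy; by rewrite mulr_ge0 ?sqr_ge0// mulr_ge0 ?time_weight_ge0.
  - have s1 := C1_mul oD (C1_cst oD C) (tang 1%N 2%N 3%N).
    have b1 := face0 _ (C1_mul oD WR1 (C1_add oD s1 usq)).
    have b2 := face0 _ (C1_add oD (tang 1%N 2%N 3%N) usq).
    have m3 := mF eps z1; have f3 := fF' eps z1.
    have b3 := bm_mul (bm_cst (box3 eps z1 (S j) : set (mR * (mR * mR))) (C + 1)) b2.
    have b4 := bm_mul (bm_cst (box3 eps z1 (S j) : set (mR * (mR * mR))) (weight_max * RR)) b3.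
    have E1 := bm_RintegralZ m3 f3 (weight_max * RR) b3.
    rewrite (bm_RintegralZ m3 f3 (C + 1) b2) in E1.
    apply: le_trans (eq_ler E1); apply: (bm_le_Rintegral m3 f3 b1 b4) => y [hy Sy] /=.
    have /andP[W0 W1] : 0 <= W (t1, y.1) <= weight_max by apply: W_bounds; split => //=; rewrite in_itv.
    have /andP[rh0 rh1] := rhoS _ Sy.
    by apply: weighted_le => //; rewrite ?addr_ge0 ?sqr_ge0// ltW.
  - have b1 := face1 _ (C1_mul oD WR1 (tang 0%N 2%N 3%N)).
    have b2 := face1 _ (tang 0%N 2%N 3%N).
    have m3 := mF t1 t2; have f3 := fF' t1 t2.
    have b4 := bm_mul (bm_cst (box3 t1 t2 (S j) : set (mR * (mR * mR))) (weight_max * RR)) b2.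
    have E1 := bm_RintegralZ m3 f3 (weight_max * RR) b2.
    rewrite ler_pM2l//; apply: le_trans (eq_ler E1); apply: (bm_le_Rintegral m3 f3 b1 b4) => y [hy Sy] /=.
    have /andP[W0 W1] : 0 <= W (y.1, z1) <= weight_max by apply: W_bounds; split => //=; rewrite in_itv.
    have /andP[rh0 rh1] := rhoS _ Sy.
    by apply: ler_wpM2r; [rewrite !addr_ge0 ?sqr_ge0|exact: ler_pM].
  - by apply: Rintegral_ge0 => q _; rewrite mulr_ge0 ?time_weight_ge0// addr_ge0 ?energy_ge0 ?sqr_ge0.
  - exact: RRJ.
  - exact: slab_error.
(* The identity left to [field] is that rate c mm equals the absorbed coefficient plus 1. *)
apply: final_sum (sum_estimate step); rewrite /rate; field.
by rewrite !lt0r_neq0.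
Qed.

End Slab.
End Global.

(** * Limits at the boundary *)

Lemma seq_small (R : realType) (I : eqType) (J : seq I) (P : I -> R -> Prop) :
  (forall j, j \in J -> exists2 d : R, 0 < d & forall t, 0 < t -> t < d -> P j t) ->
  exists2 d : R, 0 < d & forall j t, j \in J -> 0 < t -> t < d -> P j t.
Proof.
elim: J => [|x J IH] H; first by exists 1.
have [d1 d10 H1] := H x (mem_head _ _).
have [d2 d20 H2] := IH (fun j jJ => H j (mem_behead (s := x :: J) jJ)).
exists (Num.min d1 d2); first by rewrite lt_min d10.
move=> j t; rewrite inE lt_min => /orP[/eqP -> t0 /andP[h _]|jJ t0 /andP[_ h]]; [exact: H1|exact: H2].
Qed.

Lemma shrink_eps (R : realType) (dl k T : R) : 0 < dl -> 0 < k -> 0 < T ->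
  exists eps : R, [/\ 0 < eps, eps < dl & forall z t, dl <= z -> 0 <= t -> t <= T ->
    eps * z^-1 + k * eps * t <= 1 / 2].
Proof.
move=> d0 k0 T0; have kTd : 0 < k * T * dl by rewrite !mulr_gt0.
(* This makes eps / dl and k eps T at most 1/4 each. *)
pose eps := dl / (4 * (1 + k * T * dl)).
have D0 : 0 < 4 * (1 + k * T * dl) by rewrite mulr_gt0// addr_gt0.
have e0 : 0 < eps by rewrite divr_gt0.
have ed : eps <= dl / 4.
  by rewrite /eps ler_pM2l// lef_pV2 ?posrE//; lra.
exists eps; split => //; first by lra.
move=> z t dz t0 tT; have z0 : 0 < z := lt_le_trans d0 dz.
have h1 : eps * z^-1 <= 1 / 4.
  rewrite ler_pdivrMr//; lra.
have h2 : k * eps * T <= 1 / 4.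
  have -> : k * eps * T = (k * T * dl) / (4 * (1 + k * T * dl)) by rewrite /eps; field; rewrite lt0r_neq0// addr_gt0.
  by rewrite ler_pdivrMr//; lra.
have h3 : k * eps * t <= k * eps * T by rewrite ler_wpM2l// mulr_ge0// ltW.
lra.
Qed.

Lemma dist_le_add (R : realType) (a b e : R) : `|a - b| < e -> a <= b + e.
Proof. by rewrite ltr_norml => /andP[_ h]; lra. Qed.

Lemma pair_norm_le (R : realType) (U V : normedModType R) (p : U * V) (c : R) :
  `|p.1| <= c -> `|p.2| <= c -> `|p| <= c.
Proof. by move=> h1 h2; rewrite prod_normE ge_max h1 h2. Qed.

Section FaceLimits.
Context {R : realType} (At : sphere_atlas R).
Local Notation mR := (measurableTypeR R).
Local Notation E2 := (R * R)%type.
Local Notation E3 := (R * (R * R))%type.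
Local Notation E4 := ((R * R) * (R * R))%type.
Local Notation K := (chart_index At).

Lemma con_bm3 (A : set E3) (f : E3 -> R) : compact A -> measurable (A : set (mR * (mR * mR))) ->
  con A f -> bm (A : set (mR * (mR * mR))) f.
Proof.
move=> cA mA cf; split; last exact: con_bounded.
exact: (@con_measurable R _ _ (mR * (mR * mR))%type (@to3 R) A f (@open_measurable3 R) mA cf).
Qed.

Lemma face0_continuous t : continuous (fun y : E3 => ((t, y.1), y.2) : E4).
Proof.
move=> y; apply: (@pt_pair _ _ _ (fun y : E3 => (t, y.1)) (fun y => y.2)); last exact: pt_snd.
by apply: (@pt_pair _ _ _ (fun y : E3 => t) (fun y => y.1)); [exact: cvg_cst|exact: pt_fst].
Qed.

Lemma face1_continuous z : continuous (fun y : E3 => ((y.1, z), y.2) : E4).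
Proof.
move=> y; apply: (@pt_pair _ _ _ (fun y : E3 => (y.1, z)) (fun y => y.2)); last exact: pt_snd.
by apply: (@pt_pair _ _ _ (fun y : E3 => y.1) (fun y => z)); [exact: pt_fst|exact: cvg_cst].
Qed.

Lemma face0_dist (t t' z : R) (x : E2) : `|(((t, z), x) : E4) - ((t', z), x)| <= `|t - t'|.
Proof.
have -> : (((t, z), x) : E4) - ((t', z), x) = ((t - t', z - z), x - x) by [].
by rewrite !subrr; apply: pair_norm_le => /=; [apply: pair_norm_le|]; rewrite /= ?normr0 ?lexx ?normr_ge0.
Qed.

Lemma face1_dist (z z' t : R) (x : E2) : `|(((t, z), x) : E4) - ((t, z'), x)| <= `|z - z'|.
Proof.
have -> : (((t, z), x) : E4) - ((t, z'), x) = ((t - t, z - z'), x - x) by [].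
by rewrite !subrr; apply: pair_norm_le => /=; [apply: pair_norm_le|]; rewrite /= ?normr0 ?lexx ?normr_ge0.
Qed.

Variables (T z0 : R).
Hypotheses (T0 : 0 < T) (z00 : 0 < z0).
Local Notation Om := (base_Omega T z0).
Local Notation Sa := (base_all T z0).

(** Compact rectangles reaching tau = 0 and z = z0 but staying away from tau = T and z = 0: here the
    extended derivatives are uniformly continuous. *)
Lemma closed_base_all t2 eps : t2 < T -> 0 < eps -> box2 0 t2 eps z0 `<=` Sa.
Proof.
move=> t2T e0 [t z] [/=]; rewrite !in_itv /= => /andP[t0 tt] /andP[ez zz].
have [->|z1] := eqVneq z z0.
  by right; split => //=; rewrite t0 (le_trans tt (ltW t2T)).
have [->|t1] := eqVneq t 0; first by left; right; split => //=; rewrite (lt_le_trans e0 ez).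
left; left; split => /=; rewrite ?(lt_le_trans e0 ez) ?lt_neqAle ?z1 ?zz ?t0 ?andbT.
  by rewrite eq_sym t1 /=; have := le_lt_trans tt t2T; rewrite lt_neqAle.
by [].
Qed.

Variables (k : K) (c : E2) (r : R).
Hypotheses (r0 : 0 < r) (Sk : sqc c r `<=` chart_dom k).
Variable s : E4 -> R.
Hypothesis cs : con (cyl Sa k) s.
Local Notation S := (sqc c r).

Let Q t2 eps := box2 0 t2 eps z0 `*` S.

Let Qsub t2 eps : t2 < T -> 0 < eps -> Q t2 eps `<=` cyl Sa k.
Proof. by move=> h1 h2 [b x] [hb hx]; split; [exact: (closed_base_all h1 h2)|exact: Sk]. Qed.

Let Qcompact t2 eps : compact (Q t2 eps).
Proof. by apply: compact_setX; exact: box2_compact. Qed.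

Let mF a b : measurable (box3 a b S : set (mR * (mR * mR))) := box3_measurable _ _ _ _ _ _.
Let fF a b : (leb3 (box3 a b S : set (mR * (mR * mR))) < +oo)%E :=
  leb3_finite (itv_measurable _ _) (box2_measurable _ _ _ _) (itv_finite _ _) (box2_finite _ _ _ _).

Lemma face0_bm t2 eps t a b : t2 < T -> 0 < eps -> 0 <= t <= t2 -> eps <= a -> b <= z0 ->
  bm (box3 a b S : set (mR * (mR * mR))) (fun y => s ((t, y.1), y.2)).
Proof.
move=> h1 h2 ht ha hb; apply: con_bm3; [exact: box3_compact|exact: mF|].
apply: (con_comp (@face0_continuous t) _ (con_subset (Qsub h1 h2) cs)).
move=> [z x] [/= + hx]; rewrite in_itv /= => /andP[az zb]; split => //=.
by split; rewrite /= in_itv //= (le_trans ha az) (le_trans zb hb).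
Qed.

Lemma face1_bm t2 eps z a b : t2 < T -> 0 < eps -> eps <= z <= z0 -> 0 <= a -> b <= t2 ->
  bm (box3 a b S : set (mR * (mR * mR))) (fun y => s ((y.1, z), y.2)).
Proof.
move=> h1 h2 hz ha hb; apply: con_bm3; [exact: box3_compact|exact: mF|].
apply: (con_comp (@face1_continuous z) _ (con_subset (Qsub h1 h2) cs)).
move=> [t x] [/= + hx]; rewrite in_itv /= => /andP[at' tb]; split => //=.
by split; rewrite /= in_itv //= (le_trans ha at') (le_trans tb hb).
Qed.

Let fH (H : set (mR * mR)) a b : measurable H -> H `<=` S -> (leb3 (box3 a b H : set (mR * (mR * mR))) < +oo)%E.
Proof.
move=> mH HS; apply: le_lt_trans (fF a b); apply: le_measure; rewrite ?inE; [|exact: mF|].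
  by apply: measurableX; [exact: itv_measurable|].
by move=> y [h1 h2]; split => //; exact: HS.
Qed.

Let vol_le (H : set (mR * mR)) a b a' b' : measurable H -> H `<=` S -> a' <= a -> b <= b' ->
  fine (leb3 (box3 a b H : set (mR * (mR * mR)))) <= fine (leb3 (box3 a' b' S : set (mR * (mR * mR)))).
Proof.
move=> mH HS ha hb.
have fin (A : set (mR * (mR * mR))) : (leb3 A < +oo)%E -> leb3 A \is a fin_num.
  by move=> h; rewrite ge0_fin_numE; [exact: h|exact: measure_ge0].
apply: (fine_le (fin _ (fH a b mH HS)) (fin _ (fF _ _))); apply: le_measure; rewrite ?inE; [|exact: mF|].
  by apply: measurableX; [exact: itv_measurable|].
move=> [t x] [/= + hx]; rewrite in_itv /= => /andP[h1 h2].
by split; [rewrite /= in_itv /= (le_trans ha h1) (le_trans h2 hb)|exact: HS].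
Qed.

Let Rint_shift (H : set (mR * mR)) a b a' b' (f g : E3 -> R) e : measurable H -> H `<=` S ->
  bm (box3 a b S : set (mR * (mR * mR))) f -> bm (box3 a b S : set (mR * (mR * mR))) g ->
  a' <= a -> b <= b' -> 0 < e ->
  (forall y, box3 a b S y -> f y <= g y + e / (fine (leb3 (box3 a' b' S : set (mR * (mR * mR)))) + 1)) ->
  \int[leb3]_(y in box3 a b H) f y <= \int[leb3]_(y in box3 a b H) g y + e.
Proof.
move=> mH HS bf' bg' ha hb e0 HH; set vol := fine _ in HH.
have v0 : 0 <= vol by exact: fine_ge0.
have mBH : measurable (box3 a b H : set (mR * (mR * mR))) by apply: measurableX; [exact: itv_measurable|].
have sub : box3 a b H `<=` box3 a b S by move=> y [h1 h2]; split => //; exact: HS.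
have bf := bm_subset (mF a b) mBH sub bf'; have bg := bm_subset (mF a b) mBH sub bg'.
have fBH := fH a b mH HS.
apply: (le_trans (bm_le_Rintegral mBH fBH bf (bm_add bg (bm_cst _ _)) (fun y By => HH y (sub y By)))).
rewrite (bm_RintegralD mBH fBH bg (bm_cst _ _)) lerD2l Rintegral_cst//.
apply: (@le_trans _ _ (e / (vol + 1) * vol)); last exact: scale_vol.
by apply: ler_wpM2l; [rewrite divr_ge0 ?addr_ge0// ltW|exact: vol_le].
Qed.

(** Uniform continuity is used on the full rectangle up to z0, so the threshold for the time does
    not depend on [z1]. Together with the analogous independence in [lateral_limit], this lets t1
    and z1 be chosen without circularity. *)
Lemma initial_limit eps eta : 0 < eps -> 0 < eta ->
  exists2 d : R, 0 < d & forall t, 0 < t -> t < d -> forall z1, z1 < z0 ->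
  \int[leb3]_(y in box3 eps z1 S) s ((t, y.1), y.2) <=
  \int[leb3]_(y in box3 eps z1 S) s ((0, y.1), y.2) + eta.
Proof.
move=> e0 eta0; have T2 : T / 2 < T by rewrite ltr_pdivrMr// ltr_pMr// ltr1n.
have T20 : 0 < T / 2 by rewrite divr_gt0.
pose vol := fine (leb3 (box3 eps z0 S : set (mR * (mR * mR)))).
have v0 : 0 <= vol by exact: fine_ge0.
have e1 : 0 < eta / (vol + 1) by rewrite divr_gt0// ltr_wpDl.
have [d d0 Hd] := con_uniform (@Qcompact (T / 2) eps) (con_subset (Qsub T2 e0) cs) e1.
exists (Num.min d (T / 2)); first by rewrite lt_min d0.
move=> t t0; rewrite lt_min => /andP[td tT] z1 zz.
have ht : 0 <= t <= T / 2 by rewrite !ltW.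
have h0 : 0 <= (0 : R) <= T / 2 by rewrite lexx ltW.
apply: (@Rint_shift S eps z1 eps z0 (fun y => s ((t, y.1), y.2)) (fun y => s ((0, y.1), y.2))) => //.
- exact: box2_measurable.
- exact: (face0_bm T2 e0 ht (lexx _) (ltW zz)).
- exact: (face0_bm T2 e0 h0 (lexx _) (ltW zz)).
- exact: ltW.
move=> y [hy Sy]; move: hy; rewrite /= in_itv /= => /andP[h1 h2].
have q0 t' : 0 <= t' <= T / 2 -> Q (T / 2) eps ((t', y.1), y.2).
  by move=> h; split => //; split; rewrite /= in_itv //= h1 (le_trans h2 (ltW zz)).
have := Hd _ _ (q0 _ ht) (q0 _ h0) (le_lt_trans (face0_dist _ _ _ _) _).
rewrite subr0 (gtr0_norm t0) => /(_ td); exact: dist_le_add.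
Qed.

(** The threshold for the distance to z0 is independent of [t1], as the uniform continuity is taken
    on [0, t2]. Both inequalities are needed: one for the tangential data, the other for the normal
    derivative on the left side. *)
Lemma lateral_limit (H : set (mR * mR)) t2 eta : measurable H -> H `<=` S -> 0 < t2 -> t2 < T -> 0 < eta ->
  exists2 d : R, 0 < d & forall d', 0 < d' -> d' < d -> forall t1, 0 < t1 ->
  \int[leb3]_(y in box3 t1 t2 H) s ((y.1, z0 - d'), y.2) <=
  \int[leb3]_(y in box3 t1 t2 H) s ((y.1, z0), y.2) + eta /\
  \int[leb3]_(y in box3 t1 t2 H) s ((y.1, z0), y.2) <=
  \int[leb3]_(y in box3 t1 t2 H) s ((y.1, z0 - d'), y.2) + eta.
Proof.
move=> mH HS t20 t2T eta0; have z20 : 0 < z0 / 2 by rewrite divr_gt0.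
pose vol := fine (leb3 (box3 0 t2 S : set (mR * (mR * mR)))).
have v0 : 0 <= vol by exact: fine_ge0.
have e1 : 0 < eta / (vol + 1) by rewrite divr_gt0// ltr_wpDl.
have [d d0 Hd] := con_uniform (@Qcompact t2 (z0 / 2)) (con_subset (Qsub t2T z20) cs) e1.
exists (Num.min d (z0 / 2)); first by rewrite lt_min d0.
move=> d' d'0; rewrite lt_min => /andP[dd dz] t1 t10.
have hz : z0 / 2 <= z0 - d' <= z0 by apply/andP; split; lra.
have hz0 : z0 / 2 <= z0 <= z0 by apply/andP; split; lra.
have b1 := face1_bm t2T z20 hz (ltW t10) (lexx t2).
have b2 := face1_bm t2T z20 hz0 (ltW t10) (lexx t2).
have q0 y z : box3 t1 t2 S y -> z0 / 2 <= z <= z0 -> Q t2 (z0 / 2) ((y.1, z), y.2).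
  move=> [+ Sy]; rewrite /= in_itv /= => /andP[h1 h2] h; split => //.
  by split; rewrite /= in_itv //= h2 (le_trans (ltW t10) h1).
have D y : box3 t1 t2 S y -> `|s ((y.1, z0 - d'), y.2) - s ((y.1, z0), y.2)| < eta / (vol + 1).
  move=> By; have := Hd _ _ (q0 _ _ By hz) (q0 _ _ By hz0) (le_lt_trans (face1_dist _ _ _ _) _); apply.
  by rewrite addrAC subrr add0r normrN gtr0_norm.
split; apply: (@Rint_shift H t1 t2 0 t2) => //; try exact: ltW.
- by move=> y /D; exact: dist_le_add.
- by move=> y /D; rewrite distrC; exact: dist_le_add.
Qed.

End FaceLimits.

Lemma sum_le_const (R : realType) (I : eqType) (J : seq I) (x : I -> R) (b : R) :
  (forall j, j \in J -> x j <= b) -> \sum_(j <- J) x j <= (size J)%:R * b.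
Proof.
elim: J => [|i J IH] H; first by rewrite big_nil mul0r.
have := H i (mem_head _ _); have := IH (fun j jJ => H j (mem_behead (s := i :: J) jJ)).
rewrite big_cons /= -natr1; lra.
Qed.

Lemma ler_limit (R : realType) (x y C : R) : 0 <= C -> (forall eta, 0 < eta -> x <= y + eta * C) -> x <= y.
Proof.
move=> C0 H; apply/ler_addgt0Pr => e e0.
apply: (le_trans (H (e / (C + 1)) _)); first by rewrite divr_gt0// ltr_wpDl.
by rewrite lerD2l -mulrA -[leRHS]mulr1 ler_pM2l// mulrC ler_pdivrMr ?mul1r ?lerDl// ltr_wpDl.
Qed.

Lemma scale_aux (R : realType) (cc e X w0 D : R) : 0 < w0 -> D = cc * X / w0 ->
  cc * (e / (cc * X / w0 + 1) * X) = w0 * (e / (cc * X / w0 + 1) * D).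
Proof. by move=> w00 ->; set t := e / _; field; rewrite lt0r_neq0. Qed.

Lemma normal_arith (R : realType) (Yw Yl kk k w0 Y A B eta n D : R) : 0 <= Yw -> Yw + k * Yl <= A + B + eta * D ->
  kk * Yl <= k * Yl -> kk * (w0 * Y) <= kk * (Yl + w0 * eta * n) -> w0 * kk * Y <= A + B + eta * (D + w0 * kk * n).
Proof. by move=> *; lra. Qed.

Lemma con_open_continuous (R : realType) (E : topologicalType) (A : set E) (f : E -> R) x :
  open A -> con A f -> A x -> {for x, continuous f}.
Proof.
move=> oA cf Ax; have := cf x Ax; rewrite within_interior//.
by rewrite (interior_id A).1.
Qed.

Lemma scaled_sum_le (R : realType) (I : eqType) (J : seq I) (y l : I -> R) (w0 c : R) :
  (forall j, j \in J -> w0 * y j <= l j + c) -> w0 * (\sum_(j <- J) y j) <= \sum_(j <- J) l j + c * (size J)%:R.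
Proof.
elim: J => [|x J IH] H; first by rewrite !big_nil !mulr0 addr0.
have := H x (mem_head _ _); have := IH (fun j jJ => H j (mem_behead (s := x :: J) jJ)).
rewrite !big_cons /= -natr1; lra.
Qed.

Lemma con_zero_limit (R : realType) (F : R -> R) (a : R) : 0 < a -> con [set z | 0 < z <= a] F ->
  (forall z, 0 < z < a -> F z = 0) -> F a = 0.
Proof.
move=> a0 cF F0; apply/eqP/negPn/negP => Fa.
have Aa : [set z | 0 < z <= a] a by rewrite /= a0 lexx.
have Fa0 : 0 < `|F a| by rewrite normr_gt0.
have : \forall z \near a, [set z | 0 < z <= a] z -> F z != 0.
  by apply: (con_near (U := [set y | y != 0]) cF Aa); apply: open_nbhs_nbhs; split => //; exact: open_neq.
move=> /nbhs_ballP[e /= e0 He].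
have m0 : 0 < Num.min e a by rewrite lt_min e0.
have : Num.min e a / 2 < Num.min e a by rewrite ltr_pdivrMr// ltr_pMr// ltr1n.
rewrite lt_min => /andP[he ha].
have h2 : 0 < Num.min e a / 2 by rewrite divr_gt0.
have := He (a - Num.min e a / 2); rewrite F0 ?eqxx; last by apply/andP; split; lra.
move=> h; have : false by apply: h; [rewrite /ball /= opprB addrCA subrr addr0 gtr0_norm|apply/andP; split; lra].
by [].
Qed.

(** * Passage from slabs to Sigma_0 and Sigma_1 *)

Section SlabLimits.
Context {R : realType} (At : sphere_atlas R).
Local Notation mR := (measurableTypeR R).
Local Notation E2 := (R * R)%type.
Local Notation E3 := (R * (R * R))%type.
Local Notation E4 := ((R * R) * (R * R))%type.
Local Notation K := (chart_index At).

Variables (T z0 mu N Kc k1 A1 A2 cc Phi Psi : R) (J : seq (bump_box At)).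
Hypotheses (T0 : 0 < T) (z00 : 0 < z0) (mu0 : 0 <= mu) (N0 : 0 <= N) (K0 : 0 < Kc)
  (k10 : 0 <= k1) (A10 : 0 <= A1) (cc0 : 0 <= cc).
Hypothesis Jdom : forall j, j \in J -> 0 < j.2 /\ sqc j.1.2 j.2 `<=` chart_dom j.1.1.
Local Notation Om := (base_Omega T z0).
Local Notation Sa := (base_all T z0).
Local Notation S j := (sqc j.1.2 j.2).
Local Notation half j := (sq j.1.2 (j.2 / 2)).
Local Notation W eps := (time_weight mu N Kc eps).

Variables (v : E2 -> 'rV[R]_3 -> R) (w : K -> 'I_4 -> E4 -> R).
Hypothesis v2 : forall (k : K), Ck_on 2 (cyl Om k) (pull k v).
Hypothesis vS : forall (k : K), con (cyl Sa k) (pull k v).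
Hypothesis wS : forall (k : K) i, con (cyl Sa k) (w k i).
Hypothesis wE : forall (k : K) i q, cyl Om k q -> w k i q = 'D_(e4 i) (pull k v) q.

Local Notation init k q := (w k (inord 1) q ^+ 2 + w k (inord 2) q ^+ 2 + w k (inord 3) q ^+ 2 + pull k v q ^+ 2).
Local Notation late k q := (w k (inord 0) q ^+ 2 + w k (inord 2) q ^+ 2 + w k (inord 3) q ^+ 2).

Hypothesis HPhi : forall (j : bump_box At) eps z1, j \in J -> 0 < eps -> eps < z1 -> z1 < z0 ->
  \int[leb3]_(y in box3 eps z1 (S j)) init j.1.1 ((0, y.1), y.2) <= Phi.
Hypothesis HPsi : forall (j : bump_box At) t1 t2, j \in J -> 0 < t1 -> t1 < t2 -> t2 < T ->
  \int[leb3]_(y in box3 t1 t2 (S j)) late j.1.1 ((y.1, z0), y.2) <= Psi.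

(** The finitely many squares share one threshold for [t1] and one for the distance of [z1] to z0,
    obtained by [seq_small]. The normal derivative is compared only on times after the fixed
    [taa]. *)
Lemma data_limit taa T2 eps zb eta : 0 < taa -> taa < T2 -> T2 < T -> 0 < eps -> eps < zb -> zb < z0 -> 0 < eta ->
  exists t1 z1, [/\ 0 < t1 < taa, zb < z1 < z0 & z0 / 2 < z1] /\
  [/\ \sum_(j <- J) \int[leb3]_(y in box3 eps z1 (S j)) init j.1.1 ((t1, y.1), y.2) <= (size J)%:R * (Phi + eta),
   \sum_(j <- J) \int[leb3]_(y in box3 t1 T2 (S j)) late j.1.1 ((y.1, z1), y.2) <= (size J)%:R * (Psi + eta) &
   forall j, j \in J -> \int[leb3]_(y in box3 taa T2 (half j)) w j.1.1 (inord 1) ((y.1, z0), y.2) ^+ 2 <=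
     \int[leb3]_(y in box3 taa T2 (half j)) w j.1.1 (inord 1) ((y.1, z1), y.2) ^+ 2 + eta].
Proof.
move=> ta0 tT TT e0 ez zz eta0; have T20 := lt_trans ta0 tT.
have wq (k : K) i : con (cyl Sa k) (fun q => w k i q ^+ 2) by exact: (con_mul (@wS k i) (@wS k i)).
have ci (k : K) : con (cyl Sa k) (fun q => init k q).
  exact: (con_add (con_add (con_add (wq k _) (wq k _)) (wq k _)) (con_mul (@vS k) (@vS k))).
have cl (k : K) : con (cyl Sa k) (fun q => late k q).
  exact: (con_add (con_add (wq k _) (wq k _)) (wq k _)).
have L1 (j : bump_box At) : j \in J -> exists2 d : R, 0 < d & forall t, 0 < t -> t < d -> forall z1, z1 < z0 ->
    \int[leb3]_(y in box3 eps z1 (S j)) init j.1.1 ((t, y.1), y.2) <=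
    \int[leb3]_(y in box3 eps z1 (S j)) init j.1.1 ((0, y.1), y.2) + eta.
  by move=> jJ; have [_ jd] := Jdom jJ; have h := initial_limit T0 jd (ci _) e0 eta0; exact: h.
have L2 (j : bump_box At) : j \in J -> exists2 d : R, 0 < d & forall d', 0 < d' -> d' < d ->
    (forall t1, 0 < t1 -> \int[leb3]_(y in box3 t1 T2 (S j)) late j.1.1 ((y.1, z0 - d'), y.2) <=
    \int[leb3]_(y in box3 t1 T2 (S j)) late j.1.1 ((y.1, z0), y.2) + eta) /\
    \int[leb3]_(y in box3 taa T2 (half j)) w j.1.1 (inord 1) ((y.1, z0), y.2) ^+ 2 <=
     \int[leb3]_(y in box3 taa T2 (half j)) w j.1.1 (inord 1) ((y.1, z0 - d'), y.2) ^+ 2 + eta.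
  move=> jJ; have [r0 jd] := Jdom jJ.
  have [d d0 H1] := lateral_limit z00 jd (cl _) (box2_measurable _ _ _ _ : measurable (S j : set (mR * mR))) (fun x h => h) T20 TT eta0.
  have [d' d'0 H2] := lateral_limit z00 jd (wq _ (inord 1)) (half_measurable j) (sq_sqc r0) T20 TT eta0.
  exists (Num.min d d'); first by rewrite lt_min d0.
  move=> x x0; rewrite lt_min => /andP[xd xd']; split; first by move=> t1 t10; exact: (H1 _ x0 xd _ t10).1.
  exact: (H2 _ x0 xd' _ ta0).2.
have [d d0 H1] := seq_small L1; have [d' d'0 H2] := seq_small L2.
pose t1 := Num.min taa d / 2; pose x := Num.min d' (Num.min (z0 - zb) (z0 / 2)) / 2.
have md0 : 0 < Num.min taa d by rewrite lt_min ta0.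
have mx0 : 0 < Num.min d' (Num.min (z0 - zb) (z0 / 2)) by rewrite !lt_min d'0 subr_gt0 zz divr_gt0.
have [t10 t1a t1d] : [/\ 0 < t1, t1 < taa & t1 < d].
  have h : t1 < Num.min taa d by rewrite /t1 ltr_pdivrMr// ltr_pMr// ltr1n.
  by move: (h); rewrite lt_min => /andP[? ?]; split => //; rewrite divr_gt0.
have [x0 xd [xz xz']] : [/\ 0 < x, x < d' & x < z0 - zb /\ x < z0 / 2].
  have h : x < Num.min d' (Num.min (z0 - zb) (z0 / 2)) by rewrite /x ltr_pdivrMr// ltr_pMr// ltr1n.
  by move: (h); rewrite !lt_min => /and3P[? ? ?]; split => //; rewrite divr_gt0.
exists t1, (z0 - x); split.
  by split; [rewrite t10|apply/andP; split; lra|lra].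
have z1z : z0 - x < z0 by lra.
have ez1 : eps < z0 - x by lra.
split; [apply: sum_le_const => j jJ|apply: sum_le_const => j jJ|move=> j jJ].
- apply: (le_trans (H1 j t1 jJ t10 t1d _ z1z)); rewrite lerD2r; exact: HPhi.
- have [h _] := H2 j x jJ x0 xd.
  apply: (le_trans (h _ t10)); rewrite lerD2r; apply: HPsi => //; exact: lt_trans t1a tT.
- by have [_ h] := H2 j x jJ x0 xd.
Qed.

(** Lower bound of the time weight at the heights where the cutoff argument is at least 1/2; it is
    independent of eps. *)
Let w0 := expR (- (mu * N * T) - 2).
Let rhs := (size J)%:R * (Phi + Psi).

Hypothesis Hslab : forall eps t1 t2 z1, 0 < eps -> 0 < t1 -> t1 < t2 -> t2 < T -> eps < z1 -> z1 < z0 ->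
  \sum_(j <- J) \int[leb4]_(q in box2 t1 t2 eps z1 `*` half j) (W eps q.1 * energy (pull j.1.1 v) q) +
  k1 * z1 ^+ 2 * \sum_(j <- J) \int[leb3]_(y in box3 t1 t2 (half j))
      (W eps (y.1, z1) * 'D_(e4 (inord 1)) (pull j.1.1 v) ((y.1, z1), y.2) ^+ 2) <=
  A1 * (\sum_(j <- J) \int[leb3]_(y in box3 eps z1 (S j))
      ('D_(e4 (inord 1)) (pull j.1.1 v) ((t1, y.1), y.2) ^+ 2 + 'D_(e4 (inord 2)) (pull j.1.1 v) ((t1, y.1), y.2) ^+ 2
       + 'D_(e4 (inord 3)) (pull j.1.1 v) ((t1, y.1), y.2) ^+ 2 + pull j.1.1 v ((t1, y.1), y.2) ^+ 2) +
   \sum_(j <- J) \int[leb3]_(y in box3 t1 t2 (S j))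
      ('D_(e4 (inord 0)) (pull j.1.1 v) ((y.1, z1), y.2) ^+ 2 + 'D_(e4 (inord 2)) (pull j.1.1 v) ((y.1, z1), y.2) ^+ 2
       + 'D_(e4 (inord 3)) (pull j.1.1 v) ((y.1, z1), y.2) ^+ 2)) + A2.

Hypothesis Hcmp : forall eps t1 t2 z1, 0 < eps -> 0 < t1 -> t1 < t2 -> t2 < T -> eps < z1 -> z1 < z0 -> forall k : K,
  (\int[leb4]_(q in box2 t1 t2 eps z1 `*` (chart_dom k : set (mR * mR))) (W eps q.1 * energy (pull k v) q)%:E <=
  (cc * \sum_(j <- J) \int[leb4]_(q in box2 t1 t2 eps z1 `*` half j) (W eps q.1 * energy (pull j.1.1 v) q))%:E)%E.

(** First [eps] is taken small relative to [dl], so that the weight is at least [w0] for z >= dl;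
    then [t1] and [z1] are moved so close to the boundary that the face integrals exceed those of
    the data by at most [eta] for each square. *)
Lemma slab_limit taa T2 dl zb eta : 0 < taa -> taa < T2 -> T2 < T -> 0 < dl -> dl < zb -> zb < z0 -> 0 < eta ->
  exists eps t1 z1, [/\ 0 < eps < dl, 0 < t1 < taa, zb < z1 < z0 & z0 / 2 < z1] /\
  [/\ (forall b : E2, 0 <= b.1 <= T -> dl <= b.2 -> w0 <= W eps b),
    \sum_(j <- J) \int[leb4]_(q in box2 t1 T2 eps z1 `*` half j) (W eps q.1 * energy (pull j.1.1 v) q) +
    k1 * z1 ^+ 2 * \sum_(j <- J) \int[leb3]_(y in box3 t1 T2 (half j)) (W eps (y.1, z1) * w j.1.1 (inord 1) ((y.1, z1), y.2) ^+ 2)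
    <= A1 * rhs + A2 + eta * (2 * A1 * (size J)%:R) &
   forall j, j \in J -> \int[leb3]_(y in box3 taa T2 (half j)) w j.1.1 (inord 1) ((y.1, z0), y.2) ^+ 2 <=
     \int[leb3]_(y in box3 taa T2 (half j)) w j.1.1 (inord 1) ((y.1, z1), y.2) ^+ 2 + eta].
Proof.
move=> ta0 tT TT d0 dz zz eta0.
have [eps [e0 ed He]] := shrink_eps d0 K0 T0.
have [t1 [z1 [[/andP[t10 t1a] /andP[zb1 z1z] zh] [B1 B2 B3]]]] := data_limit ta0 tT TT e0 (lt_trans ed dz) zz eta0.
have ez1 : eps < z1 by exact: lt_trans ed (lt_trans dz zb1).
have tt2 := lt_trans t1a tT.
exists eps, t1, z1; split; first by split => //; apply/andP.
have inO y a b : box3 a b (S y) `<=` [set x | a <= x.1 <= b /\ S y x.2].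
  by move=> x [/= + h]; rewrite in_itv.
have eqI (j : bump_box At) i y : j \in J -> box3 eps z1 (S j) y ->
    'D_(e4 i) (pull j.1.1 v) ((t1, y.1), y.2) = w j.1.1 i ((t1, y.1), y.2).
  move=> jJ /inO[/andP[h1 h2] Sy]; rewrite wE//; split; last exact: (Jdom jJ).2.
  by split => /=; apply/andP; split => //; [exact: lt_trans tt2 TT|exact: lt_le_trans e0 h1|exact: le_lt_trans h2 z1z].
have eqL (j : bump_box At) i y : j \in J -> (t1 <= y.1 <= T2) && `[< S j y.2 >] ->
    'D_(e4 i) (pull j.1.1 v) ((y.1, z1), y.2) = w j.1.1 i ((y.1, z1), y.2).
  move=> jJ /andP[/andP[h1 h2] /asboolP Sy]; rewrite wE//; split; last exact: (Jdom jJ).2.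
  by split => /=; apply/andP; split => //; [exact: lt_le_trans t10 h1|exact: le_lt_trans h2 TT|exact: lt_trans e0 ez1].
split.
- move=> b /andP[b1 b2] db; have b20 := lt_le_trans d0 db.
  have b2' := ltW b20; exact: (time_weight_ge mu0 N0 b2' b2 (He _ _ db b1 b2)).
- have H := Hslab e0 t10 tt2 TT ez1 z1z.
  have inL (j : bump_box At) (B : set E2) y : B `<=` S j -> box3 t1 T2 B y -> (t1 <= y.1 <= T2) && `[< S j y.2 >].
    by move=> HS [/= + h]; rewrite in_itv => -> /=; apply/asboolP; exact: HS.
  rewrite [X in A1 * (X + _)](_ : _ = \sum_(j <- J) \int[leb3]_(y in box3 eps z1 (S j)) init j.1.1 ((t1, y.1), y.2)) in H; last first.
    by apply: eq_big_seq => j jJ; apply: eq_Rintegral => y /set_mem By; rewrite !eqI.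
  rewrite [X in A1 * (_ + X)](_ : _ = \sum_(j <- J) \int[leb3]_(y in box3 t1 T2 (S j)) late j.1.1 ((y.1, z1), y.2)) in H; last first.
    by apply: eq_big_seq => j jJ; apply: eq_Rintegral => y /set_mem /(inL j _ y (fun x h => h)) By; rewrite !eqL.
  rewrite [X in k1 * _ * X](_ : _ = \sum_(j <- J) \int[leb3]_(y in box3 t1 T2 (half j)) (W eps (y.1, z1) * w j.1.1 (inord 1) ((y.1, z1), y.2) ^+ 2)) in H; last first.
    apply: eq_big_seq => j jJ; apply: eq_Rintegral => y /set_mem /(inL j _ y (sq_sqc (Jdom jJ).1)) By; rewrite eqL//.
  apply: (le_trans H); have := ler_wpM2l A10 B1; have := ler_wpM2l A10 B2; rewrite /rhs; lra.
- exact: B3.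
Qed.

(** The rectangle is fixed before the slab and lies inside it, and the weight is at least [w0] on
    it. The error from the faces is arbitrary, so it disappears from the final bound. *)
Lemma energy_limit taa T2 dl zb (k : K) : 0 < taa -> taa < T2 -> T2 < T -> 0 < dl -> dl < zb -> zb < z0 ->
  (\int[leb4]_(q in box2 taa T2 dl zb `*` (chart_dom k : set (mR * mR))) (energy (pull k v) q)%:E <=
   (cc * (A1 * rhs + A2) / w0)%:E)%E.
Proof.
move=> ta0 tT TT d0 dz zz; have w00 : 0 < w0 := expR_gt0 _.
have oD := @cylOm_open R At T z0 k.
have C0 : 0 <= cc * (2 * A1 * (size J)%:R) / w0 by rewrite divr_ge0 ?mulr_ge0// ltW.
have sub0 (a b c d : R) : 0 < a -> b < T -> 0 < c -> d < z0 ->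
    box2 a b c d `*` (chart_dom k : set (mR * mR)) `<=` cyl Om k.
  move=> a0 bT c0 dz' [y x] [[/=]]; rewrite !in_itv /= => /andP[h1 h2] /andP[h3 h4] kx; split => //; split => /=.
    by rewrite (lt_le_trans a0 h1) (le_lt_trans h2 bT).
  by rewrite (lt_le_trans c0 h3) (le_lt_trans h4 dz').
have mE := @continuous_on_measurable R _ _ _ (cyl Om k) (@to4 R) _ (@open_measurable4 R) oD
  (fun x Dx => (energy_C1 (@v2) Dx).1).
have mB a b c d : measurable (box2 a b c d `*` (chart_dom k : set (mR * mR)) : set ((mR * mR) * (mR * mR))).
  by apply: measurableX; [exact: box2_measurable|exact: chart_dom_measurable].
apply/lee_addgt0Pr => e e_0.
have e1 : 0 < e / (cc * (2 * A1 * (size J)%:R) / w0 + 1) by rewrite divr_gt0// ltr_wpDl.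
have [eps [t1 [z1 [[/andP[e0 ed] /andP[t10 t1a] /andP[zb1 z1z] _] [HW Hs _]]]]] :=
  slab_limit ta0 tT TT d0 dz zz e1.
have ez1 : eps < z1 by exact: lt_trans ed (lt_trans dz zb1).
have z10 := lt_trans e0 ez1; have tt2 := lt_trans t1a tT.
have subB : box2 taa T2 dl zb `<=` box2 t1 T2 eps z1.
  move=> y [/=]; rewrite !in_itv /= => /andP[h1 h2] /andP[h3 h4]; split => /=; rewrite in_itv /=.
    by rewrite h2 (le_trans (ltW t1a) h1).
  by rewrite (le_trans (ltW ed) h3) (le_trans h4 (ltW zb1)).
have mWE : measurable_fun (box2 t1 T2 eps z1 `*` (chart_dom k : set (mR * mR)) : set ((mR * mR) * (mR * mR)))
    (fun q => (W eps q.1 * energy (pull k v) q)%:E).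
  apply/measurable_EFinP; apply: measurable_funM.
    have W1 : C1 (cyl Om k) (fun q => W eps q.1).
      apply: (C1_lift1 oD _ (@time_weight_C1 R mu N Kc eps)) => q [[_ /andP[h _]] _]; exact: h.
    have := @continuous_on_measurable R _ _ _ (cyl Om k) (@to4 R) _ (@open_measurable4 R) oD (fun x Dx => (W1 x Dx).1).
    by apply: measurable_funS; [exact: open_measurable4|exact: sub0].
  by apply: measurable_funS mE; [exact: open_measurable4|exact: sub0].
have E0 q : 0 <= energy (pull k v) q by exact: energy_ge0.
have W0 q : (0 <= (W eps q.1 * energy (pull k v) q)%:E)%E by rewrite lee_fin mulr_ge0 ?time_weight_ge0.
rewrite -(@lee_pmul2l _ w0%:E) ?lte_fin//.
have mEB : measurable_fun (box2 taa T2 dl zb `*` (chart_dom k : set (mR * mR)) : set ((mR * mR) * (mR * mR)))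
    (fun q => (energy (pull k v) q)%:E).
  by apply/measurable_EFinP; apply: measurable_funS mE; [exact: open_measurable4|exact: sub0].
rewrite -(@ge0_integralZl_EFin _ _ _ leb4 _ (mB _ _ _ _) _ (fun q _ => E0 q : (0 <= (energy (pull k v) q)%:E)%E) mEB _ (ltW w00)).
apply: (@le_trans _ _ (\int[leb4]_(q in box2 taa T2 dl zb `*` (chart_dom k : set (mR * mR))) (W eps q.1 * energy (pull k v) q)%:E)%E).
  apply: ge0_le_integral => //.
  - by move=> q _; rewrite -EFinM lee_fin mulr_ge0 // ltW.
  - under eq_fun => q do rewrite -EFinM.
    apply/measurable_EFinP; apply: measurable_funM; first exact: measurable_cst.
    by apply: measurable_funS mE; [exact: open_measurable4|exact: sub0].
  - apply: (measurable_funS (mB _ _ _ _) _ mWE).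
    by move=> q [h1 h2]; split => //; exact: subB.
  - move=> q [[/=]]; rewrite !in_itv /= => /andP[h1 h2] /andP[h3 h4] _.
    rewrite -EFinM lee_fin ler_wpM2r//; apply: HW => //.
    by rewrite (le_trans (ltW ta0) h1) (le_trans h2 (ltW TT)).
apply: (@le_trans _ _ (\int[leb4]_(q in box2 t1 T2 eps z1 `*` (chart_dom k : set (mR * mR))) (W eps q.1 * energy (pull k v) q)%:E)%E).
  apply: ge0_subset_integral => //.
  by move=> q [h1 h2]; split => //; exact: subB.
apply: (le_trans (Hcmp e0 t10 tt2 TT ez1 z1z k)).
rewrite -EFinD -EFinM lee_fin mulrDr.
have Y0 : 0 <= k1 * z1 ^+ 2 * \sum_(j <- J) \int[leb3]_(y in box3 t1 T2 (half j))
    (W eps (y.1, z1) * w j.1.1 (inord 1) ((y.1, z1), y.2) ^+ 2).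
  apply: mulr_ge0; first by rewrite mulr_ge0 ?sqr_ge0.
  apply: sumr_ge0 => j _; apply: Rintegral_ge0 => y _.
  by rewrite mulr_ge0 ?time_weight_ge0 ?sqr_ge0.
have h1 : \sum_(j <- J) \int[leb4]_(q in box2 t1 T2 eps z1 `*` half j) (W eps q.1 * energy (pull j.1.1 v) q) <=
   A1 * rhs + A2 + e / (cc * (2 * A1 * (size J)%:R) / w0 + 1) * (2 * A1 * (size J)%:R).
  by apply: le_trans Hs; rewrite lerDl.
apply: (le_trans (ler_wpM2l cc0 h1)).
have -> : w0 * (cc * (A1 * rhs + A2) / w0) = cc * (A1 * rhs + A2) by field; rewrite lt0r_neq0.
rewrite mulrDr lerD2l.
rewrite (scale_aux e w00 (erefl (cc * (2 * A1 * (size J)%:R) / w0))).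
by rewrite (ler_pM2l w00); apply: scale_vol => //; exact: ltW.
Qed.

Lemma normal_limit taa T2 : 0 < taa -> taa < T2 -> T2 < T ->
  w0 * (k1 * (z0 / 2) ^+ 2) * \sum_(j <- J) \int[leb3]_(y in box3 taa T2 (half j))
    w j.1.1 (inord 1) ((y.1, z0), y.2) ^+ 2 <= A1 * rhs + A2.
Proof.
move=> ta0 tT TT; have w00 : 0 < w0 := expR_gt0 _.
set Y := \sum_(j <- J) _; set kk := k1 * (z0 / 2) ^+ 2.
have kk0 : 0 <= kk by rewrite mulr_ge0 ?sqr_ge0.
apply: (@ler_limit _ _ _ (2 * A1 * (size J)%:R + w0 * kk * (size J)%:R)).
  by rewrite addr_ge0 ?mulr_ge0// ltW.
move=> eta eta0.
(* The cutoff level z0/4 is below z0/2 < z1, so the weight on the face z = z1 is bounded below by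
   [w0] and z1^2 by (z0 / 2)^2. *)
have d0 : 0 < z0 / 4 by rewrite divr_gt0.
have dz : z0 / 4 < z0 / 2 by lra.
have zz : z0 / 2 < z0 by lra.
have [eps [t1 [z1 [[/andP[e0 ed] /andP[t10 t1a] /andP[zb1 z1z] zh] [HW Hs HY]]]]] :=
  slab_limit ta0 tT TT d0 dz zz eta0.
have ez1 : eps < z1 by lra.
have z10 := lt_trans e0 ez1; have tt2 := lt_trans t1a tT.
have S0 : 0 <= \sum_(j <- J) \int[leb4]_(q in box2 t1 T2 eps z1 `*` half j) (W eps q.1 * energy (pull j.1.1 v) q).
  apply: sumr_ge0 => j _; apply: Rintegral_ge0 => q _; rewrite mulr_ge0 ?time_weight_ge0//; exact: energy_ge0.
set Yw := \sum_(j <- J) _ in Hs; rewrite -/Yw in Hs.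
move: Hs; set Yl := (X in _ + k1 * _ * X <= _) => Hs.
have term (j : bump_box At) : j \in J ->
    w0 * (\int[leb3]_(y in box3 taa T2 (half j)) w j.1.1 (inord 1) ((y.1, z0), y.2) ^+ 2) <=
    \int[leb3]_(y in box3 t1 T2 (half j)) (W eps (y.1, z1) * w j.1.1 (inord 1) ((y.1, z1), y.2) ^+ 2) + w0 * eta.
  move=> jJ; have [r0 jd] := Jdom jJ.
  have cw : con (cyl Sa j.1.1) (fun q => w j.1.1 (inord 1) q ^+ 2) := con_mul (@wS _ _) (@wS _ _).
  have cW : con (cyl Sa j.1.1) (fun q => W eps q.1).
    apply: con_open => q [Sq _]; apply: (@continuous_comp _ _ _ fst (W eps)); first exact: pt_fst.
    have [] // := @time_weight_C1 R mu N Kc eps q.1.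
    by case: Sq => [[[_ /andP[]]//|[_ /andP[]//]]|[_ /= ->]].
  have hz : eps <= z1 <= z0 by rewrite !ltW.
  have bW := face1_bm jd (con_mul cW cw) TT e0 hz (ltW t10) (lexx T2).
  have bw := face1_bm jd cw TT e0 hz (ltW t10) (lexx T2).
  have mS : measurable (box3 t1 T2 (S j) : set (mR * (mR * mR))) := box3_measurable _ _ _ _ _ _.
  have mH a b : measurable (box3 a b (half j) : set (mR * (mR * mR))).
    by apply: measurableX; [exact: itv_measurable|exact: half_measurable].
  have s1 : box3 t1 T2 (half j) `<=` box3 t1 T2 (S j) by move=> y [h1 h2]; split => //; exact: sq_sqc h2.
  have s2 : box3 taa T2 (half j) `<=` box3 t1 T2 (half j).
    by move=> y [/= + h2]; rewrite in_itv /= => /andP[h3 h4]; split => //=; rewrite in_itv /= h4 (le_trans (ltW t1a) h3).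
  have fH : (leb3 (box3 t1 T2 (half j) : set (mR * (mR * mR))) < +oo)%E.
    have fS : (leb3 (box3 t1 T2 (S j) : set (mR * (mR * mR))) < +oo)%E :=
      leb3_finite (itv_measurable _ _) (box2_measurable _ _ _ _) (itv_finite _ _) (box2_finite _ _ _ _).
    by apply: le_lt_trans fS; apply: le_measure; rewrite ?inE; [exact: mH|exact: mS|exact: s1].
  have fH2 : (leb3 (box3 taa T2 (half j) : set (mR * (mR * mR))) < +oo)%E.
    by apply: le_lt_trans fH; apply: le_measure; rewrite ?inE; [exact: mH|exact: mH|exact: s2].
  have bW1 := bm_subset mS (mH _ _) s1 bW; have bW2 := bm_subset (mH _ _) (mH _ _) s2 bW1.
  have bw2 := bm_subset (mH _ _) (mH _ _) s2 (bm_subset mS (mH _ _) s1 bw).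
  apply: (le_trans (ler_wpM2l (ltW w00) (HY _ jJ))); rewrite mulrDr lerD2r.
  rewrite -(bm_RintegralZ (mH _ _) fH2 _ bw2).
  apply: (le_trans (bm_le_Rintegral (mH _ _) fH2 (bm_mul (bm_cst _ w0) bw2) bW2 _)).
    move=> y [/= + _]; rewrite in_itv /= => /andP[h1 h2]; apply: ler_wpM2r; first exact: sqr_ge0.
    apply: HW => /=; first by rewrite (le_trans (ltW ta0) h1) (le_trans h2 (ltW TT)).
    lra.
  apply: (bm_Rintegral_subset (mH _ _) (mH _ _) fH s2 bW1) => y _.
  by rewrite mulr_ge0 ?time_weight_ge0 ?sqr_ge0.
have H1 : w0 * Y <= Yl + w0 * eta * (size J)%:R.
  exact: scaled_sum_le term.
have Yl0 : 0 <= Yl.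
  apply: sumr_ge0 => j _; apply: Rintegral_ge0 => y _.
  by rewrite mulr_ge0 ?time_weight_ge0 ?sqr_ge0.
have sqz : (z0 / 2) ^+ 2 <= z1 ^+ 2 by rewrite ler_pXn2r ?nnegrE ?divr_ge0 ?ltW.
have H2 : kk * Yl <= k1 * z1 ^+ 2 * Yl.
  by rewrite ler_wpM2r// ler_wpM2l.
have H3 : kk * (w0 * Y) <= kk * (Yl + w0 * eta * (size J)%:R) by rewrite ler_wpM2l.
exact: normal_arith S0 Hs H2 H3.
Qed.

Variable Lip : R.
Hypothesis L0 : 0 < Lip.
Hypothesis Jsph : forall p, sphere p -> exists2 j, j \in J & exists2 y, sq j.1.2 (j.2 / 2) y & chart j.1.1 y = p.
Hypothesis lip : forall (k l : K) x x' y y',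
  chart_dom k x -> chart_dom k x' -> chart_dom l y -> chart_dom l y' ->
  chart_rel k l x y -> chart_rel k l x' y' -> `|x - x'| <= Lip * `|y - y'|.

(** Inside Omega the z-derivative is independent of the chart, and continuity along z carries this
    to z0. The extensions [w] were obtained chart by chart, so this has to be proved. *)
Lemma normal_rel (k l : K) t x y : 0 < t < T -> chart_dom k x -> chart_dom l y -> chart_rel k l x y ->
  w k (inord 1) ((t, z0), x) = w l (inord 1) ((t, z0), y).
Proof.
move=> ht kx ly r; apply/eqP; rewrite -subr_eq0; apply/eqP.
have line (k' : K) x' : chart_dom k' x' -> con [set z | 0 < z <= z0] (fun z => w k' (inord 1) ((t, z), x')).
  move=> kx'; apply: (con_comp (i := fun z : R => ((t, z), x') : E4) _ _ (@wS k' (inord 1))).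
    move=> z; apply: (@pt_pair _ _ _ (fun z : R => (t, z)) (fun=> x')); last exact: cvg_cst.
    by apply: (@pt_pair _ _ _ (fun z : R => t) (fun z => z)); [exact: cvg_cst|exact: cvg_id].
  move=> z /= /andP[h1 h2]; split => //=; have /andP[t0 tT] := ht.
  have [->|zz] := eqVneq z z0; first by right; split => //=; rewrite !ltW.
  by left; left; split => //=; rewrite h1 lt_neqAle zz.
have c1 := con_mul (@con_cst R _ [set z : R | 0 < z <= z0] (-1)) (line _ _ ly).
have c2 := con_add (line _ _ kx) c1.
have zero z : 0 < z < z0 -> w k (inord 1) ((t, z), x) + -1 * w l (inord 1) ((t, z), y) = 0.
  move=> hz; rewrite mulN1r !wE ?e4_1; [|by split; [split|]..].
  by rewrite (pull_derive1_rel v (t, z) (0, 1) r) subrr.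
by have := con_zero_limit z00 c2 zero; rewrite mulN1r.
Qed.

(** The normal derivative is a scalar on the sphere, so only the measure factor (2 Lip)^2 is lost in
    passing from the half-size squares to a chart domain. *)
Lemma normal_chart taa T2 (k : K) : 0 < taa -> taa < T2 -> T2 < T ->
  (\int[leb3]_(y in box3 taa T2 (chart_dom k)) (w k (inord 1) ((y.1, z0), y.2) ^+ 2)%:E <=
   ((2 * Lip) ^+ 2 * \sum_(j <- J) \int[leb3]_(y in box3 taa T2 (half j)) w j.1.1 (inord 1) ((y.1, z0), y.2) ^+ 2)%:E)%E.
Proof.
move=> ta0 tT TT; pose GG (k : K) (y : mR * (mR * mR)) : R := w k (inord 1) ((y.1, z0), y.2) ^+ 2.
have mA : measurable (`[taa, T2]%classic : set mR) := itv_measurable _ _.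
have Sx (t : R) : (`[taa, T2]%classic : set mR) t -> 0 < t < T.
  by rewrite /= in_itv /= => /andP[h1 h2]; rewrite (lt_le_trans ta0 h1) (le_lt_trans h2 TT).
have conG (l : K) : con (box3 taa T2 (chart_dom l)) (GG l).
  have cc2 := con_mul (@wS l (inord 1)) (@wS l (inord 1)).
  apply: (con_comp (i := fun y : E3 => ((y.1, z0), y.2) : E4) (@face1_continuous R z0) _ cc2).
  move=> y [/Sx /andP[h1 h2] h3]; split => //; right; split => //=; by rewrite !ltW.
have mD (l : K) : measurable (box3 taa T2 (chart_dom l) : set (mR * (mR * mR))).
  by apply: measurableX => //; exact: chart_dom_measurable.
have mG (l : K) : measurable_fun (`[taa, T2]%classic `*` (chart_dom l : set (mR * mR)) : set (mR * (mR * mR))) (GG l).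
  exact: (@con_measurable R _ _ (mR * (mR * mR))%type (@to3 R) _ (GG l) (@open_measurable3 R) (mD l) (@conG l)).
have pos (l : K) q : (`[taa, T2]%classic `*` (chart_dom l : set (mR * mR)) : set (mR * (mR * mR))) q -> 0 <= GG l q.
  by move=> _; exact: sqr_ge0.
have c1 : 0 <= (2 * Lip) ^+ 2 * 1 by rewrite mulr1 sqr_ge0.
have H := @compare_product R At _ mR (@lebesgue_measure R) J `[taa, T2]%classic GG _ mA c1 Jdom mG pos k.
rewrite mulr1 in H.
have bmH (j : bump_box At) : j \in J -> (\int[leb3]_(y in box3 taa T2 (half j)) w j.1.1 (inord 1) ((y.1, z0), y.2) ^+ 2)%:E =
    (\int[leb3]_(y in box3 taa T2 (half j)) (GG j.1.1 y)%:E)%E.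
  move=> jJ; have [r0 jd] := Jdom jJ.
  have cw : con (cyl Sa j.1.1) (fun q => w j.1.1 (inord 1) q ^+ 2) := con_mul (@wS _ _) (@wS _ _).
  have hz : z0 / 2 <= z0 <= z0 by rewrite lexx andbT ler_pdivrMr// ler_pMr// ler1n.
  have z20 : 0 < z0 / 2 by rewrite divr_gt0.
  have bw := face1_bm jd cw TT z20 hz (ltW ta0) (lexx T2).
  have mS : measurable (box3 taa T2 (S j) : set (mR * (mR * mR))) := box3_measurable _ _ _ _ _ _.
  have mH : measurable (box3 taa T2 (half j) : set (mR * (mR * mR))).
    by apply: measurableX; [exact: itv_measurable|exact: half_measurable].
  have s1 : box3 taa T2 (half j) `<=` box3 taa T2 (S j) by move=> y [h1 h2]; split => //; exact: sq_sqc h2.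
  have fS : (leb3 (box3 taa T2 (S j) : set (mR * (mR * mR))) < +oo)%E :=
    leb3_finite (itv_measurable _ _) (box2_measurable _ _ _ _) (itv_finite _ _) (box2_finite _ _ _ _).
  have fH : (leb3 (box3 taa T2 (half j) : set (mR * (mR * mR))) < +oo)%E.
    by apply: le_lt_trans fS; apply: le_measure; rewrite ?inE; [exact: mH|exact: mS|exact: s1].
  exact: (bm_RintegralE mH fH (bm_subset mS mH s1 bw)).
rewrite EFinM -sumEFin (eq_big_seq _ bmH); apply: H => t At'.
rewrite -[(2 * Lip) ^+ 2]mulr1.
apply: (chart_integral_le (G := fun l x => GG l (t, x)) Jdom Jsph L0) => //.
- move=> l x lx; apply: (con_open_continuous (@chart_dom_open R At l) _ lx).
  have c2 := con_comp (A' := chart_dom l) (i := fun x : E2 => (t, x) : E3) _ _ (@conG l).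
  by apply: c2 => //; move=> z; apply: (@pt_pair _ _ _ (fun=> t) (fun z => z)); [exact: cvg_cst|exact: cvg_id].
- by move=> l x _; exact: sqr_ge0.
- by move=> l x y kx ly r; rewrite mul1r /GG /= (normal_rel (Sx _ At') kx ly r).
Qed.

End SlabLimits.

(** * Cauchy data *)

Section LebesgueNorms.
Context {R : realType}.

Lemma poweR_sqr (x : \bar R) : (0 <= x -> x `^ 2 = x ^+ 2)%E.
Proof.
case: x => [r|_|//]; last by rewrite poweRyr ?expe2 ?mulyy.
by rewrite lee_fin => r0; rewrite poweR_EFin powR_mulrn// EFin_expe.
Qed.

Lemma Lpnorm_sqr d (X : measurableType d) (E : normedModType R) (mu : {measure set X -> \bar R})
  (toE : X -> E) (D : set E) (u : E -> R) :
  (Lpnorm mu toE 2%:E D u ^+ 2 = \int[mu]_(x in toE @^-1` D) (u (toE x) ^+ 2)%:E)%E.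
Proof.
rewrite -poweR_sqr ?Lnorm_ge0// /Lpnorm poweR_Lnorm// [RHS]integral_mkcond.
apply: eq_integral => x _ /=; rewrite /restrict /patch.
have -> : (x \in toE @^-1` D) = (toE x \in D) by apply/idP/idP; rewrite !in_setE.
case: ifPn => _; last by rewrite normr0 powR0.
by rewrite powR_mulrn// real_normK ?num_real.
Qed.

End LebesgueNorms.

Section OpenClosedBox.
Context {R : realType}.
Local Notation mR := (measurableTypeR R).
Local Notation E3 := (R * (R * R))%type.
Variables (j k : E3).
Local Notation B := (box3 j.1 k.1 (box2 j.2.1 k.2.1 j.2.2 k.2.2)).

Lemma obox3_box3 : obox3 j k `<=` B.
Proof.
move=> y [/= + [/= + +]]; rewrite !in_itv /= => h1 h2 h3.
by split; [|split]; rewrite /= in_itv /=; lra.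
Qed.

Lemma obox3_measurable : measurable (obox3 j k : set (mR * (mR * mR))).
Proof. by apply: measurableX; [exact: measurable_itv|apply: measurableX; exact: measurable_itv]. Qed.

(** Endpoints do not change the length of an interval, so the two boxes have the same finite
    measure. *)
Lemma box3_obox3_null : leb3 (B `\` obox3 j k : set (mR * (mR * mR))) = 0%E.
Proof.
have mB : measurable (B : set (mR * (mR * mR))) := box3_measurable _ _ _ _ _ _.
have fB : (leb3 (B : set (mR * (mR * mR))) < +oo)%E :=
  leb3_finite (itv_measurable _ _) (box2_measurable _ _ _ _) (itv_finite _ _) (box2_finite _ _ _ _).
have mO := obox3_measurable.
have E : leb3 (obox3 j k : set (mR * (mR * mR))) = leb3 (B : set (mR * (mR * mR))).
  have h (a b : R) : @lebesgue_measure R `]a, b[%classic = @lebesgue_measure R `[a, b]%classic.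
    by rewrite !lebesgue_measure_itv.
  have m2 (X Y : interval R) : measurable ([set` X] `*` [set` Y] : set (mR * mR)) by apply: measurableX; exact: measurable_itv.
  have P (X Y Z : interval R) : leb3 ([set` X] `*` ([set` Y] `*` [set` Z]) : set (mR * (mR * mR))) =
      (@lebesgue_measure R [set` X] * (@lebesgue_measure R [set` Y] * @lebesgue_measure R [set` Z]))%E.
    rewrite -[X in _ = (_ * X)%E](@product_measure1E _ _ mR mR R _ lebesgue_measure) ?measurable_itv//.
    by rewrite -[RHS](@product_measure1E _ _ mR (mR * mR)%type R _ leb2) ?measurable_itv//; exact: m2.
  by rewrite /obox3 /box3 /box2 !P !h.
have h0 : leb3 (B : set (mR * (mR * mR))) \is a fin_num by rewrite ge0_fin_numE; [exact: fB|exact: measure_ge0].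
have -> : leb3 (B `\` obox3 j k : set (mR * (mR * mR))) = (leb3 (B : set (mR * (mR * mR))) - leb3 (obox3 j k : set (mR * (mR * mR))))%E.
  by rewrite -[in RHS](setIidr obox3_box3); exact: measureD mB mO fB.
rewrite E; exact: subee h0.
Qed.

Lemma integral_obox3 (f : E3 -> \bar R) : measurable_fun (B : set (mR * (mR * mR))) f ->
  (forall y, B y -> (0 <= f y)%E) -> (\int[leb3]_(y in B) f y = \int[leb3]_(y in obox3 j k) f y)%E.
Proof.
move=> mf f0; have mB : measurable (B : set (mR * (mR * mR))) := box3_measurable _ _ _ _ _ _.
have mN : measurable (B `\` obox3 j k : set (mR * (mR * mR))).
  by apply: measurableD => //; exact: obox3_measurable.
rewrite (ge0_negligible_integral mN mB mf f0 box3_obox3_null).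
by congr (integral _ _ _); rewrite setDD; apply/setIidr; exact: obox3_box3.
Qed.

End OpenClosedBox.

Lemma derive_affine (R : realType) (E F : normedModType R) (u : F -> R) (i : E -> F) (e : E) (l : F) y :
  (forall h : R, i (h *: e + y) = h *: l + i y) -> 'D_e (u \o i) y = 'D_l u (i y).
Proof.
move=> H; rewrite /derive; set d := (fun h : R => _); set d' := (fun h : R => _).
suff -> : d = d' by [].
by apply/funext => h; rewrite /d /d' /= H.
Qed.

Lemma derivable_affine (R : realType) (E F : normedModType R) (u : F -> R) (i : E -> F) (e : E) (l : F) y :
  (forall h : R, i (h *: e + y) = h *: l + i y) -> derivable u (i y) l -> derivable (u \o i) y e.
Proof.
move=> H; rewrite /derivable; set d := (fun h : R => _); set d' := (fun h : R => _).
suff -> : d = d' by [].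
by apply/funext => h; rewrite /d /d' /= H.
Qed.

Lemma C1_affine (R : realType) (E F : normedModType R) (D : set E) (O : set F) (u : F -> R) (i : E -> F) (l : E -> F) :
  open D -> continuous i -> (forall e y (h : R), i (h *: e + y) = h *: l e + i y) ->
  (forall y, D y -> O (i y)) -> C1 O u -> C1 D (u \o i).
Proof.
move=> oD ci H DO u1; apply: (@C1_intro _ _ _ oD _ (fun e => 'D_(l e) u \o i)) => [y|y e] /DO Oy.
  by apply: continuous_comp; [exact: ci|exact: (u1 _ Oy).1].
have [_ /(_ (l e))[d c]] := u1 _ Oy; split; last by apply: continuous_comp; [exact: ci|exact: c].
by split; [exact: derivable_affine (H e y) d|exact: derive_affine (H e y)].
Qed.

Lemma e3_cases (R : realType) (j : 'I_3) :
  @e3 R j = (1, (0, 0)) \/ @e3 R j = (0, (1, 0)) \/ @e3 R j = (0, (0, 1)).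
Proof. by rewrite /e3; case: j => -[|[|[|]]]//= _; [left|right; left|right; right]. Qed.

Section FaceData.
Context {R : realType}.
Local Notation mR := (measurableTypeR R).
Local Notation E2 := (R * R)%type.
Local Notation E3 := (R * (R * R))%type.
Local Notation E4 := ((R * R) * (R * R))%type.
Variables (O A : set E4) (D : set E3) (u : E4 -> R) (w : 'I_3 -> E4 -> R) (psi : E3 -> R).
Variables (i : R -> E3 -> E4) (l : E3 -> E4) (d0 : R) (a b : R) (c : E2) (r : R).
Local Notation B := (box3 a b (sqc c r)).
Variable Q : set E4.
Hypotheses (oD : open D) (BD : B `<=` D) (d00 : 0 < d0) (ab : a < b) (r0 : 0 < r).
Hypotheses (u1 : C1 O u) (cu : con A u) (cw : forall j, con A (w j)).
Hypothesis wE : forall j q, O q -> w j q = 'D_(l (e3 j)) u q.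
Hypotheses (ci : forall d, continuous (i d)) (iE : forall d e y (h : R), i d (h *: e + y) = h *: l e + i d y).
Hypothesis iO : forall d y, 0 < d -> d < d0 -> D y -> O (i d y).
Hypotheses (cQ : compact Q) (QA : Q `<=` A).
Hypothesis iQ : forall d y, 0 <= d -> d < d0 -> B y -> Q (i d y).
Hypothesis idist : forall d y, 0 < d -> `|i d y - i 0 y| <= d.
Hypothesis ae_psi : {ae leb3, forall y, D (to3 y) -> u (i 0 (to3 y)) = psi (to3 y)}.

Let mB : measurable (B : set (mR * (mR * mR))) := box3_measurable _ _ _ _ _ _.

Let bface (s : E4 -> R) : con A s -> bm (B : set (mR * (mR * mR))) (fun y => s (i 0 y)).
Proof.
move=> cs; apply: con_bm3; [exact: box3_compact|exact: mB|].
by apply: (con_comp (@ci 0) _ (con_subset QA cs)) => y; exact: iQ.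
Qed.

(** The map [i d] places the face at distance [d] inside the region and [l] is its linear part. The
    restrictions of [u] to the shifted faces are C^1, converge uniformly with their derivatives, and
    so serve as the approximations required by [weak_trace]. *)
Lemma face_trace j (G : E3 -> R) : inL2 leb3 to3 D psi -> inL2 leb3 to3 D G -> weak_derivative leb3 to3 D (e3 j) psi G ->
  (\int[leb3]_(y in B) (w j (i 0 y) ^+ 2)%:E <= Lpnorm leb3 to3 2%:E D G ^+ 2)%E.
Proof.
move=> [mpsi _] [mG fG] wd.
have bw := bface (@cw j).
rewrite Lpnorm_sqr.
pose p : E3 := (a, (c.1 - r, c.2 - r)); pose q : E3 := (b, (c.1 + r, c.2 + r)).
have rr (x : R) : x - r < x + r by have := r0; lra.
have -> : (\int[leb3]_(y in B) (w j (i 0 y) ^+ 2)%:E = \int[leb3]_(y in obox3 p q) (w j (i 0 y) ^+ 2)%:E)%E.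
  apply: (@integral_obox3 R p q (fun y => (w j (i 0 y) ^+ 2)%:E)) => [|y _]; last by rewrite lee_fin sqr_ge0.
  by apply/measurable_EFinP; apply: measurable_funX; have [] := bw.
have lt2 m : 0 < d0 / m.+2%:R /\ d0 / m.+2%:R < d0.
  split; first by rewrite divr_gt0.
  by rewrite ltr_pdivrMr// ltr_pMr// ltr1n.
have G2 : (\int[leb3]_(y in to3 @^-1` D) (G (to3 y) ^+ 2)%:E < +oo)%E.
  rewrite -Lpnorm_sqr; move: fG; have := Lnorm_ge0 leb3 2%:E (EFin \o ((G \_ D) \o to3)); rewrite -/(Lpnorm leb3 to3 2%:E D G).
  by case: (Lpnorm _ _ _ _ _) => // s _ _; rewrite -EFin_expe ltry.
have um1 m : C1 D (u \o i (d0 / m.+2%:R)).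
  have [h1 h2] := lt2 m; exact: (C1_affine oD (@ci _) (iE _) (fun y Dy => iO h1 h2 Dy) u1).
have HW := @weak_trace R D psi (u \o i 0) (w j \o i 0) G (e3 j) p q (fun m => u \o i (d0 / m.+2%:R)) oD BD ab (rr _) (rr _) (e3_cases R j) mG mpsi G2 wd ae_psi (bface cu) bw um1.
apply: HW => eta eta0.
have [d1 d10 H1] := con_uniform cQ (con_subset QA cu) eta0.
have [d2 d20 H2] := con_uniform cQ (con_subset QA (@cw j)) eta0.
have dm0 : 0 < Num.min d1 d2 by rewrite lt_min d10.
(* The shift d0 / (m + 2) is then below both moduli of continuity; the offset 2 keeps it strictly
   below d0 for every m. *)
exists (Num.bound (d0 / Num.min d1 d2)); set m := Num.bound _ => y By.
have [h1 h2] := lt2 m.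
have : d0 / m.+2%:R < Num.min d1 d2.
  rewrite ltr_pdivrMr// mulrC -ltr_pdivrMr//.
  apply: lt_le_trans (archi_boundP _) _; first by rewrite divr_ge0 ?ltW.
  by rewrite ler_nat -/m ltnW// ltnW.
rewrite lt_min => /andP[k1 k2].
have q0 := iQ (lexx 0) d00 By; have qm := iQ (ltW h1) h2 By.
have hd := idist y h1.
split; first by apply/ltW/H1 => //; exact: le_lt_trans hd k1.
rewrite (derive_affine u (iE _ (e3 j) y)) -wE; last exact: (iO h1 h2 (BD By)).
by apply/ltW/H2 => //; exact: le_lt_trans hd k2.
Qed.

Lemma face_trace0 : measurable_on to3 D psi ->
  (\int[leb3]_(y in B) (u (i 0 y) ^+ 2)%:E <= Lpnorm leb3 to3 2%:E D psi ^+ 2)%E.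
Proof.
move=> mpsi; have bu := bface cu; rewrite Lpnorm_sqr.
have mD : measurable (to3 @^-1` D : set (mR * (mR * mR))) := open_measurable3 oD.
have m2 : measurable_fun (to3 @^-1` D : set (mR * (mR * mR))) (fun y => (psi (to3 y) ^+ 2)%:E).
  by apply/measurable_EFinP; apply: measurable_funX; exact: mpsi.
apply: (@le_trans _ _ (\int[leb3]_(y in B) (psi (to3 y) ^+ 2)%:E)%E).
  apply: ae_ge0_le_integral => //.
  - by move=> y _; rewrite lee_fin sqr_ge0.
  - by apply/measurable_EFinP; apply: measurable_funX; have [] := bu.
  - by move=> y _; rewrite lee_fin sqr_ge0.
  - exact: measurable_funS mD _ m2.
  - by apply: filterS ae_psi => y H By; rewrite -H//; exact: BD.
by apply: ge0_subset_integral => // y _; rewrite lee_fin sqr_ge0.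
Qed.

(** The bound holds for each weak gradient of the data, hence for the infimum that defines the norm;
    when there is none the right side is infinite. *)
Lemma face_H1 : (\int[leb3]_(y in B) (\sum_(j < 3) w j (i 0 y) ^+ 2 + u (i 0 y) ^+ 2)%:E
  <= H1sqnorm leb3 to3 e3 D psi)%E.
Proof.
apply: le_ereal_inf_tmp => _ [G [[mpsi fpsi] HG] <-].
have mw j : measurable_fun (B : set (mR * (mR * mR))) (fun y => (w j (i 0 y) ^+ 2)%:E).
  by apply/measurable_EFinP; apply: measurable_funX; have [] := bface (@cw j).
have mu : measurable_fun (B : set (mR * (mR * mR))) (fun y => (u (i 0 y) ^+ 2)%:E).
  by apply/measurable_EFinP; apply: measurable_funX; have [] := bface cu.
under eq_integral => y _ do rewrite EFinD -sumEFin.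
rewrite ge0_integralD//; last 3 first.
- by move=> y _; apply: sume_ge0 => j _; rewrite lee_fin sqr_ge0.
- by apply: emeasurable_sum => j; exact: mw.
- by move=> y _; rewrite lee_fin sqr_ge0.
rewrite addeC; apply: leeD; first exact: face_trace0.
rewrite ge0_integral_sum//; last by move=> j y _; rewrite lee_fin sqr_ge0.
apply: lee_sum => j _; have [g1 g2] := HG j; exact: face_trace.
Qed.

End FaceData.

Section CauchyData.
Context {R : realType} (At : sphere_atlas R).
Local Notation mR := (measurableTypeR R).
Local Notation E2 := (R * R)%type.
Local Notation E3 := (R * (R * R))%type.
Local Notation E4 := ((R * R) * (R * R))%type.
Variables (T z0 : R) (k : chart_index At) (v : E2 -> 'rV[R]_3 -> R) (w : 'I_4 -> E4 -> R) (c : E2) (r : R).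
Hypotheses (T0 : 0 < T) (z00 : 0 < z0) (r0 : 0 < r).
Local Notation Om := (base_Omega T z0).
Local Notation Sa := (base_all T z0).
Local Notation S := (sqc c r).
Hypothesis Sk : S `<=` chart_dom k.
Hypothesis v1 : C1 (cyl Om k) (pull k v).
Hypothesis vS : con (cyl Sa k) (pull k v).
Hypothesis wS : forall i, con (cyl Sa k) (w i).
Hypothesis wE : forall i q, cyl Om k q -> w i q = 'D_(e4 i) (pull k v) q.

Let cyl3_open s : open (cyl3 s k).
Proof.
have -> : cyl3 s k = fst @^-1` `]0, s[%classic `&` snd @^-1` (chart_dom k).
  by apply/seteqP; split => y /=; rewrite in_itv.
apply: openI; apply: open_comp; [by move=> x _; exact: pt_fst|exact: interval_open|by move=> x _; exact: pt_snd|].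
exact: (@chart_dom_open R At k).
Qed.

Lemma initial_data phi eps z1 : 0 < eps -> eps < z1 -> z1 < z0 ->
  {ae leb3, forall y, cyl3 z0 k (to3 y) -> pull k v ((0, (to3 y).1), (to3 y).2) = pull3 k phi (to3 y)} ->
  ((\int[leb3]_(y in box3 eps z1 S) (w (inord 1) ((0, y.1), y.2) ^+ 2 + w (inord 2) ((0, y.1), y.2) ^+ 2
     + w (inord 3) ((0, y.1), y.2) ^+ 2 + pull k v ((0, y.1), y.2) ^+ 2))%:E
    <= H1sqnorm leb3 to3 e3 (cyl3 z0 k) (pull3 k phi))%E.
Proof.
move=> e0 ez zz ae.
have T20 : 0 < T / 2 by rewrite divr_gt0.
have T2 : T / 2 < T by rewrite ltr_pdivrMr// ltr_pMr// ltr1n.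
have BD : box3 eps z1 S `<=` cyl3 z0 k.
  move=> y [/= + Sy]; rewrite in_itv /= => /andP[h1 h2]; split; last exact: Sk.
  by rewrite (lt_le_trans e0 h1) (le_lt_trans h2 zz).
pose Q := box2 0 (T / 2) eps z0 `*` S : set E4.
have cQ : compact Q by apply: compact_setX; exact: box2_compact.
have QA : Q `<=` cyl Sa k by move=> [b x] [hb hx]; split; [exact: (closed_base_all T2 e0 hb)|exact: Sk].
pose i d (y : E3) : E4 := ((d, y.1), y.2); pose l (e : E3) : E4 := ((0, e.1), e.2).
(* The tangential directions of Sigma_0 are z, x2, x3. *)
pose w' (j : 'I_3) := w (inord j.+1).
have le3 j : l (e3 j) = e4 (inord j.+1).
  by case: j => -[|[|[|]]]// h; rewrite /l /e3 /= ?e4_1 ?e4_2 ?e4_3.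
have w'E j q : cyl Om k q -> w' j q = 'D_(l (e3 j)) (pull k v) q by move=> Oq; rewrite le3; exact: wE.
have iE d e y (h : R) : i d (h *: e + y) = h *: l e + i d y.
  by rewrite /i /l; congr ((_, _), _); rewrite /= scaler0 add0r.
have iO d y : 0 < d -> d < T / 2 -> cyl3 z0 k y -> cyl Om k (i d y).
  by move=> d0 dT [h1 h2]; split => //; split => //=; rewrite d0 (lt_trans dT T2).
have iQ d y : 0 <= d -> d < T / 2 -> box3 eps z1 S y -> Q (i d y).
  move=> d0 dT [/= + Sy]; rewrite in_itv /= => /andP[h1 h2]; split => //.
  by split; rewrite /= in_itv /= ?d0 ?(ltW dT) ?h1 ?(le_trans h2 (ltW zz)).
have idd d y : 0 < d -> `|i d y - i 0 y| <= d.
  by move=> d0; have := face0_dist d 0 y.1 y.2; rewrite subr0 (gtr0_norm d0).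
have H := @face_H1 R (cyl Om k) (cyl Sa k) (cyl3 z0 k) (pull k v) w' (pull3 k phi) i l (T / 2) eps z1 c r Q
  (@cyl3_open z0) BD T20 ez r0 v1 vS (fun j => @wS _) w'E (@face0_continuous R) iE iO cQ QA iQ idd ae.
apply: le_trans H.
have mB : measurable (box3 eps z1 S : set (mR * (mR * mR))) := box3_measurable _ _ _ _ _ _.
have fB : (leb3 (box3 eps z1 S : set (mR * (mR * mR))) < +oo)%E :=
  leb3_finite (itv_measurable _ _) (box2_measurable _ _ _ _) (itv_finite _ _) (box2_finite _ _ _ _).
have bf (s : E4 -> R) : con (cyl Sa k) s -> bm (box3 eps z1 S : set (mR * (mR * mR))) (fun y => s (i 0 y)).
  move=> cs; apply: con_bm3; [exact: box3_compact|exact: mB|].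
  by apply: (con_comp (@face0_continuous R 0) _ (con_subset QA cs)) => y; exact: iQ.
have wq j : con (cyl Sa k) (fun q => w j q ^+ 2) by exact: (con_mul (@wS j) (@wS j)).
rewrite (bm_RintegralE mB fB (bf _ (con_add (con_add (con_add (wq _) (wq _)) (wq _)) (con_mul vS vS)))).
rewrite le_eqVlt; apply/orP; left; apply/eqP; apply: eq_integral => y _.
by rewrite !big_ord_recr big_ord0 /= add0r /w' /= -expr2.
Qed.

Lemma lateral_data psi t1 t2 : 0 < t1 -> t1 < t2 -> t2 < T ->
  {ae leb3, forall y, cyl3 T k (to3 y) -> pull k v (((to3 y).1, z0), (to3 y).2) = pull3 k psi (to3 y)} ->
  ((\int[leb3]_(y in box3 t1 t2 S) (w (inord 0) ((y.1, z0), y.2) ^+ 2 + w (inord 2) ((y.1, z0), y.2) ^+ 2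
     + w (inord 3) ((y.1, z0), y.2) ^+ 2))%:E
    <= H1sqnorm leb3 to3 e3 (cyl3 T k) (pull3 k psi))%E.
Proof.
move=> t10 tt t2T ae.
have z20 : 0 < z0 / 2 by rewrite divr_gt0.
have BD : box3 t1 t2 S `<=` cyl3 T k.
  move=> y [/= + Sy]; rewrite in_itv /= => /andP[h1 h2]; split; last exact: Sk.
  by rewrite (lt_le_trans t10 h1) (le_lt_trans h2 t2T).
pose Q := box2 0 t2 (z0 / 2) z0 `*` S : set E4.
have cQ : compact Q by apply: compact_setX; exact: box2_compact.
have QA : Q `<=` cyl Sa k by move=> [b x] [hb hx]; split; [exact: (closed_base_all t2T z20 hb)|exact: Sk].
pose i d (y : E3) : E4 := ((y.1, z0 - d), y.2); pose l (e : E3) : E4 := ((e.1, 0), e.2).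
(* The tangential directions of Sigma_1 are tau, x2, x3, so index 1 is skipped. *)
pose w' (j : 'I_3) := w (inord (nth 0%N [:: 0; 2; 3]%N j)).
have le3 j : l (e3 j) = e4 (inord (nth 0%N [:: 0; 2; 3]%N j)).
  by case: j => -[|[|[|]]]// h; rewrite /l /e3 /= ?e4_0 ?e4_2 ?e4_3.
have w'E j q : cyl Om k q -> w' j q = 'D_(l (e3 j)) (pull k v) q by move=> Oq; rewrite le3; exact: wE.
have iE d e y (h : R) : i d (h *: e + y) = h *: l e + i d y.
  by rewrite /i /l; congr ((_, _), _); rewrite /= scaler0 add0r.
have iO d y : 0 < d -> d < z0 / 2 -> cyl3 T k y -> cyl Om k (i d y).
  by move=> d0 dT [h1 h2]; split => //; split => //=; apply/andP; split; lra.
have iQ d y : 0 <= d -> d < z0 / 2 -> box3 t1 t2 S y -> Q (i d y).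
  move=> d0 dT [/= + Sy]; rewrite in_itv /= => /andP[h1 h2]; split => //.
  split; rewrite /= in_itv /=; first by rewrite h2 (le_trans (ltW t10) h1).
  by apply/andP; split; lra.
have idd d y : 0 < d -> `|i d y - i 0 y| <= d.
  move=> d0; have := face1_dist (z0 - d) (z0 - 0) y.1 y.2.
  by rewrite /i !subr0 addrAC subrr add0r normrN (gtr0_norm d0).
have ci d : continuous (i d) by exact: (@face1_continuous R).
have H := @face_H1 R (cyl Om k) (cyl Sa k) (cyl3 T k) (pull k v) w' (pull3 k psi) i l (z0 / 2) t1 t2 c r Q
  (@cyl3_open T) BD z20 tt r0 v1 vS (fun j => @wS _) w'E ci iE iO cQ QA iQ idd.
have ae' : {ae leb3, forall y, cyl3 T k (to3 y) -> pull k v (i 0 (to3 y)) = pull3 k psi (to3 y)}.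
  by apply: filterS ae => y h; rewrite /i subr0.
apply: le_trans (H ae').
have mB : measurable (box3 t1 t2 S : set (mR * (mR * mR))) := box3_measurable _ _ _ _ _ _.
have fB : (leb3 (box3 t1 t2 S : set (mR * (mR * mR))) < +oo)%E :=
  leb3_finite (itv_measurable _ _) (box2_measurable _ _ _ _) (itv_finite _ _) (box2_finite _ _ _ _).
have bf (s : E4 -> R) : con (cyl Sa k) s -> bm (box3 t1 t2 S : set (mR * (mR * mR))) (fun y => s ((y.1, z0), y.2)).
  move=> cs; apply: con_bm3; [exact: box3_compact|exact: mB|].
  apply: (con_comp (@face1_continuous R z0) _ (con_subset QA cs)) => y By.
  by have := iQ 0 y (lexx 0) z20 By; rewrite /i subr0.
have wq j : con (cyl Sa k) (fun q => w j q ^+ 2) by exact: (con_mul (@wS j) (@wS j)).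
have b1 := bf _ (con_add (con_add (wq (inord 0)) (wq (inord 2))) (wq (inord 3))).
rewrite (bm_RintegralE mB fB b1); apply: ge0_le_integral => //.
- by move=> y _; rewrite lee_fin !addr_ge0 ?sqr_ge0.
- by apply/measurable_EFinP; have [] := b1.
- apply/measurable_EFinP; have [m2 _] := bf _ (con_add (con_add (con_add (wq (inord 0)) (wq (inord 2))) (wq (inord 3))) (con_mul vS vS)).
  by apply: eq_measurable_fun m2 => y _; rewrite !big_ord_recr big_ord0 /= add0r /w' /i /= subr0 -expr2.
by move=> y _; rewrite lee_fin !big_ord_recr big_ord0 /= add0r /w' /i /= subr0 lerDl sqr_ge0.
Qed.

End CauchyData.

(** * Sobolev norms *)

Section ClassicalGradient.
Context {R : realType}.
Local Notation mR := (measurableTypeR R).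
Local Notation E2 := (R * R)%type.
Local Notation E4 := ((R * R) * (R * R))%type.
Local Notation mE := ((mR * mR) * (mR * mR))%type.

(** Points outside [O] lie in the open complement of [K], near which the extension by 0 is
    constant. *)
Lemma patch_continuous (O K : set E4) (h : E4 -> R) : open O -> compact K -> K `<=` O ->
  (forall x, O x -> {for x, continuous h}) -> (forall x, O x -> ~ K x -> h x = 0) ->
  (forall x, ~ K x -> (h \_ O) x = 0) /\ continuous (h \_ O).
Proof.
move=> oO cK KO ch h0.
have z x : ~ K x -> (h \_ O) x = 0.
  by rewrite /patch; case: ifPn => // /set_mem Ox Kx; exact: h0.
split => // x; have [Ox|nO] := pselect (O x).
  have e : \forall y \near x, h y = (h \_ O) y.
    by have := open_nbhs_nbhs (conj oO Ox); apply: filterS => y Oy; rewrite /patch mem_set.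
  rewrite /continuous_at {2}/patch (mem_set Ox); apply: cvg_trans (ch x Ox); exact: near_eq_cvg.
have Kx : ~ K x by move=> /KO.
have cl : open (~` K) by apply: closed_openC; exact: (compact_closed (@norm_hausdorff R E4) cK).
have e : \forall y \near x, (0 : R) = (h \_ O) y.
  by have := open_nbhs_nbhs (conj cl Kx); apply: filterS => y /z ->.
rewrite /continuous_at (z _ Kx); apply: (cvg_trans (near_eq_cvg e)); exact: cvg_cst.
Qed.

Lemma e4_cases (i : 'I_4) : [\/ @e4 R i = ((1, 0), (0, 0)), @e4 R i = ((0, 1), (0, 0)) |
  exists2 w, w = (1, 0) \/ w = (0, 1) & @e4 R i = ((0, 0), w)].
Proof.
by rewrite /e4; case: i => -[|[|[|[|]]]]//= _; [constructor 1|constructor 2|constructor 3; exists (1, 0); [left|]|constructor 3; exists (0, 1); [right|]].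
Qed.

Lemma integral_derive_compact (Psi : E4 -> R) (K : set E4) i : compact K -> C1 setT Psi ->
  (forall x, ~ K x -> Psi x = 0) ->
  exists2 N : R, 0 < N & let B := box2 (- N) N (- N) N `*` box2 (- N) N (- N) N in
    K `<=` B /\ \int[leb4]_(q in B) 'D_(e4 i) Psi q = 0.
Proof.
move=> cK P1 P0.
have [M HM] : exists M : R, forall x, K x -> `|(`|x|)| <= M.
  apply: (@con_bounded R E4 K (fun x => `|x|) cK); apply: con_open => x _; exact: norm_continuous.
pose N := `|M| + 1; have N0 : 0 < N by rewrite ltr_wpDl.
have NN : - N < N by rewrite gtrN.
have inK x : K x -> [/\ `|x.1.1| < N, `|x.1.2| < N, `|x.2.1| < N & `|x.2.2| < N].
  move=> /HM; rewrite normr_id => h; have {h} : `|x| < N.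
    by apply: le_lt_trans h _; apply: le_lt_trans (ler_norm M) _; rewrite ltrDl.
  by rewrite /Num.norm /= gt_max [X in X < _]/Num.norm /= [X in _ && (X < _)]/Num.norm /= !gt_max => /andP[/andP[? ?] /andP[? ?]].
exists N => //; set B := (X in let B := X in _); have KB : K `<=` B.
  move=> [[t z] [x y]] /inK[/= h1 h2 h3 h4]; split; split; rewrite /= in_itv /= -ler_norml; exact: ltW.
have out (q : E4) : q.1.1 = N \/ q.1.1 = -N \/ q.1.2 = N \/ q.1.2 = - N \/ q.2.1 = N \/ q.2.1 = - N \/ q.2.2 = N \/ q.2.2 = - N -> Psi q = 0.
  move=> H; apply: P0 => /inK[]; have nN : `|N| = N by rewrite gtr0_norm.
  by case: H => [|[|[|[|[|[|[|]]]]]]] -> h1 h2 h3 h4; move: h1 h2 h3 h4; rewrite ?normrN nN ltxx.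
split => //.
have BT : B `<=` setT by [].
have [->|->|[w hw ->]] := e4_cases i.
- rewrite (ibp4_0 NN openT P1 BT); apply: Rintegral_eq0 => y _.
  by rewrite !out ?subrr//=; tauto.
- rewrite (ibp4_1 NN openT P1 BT); apply: Rintegral_eq0 => y _.
  by rewrite !out ?subrr//=; tauto.
by apply: (ibp4_zero NN NN openT P1 BT hw) => c x _ _ H; apply: out => /=; tauto.
Qed.

Variables (O : set E4) (u : E4 -> R).
Hypotheses (oO : open O) (u1 : C1 O u).

(** The product of [u] with a test function, extended by 0, is C^1 on the whole space because the
    support is compact in [O]. Its derivative integrates to 0 over a cube containing the support, so
    no regularity of the boundary of [O] enters. *)
Lemma classical_weak_derivative i : weak_derivative leb4 to4 O (e4 i) u ('D_(e4 i) u).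
Proof.
move=> eta [seta [K [cK KO eta0]]].
have e1 : C1 setT eta by apply/Ck1_C1/seta.
have clK : open (~` K) by apply: closed_openC; exact: (compact_closed (@norm_hausdorff R E4) cK).
have Deta0 v x : ~ K x -> 'D_v eta x = 0.
  move=> Kx; have e : \forall y \near x, eta y = cst (0 : R) y.
    by have := open_nbhs_nbhs (conj clK Kx); apply: filterS => y /eta0.
  by rewrite (near_eq_derive _ e) derive_cst.
have cu x : O x -> {for x, continuous u} by move=> /u1[].
have cDu v x : O x -> {for x, continuous ('D_v u)} by move=> /u1[_ /(_ v)[]].
have ce x : {for x, continuous eta} by have [] := e1 x Logic.I.
have cDe v x : {for x, continuous ('D_v eta)} by have [_ /(_ v)[]] := e1 x Logic.I.
have [P0 cP] := @patch_continuous O K (fun q => u q * eta q) oO cK KO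
  (fun x Ox => cvgM (cu x Ox) (ce x)) (fun x _ Kx => etrans (congr1 _ (eta0 _ Kx)) (mulr0 _)).
have [F10 cF1] := @patch_continuous O K (fun q => u q * 'D_(e4 i) eta q) oO cK KO
  (fun x Ox => cvgM (cu x Ox) (cDe _ x)) (fun x _ Kx => etrans (congr1 _ (Deta0 _ _ Kx)) (mulr0 _)).
have [F20 cF2] := @patch_continuous O K (fun q => 'D_(e4 i) u q * eta q) oO cK KO
  (fun x Ox => cvgM (cDu _ x Ox) (ce x)) (fun x _ Kx => etrans (congr1 _ (eta0 _ Kx)) (mulr0 _)).
pose Psi := (fun q => u q * eta q) \_ O.
have dP v x : is_derive x v Psi (((fun q => u q * 'D_v eta q + 'D_v u q * eta q) \_ O) x).
  have [Ox|nO] := pselect (O x).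
    have e : \forall y \near x, u y * eta y = Psi y.
      by have := open_nbhs_nbhs (conj oO Ox); apply: filterS => y Oy; rewrite /Psi /patch mem_set.
    rewrite /patch (mem_set Ox); apply: near_eq_is_derive e _.
    have [_ /(_ v)[/derivableP d1 _]] := u1 Ox; have [_ /(_ v)[/derivableP d2 _]] := e1 x Logic.I.
    by rewrite ['D_v u x * _]mulrC; exact: is_derive_mul d1 d2.
  have Kx : ~ K x by move=> /KO.
  rewrite /patch ifF; last by apply/negP => /set_mem.
  have e : \forall y \near x, (0 : R) = Psi y.
    by have := open_nbhs_nbhs (conj clK Kx); apply: filterS => y /P0 h; rewrite /Psi h.
  by apply: near_eq_is_derive e _; exact: is_derive_cst.
have P1 : C1 setT Psi.
  apply: (@C1_intro _ _ _ openT _ (fun v => (fun q => u q * 'D_v eta q + 'D_v u q * eta q) \_ O)) => [x _|x v _]; first exact: cP.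
  split; first exact: dP.
  have [_ c] := @patch_continuous O K (fun q => u q * 'D_v eta q + 'D_v u q * eta q) oO cK KO
    (fun x Ox => cvgD (cvgM (cu x Ox) (cDe v x)) (cvgM (cDu v x Ox) (ce x)))
    (fun x _ Kx => etrans (congr2 (fun a b => u x * a + 'D_v u x * b) (Deta0 v x Kx) (eta0 x Kx)) (etrans (congr2 +%R (mulr0 _) (mulr0 _)) (addr0 _))).
  exact: c.
have [N N0 [KB I0]] := integral_derive_compact i cK P1 P0.
move: KB I0; set B := box2 _ _ _ _ `*` _ => KB I0.
have cB : compact B by apply: compact_setX; exact: box2_compact.
have mB : measurable (B : set mE) by apply: measurableX; exact: box2_measurable.
have fB : (leb4 (B : set mE) < +oo)%E.
  by apply: leb4_finite; [exact: box2_measurable|exact: box2_measurable|exact: box2_finite|exact: box2_finite].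
have bmB (h : E4 -> R) : continuous h -> bm (B : set mE) h.
  by move=> ch; apply: (bm_compact4 openT cB _ mB) => // x _; exact: ch.
have toB (h : E4 -> R) : continuous (h \_ O) -> (forall x, ~ K x -> (h \_ O) x = 0) ->
    (\int[leb4]_(q in to4 @^-1` O) (h (to4 q))%:E = (\int[leb4]_(q in B) (h \_ O) q)%:E)%E.
  move=> ch h0; rewrite (bm_RintegralE mB fB (bmB _ ch)) [LHS]integral_mkcond [RHS]integral_mkcond.
  apply: eq_integral => q _; rewrite /restrict /patch.
  have -> : (q \in to4 @^-1` O) = ((q : E4) \in O) by apply/idP/idP; rewrite !in_setE.
  case: ifPn => hO; case: ifPn => hB //=.
  have := h0 q; rewrite /patch hO => -> // /KB Bq; by rewrite (mem_set Bq) in hB.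
rewrite (toB (fun q => u q * 'D_(e4 i) eta q) cF1 F10) (toB (fun q => 'D_(e4 i) u q * eta q) cF2 F20).
rewrite -EFinN; congr (_%:E); apply/eqP; rewrite -addr_eq0 -(bm_RintegralD mB fB (bmB _ cF1) (bmB _ cF2)).
rewrite -[X in _ == X]I0; apply/eqP; apply: eq_Rintegral => q _.
have [_ ->] := dP (e4 i) q; rewrite /patch; by case: ifP => _ //; rewrite addr0.
Qed.

Lemma Lpnorm_lty D (g : E4 -> R) : (\int[leb4]_(q in to4 @^-1` D) (g (to4 q) ^+ 2)%:E < +oo)%E ->
  (Lpnorm leb4 to4 2%:E D g < +oo)%E.
Proof.
rewrite -Lpnorm_sqr; have := Lnorm_ge0 leb4 2%:E (EFin \o ((g \_ D) \o to4)); rewrite -/(Lpnorm leb4 to4 2%:E D g).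
by case: (Lpnorm _ _ _ _ _) => // s _ _; exact: ltry.
Qed.

(** The classical gradient is one competitor in the infimum; finiteness of the energy puts it in
    L^2. *)
Lemma H1sqnorm_classical : (\int[leb4]_(q in to4 @^-1` O) (energy u (to4 q))%:E < +oo)%E ->
  (H1sqnorm leb4 to4 e4 O u <= \int[leb4]_(q in to4 @^-1` O) (energy u (to4 q))%:E)%E.
Proof.
have mO : measurable (to4 @^-1` O : set mE) := open_measurable4 oO.
have mc (h : E4 -> R) : (forall x, O x -> {for x, continuous h}) -> measurable_on to4 O h.
  by move=> ch; exact: (@continuous_on_measurable R _ _ _ O (@to4 R) h (@open_measurable4 R) oO ch).
have mu : measurable_on to4 O u by apply: mc => x /u1[].
have mD i : measurable_on to4 O ('D_(e4 i) u) by apply: mc => x /u1[_ /(_ (e4 i))[]].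
have sq (h : E4 -> R) : measurable_on to4 O h -> measurable_fun (to4 @^-1` O : set mE) (fun q => (h (to4 q) ^+ 2)%:E).
  by move=> mh; apply/measurable_EFinP; exact: measurable_funX.
have E : (\int[leb4]_(q in to4 @^-1` O) (energy u (to4 q))%:E = Lpnorm leb4 to4 2%:E O u ^+ 2 +
    \sum_(i < 4) Lpnorm leb4 to4 2%:E O ('D_(e4 i) u) ^+ 2)%E.
  under eq_integral => q _ do rewrite /energy EFinD -sumEFin.
  rewrite ge0_integralD//; last 4 first.
  - by move=> q _; rewrite lee_fin sqr_ge0.
  - exact: sq.
  - by move=> q _; apply: sume_ge0 => i _; rewrite lee_fin sqr_ge0.
  - by apply: emeasurable_sum => i; exact: (sq _ (mD i)).
  rewrite Lpnorm_sqr; congr (_ + _)%E; rewrite ge0_integral_sum//.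
  - by apply: eq_bigr => i _; rewrite Lpnorm_sqr.
  - by move=> i; exact: (sq _ (mD i)).
  - by move=> i q _; rewrite lee_fin sqr_ge0.
move=> fE; rewrite E; apply: ereal_inf_lbound; exists (fun i => 'D_(e4 i) u) => //.
have le (h : E4 -> R) : measurable_on to4 O h -> (forall q, h q ^+ 2 <= energy u q) -> inL2 leb4 to4 O h.
  move=> mh hle; split => //; apply: Lpnorm_lty; apply: le_lt_trans fE.
  apply: ge0_le_integral => //.
  - by move=> q _; rewrite lee_fin sqr_ge0.
  - exact: sq.
  - under eq_fun => q do rewrite /energy EFinD -sumEFin.
    by apply: emeasurable_funD; [exact: sq|apply: emeasurable_sum => i; exact: (sq _ (mD i))].
  - by move=> q _; rewrite lee_fin.
split => [|i].
  by apply: le => // q; rewrite /energy lerDl sumr_ge0// => i _; exact: sqr_ge0.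
split; last exact: classical_weak_derivative.
apply: le => // q; rewrite /energy (bigD1 i)//= addrCA lerDl addr_ge0 ?sqr_ge0//.
by apply: sumr_ge0 => j _; exact: sqr_ge0.
Qed.

End ClassicalGradient.

Section Final.
Context {R : realType} (At : sphere_atlas R).
Local Notation mR := (measurableTypeR R).
Local Notation E2 := (R * R)%type.
Local Notation E3 := (R * (R * R))%type.
Local Notation E4 := ((R * R) * (R * R))%type.
Local Notation K := (chart_index At).

Lemma Lpnorm_inf_bound d (X : measurableType d) (E : normedModType R) (mu : {measure set X -> \bar R})
  (toE : X -> E) (D : set E) (u : E -> R) (M : R) :
  (Lpnorm mu toE +oo%E D u <= M%:E)%E -> {ae mu, forall x, D (toE x) -> `|u (toE x)| <= M}.
Proof.
rewrite /Lpnorm unlock; case: ifPn => [_ /ess_supP|m0 _].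
  by apply: filterS => x /= + Dx; rewrite /patch mem_set.
(* In this branch the whole space is null, where the norm is 0 by convention, and any statement
   holds almost everywhere. *)
have h : mu [set: X] = 0%E by apply/eqP; rewrite eq_le measure_ge0 andbT leNgt.
by exists setT; split => //; exact: measurableT.
Qed.

Lemma good_cover_exists : exists (J : seq (bump_box At)) (mm RR Lip : R), good_cover J mm RR Lip.
Proof.
have [J [J1 J2]] := box_cover At; have [Lip L0 HL] := chart_lipschitz At.
have [mm mm0 Hm] : exists2 mm : R, 0 < mm & forall j, j \in J -> mm <= (3 / 4 * j.2 ^+ 2) ^+ 2.
  clear J2; elim: J J1 => [|j J' IH] HJ; first by exists 1.
  have [mm mm0 H] := IH (fun j jJ => HJ j (mem_behead (s := _ :: J') jJ)).
  have [r0 _] := HJ j (mem_head _ _).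
  exists (Num.min mm ((3 / 4 * j.2 ^+ 2) ^+ 2)).
    by rewrite lt_min mm0 exprn_gt0// mulr_gt0// ?exprn_gt0// divr_gt0.
  move=> i; rewrite inE ge_min => /orP[/eqP ->|/H ->]//; by rewrite lexx orbT.
pose RR := \sum_(j <- J) (`|j.2| ^+ 4 + 2 * `|j.2| ^+ 3).
have t0 (j : bump_box At) : 0 <= `|j.2| ^+ 4 + 2 * `|j.2| ^+ 3 by rewrite addr_ge0 ?mulr_ge0 ?exprn_ge0.
exists J, mm, RR, Lip; split => //; split => //; first by apply: sumr_ge0.
move=> j jJ; have [r0 _] := J1 j jJ; rewrite /RR (big_rem j jJ) /= gtr0_norm//.
by rewrite lerDl; apply: sumr_ge0.
Qed.

Lemma exhaustion d1 (T1 : measurableType d1) (mu : {measure set T1 -> \bar R}) (F : (set T1)^nat) (f : T1 -> R) (M : \bar R) :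
  nondecreasing_seq F -> (forall n, measurable (F n)) -> (forall n, measurable_fun (F n) f) ->
  (forall x, 0 <= f x) -> (forall n, (\int[mu]_(x in F n) (f x)%:E <= M)%E) ->
  (\int[mu]_(x in \bigcup_n F n) (f x)%:E <= M)%E.
Proof.
move=> nd mF mf f0 H.
have mf' n : measurable_fun (F n) (EFin \o f) by exact/measurable_EFinP.
have c := @ge0_nondecreasing_set_cvg_integral _ _ R F (EFin \o f) mu nd mF
  mf' (fun n x _ => f0 x).
rewrite -(cvg_lim _ c)//; apply: lime_le; first by apply/cvg_ex; eexists; exact: c.
exact: nearW.
Qed.

End Final.

(** * The a priori estimate *)

Section InnerIntervals.
Context {R : realType}.

(** The offset 3 makes the interval [gap, a - gap] nondegenerate for every index. *)
Definition gap (a : R) (n : nat) : R := a / n.+3%:R.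

Lemma gap_bounds a n : 0 < a -> [/\ 0 < gap a n, gap a n < a - gap a n & a - gap a n < a].
Proof.
move=> a0; have g0 : 0 < gap a n by rewrite divr_gt0.
have h : gap a n * 3 <= a.
  by rewrite /gap -mulrA ler_piMr ?(ltW a0)// mulrC ler_pdivrMr// mul1r ler_nat.
by split => //; lra.
Qed.

Lemma gap_le a m n : 0 < a -> (m <= n)%N -> gap a n <= gap a m.
Proof. by move=> a0 mn; rewrite /gap ler_pM2l// lef_pV2 ?posrE// ler_nat. Qed.

Lemma gap_small a e : 0 < a -> 0 < e -> exists n, gap a n <= e.
Proof.
move=> a0 e0; exists (Num.bound (a / e)); rewrite /gap ler_pdivrMr// mulrC -ler_pdivrMr//.
apply: ltW; apply: lt_le_trans (archi_boundP _) _; first by rewrite divr_ge0 ?ltW.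
by rewrite ler_nat -addn3 leq_addr.
Qed.

Lemma gap_cover a t : 0 < a -> 0 < t < a -> exists n, gap a n <= t <= a - gap a n.
Proof.
move=> a0 /andP[t0 ta]; have [|n Hn] := @gap_small a (Num.min t (a - t)) a0.
  by rewrite lt_min t0 subr_gt0.
by exists n; move: Hn; rewrite le_min => /andP[h1 h2]; rewrite h1; lra.
Qed.

End InnerIntervals.

Lemma slab_arith (R : realType) (X P C I Lt E Cp wm F : R) :
  X <= P * ((C + 1) * I + C * Lt) + E * (Cp * wm * F) -> 0 <= P * Lt ->
  X <= P * (C + 1) * (I + Lt) + E * (Cp * wm) * F.
Proof. by move=> *; lra. Qed.

Lemma split_data (R : realType) (A1 A2 n p s F : R) : 0 <= A1 -> 0 <= A2 -> 0 <= n -> 0 <= p -> 0 <= s -> 0 <= F ->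
  A1 * (n * (p + s)) + A2 * F <= (A1 * n + A2) * (p + s + F).
Proof.
move=> a1 a2 n0 p0 s0 F0; have := mulr_ge0 (mulr_ge0 a1 n0) F0; have := mulr_ge0 a2 (addr_ge0 p0 s0); lra.
Qed.

Lemma energy_arith (R : realType) (cc w0 x D y : R) : 0 <= cc -> 0 < w0 -> x <= D * y -> cc * x / w0 <= cc * D / w0 * y.
Proof.
move=> c0 w00 h; have -> : cc * D / w0 * y = cc * (D * y) / w0 by ring.
by rewrite ler_pM2r ?invr_gt0// ler_wpM2l.
Qed.

Lemma normal_arith2 (R : realType) (cc kn X x D y : R) : 0 <= cc -> 0 < kn -> kn * X <= x -> x <= D * y ->
  cc * X <= cc * D / kn * y.
Proof.
move=> c0 k0 h1 h2; have -> : cc * D / kn * y = cc * (D * y / kn) by ring.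
by rewrite ler_wpM2l// ler_pdivlMr// mulrC (le_trans h1).
Qed.

Section Apriori.
Context {R : realType} (At : sphere_atlas R).
Local Notation mR := (measurableTypeR R).
Local Notation E2 := (R * R)%type.
Local Notation E3 := (R * (R * R))%type.
Local Notation E4 := ((R * R) * (R * R))%type.
Local Notation K := (chart_index At).
Variables (T z0 M L Lip beta Kc N c C Cp mm RR : R) (J : seq (bump_box At)).
Hypotheses (T0 : 0 < T) (z00 : 0 < z0) (M0 : 0 <= M) (b0 : 0 < beta) (K0 : 0 < Kc) (N0 : 0 < N)
  (c0 : 0 < c) (cN : c <= N) (C0 : 0 < C) (Cp0 : 0 <= Cp).
Hypothesis Hcur : null_current_bound M L z0 beta Kc N c C.
Hypothesis HJ : good_cover J mm RR Lip.

Let mu : R := rate M Lip beta c C Cp mm RR J.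
Let wm : R := weight_max z0 M Lip beta c C Cp mm RR J.
Let n : R := (size J)%:R.
Let A1 : R := wm * RR * (C + 1).
Let A2' : R := err_const M beta C * RR * n * (Cp * wm).
Let w0 : R := expR (- (mu * N * T) - 2).
Let kn : R := w0 * (c * mm * (z0 / 2) ^+ 2).

(** [A1] multiplies the Cauchy data, which are counted once for each square of the cover, and [A2']
    multiplies the source. *)
Definition data_const : R := A1 * n + A2'.
Definition energy_const : R := cmp_const Lip * data_const / w0.
Definition normal_const : R := (2 * Lip) ^+ 2 * data_const / kn.

Local Notation Om := (base_Omega T z0).
Local Notation Sa := (base_all T z0).
Local Notation S j := (sqc j.1.2 j.2).
Local Notation half j := (sq j.1.2 (j.2 / 2)).

Let wm0 : 0 < wm. Proof. exact: expR_gt0. Qed.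
Let A10 : 0 <= A1.
Proof. by have [R0 _] := cover_upper HJ; rewrite /A1 mulr_ge0 ?mulr_ge0 ?addr_ge0// ltW. Qed.
Let e0 : 0 <= err_const M beta C.
Proof. by rewrite /err_const !addr_ge0// ?mulr_ge0 ?addr_ge0 ?invr_ge0// ltW. Qed.
Let A20 : 0 <= A2'.
Proof. by have [R0 _] := cover_upper HJ; rewrite /A2' !mulr_ge0// ltW. Qed.
Let kn0 : 0 < kn.
Proof. by have [mm0 _] := cover_lower HJ; rewrite /kn !mulr_gt0 ?expR_gt0 ?exprn_gt0 ?divr_gt0. Qed.

Lemma data_const_ge0 : 0 <= data_const.
Proof. by rewrite /data_const addr_ge0// mulr_ge0. Qed.

Lemma energy_const_ge0 : 0 <= energy_const.
Proof. by rewrite /energy_const divr_ge0 ?expR_ge0// mulr_ge0 ?data_const_ge0// cmp_const_ge0. Qed.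

Lemma normal_const_ge0 : 0 <= normal_const.
Proof. by rewrite /normal_const divr_ge0 ?(ltW kn0)// mulr_ge0 ?data_const_ge0 ?sqr_ge0. Qed.

Variables (G : K -> E4 -> 'M[R]_4) (v : E2 -> 'rV[R]_3 -> R) (V f : K -> E4 -> R) (F Phi Psi : R).
Variables (w : K -> 'I_4 -> E4 -> R) (phi psi : R -> 'rV[R]_3 -> R).
Hypothesis G1 : forall (k : K) i j, C1 (cyl Om k) (fun q => G k q i j).
Hypothesis v2 : forall (k : K), Ck_on 2 (cyl Om k) (pull k v).
Hypothesis GN : forall (k : K) q, cyl Om k q -> null_inverse L (G k q).
Hypothesis GM : forall (k : K) q i j, cyl Om k q -> `|G k q i j| <= M.
Hypothesis dGM : forall (k : K) q i j l, cyl Om k q -> `|'D_(e4 l) (fun q => G k q i j) q| <= M.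
Hypothesis GV : forall (k : K) q, cyl Om k q -> G k q (inord 1) (inord 1) = q.1.2 ^+ 2 * V k q.
Hypothesis VB : forall (k : K) q, cyl Om k q -> 1 / 2 <= V k q <= 3 / 2.
Hypothesis mf : forall (k : K), measurable_on to4 (cyl Om k) (f k).
Hypotheses (F0 : 0 <= F) (Phi0 : 0 <= Phi) (Psi0 : 0 <= Psi).
Hypothesis fF : forall (k : K), (\int[leb4]_(q in to4 @^-1` (cyl Om k)) ((f k (to4 q)) ^+ 2)%:E <= F%:E)%E.
Hypothesis Pf : forall (k : K), {ae leb4, forall q, cyl Om k (to4 q) ->
  principal (G k) (pull k v) (to4 q) ^+ 2 <= Cp * (f k (to4 q) ^+ 2 + energy (pull k v) (to4 q))}.
Hypothesis vS : forall (k : K), con (cyl Sa k) (pull k v).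
Hypothesis wS : forall (k : K) i, con (cyl Sa k) (w k i).
Hypothesis wE : forall (k : K) i q, cyl Om k q -> w k i q = 'D_(e4 i) (pull k v) q.
Hypothesis HPhi : forall k : K, (H1sqnorm leb3 to3 e3 (cyl3 z0 k) (pull3 k phi) <= Phi%:E)%E.
Hypothesis HPsi : forall k : K, (H1sqnorm leb3 to3 e3 (cyl3 T k) (pull3 k psi) <= Psi%:E)%E.
Hypothesis aephi : forall k : K, {ae leb3, forall y, cyl3 z0 k (to3 y) ->
  pull k v ((0, (to3 y).1), (to3 y).2) = pull3 k phi (to3 y)}.
Hypothesis aepsi : forall k : K, {ae leb3, forall y, cyl3 T k (to3 y) ->
  pull k v (((to3 y).1, z0), (to3 y).2) = pull3 k psi (to3 y)}.

Let mu0 : 0 <= mu. Proof. exact: (rate_ge0 M0 b0 c0 C0 Cp0 HJ). Qed.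
Let k10 : 0 <= c * mm. Proof. by have [mm0 _] := cover_lower HJ; rewrite mulr_ge0// ltW. Qed.
Let v1 (k : K) : C1 (cyl Om k) (pull k v) := Ck2_C1 (@v2 k).

Let dPhi (j : bump_box At) eps z1 : j \in J -> 0 < eps -> eps < z1 -> z1 < z0 ->
  \int[leb3]_(y in box3 eps z1 (S j)) (w j.1.1 (inord 1) ((0, y.1), y.2) ^+ 2 + w j.1.1 (inord 2) ((0, y.1), y.2) ^+ 2
     + w j.1.1 (inord 3) ((0, y.1), y.2) ^+ 2 + pull j.1.1 v ((0, y.1), y.2) ^+ 2) <= Phi.
Proof.
move=> jJ e_0 ez zz; have [r0 jd] := cover_dom HJ jJ; rewrite -lee_fin.
apply: le_trans (HPhi j.1.1).
exact: (initial_data T0 r0 jd (@v1 _) (@vS _) (@wS _) (@wE _) e_0 ez zz (@aephi _)).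
Qed.

Let dPsi (j : bump_box At) t1 t2 : j \in J -> 0 < t1 -> t1 < t2 -> t2 < T ->
  \int[leb3]_(y in box3 t1 t2 (S j)) (w j.1.1 (inord 0) ((y.1, z0), y.2) ^+ 2 + w j.1.1 (inord 2) ((y.1, z0), y.2) ^+ 2
     + w j.1.1 (inord 3) ((y.1, z0), y.2) ^+ 2) <= Psi.
Proof.
move=> jJ t10 tt tT; have [r0 jd] := cover_dom HJ jJ; rewrite -lee_fin.
apply: le_trans (HPsi j.1.1).
exact: (lateral_data z00 r0 jd (@v1 _) (@vS _) (@wS _) (@wE _) t10 tt tT (@aepsi _)).
Qed.

Let slab eps t1 t2 z1 : 0 < eps -> 0 < t1 -> t1 < t2 -> t2 < T -> eps < z1 -> z1 < z0 ->
  \sum_(j <- J) slab_energy M Lip beta Kc N c C Cp mm RR J v eps t1 t2 z1 j +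
  c * mm * z1 ^+ 2 * \sum_(j <- J) lateral_normal M Lip beta Kc N c C Cp mm RR J v eps t1 t2 z1 j <=
  A1 * (\sum_(j <- J) initial_energy v eps t1 z1 j + \sum_(j <- J) lateral_energy v t1 t2 z1 j) + A2' * F.
Proof.
move=> e_0 t10 tt tT ez zz.
have H := slab_estimate M0 b0 K0 N0 c0 cN C0 Cp0 Hcur HJ G1 v2 GN GM dGM GV VB mf fF Pf e_0 t10 tt tT ez zz.
have L0 : 0 <= \sum_(j <- J) lateral_energy v t1 t2 z1 j.
  by apply: sumr_ge0 => j _; apply: Rintegral_ge0 => y _; rewrite !addr_ge0 ?sqr_ge0.
have [R0 _] := cover_upper HJ.
have W0 : 0 <= wm * RR by rewrite mulr_ge0// ltW.
move: H; rewrite [c * z1 ^+ 2 * mm]mulrAC => H.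
exact: (slab_arith H (mulr_ge0 W0 L0)).
Qed.

(** The bound on inner rectangles has a constant independent of the rectangle, so monotone
    convergence along an exhaustion of Omega keeps it. *)
Lemma apriori_energy (k : K) : (\int[leb4]_(q in to4 @^-1` (cyl Om k)) (energy (pull k v) (to4 q))%:E <=
  (energy_const * (Phi + Psi + F))%:E)%E.
Proof.
pose Fn (m : nat) : set ((mR * mR) * (mR * mR)) :=
  box2 (gap T m) (T - gap T m) (gap z0 m) (z0 - gap z0 m) `*` (chart_dom k : set (mR * mR)).
have cover : to4 @^-1` (cyl Om k) = \bigcup_m Fn m.
  apply/seteqP; split => [[[t z] x] [[/= ht hz] kx]|[[t z] x] [m _ [[/= ht hz] kx]]].
    have [m1 H1] := gap_cover T0 ht; have [m2 H2] := gap_cover z00 hz.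
    exists (maxn m1 m2) => //; split => //; split; rewrite /= in_itv /=.
      have := gap_le T0 (leq_maxl m1 m2); move/andP: H1 => [? ?] ?; apply/andP; split; lra.
    have := gap_le z00 (leq_maxr m1 m2); move/andP: H2 => [? ?] ?; apply/andP; split; lra.
  split => //; split => /=; move: ht hz; rewrite !in_itv /= => /andP[? ?] /andP[? ?].
    by have [? ? ?] := gap_bounds m T0; apply/andP; split; lra.
  by have [? ? ?] := gap_bounds m z00; apply/andP; split; lra.
have oD := @cylOm_open R At T z0 k.
have mFn m : measurable (Fn m) by apply: measurableX; [exact: box2_measurable|exact: chart_dom_measurable].
have mE : measurable_fun (to4 @^-1` (cyl Om k) : set ((mR * mR) * (mR * mR))) (energy (pull k v)).
  exact: (@continuous_on_measurable R _ _ _ (cyl Om k) (@to4 R) _ (@open_measurable4 R) oD (fun x Dx => (energy_C1 (@v2) Dx).1)).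
rewrite cover; apply: exhaustion => //.
- move=> m1 m2 m12; apply/subsetPset => -[[t z] x] [[/=]]; rewrite !in_itv /= => /andP[? ?] /andP[? ?] kx; split => //.
  by have := gap_le T0 m12; have := gap_le z00 m12 => *; split; rewrite /= in_itv /=; apply/andP; split; lra.
- by move=> m; apply: measurable_funS mE; [exact: open_measurable4|rewrite cover; exact: bigcup_sup].
- by move=> q; exact: energy_ge0.
move=> m; have [g1 g2 g3] := gap_bounds m T0; have [h1 h2 h3] := gap_bounds m z00.
have H := energy_limit T0 z00 mu0 (ltW N0) K0 k10 A10 (cmp_const_ge0 Lip) (cover_dom HJ) v2 vS wS wE dPhi dPsi
  (A2 := A2' * F) slab (fun eps t1 t2 z1 a b cc d e g => slab_compare M beta Kc N c C Cp HJ v2 a b d g) k g1 g2 g3 h1 h2 h3.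
apply: (le_trans H); rewrite lee_fin.
apply: (energy_arith (cmp_const_ge0 Lip) (expR_gt0 _)).
exact: (split_data A10 A20 (ler0n R (size J)) Phi0 Psi0 F0).
Qed.

Lemma apriori_normal (k : K) : (\int[leb3]_(y in to3 @^-1` (cyl3 T k)) (w k (inord 1) (((to3 y).1, z0), (to3 y).2) ^+ 2)%:E <=
  (normal_const * (Phi + Psi + F))%:E)%E.
Proof.
have [L0 lip] := cover_lip HJ.
pose Fn (m : nat) : set (mR * (mR * mR)) := box3 (gap T m) (T - gap T m) (chart_dom k).
have cover : to3 @^-1` (cyl3 T k) = \bigcup_m Fn m.
  apply/seteqP; split => [[t x] [/= ht kx]|[t x] [m _ [/= ht kx]]].
    by have [m Hm] := gap_cover T0 ht; exists m => //; split => //=; rewrite in_itv.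
  split => //=; move: ht; rewrite in_itv /= => /andP[? ?].
  by have [? ? ?] := gap_bounds m T0; apply/andP; split; lra.
have mFn m : measurable (Fn m) by apply: measurableX; [exact: itv_measurable|exact: chart_dom_measurable].
rewrite cover; apply: (exhaustion (f := fun y : mR * (mR * mR) => w k (inord 1) ((y.1, z0), y.2) ^+ 2)) => //.
- move=> m1 m2 m12; apply/subsetPset => -[t x] [/=]; rewrite !in_itv /= => /andP[? ?] kx; split => //.
  by have := gap_le T0 m12 => *; rewrite /= in_itv /=; apply/andP; split; lra.
- move=> m; have [g1 g2 g3] := gap_bounds m T0; apply: measurable_funX.
  have cw : con (Fn m : set E3) (fun y => w k (inord 1) ((y.1, z0), y.2)).
    apply: (con_comp (i := fun y : E3 => ((y.1, z0), y.2) : E4) (@face1_continuous R z0) _ (@wS k (inord 1))).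
    move=> y [/= + kx]; rewrite in_itv /= => /andP[? ?]; split => //; right; split => //=; apply/andP; split; lra.
  exact: (@con_measurable R _ _ (mR * (mR * mR))%type (@to3 R) _ _ (@open_measurable3 R) (mFn m) cw).
- by move=> y; exact: sqr_ge0.
move=> m; have [g1 g2 g3] := gap_bounds m T0.
apply: (le_trans (normal_chart z00 (cover_dom HJ) wS wE L0 (cover_sphere HJ) lip k g1 g2 g3)).
rewrite lee_fin.
have H := normal_limit T0 z00 mu0 (ltW N0) K0 k10 A10 (cover_dom HJ) vS wS wE dPhi dPsi (A2 := A2' * F) slab g1 g2 g3.
exact: (normal_arith2 (sqr_ge0 _) kn0 H (split_data A10 A20 (ler0n R (size J)) Phi0 Psi0 F0)).
Qed.

End Apriori.

(** The equation is solved for the wave operator, which turns |P| into |f| + (A + B) S + s |u|; the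
    factor 3 is that of the square of a sum of three terms. *)
Lemma principal_square (R : realType) (P f b A S u B s : R) (a w : R) :
  f = b + a + w -> `|P| <= `|b| + A * S -> `|a| <= B * S -> `|w| <= s * `|u| -> 0 <= A -> 0 <= B -> 0 <= S -> 0 <= s ->
  P ^+ 2 <= 3 * (f ^+ 2 + (A + B) ^+ 2 * S ^+ 2 + s ^+ 2 * u ^+ 2).
Proof.
move=> fE hP ha hw A0 B0 S0 s0.
have hb : `|b| <= `|f| + B * S + s * `|u|.
  have -> : b = f - a - w by rewrite fE; ring.
  by rewrite (le_trans (ler_normB _ _))// lerD// (le_trans (ler_normB _ _))// lerD2l.
have h : `|P| <= `|f| + (A + B) * S + s * `|u| by lra.
have h2 : P ^+ 2 <= (`|f| + (A + B) * S + s * `|u|) ^+ 2.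
  rewrite -(real_normK (num_real P)) ler_pXn2r ?nnegrE//.
  by rewrite !addr_ge0 ?mulr_ge0 ?addr_ge0.
apply: (le_trans h2); rewrite -(real_normK (num_real f)) -(real_normK (num_real u)) -!exprMn.
set x := `|f|; set y := (A + B) * S; set z := s * `|u|.
by have := sqr_ge0 (x - y); have := sqr_ge0 (x - z); have := sqr_ge0 (y - z); lra.
Qed.

Lemma sum4_square (R : realType) (x : 'I_4 -> R) : (\sum_(i < 4) `|x i|) ^+ 2 <= 4 * \sum_(i < 4) x i ^+ 2.
Proof.
rewrite !sum4; move: (x _) (x _) (x _) (x _) => a b c d.
rewrite -(real_normK (num_real a)) -(real_normK (num_real b)) -(real_normK (num_real c)) -(real_normK (num_real d)).
move: `|a| `|b| `|c| `|d| => {}a {}b {}c {}d.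
have := sqr_ge0 (a - b); have := sqr_ge0 (a - c); have := sqr_ge0 (a - d).
have := sqr_ge0 (b - c); have := sqr_ge0 (b - d); have := sqr_ge0 (c - d); lra.
Qed.

Lemma sqrt_data (R : realType) (a b x y z : R) : 0 <= a -> 0 <= b -> 0 <= x -> 0 <= y -> 0 <= z ->
  Num.sqrt (a * (y + z + x)) + Num.sqrt (b * (y + z + x)) <=
  (Num.sqrt a + Num.sqrt b + 1) * (Num.sqrt x + Num.sqrt y + Num.sqrt z).
Proof.
move=> a0 b0 x0 y0 z0; rewrite !sqrtrM//.
set s := Num.sqrt x + _ + _; have s0 : 0 <= s by rewrite !addr_ge0 ?sqrtr_ge0.
have h : Num.sqrt (y + z + x) <= s.
  have E : s = Num.sqrt (s ^+ 2) by rewrite sqrtr_sqr ger0_norm.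
  rewrite [leRHS]E; apply: ler_wsqrtr.
  rewrite -{1}(sqr_sqrtr x0) -{1}(sqr_sqrtr y0) -{1}(sqr_sqrtr z0) /s.
  have := mulr_ge0 (sqrtr_ge0 x) (sqrtr_ge0 y); have := mulr_ge0 (sqrtr_ge0 x) (sqrtr_ge0 z).
  have := mulr_ge0 (sqrtr_ge0 y) (sqrtr_ge0 z); lra.
have h1 := ler_wpM2l (sqrtr_ge0 a) h; have h2 := ler_wpM2l (sqrtr_ge0 b) h; lra.
Qed.

Lemma poweR_half_le (R : realType) (x : \bar R) (c : R) : (0 <= x)%E -> (x <= c%:E)%E ->
  (x `^ 2^-1 <= (Num.sqrt c)%:E)%E.
Proof.
move=> x0 xc; rewrite (poweR12_sqrt x0) -[leRHS]/(sqrte c%:E) lee_sqrt//; exact: le_trans xc.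
Qed.

Lemma poweR_half_fin (R : realType) (x : \bar R) : (0 <= x)%E -> (x `^ 2^-1 < +oo)%E ->
  exists c : R, [/\ 0 <= c, x = c%:E & (x `^ 2^-1 = (Num.sqrt c)%:E)%E].
Proof.
move=> x0 h; have /fineK E : x \is a fin_num.
  by rewrite ge0_fin_numE//; apply: lty_poweRy h.
exists (fine x); split; [exact: fine_ge0|by rewrite E|by rewrite (poweR12_sqrt x0) -{1}E].
Qed.

Lemma H1sqnorm_ge0 (R : realType) d (X : measurableType d) (E : normedModType R)
  (mu : {measure set X -> \bar R}) (toE : X -> E) n (e : 'I_n -> E) D u : (0 <= H1sqnorm mu toE e D u)%E.
Proof.
apply: le_ereal_inf_tmp => _ [G _ <-]; apply: adde_ge0; first by apply: expe_ge0; exact: Lnorm_ge0.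
by apply: sume_ge0 => i _; apply: expe_ge0; exact: Lnorm_ge0.
Qed.

Lemma sum_chart_le (R : realType) n (x : 'I_n -> \bar R) (c : R) : (forall k, x k <= c%:E)%E ->
  (\sum_(k < n) x k <= (n%:R * c)%:E)%E.
Proof.
move=> H; apply: (@le_trans _ _ (\sum_(k < n) c%:E)%E); first exact: lee_sum.
by rewrite sumEFin sumr_const card_ord mulr_natl.
Qed.

(** Any relatively continuous extension computes the trace: the point lies in the closure of [D], so
    the filter is proper and limits are unique. *)
Lemma trace_limit (R : realType) (E : normedModType R) (D A : set E) (w g : E -> R) p :
  D `<=` A -> A p -> closure D p -> con A w -> (forall q, D q -> w q = g q) -> bd_trace D g p = w p.
Proof.
move=> DA Ap cp cw wg; have F : ProperFilter (within D (nbhs p)) by exact: within_nbhs_proper.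
rewrite /bd_trace; apply: cvg_lim; first exact: norm_hausdorff.
move=> U /(con_near cw Ap) HU; rewrite /within /=; apply: filterS HU => y HU Dy.
by rewrite /= -wg//; apply: HU; exact: DA.
Qed.

Lemma final_square (R : realType) (f A S2 B u Q : R) : S2 <= 4 * Q -> 0 <= Q ->
  f ^+ 2 + A ^+ 2 * S2 + B ^+ 2 * u ^+ 2 <= (1 + 4 * A ^+ 2 + B ^+ 2) * (f ^+ 2 + (u ^+ 2 + Q)).
Proof.
move=> h Q0; have h1 : A ^+ 2 * S2 <= A ^+ 2 * (4 * Q) by rewrite ler_wpM2l ?sqr_ge0.
have := mulr_ge0 (sqr_ge0 A) (addr_ge0 (sqr_ge0 f) (sqr_ge0 u)).
have := mulr_ge0 (sqr_ge0 B) (addr_ge0 (sqr_ge0 f) Q0); have := sqr_ge0 u; lra.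
Qed.

Section Bounds.
Context {R : realType} (At : sphere_atlas R).
Local Notation E2 := (R * R)%type.
Local Notation E4 := ((R * R) * (R * R))%type.
Local Notation K := (chart_index At).

Lemma C1norm_inv_bound (T z0 Mg : R) (g : K -> E4 -> 'M[R]_4) (k : K) q i j :
  (C1norm_inv T z0 g <= Mg%:E)%E -> cyl (base_Omega T z0) k q ->
  `|invmx (g k q) i j| <= `|Mg| /\ forall l, `|'D_(e4 l) (fun q' => invmx (g k q') i j) q| <= `|Mg|.
Proof.
move=> H Oq; have : `|invmx (g k q) i j| + \sum_(l < 4) `|'D_(e4 l) (fun q' => invmx (g k q') i j) q| <= `|Mg|.
  apply: (le_trans _ (ler_norm Mg)); rewrite -lee_fin; apply: le_trans H.
  by apply: ereal_sup_ubound; exists k, i, j, q.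
move=> h; split => [|l]; first by apply: le_trans h; rewrite lerDl sumr_ge0.
by apply: le_trans h; rewrite (bigD1 l)//= addrCA lerDl addr_ge0// sumr_ge0.
Qed.

Lemma lateral_closure (T z0 t : R) (k : K) x : 0 < z0 -> 0 < t < T -> chart_dom k x ->
  closure (cyl (base_Omega T z0) k) ((t, z0), x).
Proof.
move=> z00 ht kx B /nbhs_ballP[e /= e0 He].
have m0 : 0 < Num.min e z0 by rewrite lt_min e0.
have : Num.min e z0 / 2 < Num.min e z0 by rewrite ltr_pdivrMr// ltr_pMr// ltr1n.
rewrite lt_min => /andP[h1 h2]; have h3 : 0 < Num.min e z0 / 2 by rewrite divr_gt0.
exists ((t, z0 - Num.min e z0 / 2), x); split.
  by split => //; split => //=; apply/andP; split; lra.
apply: He; rewrite -ball_normE /=; apply: le_lt_trans (face1_dist _ _ _ _) _.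
by rewrite opprB addrCA subrr addr0 gtr0_norm.
Qed.

(** Where the equation and the bounds on the coefficients hold, the divergence term is controlled by
    the source and the energy with a constant built only from the norms of the coefficients and
    [L]. *)
Lemma principal_bound (g : E4 -> 'M[R]_4) (a : 'I_4 -> E4 -> R) (om u f : E4 -> R)
    (D : set E4) (q : E4) (M L Ma Mw : R) :
  open D -> (forall i j, C1 D (fun q => invmx (g q) i j)) -> Ck_on 2 D u -> D q ->
  0 < L -> (forall q', D q' -> null_inverse L (invmx (g q')) /\ `|\det (g q')| = (minor2 (invmx (g q')))^-1) ->
  0 <= M -> (forall i j, `|invmx (g q) i j| <= M) -> (forall i j l, `|'D_(e4 l) (fun q => invmx (g q) i j) q| <= M) ->
  (forall i, `|a i q| <= Ma) -> `|om q| <= Mw -> 0 <= Ma -> 0 <= Mw ->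
  Lop g a om u q = f q ->
  principal (fun q => invmx (g q)) u q ^+ 2 <=
    3 * (1 + 4 * (8 * M ^+ 3 * L ^+ 2 + Ma) ^+ 2 + Mw ^+ 2) * (f q ^+ 2 + energy u q).
Proof.
move=> oD G1 u2 Dq L0 GN M0 GM dGM aM oM Ma0 Mw0 eqf.
have L2 : 0 < L ^- 2 by rewrite invr_gt0 exprn_gt0.
have p0 q' : D q' -> 0 < minor2 (invmx (g q')).
  by move=> /GN[n _]; exact: lt_le_trans L2 (null_minor n).
have H := box_principal_le oD G1 u2 Dq p0 (fun q' Dq' => (GN q' Dq').2) M0 GM dGM L0 (null_minor (GN q Dq).1).
pose S := \sum_(j < 4) `|'D_(e4 j) u q|.
have S0 : 0 <= S by apply: sumr_ge0 => j _; exact: normr_ge0.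
have ha : `|\sum_(i < 4) a i q * 'D_(e4 i) u q| <= Ma * S.
  rewrite /S mulr_sumr; apply: (le_trans (ler_norm_sum _ _ _)); apply: ler_sum => i _.
  by rewrite normrM ler_wpM2r.
have hw : `|om q * u q| <= Mw * `|u q| by rewrite normrM ler_wpM2r.
have A0 : 0 <= 8 * M ^+ 3 * L ^+ 2 by rewrite !mulr_ge0 ?exprn_ge0// ltW.
have hP := principal_square (esym eqf) H ha hw A0 Ma0 S0 Mw0.
have h4 := sum4_square (fun j => 'D_(e4 j) u q); rewrite -/S in h4.
apply: (le_trans hP); rewrite -[leRHS]mulrA; apply: ler_wpM2l => //.
have hE : energy u q = u q ^+ 2 + \sum_(j < 4) ('D_(e4 j) u q) ^+ 2 by [].
have Q0 : 0 <= \sum_(j < 4) ('D_(e4 j) u q) ^+ 2 by apply: sumr_ge0 => j _; exact: sqr_ge0.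
rewrite hE; apply: final_square h4 Q0.
Qed.

End Bounds.

Theorem theorem3p3 (R : realType) (At : sphere_atlas R)
    (T z0 lambda Lambda Mg Ma Mw : R)
    (T_gt0 : 0 < T) (z0_gt0 : 0 < z0)
    (lambda_gt0 : 0 < lambda) (Lambda_gt0 : 0 < Lambda) :
  exists2 C : R, 0 < C &
  forall (V : R * R -> 'rV[R]_3 -> R)
    (U : chart_index At -> (R * R) * (R * R) -> R * R)
    (h : chart_index At -> (R * R) * (R * R) -> 'M[R]_2)
    (a : chart_index At -> 'I_4 -> (R * R) * (R * R) -> R)
    (omega f v : R * R -> 'rV[R]_3 -> R)
    (phi psi : R -> 'rV[R]_3 -> R),
  let Om := base_Omega T z0 in
  let S := base_all T z0 in
  let g := metric V U h in
  (forall k : chart_index At, {within cyl S k, continuous (pull k V)}) ->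
  (forall k : chart_index At, {within cyl S k, continuous (U k)}) ->
  (forall k : chart_index At, {within cyl S k, continuous (h k)}) ->
  is_vector_field S U ->
  is_metric S h ->
  asymptotics S V U h ->
  (forall b p, S b -> sphere p -> 1 / 2 <= V b p <= 3 / 2) ->
  (forall (k : chart_index At) q w, cyl Om k q ->
     lambda * (w.1 ^+ 2 + w.2 ^+ 2) <= quad (h k q) w
       <= Lambda * (w.1 ^+ 2 + w.2 ^+ 2)) ->
  (forall (k : chart_index At) i j, Ck_on 1 (cyl Om k) (fun q => invmx (g k q) i j)) ->
  (C1norm_inv T z0 g <= Mg%:E)%E ->
  (forall (k : chart_index At) i, measurable_on to4 (cyl Om k) (a k i)) ->
  (forall (k : chart_index At) i, Lpnorm leb4 to4 +oo%E (cyl Om k) (a k i) <= Ma%:E)%E ->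
  (forall k : chart_index At, measurable_on to4 (cyl Om k) (pull k omega)) ->
  (forall k : chart_index At, Lpnorm leb4 to4 +oo%E (cyl Om k) (pull k omega) <= Mw%:E)%E ->
  (forall k : chart_index At, measurable_on to4 (cyl Om k) (pull k f)) ->
  (L2norm_Omega At T z0 f < +oo)%E ->
  (H1norm_Sigma At z0 phi < +oo)%E ->
  (H1norm_Sigma At T psi < +oo)%E ->
  (forall k : chart_index At, Ck_on 2 (cyl Om k) (pull k v)) ->
  (forall k : chart_index At, C1_upto e4 (cyl Om k) (cyl S k) (pull k v)) ->
  (forall k : chart_index At, {ae leb4, forall q, cyl Om k (to4 q) ->
     Lop (g k) (a k) (pull k omega) (pull k v) (to4 q)
       = pull k f (to4 q)}) ->
  (forall k : chart_index At, {ae leb3, forall y, cyl3 z0 k (to3 y) ->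
     pull k v ((0, (to3 y).1), (to3 y).2) = pull3 k phi (to3 y)}) ->
  (forall k : chart_index At, {ae leb3, forall y, cyl3 T k (to3 y) ->
     pull k v (((to3 y).1, z0), (to3 y).2) = pull3 k psi (to3 y)}) ->
  (H1norm_Omega At T z0 v + L2norm_dz_Sigma1 At T z0 v
     <= C%:E * (L2norm_Omega At T z0 f + H1norm_Sigma At z0 phi
                + H1norm_Sigma At T psi))%E.
Proof.
(* [Mg] is an arbitrary real, hence the absolute value. In the next step [Lambda] is the constant
   [L]: the bound h <= Lambda gives g^{AB} >= 1 / Lambda. *)
pose M := `|Mg|; have M0 : 0 <= M := normr_ge0 Mg.
have [beta [Kc [N [c [C [[b0 K0 N0 c0 cN] [C0 Hcur]]]]]]] := current_bounds M0 Lambda_gt0 z0_gt0.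
have [J [mm [RR [Lip HJ]]]] := good_cover_exists At.
pose Cp := 3 * (1 + 4 * (8 * M ^+ 3 * Lambda ^+ 2 + `|Ma|) ^+ 2 + `|Mw| ^+ 2).
have Cp0 : 0 <= Cp by rewrite /Cp; apply: mulr_ge0 => //; rewrite !addr_ge0 ?sqr_ge0// mulr_ge0 ?sqr_ge0.
pose ec := energy_const T z0 M Lip beta N c C Cp mm RR J.
pose nc := normal_const T z0 M Lip beta N c C Cp mm RR J.
have ec0 : 0 <= ec := energy_const_ge0 T z0 N c M0 b0 C0 Cp0 HJ.
have nc0 : 0 <= nc := normal_const_ge0 T N z0_gt0 M0 b0 c0 C0 Cp0 HJ.
pose nk := (nb_charts At)%:R : R; have nk0 : 0 <= nk := ler0n _ _.
have nec0 : 0 <= nk * ec by exact: mulr_ge0.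
have nnc0 : 0 <= nk * nc by exact: mulr_ge0.
(* The norms are l^2-sums over the charts, hence the number of charts under the roots; the summand 1
   ensures positivity. All constants are fixed before the metric, the coefficients and the
   solution. *)
exists (Num.sqrt (nk * ec) + Num.sqrt (nk * nc) + 1); first by rewrite ltr_wpDl ?addr_ge0 ?sqrtr_ge0.
move=> V U h a omega f v phi psi Om S g _ _ _ _ [hsym _ _] _ Vb hb G1 Gn _ am _ om fm f2 phi2 psi2 v2 vC1 eqn aephi aepsi.
have OmS : Om `<=` S by move=> b Ob; left; left.
have sq0 d (X : measurableType d) (E : normedModType R) (m : {measure set X -> \bar R}) (toE : X -> E) D u :
    (0 <= Lpnorm m toE 2%:E D u ^+ 2)%E by apply: expe_ge0; exact: Lnorm_ge0.
have sum0 (x : chart_index At -> \bar R) : (forall k, 0 <= x k)%E -> (0 <= \sum_k x k)%E.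
  by move=> x0; apply: sume_ge0 => k _; exact: x0.
have [F [F0 FE FN]] := poweR_half_fin (sum0 _ (fun k => sq0 _ _ _ leb4 to4 (cyl Om k) (pull k f))) f2.
have [Phi [Phi0 PhiE PhiN]] := poweR_half_fin (sum0 _ (fun k => H1sqnorm_ge0 leb3 to3 e3 (cyl3 z0 k) (pull3 k phi))) phi2.
have [Psi [Psi0 PsiE PsiN]] := poweR_half_fin (sum0 _ (fun k => H1sqnorm_ge0 leb3 to3 e3 (cyl3 T k) (pull3 k psi))) psi2.
have leS (x : chart_index At -> \bar R) (y : \bar R) k : (\sum_k x k = y -> (forall k, 0 <= x k) -> x k <= y)%E.
  by move=> <- x0; rewrite (bigD1 k)//= leeDl// sume_ge0.
(* The continuous extensions of the first derivatives are given separately for each chart and index;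
   one choice collects them in a single family. *)
have [w wP] : exists w : chart_index At -> 'I_4 -> (R * R) * (R * R) -> R, forall k i,
    con (cyl S k) (w k i) /\ forall q, cyl Om k q -> w k i q = 'D_(e4 i) (pull k v) q.
  have H (ki : chart_index At * 'I_4) : exists w0 : (R * R) * (R * R) -> R,
      con (cyl S ki.1) w0 /\ forall q, cyl Om ki.1 q -> w0 q = 'D_(e4 ki.2) (pull ki.1 v) q.
    have [_ _ /(_ ki.2)[w0 [cw Ew]]] := vC1 ki.1; exists w0; split; [exact: within_con|exact: Ew].
  by have [w0 P] := choice H; exists (fun k i => w0 (k, i)) => k i; exact: (P (k, i)).
have GN (k : chart_index At) q : cyl Om k q -> null_inverse Lambda (invmx (g k q)) /\
    `|\det (g k q)| = (minor2 (invmx (g k q)))^-1 /\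
    invmx (g k q) (inord 1) (inord 1) = q.1.2 ^+ 2 * pull k V q.
  move=> Oq; apply: (metric_inverse V U lambda_gt0 _ (fun x => hb k q x Oq)).
  by apply: hsym; case: Oq => Ob kx; split => //; exact: OmS.
have GM (k : chart_index At) q i j : cyl Om k q -> `|invmx (g k q) i j| <= M.
  by move=> Oq; exact: (C1norm_inv_bound i j Gn Oq).1.
have dGM (k : chart_index At) q i j l : cyl Om k q -> `|'D_(e4 l) (fun q' => invmx (g k q') i j) q| <= M.
  by move=> Oq; exact: (C1norm_inv_bound i j Gn Oq).2.
have G1' (k : chart_index At) i j : C1 (cyl Om k) (fun q => invmx (g k q) i j) := (Ck1_C1 _ _).1 (G1 k i j).
have VB (k : chart_index At) q : cyl Om k q -> 1 / 2 <= pull k V q <= 3 / 2.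
  by move=> [Ob kx]; apply: Vb; [exact: OmS|apply: chart_sphere; exact: chart_dom_ext].
have fF (k : chart_index At) : (\int[leb4]_(q in to4 @^-1` (cyl Om k)) (pull k f (to4 q) ^+ 2)%:E <= F%:E)%E.
  by rewrite -Lpnorm_sqr; apply: (leS _ _ k FE) => k'; exact: sq0.
have Pp (k : chart_index At) q : cyl Om k q -> (forall i, `|a k i q| <= `|Ma|) -> `|pull k omega q| <= `|Mw| ->
    Lop (g k) (a k) (pull k omega) (pull k v) q = pull k f q ->
    principal (fun q => invmx (g k q)) (pull k v) q ^+ 2 <= Cp * (pull k f q ^+ 2 + energy (pull k v) q).
  move=> Oq ea eo e.
  have oD : open (cyl Om k) by exact: cylOm_open.
  have GNk q' : cyl Om k q' -> null_inverse Lambda (invmx (g k q')) /\ `|\det (g k q')| = (minor2 (invmx (g k q')))^-1.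
    by move=> /GN[n1 [n2 _]]; split.
  exact: (principal_bound oD (@G1' k) (v2 k) Oq Lambda_gt0 GNk M0 (fun i j => GM k q i j Oq)
    (fun i j l => dGM k q i j l Oq) ea eo (normr_ge0 _) (normr_ge0 _) e).
have Pf (k : chart_index At) : {ae leb4, forall q, cyl Om k (to4 q) -> principal (fun q => invmx (g k q)) (pull k v) (to4 q) ^+ 2 <=
    Cp * (pull k f (to4 q) ^+ 2 + energy (pull k v) (to4 q))}.
  have aea : {ae leb4, forall q, forall i, cyl Om k (to4 q) -> `|a k i (to4 q)| <= Ma}.
      (* The four exceptional sets are merged by running through the naturals with [inord]. *)
      have all_i := ae_foralln (fun m => Lpnorm_inf_bound (am k (inord m))).
    by apply: filterS all_i => q bnd i; have := bnd i; rewrite inord_val.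
  apply: filterS3 (eqn k) aea (Lpnorm_inf_bound (om k)) => q eq1 eq2 eq3 Oq.
  apply: (Pp _ _ Oq) => [i||]; [|by apply: le_trans (eq3 Oq) (ler_norm _)|exact: eq1].
  exact: le_trans (eq2 i Oq) (ler_norm _).
have vS (k : chart_index At) : con (cyl S k) (pull k v) by have [_ cv _] := vC1 k; exact: within_con.
have wS (k : chart_index At) i : con (cyl S k) (w k i) := (wP k i).1.
have wE (k : chart_index At) i q : cyl Om k q -> w k i q = 'D_(e4 i) (pull k v) q := (wP k i).2 q.
have HPhi (k : chart_index At) : (H1sqnorm leb3 to3 e3 (cyl3 z0 k) (pull3 k phi) <= Phi%:E)%E.
  by apply: (leS _ _ k PhiE) => k'; exact: H1sqnorm_ge0.
have HPsi (k : chart_index At) : (H1sqnorm leb3 to3 e3 (cyl3 T k) (pull3 k psi) <= Psi%:E)%E.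
  by apply: (leS _ _ k PsiE) => k'; exact: H1sqnorm_ge0.
have GV (k : chart_index At) q : cyl Om k q -> invmx (g k q) (inord 1) (inord 1) = q.1.2 ^+ 2 * pull k V q by move=> /GN[_ []].
have GN' (k : chart_index At) q : cyl Om k q -> null_inverse Lambda (invmx (g k q)) by move=> /GN[].
have AE := apriori_energy T_gt0 z0_gt0 M0 b0 K0 N0 c0 cN C0 Cp0 Hcur HJ G1' v2 GN' GM dGM GV VB fm
  F0 Phi0 Psi0 fF Pf vS wS wE HPhi HPsi aephi aepsi.
have AN := apriori_normal T_gt0 z0_gt0 M0 b0 K0 N0 c0 cN C0 Cp0 Hcur HJ G1' v2 GN' GM dGM GV VB fm
  F0 Phi0 Psi0 fF Pf vS wS wE HPhi HPsi aephi aepsi.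
have B1 : (H1norm_Omega At T z0 v <= (Num.sqrt (nk * ec * (Phi + Psi + F)))%:E)%E.
  apply: poweR_half_le; first by apply: sume_ge0 => k _; exact: H1sqnorm_ge0.
  rewrite -mulrA; apply: sum_chart_le => k; apply: le_trans (AE k).
  apply: (H1sqnorm_classical (@cylOm_open _ _ _ _ k) (Ck2_C1 (v2 k))).
  exact: le_lt_trans (AE k) (ltry _).
have B2 : (L2norm_dz_Sigma1 At T z0 v <= (Num.sqrt (nk * nc * (Phi + Psi + F)))%:E)%E.
  apply: poweR_half_le; first by apply: sume_ge0 => k _; exact: sq0.
  rewrite -mulrA; apply: sum_chart_le => k; apply: le_trans (AN k).
  rewrite Lpnorm_sqr le_eqVlt; apply/orP; left; apply/eqP; apply: eq_integral => y /set_mem [ht kx].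
  (* The trace in the statement is a limit from inside Omega; it coincides with the extension [w],
     for which the estimate has been proved. *)
  congr (((_ : R) ^+ 2)%:E); apply: (trace_limit (A := cyl S k)) => //.
  - by move=> q [Ob kx']; split => //; exact: OmS.
  - by split => //; right; split => //=; case/andP: ht => *; apply/andP; split; exact: ltW.
  - exact: lateral_closure.
  - exact: wE.
apply: (le_trans (leeD B1 B2)); rewrite -EFinD.
have -> : L2norm_Omega At T z0 f = (Num.sqrt F)%:E by exact: FN.
have -> : H1norm_Sigma At z0 phi = (Num.sqrt Phi)%:E by exact: PhiN.
have -> : H1norm_Sigma At T psi = (Num.sqrt Psi)%:E by exact: PsiN.
by rewrite -!EFinD -EFinM lee_fin; exact: sqrt_data.
Qed.
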